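(* For every $\rho<1$ there exists $L>0$ such that the following holds. If $G$ is a regular graph with spectral radius at most $\rho$ and girth at least $L$, then the percolation triangle condition holds at $p_c$, i.e. $$\sum_{x,y}\mathbb{P}_{p_c}(0\leftrightarrow x)\,\mathbb{P}_{p_c}(x\leftrightarrow y)\,\mathbb{P}_{p_c}(y\leftrightarrow 0)<\infty.$$ Hence, if $G$ is moreover transitive and unimodular, the critical exponents $\beta,\gamma,\delta$ exist and $\beta=\gamma=1$, $\delta=2$.
   Context: Graphs are connected, locally finite and infinite, with a fixed vertex $0$. The spectral radius is $\lim_{n} p^{2n}(0,0)^{1/(2n)}$ where $p^n$ is the $n$-step simple random walk transition probability; the girth is the length of the shortest cycle. $\mathbb{P}_p$ is $p$-bond percolation (each edge open independently with probability $p$); $x\leftrightarrow y$ means $x,y$ are joined by an open path; $\mathcal{C}(0)$ is the open cluster of $0$; $p_c=\inf\{p:\mathbb{P}_p(\exists\text{ infinite open cluster})>0\}$. A graph is unimodular if $|S(x)y|=|S(y)x|$ for all vertices $x,y$, where $S(x)$ is the stabilizer of $x$ in the automorphism group. The exponents are defined by $\mathbb{P}_p(|\mathcal{C}(0)|=\infty)\asymp (p-p_c)^\beta$ for $p>p_c$, $\mathbb{E}_p|\mathcal{C}(0)|\asymp (p_c-p)^{-\gamma}$ for $p<p_c$, and $\mathbb{P}_{p_c}(|\mathcal{C}(0)|\ge n)\asymp n^{-1/\delta}$, where $\asymp$ means the ratio of the two sides is bounded above and below by positive constants. *)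

(* Defs.v *)
From HB Require Import structures.
From mathcomp Require Import all_boot all_order all_algebra.
From mathcomp Require Import all_classical all_reals all_analysis.
Set Implicit Arguments. Unset Strict Implicit. Unset Printing Implicit Defensive.
Import Order.TTheory GRing.Theory Num.Theory.
Local Open Scope classical_set_scope.
Local Open Scope ring_scope.

(* A locally finite simple graph on a countable vertex type V is given by its
   neighbour lists nb : V -> seq V. *)
Section Graph.
Variables (V : countType) (nb : V -> seq V).

Definition adj (x y : V) : bool := y \in nb x.

Definition simple_graph : Prop :=
  (forall x, uniq (nb x)) /\ (forall x, x \notin nb x) /\
  (forall x y, adj x y = adj y x).

Definition graph_connected : Prop :=
  forall x y : V, exists s : seq V, path adj x s /\ last x s = y.

Definition infinite_graph : Prop := ~ finite_set [set: V].

Definition regular : Prop := exists d : nat, forall x, size (nb x) = d.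

Definition girth_ge (L : nat) : Prop :=
  forall c : seq V, uniq c -> (3 <= size c)%N -> cycle adj c -> (L <= size c)%N.

Fixpoint srw {R : realType} (n : nat) (x y : V) : R :=
  match n with
  | 0 => (x == y)%:R
  | n'.+1 => \sum_(z <- nb x) (size (nb x))%:R^-1 * srw n' z y
  end.

Definition spectral_radius {R : realType} (o : V) : R :=
  limn (fun n : nat => powR (srw n.*2.+2 o o) ((n.*2.+2)%:R^-1)).

Fixpoint ball (o : V) (n : nat) : seq V :=
  match n with
  | 0 => [:: o]
  | n'.+1 => undup (ball o n' ++ flatten (map nb (ball o n')))
  end.

(* edges with both endpoints in ball o n, each undirected edge {x,y} listed
   once as the ordered pair (x,y) with pickle x < pickle y *)
Definition bedges (o : V) (n : nat) : seq (V * V) :=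
  [seq (x, y) | x <- ball o n, y <- [seq y <- nb x | (y \in ball o n) && (pickle x < pickle y)%N]].

Fixpoint reach (S : seq (V * V)) (k : nat) (A : seq V) : seq V :=
  match k with
  | 0 => A
  | k'.+1 => reach S k' (undup (A ++ [seq e.2 | e <- S & e.1 \in A]
                                ++ [seq e.1 | e <- S & e.2 \in A]))
  end.

Definition cl (S : seq (V * V)) (x : V) : seq V := reach S (size S) [:: x].

(* expectation of f(open edge set) for independent Bernoulli(p) edges in es *)
Fixpoint Ex {R : realType} (p : R) (es acc : seq (V * V))
    (f : seq (V * V) -> R) : R :=
  match es with
  | [::] => f acc
  | e :: es' => p * Ex p es' (e :: acc) f + (1 - p) * Ex p es' acc f
  end.

Definition Pr {R : realType} (o : V) (p : R) (n : nat) (P : seq (V * V) -> bool) : R :=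
  Ex p (bedges o n) [::] (fun S => (P S)%:R).

(* P_p(x <-> y) : increasing limit over balls of P_p(x <-> y inside ball n) *)
Definition tau {R : realType} (o : V) (p : R) (x y : V) : R :=
  sup [set Pr o p n (fun S => y \in cl S x) | n in [set: nat]].

(* P_p(|C(o)| = oo) : decreasing limit of P_p(o <-> sphere of radius n+1) *)
Definition theta {R : realType} (o : V) (p : R) : R :=
  inf [set Pr o p n.+1 (fun S => has (fun v => v \notin ball o n) (cl S o))
       | n in [set: nat]].

(* P_p(there is an infinite open cluster) :
   sup_m lim_n P_p(some x in ball m is joined to the sphere of radius m+n+1) *)
Definition Pinf {R : realType} (o : V) (p : R) : R :=
  sup [set inf [set Pr o p (m + n).+1
                  (fun S => has (fun x => has (fun v => v \notin ball o (m + n))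
                                                (cl S x)) (ball o m))
                 | n in [set: nat]] | m in [set: nat]].

Definition p_c {R : realType} (o : V) : R :=
  inf [set p : R | 0 <= p <= 1 /\ 0 < Pinf o p].

(* E_p |C(o)| : increasing limit of E_p |C(o) restricted to ball n| *)
Definition chi {R : realType} (o : V) (p : R) : \bar R :=
  ereal_sup [set (Ex p (bedges o n) [::] (fun S => (size (cl S o))%:R))%:E
            | n in [set: nat]].

Definition cluster_tail {R : realType} (o : V) (p : R) (k : nat) : R :=
  sup [set Pr o p n (fun S => (k <= size (cl S o))%N) | n in [set: nat]].

Definition triangle_condition {R : realType} (o : V) (p : R) : Prop :=
  (\esum_(xy in [set: V * V])
      (tau o p o xy.1 * tau o p xy.1 xy.2 * tau o p xy.2 o)%:E < +oo)%E.

Definition automorphism (f : V -> V) : Prop :=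
  bijective f /\ forall x y, adj (f x) (f y) = adj x y.

Definition transitive_graph : Prop :=
  forall x y, exists f, automorphism f /\ f x = y.

Definition stab_orbit (x y : V) : set V :=
  [set z | exists f, automorphism f /\ f x = x /\ z = f y].

Definition unimodular : Prop :=
  forall x y, (stab_orbit x y #= stab_orbit y x)%card.

End Graph.

(* critical exponents, with "asymp" read as two-sided bounds by positive
   constants on the whole stated range *)
Definition beta_is {R : realType} (V : countType) (nb : V -> seq V) (o : V) (b : R) : Prop :=
  exists c C : R, 0 < c /\ 0 < C /\
    forall p : R, p_c nb o < p -> p <= 1 ->
      c * powR (p - p_c nb o) b <= theta nb o p <= C * powR (p - p_c nb o) b.

Definition gamma_is {R : realType} (V : countType) (nb : V -> seq V) (o : V) (g : R) : Prop :=
  exists c C : R, 0 < c /\ 0 < C /\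
    forall p : R, 0 <= p -> p < p_c nb o ->
      ((c * powR (p_c nb o - p) (- g))%:E <= chi nb o p <=
       (C * powR (p_c nb o - p) (- g))%:E)%E.

Definition delta_is {R : realType} (V : countType) (nb : V -> seq V) (o : V) (d : R) : Prop :=
  exists c C : R, 0 < c /\ 0 < C /\
    forall k : nat, (1 <= k)%N ->
      c * powR k%:R (- d^-1) <= cluster_tail nb o (p_c nb o) k
        <= C * powR k%:R (- d^-1).

(* Main.v *)
Require Import Defs.
From HB Require Import structures.
From mathcomp Require Import all_boot all_order all_algebra.
From mathcomp Require Import all_classical all_reals all_analysis.
From mathcomp Require Import ring lra zify.
From mathcomp Require finmap polyrcf.
Set Implicit Arguments. Unset Strict Implicit. Unset Printing Implicit Defensive.
Import Order.TTheory GRing.Theory Num.Theory.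
Local Open Scope classical_set_scope.
Local Open Scope ring_scope.

                                 

(** Large girth together with spectral radius below 1 makes percolation near parameter 1/(d-1)
    behave as on the d-regular tree: whenever two explored branches fail to be disjoint, they close
    a simple cycle, and cycles, having length at least L, contribute an arbitrarily small total
    weight.

    The analytic input compares non-backtracking walks with all walks. If B_n counts the former and
    A is the adjacency operator, then, up to a truncation, the sum of r^n B_n is at most twice the
    sum of s^m A^m with s = r/(1+(d-1)r^2) ([nbc_le_apow]). The spectral radius bounds A^m by (d
    rho)^m / rho ([apow_spectral]), so both series converge for r slightly above 1/(d-1). Thus
    [walk_bounds] provides a window ending at pm = (1+2e)/(d-1) in which the closed non-backtracking
    walks of length n >= L, weighted by n^2 pm^n, sum to at most a prescribed eta, while the
    triangle sum of the Green function is bounded.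

    Triangle condition. For finite S containing o, let phi(S) be the expected number of open edges
    leaving S from the cluster of o inside S. Counting degrees as on a tree, with an error given by
    cycles, yields phi(S) >= 1 once p(d-1) >= 1+e ([boundary_ge1]). Russo's formula and an
    exploration from outside turn this into percolation at pm ([pivotal_lower], [theta_growth]),
    hence p_c <= pm. Open simple paths are non-backtracking walks ([two_point_walks]), so the
    two-point function at p_c is at most twice the Green function and the triangle sum is finite.

    Exponents. They follow from the same cycle estimate, in the form [cycle_expect]: a collision
    between independent connections costs the open edges of a cycle. For gamma, it gives a lower
    bound of order chi^2 for the derivative of the susceptibility ([an_volume],
    [gamma_upper_bound]); the converse bound comes from sprinkling ([chi_sprinkle]). For beta and
    delta, colour vertices green independently with probability h and let M(h) be the probability
    that the cluster of o contains a green vertex. A configuration has at most one fork behind which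
    two disjoint arms reach green vertices while the rest of the cluster of o is not green
    ([branch_unique]). Bounding the expected number of such forks from below gives M(h)
    E[|C| (1-h)^|C|] <= const, hence M(h)^2 <= const h uniformly below p_c ([mag_sqrt]), and at p_c
    by continuity in finite volumes. Sprinkling from p_c ([sprinkle_tail]) converts this into a
    linear upper bound for the percolation probability, matched from below by [theta_growth];
    comparing the two at p - p_c of order k^(-1/2) gives the lower tail bound at p_c. *)

(** * Finite product Bernoulli measures: independence, exploration, Russo's formula *)

Section Bernoulli.
Context {R : realType} {T : eqType}.
Implicit Types (p q : R) (es F : seq T) (w : T -> bool) (f g : (T -> bool) -> R).

Definition addc e w : T -> bool := fun x => (x == e) || w x.
Definition res (Q : T -> bool) w : T -> bool := fun x => w x && Q x.
Definition subc w es := forall x, w x -> x \in es.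
Definition lec w w' := forall x : T, w x -> w' x.

                                                                                             
(** Configurations are predicates rather than the edge lists used by [Ex], so that restriction and
    union of configurations are pointwise operations. Every expectation is a polynomial in [p]. *)
Fixpoint EE p es f : R :=
  if es is e :: es' then p * EE p es' (fun w => f (addc e w)) + (1 - p) * EE p es' f
  else f (fun _ => false).

Lemma subc_addc e w es : subc w es -> subc (addc e w) (e :: es).
Proof. by move=> h x /orP[/eqP->|/h hx]; rewrite inE ?eqxx // hx orbT. Qed.

Lemma subc_cons e w es : subc w es -> subc w (e :: es).
Proof. by move=> h x /h hx; rewrite inE hx orbT. Qed.

Lemma EE_ext p es f g : (forall w, subc w es -> f w = g w) -> EE p es f = EE p es g.
Proof.
elim: es f g => [|e es IH] f g h /=; first exact: h.
congr (_ * _ + _ * _); apply: IH => w hw; apply: h; [exact: subc_addc|exact: subc_cons].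
Qed.

Lemma EE_le p es f g : 0 <= p <= 1 ->
  (forall w, subc w es -> f w <= g w) -> EE p es f <= EE p es g.
Proof.
move=> /andP[p0 p1]; elim: es f g => [|e es IH] f g h /=; first exact: h.
apply: lerD; apply: ler_wpM2l => //; rewrite ?subr_ge0 //; apply: IH => w hw; apply: h;
  [exact: subc_addc|exact: subc_cons].
Qed.

Lemma EED p es f g : EE p es (fun w => f w + g w) = EE p es f + EE p es g.
Proof.
by elim: es f g => [//|e es IH] f g /=; rewrite !IH !mulrDr addrACA.
Qed.

Lemma EEZ p es a f : EE p es (fun w => a * f w) = a * EE p es f.
Proof. by elim: es f => [//|e es IH] f /=; rewrite !IH; ring. Qed.

Lemma EEZr p es a f : EE p es (fun w => f w * a) = EE p es f * a.
Proof. by elim: es f => [//|e es IH] f /=; rewrite !IH; ring. Qed.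

Lemma EEN p es f : EE p es (fun w => - f w) = - EE p es f.
Proof. by elim: es f => [//|e es IH] f /=; rewrite !IH; ring. Qed.

Lemma EEB p es f g : EE p es (fun w => f w - g w) = EE p es f - EE p es g.
Proof. by rewrite -EEN -EED. Qed.

Lemma EE_cst p es a : EE p es (fun=> a) = a.
Proof. by elim: es => [//|e es IH] /=; rewrite IH; ring. Qed.

Lemma EE_sum p es (I : Type) (r : seq I) (P : pred I) (F : I -> (T -> bool) -> R) :
  EE p es (fun w => \sum_(i <- r | P i) F i w) = \sum_(i <- r | P i) EE p es (F i).
Proof.
elim: r => [|i r IH].
  by under EE_ext => w _ do rewrite big_nil; rewrite EE_cst big_nil.
rewrite big_cons -IH; under EE_ext => w _ do rewrite big_cons.
by case: ifP => _; rewrite ?EED.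
Qed.

Lemma EE_ge0 p es f : 0 <= p <= 1 -> (forall w, subc w es -> 0 <= f w) -> 0 <= EE p es f.
Proof. by move=> hp h; rewrite -(EE_cst p es 0); apply: EE_le. Qed.

Lemma EE_le_cst p es f c : 0 <= p <= 1 -> (forall w, subc w es -> f w <= c) -> EE p es f <= c.
Proof. by move=> hp h; rewrite -[leRHS](EE_cst p es); apply: EE_le. Qed.

Lemma res_addc Q e w : res Q (addc e w) = if Q e then addc e (res Q w) else res Q w.
Proof.
apply/funext => x; rewrite /res /addc; case: ifP => h.
  by case: eqVneq => [->|]; rewrite ?h.
by case: eqVneq => [->|]; rewrite ?h ?andbF.
Qed.

                                                                                       
                                                                                         
(** States inside and outside [Q] are independent, so one half may be replaced by a fresh copy;
    [EE_indep] is the product case. *)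
Lemma EE_fubini p es Q (F : (T -> bool) -> (T -> bool) -> R) :
  EE p es (fun w => F (res Q w) (res (predC Q) w)) =
  EE p es (fun w => EE p es (fun w' => F (res Q w) (res (predC Q) w'))).
Proof.
elim: es F => [//|e es IH] F.
have resC w : res (predC Q) (addc e w) =
    if Q e then res (predC Q) w else addc e (res (predC Q) w).
  by rewrite res_addc /=; case: (Q e).
case he: (Q e).
  have h1 : EE p (e :: es) (fun w => F (res Q w) (res (predC Q) w)) =
     p * EE p es (fun w => F (addc e (res Q w)) (res (predC Q) w)) +
     (1 - p) * EE p es (fun w => F (res Q w) (res (predC Q) w)).
    by congr (_ * _ + _); apply: EE_ext => w _; rewrite res_addc resC he.
  rewrite h1 (IH (fun a => F (addc e a))) (IH F) /=.
  congr (_ * _ + _ * _); apply: EE_ext => w _.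
    rewrite res_addc he -[LHS]mul1r.
    under [in RHS]EE_ext => w' _ do rewrite resC he.
    by ring.
  under [X in _ = p * X + _]EE_ext => w' _ do rewrite resC he.
  by ring.
have h1 : EE p (e :: es) (fun w => F (res Q w) (res (predC Q) w)) =
   p * EE p es (fun w => F (res Q w) (addc e (res (predC Q) w))) +
   (1 - p) * EE p es (fun w => F (res Q w) (res (predC Q) w)).
  by congr (_ * _ + _); apply: EE_ext => w _; rewrite res_addc resC he.
rewrite h1 (IH (fun a b => F a (addc e b))) (IH F) -!EEZ -EED /=.
under [X in _ = p * X + _]EE_ext => w _ do rewrite res_addc he.
set Y := EE _ _ _; set Z := EE _ _ _.
suff -> : Y = Z by ring.
by apply: EE_ext => w _; congr (_ * _ + _ * _); apply: EE_ext => w' _; rewrite resC he.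
Qed.

Lemma EE_indep p es Q f g :
  EE p es (fun w => f (res Q w) * g (res (predC Q) w)) =
  EE p es (fun w => f (res Q w)) * EE p es (fun w => g (res (predC Q) w)).
Proof.
rewrite (EE_fubini p es Q (fun a b => f a * g b)) -EEZr.
by apply: EE_ext => w _; rewrite EEZ.
Qed.

Lemma EE_filter p es Q f : EE p es (fun w => f (res Q w)) = EE p [seq e <- es | Q e] f.
Proof.
elim: es f => [|e es IH] f /=; first by congr f; apply/funext.
under EE_ext => w _ do rewrite res_addc.
case: ifP => he /=; first by rewrite IH (IH (fun w => f (addc e w))).
by rewrite IH; ring.
Qed.

Lemma addcC a b w : addc a (addc b w) = addc b (addc a w).
Proof. by apply/funext => x; rewrite /addc orbCA. Qed.

Lemma EE_perm p es es' f : perm_eq es es' -> EE p es f = EE p es' f.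
Proof.
have swap a b l g : EE p (a :: b :: l) g = EE p (b :: a :: l) g.
  rewrite /=; under [X in _ = _ * (_ * X + _) + _]EE_ext => w _ do rewrite addcC.
  by ring.
have toFront l1 a l2 g : EE p (l1 ++ a :: l2) g = EE p (a :: l1 ++ l2) g.
  elim: l1 g => [//|b l1 IH] g; rewrite -swap cat_cons.
  by rewrite [LHS]/= !IH.
elim: es es' f => [|a es IH] es' f hp.
  by move: hp; rewrite perm_sym => /perm_nilP ->.
have ha : a \in es' by rewrite -(perm_mem hp) mem_head.
case/splitPr: ha hp => l1 l2 hp.
rewrite toFront /=; have hp' : perm_eq es (l1 ++ l2).
  by rewrite -(perm_cons a) (permPl hp) perm_catC /= perm_cons perm_catC.
by rewrite !(IH _ _ hp').
Qed.

Lemma EE_values (A : eqType) es (K : (T -> bool) -> A) :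
  exists r : seq A, uniq r /\ forall w, subc w es -> K w \in r.
Proof.
elim: es K => [|e es IH] K.
  exists [:: K (fun=> false)]; split=> // w hw; rewrite inE; apply/eqP; congr K.
  by apply/funext => x; apply/negP => /hw.
have [r1 [_ h1]] := IH K; have [r2 [_ h2]] := IH (fun w => K (addc e w)).
exists (undup (r1 ++ r2)); split; first exact: undup_uniq.
move=> w hw; rewrite mem_undup mem_cat.
pose w0 := res (predC1 e) w.
have hw0 : subc w0 es.
  by move=> x /andP[/hw]; rewrite inE => /orP[/eqP->|//]; rewrite /= eqxx.
case we : (w e); last first.
  suff -> : w = w0 by rewrite h1.
  apply/funext => x; rewrite /w0 /res /=; case: eqVneq => [->|]; rewrite ?we ?andbT //.
suff -> : w = addc e w0 by rewrite h2 ?orbT.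
by apply/funext => x; rewrite /w0 /res /addc /=; case: eqVneq => [->|]; rewrite ?we ?andbT.
Qed.

Lemma big_pick (A : eqType) (r : seq A) (a : A) (G : A -> R) : uniq r -> a \in r ->
  \sum_(b <- r) (a == b)%:R * G b = G a.
Proof.
move=> hu ha; rewrite (bigD1_seq a) //= eqxx mul1r big1 ?addr0 // => b hb.
by rewrite eq_sym (negbTE hb) mul0r.
Qed.

Lemma res_res Q Q' w : res Q (res Q' w) = res (predI Q Q') w.
Proof. by apply/funext => x; rewrite /res /=; case: (w x); case: (Q x); case: (Q' x). Qed.

                                                                                   
                        
(** The Markov property of an exploration. The hypothesis says that the states in [Q (K w)] alone
    reveal [K w], so everything outside is still fresh. The proof conditions on each of the finitely
    many values of [K] and uses [EE_indep]. *)
Lemma EE_explore (A : eqType) p es (K : (T -> bool) -> A) (Q : A -> T -> bool)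
    (Phi : A -> (T -> bool) -> R) :
  (forall w w', subc w es -> subc w' es ->
     res (Q (K w)) w = res (Q (K w)) w' -> K w' = K w) ->
  EE p es (fun w => Phi (K w) (res (predC (Q (K w))) w)) =
  EE p es (fun w => EE p es (fun w' => Phi (K w) (res (predC (Q (K w))) w'))).
Proof.
move=> hK; have [r [ur hr]] := EE_values es K.
have sres Q' w : subc w es -> subc (res Q' w) es by move=> h x /andP[/h].
(* The event that [K] takes the value [a] is read off from the states in [Q a]. *)
have hKa a w : subc w es -> (K w == a) = (K (res (Q a) w) == a).
  move=> hw; have rr w' : res (Q a) (res (Q a) w') = res (Q a) w'.
    by rewrite res_res; congr res; apply/funext => x /=; rewrite andbb.
  apply/eqP/eqP => h.
    by rewrite -[RHS]h; apply: hK; rewrite ?h ?rr //; exact: sres.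
  by rewrite -[RHS]h; apply: hK; rewrite ?h ?rr //; exact: sres.
transitivity (\sum_(a <- r) EE p es (fun w => (K w == a)%:R * Phi a (res (predC (Q a)) w))).
  rewrite -EE_sum; apply: EE_ext => w hw.
  by rewrite (big_pick (fun a => Phi a (res (predC (Q a)) w))) ?hr.
transitivity (\sum_(a <- r) EE p es (fun w => (K w == a)%:R *
    EE p es (fun w' => Phi a (res (predC (Q a)) w')))); last first.
  rewrite -EE_sum; apply: EE_ext => w hw.
  by rewrite (big_pick (fun a => EE p es (fun w' => Phi a (res (predC (Q a)) w')))) ?hr.
apply: eq_bigr => a _; rewrite EEZr.
have e1 : EE p es (fun w => (K w == a)%:R : R) = EE p es (fun w => (K (res (Q a) w) == a)%:R).
  by apply: EE_ext => w hw; rewrite hKa.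
rewrite e1 -(EE_indep p es (Q a) (fun v => (K v == a)%:R) (Phi a)).
by apply: EE_ext => w hw; rewrite hKa.
Qed.

Lemma EE_all_le p es F : 0 <= p <= 1 -> uniq es -> uniq F ->
  EE p es (fun w => (all w F)%:R) <= p ^+ size F.
Proof.
move=> hp; have /andP[p0 p1] := hp; elim: es F => [|e es IH] F /=.
  by case: F => [|a F] _ _ //=; rewrite exprn_ge0.
move=> /andP[ne ues] uF; case: (boolP (e \in F)) => heF.
  rewrite [X in _ + (1 - p) * X](_ : _ = 0); last first.
    rewrite -(EE_cst p es 0); apply: EE_ext => w hw; case: allP => // h.
    by move: (hw _ (h _ heF)); rewrite (negbTE ne).
  rewrite mulr0 addr0 (_ : size F = (size (rem e F)).+1); last first.
    by rewrite size_rem // prednK //; case: (F) heF.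
  rewrite exprS ler_wpM2l //; apply: le_trans (IH _ ues (rem_uniq _ uF)).
  apply: EE_le => // w _; rewrite ler_nat.
  case: (boolP (all (addc e w) F)) => // /allP h; rewrite lt0b; apply/allP => x.
  by rewrite mem_rem_uniq // inE => /andP[/negbTE hx /h]; rewrite /addc hx.
have e1 : EE p es (fun w => (all (addc e w) F)%:R) = EE p es (fun w => (all w F)%:R).
  apply: EE_ext => w _; congr ((nat_of_bool _)%:R); apply: eq_in_all => x hx.
  by rewrite /addc; case: eqVneq => // hxe; rewrite -hxe hx in heF.
by rewrite e1 -mulrDl [p + _]addrC subrK mul1r IH.
Qed.

Definition incr f := forall w w', lec w w' -> f w <= f w'.
Definition decr f := forall w w', lec w w' -> f w' <= f w.

Lemma EE_open p es F g : 0 <= p <= 1 -> uniq es -> uniq F -> (forall w, 0 <= g w) ->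
  EE p es (fun w => (all w F)%:R * g (res [predC F] w)) <=
  p ^+ size F * EE p es (fun w => g (res [predC F] w)).
Proof.
move=> hp ues uF g0.
have e1 : EE p es (fun w => (all w F)%:R * g (res [predC F] w)) =
          EE p es (fun w => (all (res (mem F) w) F)%:R * g (res (predC (mem F)) w)).
  apply: EE_ext => w _; congr ((nat_of_bool _)%:R * _); apply: eq_in_all => x hx.
  by rewrite /res /= hx andbT.
rewrite e1 (EE_indep p es (mem F) (fun v => (all v F)%:R)) ler_wpM2r //.
  by apply: EE_ge0.
rewrite (_ : EE p es _ = EE p es (fun w => (all w F)%:R)); first exact: EE_all_le.
apply: EE_ext => w _; congr ((nat_of_bool _)%:R); apply: eq_in_all => x hx.
by rewrite /res /= hx andbT.
Qed.

Definition addF F w : T -> bool := fun x => (x \in F) || w x.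

(** [W] is decreasing and has to be decoupled from the states on [F]: with [F] open, [W w] is at
    most its value with [F] added to the restriction off [F], which no longer depends on [F]. After
    using independence, that value is in turn at most [W w]. *)
Lemma EE_open_decr p es F h W : 0 <= p <= 1 -> uniq es -> uniq F ->
  incr h -> decr W -> (forall w, 0 <= h w) -> (forall w, 0 <= W w) ->
  EE p es (fun w => (all w F)%:R * (h (res [predC F] w) * W w)) <=
  p ^+ size F * EE p es (fun w => h w * W w).
Proof.
move=> hp ues uF hh hW h0 W0; have /andP[p0 p1] := hp.
pose g v := h v * W (addF F v).
apply: (@le_trans _ _ (p ^+ size F * EE p es (fun w => g (res [predC F] w)))).
  apply: le_trans (EE_open hp ues uF _); last by move=> w; rewrite /g mulr_ge0.
  apply: EE_le => // w _; case: allP => hF; rewrite ?mul0r // !mul1r.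
  rewrite /g ler_wpM2l // hW // => x; rewrite /addF /res /=.
  by move=> /orP[/hF|/andP[]].
rewrite ler_wpM2l ?exprn_ge0 //; apply: EE_le => // w _; rewrite /g ler_pM //.
  by apply: hh => x /andP[].
by apply: hW => x hx; rewrite /addF /res /= hx; case: (x \in F).
Qed.

Lemma EE_open_incr p es F h : 0 <= p <= 1 -> uniq es -> uniq F ->
  incr h -> (forall w, 0 <= h w) ->
  EE p es (fun w => (all w F)%:R * h (res [predC F] w)) <=
  p ^+ size F * EE p es h.
Proof.
move=> hp ues uF hh h0.
have := @EE_open_decr p es F h (fun=> 1) hp ues uF hh.
rewrite (_ : EE p es (fun w => h w * 1) = EE p es h); last by apply: EE_ext => w _; rewrite mulr1.
by under EE_ext => w _ do rewrite mulr1; apply.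
Qed.

Lemma EE_all_eq p es F : 0 <= p <= 1 -> uniq es -> uniq F -> {subset F <= es} ->
  EE p es (fun w => (all w F)%:R) = p ^+ size F.
Proof.
move=> hp; have /andP[p0 p1] := hp; elim: es F => [|e es IH] F /=.
  by case: F => [|a F] _ _ //= h; move: (h a); rewrite mem_head => /(_ isT).
move=> /andP[ne ues] uF sF; case: (boolP (e \in F)) => heF.
  rewrite [X in _ + (1 - p) * X](_ : _ = 0); last first.
    rewrite -(EE_cst p es 0); apply: EE_ext => w hw; case: allP => // h.
    by move: (hw _ (h _ heF)); rewrite (negbTE ne).
  rewrite mulr0 addr0 (_ : size F = (size (rem e F)).+1); last first.
    by rewrite size_rem // prednK //; case: (F) heF.
  rewrite exprS -(IH _ ues (rem_uniq _ uF)).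
    congr (_ * _); apply: EE_ext => w _; congr ((nat_of_bool _)%:R).
    apply/allP/allP => h x.
      by rewrite mem_rem_uniq // inE => /andP[/negbTE hx /h]; rewrite /addc hx.
    move=> hx; rewrite /addc; case: eqVneq => //= hxe; apply: h.
    by rewrite mem_rem_uniq // inE hxe.
  move=> x; rewrite mem_rem_uniq // inE => /andP[/= hx /sF]; rewrite inE (negbTE hx) //.
have e1 : EE p es (fun w => (all (addc e w) F)%:R) = EE p es (fun w => (all w F)%:R).
  apply: EE_ext => w _; congr ((nat_of_bool _)%:R); apply: eq_in_all => x hx.
  by rewrite /addc; case: eqVneq => // hxe; rewrite -hxe hx in heF.
rewrite e1 -mulrDl [p + _]addrC subrK mul1r IH // => x hx.
by move: (sF _ hx); rewrite inE => /orP[/eqP hxe|//]; rewrite -hxe hx in heF.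
Qed.

Lemma EE_open_eq p es F g : 0 <= p <= 1 -> uniq es -> uniq F -> {subset F <= es} ->
  EE p es (fun w => (all w F)%:R * g (res [predC F] w)) =
  p ^+ size F * EE p es (fun w => g (res [predC F] w)).
Proof.
move=> hp ues uF sF.
rewrite (_ : EE p es _ =
          EE p es (fun w => (all (res (mem F) w) F)%:R * g (res (predC (mem F)) w))).
  rewrite (EE_indep p es (mem F) (fun v => (all v F)%:R)); congr (_ * _).
  rewrite -(EE_all_eq hp ues uF sF); apply: EE_ext => w _.
  congr ((nat_of_bool _)%:R); apply: eq_in_all => x hx.
  by rewrite /res /= hx andbT.
apply: EE_ext => w _; congr ((nat_of_bool _)%:R * _); apply: eq_in_all => x hx.
by rewrite /res /= hx andbT.
Qed.

Lemma EE_none_ge p es F : 0 <= p <= 1 -> uniq es -> uniq F ->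
  (1 - p) ^+ size F <= EE p es (fun w => (~~ has w F)%:R).
Proof.
move=> hp; have /andP[p0 p1] := hp; have q0 : 0 <= 1 - p by rewrite subr_ge0.
elim: es F => [|e es IH] F /=.
  move=> _ _; rewrite (_ : has _ F = false) /=; last by elim: F => [|a F].
  by rewrite exprn_ile1 // lerBlDr lerDl.
move=> /andP[ne ues] uF; case: (boolP (e \in F)) => heF.
  rewrite [X in p * X](_ : _ = 0); last first.
    rewrite -(EE_cst p es 0); apply: EE_ext => w hw; case: hasP => // h.
    by case: h; exists e => //; rewrite /addc eqxx.
  rewrite mulr0 add0r (_ : size F = (size (rem e F)).+1); last first.
    by rewrite size_rem // prednK //; case: (F) heF.
  rewrite exprS ler_wpM2l //; apply: le_trans (IH _ ues (rem_uniq _ uF)) _.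
  apply: EE_le => // w hw; rewrite ler_nat; case: (boolP (has w F)) => [/hasP[x xF wx]|_]; last exact: leq_b1.
  rewrite leqn0 eqb0 negbK; apply/hasP; exists x => //; rewrite mem_rem_uniq // inE xF andbT.
  by apply: contraNneq ne => <-; apply: hw.
have e1 : EE p es (fun w => (~~ has (addc e w) F)%:R) = EE p es (fun w => (~~ has w F)%:R).
  apply: EE_ext => w _; congr ((nat_of_bool (~~ _))%:R); apply: eq_in_has => x hx.
  by rewrite /addc; case: eqVneq => // hxe; rewrite -hxe hx in heF.
by rewrite e1 -mulrDl [p + _]addrC subrK mul1r IH.
Qed.

(** On the event that [F] is closed, which has probability at least (1-p)^|F| and is independent of
    the other states, a configuration equals its restriction off [F]. *)
Lemma EE_closed p es F g : 0 <= p <= 1 -> uniq es -> uniq F -> (forall w, 0 <= g w) ->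
  (1 - p) ^+ size F * EE p es (fun w => g (res [predC F] w)) <= EE p es g.
Proof.
move=> hp ues uF g0.
apply: (@le_trans _ _ (EE p es (fun w => (~~ has (res (mem F) w) F)%:R) *
   EE p es (fun w => g (res [predC F] w)))).
  rewrite ler_wpM2r //; first by apply: EE_ge0.
  apply: le_trans (EE_none_ge hp ues uF) _; apply: EE_le => // w _.
  rewrite ler_nat; case: (boolP (has w F)) => // h; case: (boolP (has _ F)) => // /hasP[x xF].
  by move=> /andP[wx _]; case/negP: h; apply/hasP; exists x.
rewrite -(EE_indep p es (mem F) (fun v => (~~ has v F)%:R)); apply: EE_le => // w _.
case: hasP => /= h; first by rewrite mul0r.
rewrite mul1r (_ : res _ w = w) //; apply/funext => x; rewrite /res /=.
case wx : (w x) => //=; apply/negP => xF; apply: h; exists x => //.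
by rewrite /res /= wx.
Qed.

Lemma EE_sprinkle p q es f :
  EE (p + (1 - p) * q) es f = EE p es (fun w => EE q es (fun v => f (fun x => w x || v x))).
Proof.
elim: es f => [//|e es IH] f; rewrite [LHS]/= !IH.
pose U w v : T -> bool := fun x => w x || v x.
have e1 w v : U (addc e w) (addc e v) = addc e (U w v).
  by apply/funext => x; rewrite /U /addc; case: (x == e).
have e2 w v : U (addc e w) v = addc e (U w v).
  by apply/funext => x; rewrite /U /addc orbA.
have e3 w v : U w (addc e v) = addc e (U w v).
  by apply/funext => x; rewrite /U /addc; case: (x == e); case: (w x).
pose A := EE p es (fun w => EE q es (fun v => f (addc e (U w v)))).
pose B := EE p es (fun w => EE q es (fun v => f (U w v))).
have hA : EE p es (fun w => EE q (e :: es) (fun v => f (U (addc e w) v))) = A.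
  apply: EE_ext => w _ /=; under EE_ext => v _ do rewrite e1.
  by under [in X in _ + X]EE_ext => v _ do rewrite e2; ring.
have hB : EE p es (fun w => EE q (e :: es) (fun v => f (U w v))) = q * A + (1 - q) * B.
  rewrite -!EEZ -EED; apply: EE_ext => w _ /=; congr (_ + _).
  by under EE_ext => v _ do rewrite e3.
rewrite [RHS](_ : _ = p * A + (1 - p) * (q * A + (1 - q) * B)); last by rewrite -hB -hA.
rewrite -/A -/B -/(U _ _); rewrite /A /B /U; ring.
Qed.

Lemma EE_mono p q es f : 0 <= p -> p <= q -> q <= 1 -> incr f -> EE p es f <= EE q es f.
Proof.
move=> p0 pq q1; elim: es f => [//|e es IH] f hf /=.
have q0 : 0 <= q := le_trans p0 pq.
have i1 : incr (fun w => f (addc e w)).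
  by move=> w w' h; apply: hf => x /orP[/eqP->|/h hx]; rewrite /addc ?eqxx // hx orbT.
apply: (@le_trans _ _ (p * EE q es (fun w => f (addc e w)) + (1 - p) * EE q es f)).
  by apply: lerD; rewrite ler_wpM2l ?subr_ge0 ?(le_trans pq) //; exact: IH.
have : EE q es f <= EE q es (fun w => f (addc e w)).
  by apply: EE_le; rewrite ?q0 // => w _; apply: hf => x hx; rewrite /addc hx orbT.
set X := EE q es f; set Y := EE q es _ => XY.
by nra.
Qed.

Lemma EE_es_mono p es es' f : 0 <= p <= 1 -> uniq es -> uniq es' -> {subset es <= es'} ->
  incr f -> EE p es f <= EE p es' f.
Proof.
move=> hp u u' s hf.
have hperm : perm_eq es [seq e <- es' | e \in es].
  apply: uniq_perm => //; first exact: filter_uniq.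
  by move=> x; rewrite mem_filter; case: (boolP (x \in es)) => //= /s ->.
rewrite (EE_perm _ _ hperm) -(EE_filter p es' (mem es)); apply: EE_le => // w _.
by apply: hf => x /andP[].
Qed.

(** The expectation with the parameter as an indeterminate; Russo's formula and continuity in [p]
    become facts about polynomials. *)
Fixpoint EEp es f : {poly R} :=
  if es is e :: es' then 'X * EEp es' (fun w => f (addc e w)) + (1 - 'X) * EEp es' f
  else (f (fun _ => false))%:P.

Lemma EEpE p es f : (EEp es f).[p] = EE p es f.
Proof. by elim: es f => [|e es IH] f /=; rewrite !hornerE // !IH. Qed.

Lemma EEp_deriv p es f : uniq es -> (EEp es f)^`().[p] =
  \sum_(e <- es) EE p es (fun w => f (addc e w) - f (res (predC1 e) w)).
Proof.
elim: es f => [|e es IH] f /= ues; first by rewrite derivC horner0 big_nil.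
case/andP: ues => ne ues.
rewrite derivD !derivM derivB derivX (derivC 1) sub0r.
rewrite !hornerE !IH // !EEpE big_cons.
have hres w : subc w es -> res (predC1 e) w = w.
  move=> hw; apply/funext => x; rewrite /res /=; case wx: (w x) => //=.
  by apply: contraNneq ne => <-; apply: hw.
rewrite [X in _ = p * X + _ + _](_ : _ = EE p es (fun w => f (addc e w) - f w)); last first.
  apply: EE_ext => w hw; rewrite res_addc /= eqxx hres //; congr (f _ - _).
  by apply/funext => x; rewrite /addc; case: (x == e).
rewrite [X in _ = _ + (1 - p) * X + _](_ : _ = EE p es (fun w => f (addc e w) - f w)); last first.
  by apply: EE_ext => w hw; rewrite hres.
have -> : \sum_(j <- es) (p * EE p es (fun w => f (addc j (addc e w)) - f (res (predC1 j) (addc e w)))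
      + (1 - p) * EE p es (fun w => f (addc j w) - f (res (predC1 j) w))) =
   p * (\sum_(j <- es) EE p es (fun w => f (addc e (addc j w)) - f (addc e (res (predC1 j) w))))
   + (1 - p) * (\sum_(j <- es) EE p es (fun w => f (addc j w) - f (res (predC1 j) w))).
  rewrite !mulr_sumr -big_split /=; apply: eq_big_seq => j hj; congr (_ * _ + _).
  apply: EE_ext => w _; rewrite addcC res_addc /= ifT //.
  by apply: contraNneq ne => ->.
rewrite EEB /=.
ring.
Qed.

(** Russo's formula integrated by the mean value theorem: a single intermediate parameter serves all
    edges, and no derivative in infinite volume is ever taken. *)
Lemma russo_mvt p q es f : p < q -> uniq es -> exists2 c, p < c < q &
  EE q es f - EE p es f =
  (q - p) * \sum_(e <- es) EE c es (fun w => f (addc e w) - f (res (predC1 e) w)).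
Proof.
move=> pq ues; have [c hc he] := polyrcf.poly_mvt (EEp es f) pq.
by exists c; rewrite // -!EEpE he mulrC EEp_deriv.
Qed.

(** Continuity of a polynomial at [b]. It carries subcritical estimates in a fixed finite volume to
    p_c. *)
Lemma EE_le_left a b es f c : a < b ->
  (forall p, a <= p < b -> EE p es f <= c) -> EE b es f <= c.
Proof.
move=> ab h; rewrite -EEpE; apply: contraT; rewrite -ltNge => hlt.
have e0 : 0 < (EEp es f).[b] - c by rewrite subr_gt0.
have [e e1 he] := polyrcf.poly_cont b (EEp es f) e0.
have [m m1 m2] : exists2 m, a <= m < b & `|m - b| < e.
  exists (Num.max a (b - e / 2)).
    by rewrite le_max lexx /= gt_max ab; lra.
  by rewrite ltr_norml; case: (leP a (b - e / 2)) => ?; lra.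
have := he _ m2; have := h _ m1; rewrite -EEpE ltr_norml; lra.
Qed.

End Bernoulli.

                                

(** * Undirected edges and the edges of a path *)

Section Edges.
Context {V : countType}.

(** The orientation with increasing [pickle] is the one listed by [bedges], so both orders of a pair
    name the same element. *)
Definition edge (x y : V) : V * V := if (pickle x < pickle y)%N then (x, y) else (y, x).

Lemma edgeC x y : edge x y = edge y x.
Proof.
rewrite /edge; case: ltngtP => // h; suff -> : x = y by [].
exact: (pcan_inj pickleK h).
Qed.

Lemma edge_inj x y a b : edge x y = edge a b -> (x = a /\ y = b) \/ (x = b /\ y = a).
Proof. by rewrite /edge; case: ifP; case: ifP => _ _ [-> ->]; tauto. Qed.

Definition touch (A : V -> bool) (e : V * V) : bool := A e.1 || A e.2.

Lemma touch_edge A x y : touch A (edge x y) = A x || A y.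
Proof. by rewrite /touch /edge; case: ifP => _ //=; rewrite orbC. Qed.

Fixpoint pedges (x : V) (s : seq V) : seq (V * V) :=
  if s is y :: s' then edge x y :: pedges y s' else [::].

Lemma size_pedges x s : size (pedges x s) = size s.
Proof. by elim: s x => //= y s IH x; rewrite IH. Qed.

Lemma pedges_cat x s t : pedges x (s ++ t) = pedges x s ++ pedges (last x s) t.
Proof. by elim: s x => //= y s IH x; rewrite IH. Qed.

Lemma mem_pedges x s e : e \in pedges x s ->
  exists a b, [/\ e = edge a b, a \in belast x s & b \in s].
Proof.
elim: s x => //= y s IH x; rewrite inE => /orP[/eqP->|/IH[a [b [-> ha hb]]]].
  by exists x, y; rewrite !mem_head.
by exists a, b; rewrite !inE ha hb !orbT.
Qed.

Lemma mem_pedges_edge x s a b : edge a b \in pedges x s -> (a \in x :: s) && (b \in x :: s).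
Proof.
move=> /mem_pedges[c [d [he /mem_belast hc hd]]].
have hd' : d \in x :: s by rewrite inE hd orbT.
by case: (edge_inj he) => -[-> ->]; rewrite hc hd'.
Qed.

Lemma uniq_pedges x s : uniq (x :: s) -> uniq (pedges x s).
Proof.
elim: s x => //= y s IH x /andP[hx hu]; rewrite IH // andbT.
by apply/negP => /mem_pedges_edge /andP[h _]; rewrite h in hx.
Qed.

Lemma pedges_disj x s t e : uniq (x :: s ++ t) -> e \in pedges (last x s) t ->
  e \notin pedges x s.
Proof.
rewrite -cat_cons cat_uniq => /and3P[_ /hasPn h _] /mem_pedges[a [b [-> _ hb]]].
by apply/negP => /mem_pedges_edge /andP[_]; apply/negP; exact: h.
Qed.

End Edges.

(** * Connectivity, collisions that create cycles, and forks *)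

Section Conn.
Context {V : countType}.
Variable nb : V -> seq V.
Hypothesis nbC : forall x y, adj nb x y = adj nb y x.
Implicit Types (w : V * V -> bool) (A B : V -> bool) (x y z v : V).

Definition oadj w : rel V := fun x y => adj nb x y && w (edge x y).

Definition cn w x y : bool := `[< exists s, path (oadj w) x s /\ last x s = y >].

(** What remains unexplored after the vertices of [A] and all edges at them have been revealed. *)
Definition off A w : V * V -> bool := res (predC (touch A)) w.

Definition hit w B x : bool := `[< exists y, B y /\ cn w x y >].

Definition hitoff A w B x : bool := ~~ A x && hit (off A w) B x.

Lemma oadjC w x y : oadj w x y = oadj w y x.
Proof. by rewrite /oadj nbC edgeC. Qed.

Lemma off_edge A w x y : off A w (edge x y) = [&& w (edge x y), ~~ A x & ~~ A y].
Proof. by rewrite /off /res /= touch_edge negb_or. Qed.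

Lemma cnP w x y : reflect (exists s, path (oadj w) x s /\ last x s = y) (cn w x y).
Proof. exact: asboolP. Qed.

Lemma cn_refl w x : cn w x x.
Proof. by apply/cnP; exists [::]. Qed.

Lemma cn_trans w y x z : cn w x y -> cn w y z -> cn w x z.
Proof.
move=> /cnP[s [ps <-]] /cnP[t [pt <-]]; apply/cnP; exists (s ++ t).
by rewrite cat_path ps last_cat.
Qed.

Lemma cn_edge w x y : oadj w x y -> cn w x y.
Proof. by move=> h; apply/cnP; exists [:: y]; rewrite /= h. Qed.

Lemma cn_sym w x y : cn w x y = cn w y x.
Proof.
have h a b : cn w a b -> cn w b a.
  move=> /cnP[s [ps <-]]; elim: s a ps => [|c s IH] a /=; first by rewrite cn_refl.
  move=> /andP[hac /IH h]; apply: cn_trans h _; apply: cn_edge; by rewrite oadjC.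
by apply/idP/idP; apply: h.
Qed.

Lemma cn_ind w x (P : V -> Prop) : P x ->
  (forall a b, cn w x a -> cn w x b -> P a -> oadj w a b -> P b) ->
  forall y, cn w x y -> P y.
Proof.
move=> Px hP y /cnP[s [ps <-]]; elim/last_ind: s ps => [//|s b IH].
rewrite rcons_path last_rcons => /andP[ps h].
have ca : cn w x (last x s) by apply/cnP; exists s.
exact: hP ca (cn_trans ca (cn_edge h)) (IH ps) h.
Qed.

Lemma cn_local w w' x y :
  (forall a b, cn w x a -> cn w x b -> w (edge a b) -> w' (edge a b)) ->
  cn w x y -> cn w' x y.
Proof.
move=> h; move: y; apply: cn_ind; first exact: cn_refl.
move=> a b ca cb ca' hab; apply: cn_trans ca' (cn_edge _).
by move: hab; rewrite /oadj => /andP[-> /(h _ _ ca cb)].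
Qed.

Lemma cn_mono w w' x y : lec w w' -> cn w x y -> cn w' x y.
Proof. by move=> h; apply: cn_local => a b _ _ /h. Qed.

Lemma cn_simple w x y : cn w x y ->
  exists s, [/\ path (oadj w) x s, last x s = y & uniq (x :: s)].
Proof. by move=> /cnP[s [ps <-]]; case/shortenP: ps => s' ps' us' _; exists s'. Qed.

Lemma path_oadj w x s : path (oadj w) x s = path (adj nb) x s && all w (pedges x s).
Proof. by elim: s x => //= y s IH x; rewrite IH /oadj -!andbA; congr (_ && _); rewrite andbCA. Qed.

Lemma path_cn w x s y : path (oadj w) x s -> y \in x :: s -> cn w x y.
Proof.
elim: s x => [|z s IH] x /=; first by rewrite inE => _ /eqP->; exact: cn_refl.
move=> /andP[hxz ps]; rewrite inE => /orP[/eqP->|hy]; first exact: cn_refl.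
exact: cn_trans (cn_edge hxz) (IH _ ps hy).
Qed.

Lemma hitP w B x : reflect (exists y, B y /\ cn w x y) (hit w B x).
Proof. exact: asboolP. Qed.

Lemma hit_mono w w' B x : lec w w' -> hit w B x -> hit w' B x.
Proof. by move=> h /hitP[y [By hy]]; apply/hitP; exists y; split=> //; exact: cn_mono hy. Qed.

Lemma hit_cn w B x y : cn w x y -> hit w B y -> hit w B x.
Proof. by move=> h /hitP[z [Bz hz]]; apply/hitP; exists z; split=> //; exact: cn_trans hz. Qed.

Lemma hit_pred1 w x y : hit w (pred1 y) x = cn w x y.
Proof.
apply/hitP/idP => [[z [/eqP-> //]]|h]; by exists y; rewrite /= eqxx.
Qed.

Lemma off_le A w : lec (off A w) w.
Proof. by move=> e /andP[]. Qed.

Lemma res_le Q w : lec (res Q w) w.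
Proof. by move=> e /andP[]. Qed.

Lemma cn_off_notin A w x y : ~~ A x -> cn (off A w) x y -> ~~ A y.
Proof.
move=> Ax; move: y; apply: cn_ind => // a b _ _ _ /andP[_].
by rewrite off_edge => /and3P[].
Qed.

Lemma path_split A x s : (all (predC A) (x :: s)) \/
  exists s1 s2, [/\ s = s1 ++ s2, A (last x s1) & all (predC A) (belast x s1)].
Proof.
elim: s x => [|y s IH] x /=.
  by case hA : (A x); [right; exists [::], [::]|left].
case hA : (A x); first by right; exists [::], (y :: s).
case: (IH y) => [h|[s1 [s2 [-> h1 h2]]]]; first by left.
by right; exists (y :: s1), s2; rewrite /= hA h1 h2.
Qed.

Lemma path_off A w x s : path (oadj w) x s -> all (predC A) (x :: s) -> path (oadj (off A w)) x s.
Proof.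
elim: s x => //= y s IH x /andP[hxy ps] /and3P[Ax Ay As].
rewrite IH //= ?Ay // andbT; move: hxy; rewrite /oadj off_edge => /andP[-> ->].
by move: Ax Ay => /= -> ->.
Qed.

Lemma path_lec w w' x s : path (oadj w) x s -> all w' (pedges x s) -> path (oadj w') x s.
Proof. by rewrite !path_oadj => /andP[-> _] ->. Qed.

Lemma path_res w (F : seq (V * V)) x s : path (oadj w) x s -> (forall e, e \in pedges x s -> e \notin F) ->
  path (oadj (res [predC F] w)) x s.
Proof.
move=> ps h; apply: (path_lec ps); apply/allP => e he.
move: ps; rewrite path_oadj => /andP[_ /allP hw].
by rewrite /res hw //= h.
Qed.

(** A simple path is cut at its first vertex in [A]. By simplicity the remainder avoids the edges of
    the first piece, so the two pieces can later be paid for separately. *)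
Lemma first_hit A w x y : cn w x y ->
  (~~ A x && cn (off A w) x y) \/
  exists s, [/\ path (oadj w) x s, uniq (x :: s), A (last x s),
    all (predC A) (belast x s) & cn (res [predC pedges x s] w) (last x s) y].
Proof.
move=> /cn_simple[s [ps <- us]].
case: (path_split A x s) => [h|[s1 [s2 [es h1 h2]]]].
  left; have /= /andP[-> _] := h; apply/cnP; exists s; split=> //; exact: path_off.
right; exists s1; move: ps us; rewrite es cat_path -cat_cons cat_uniq => /andP[p1 p2] /and3P[u1 h3 u2].
split=> //; apply/cnP; exists s2; rewrite last_cat; split=> //.
apply: path_res p2 _ => e; apply: pedges_disj.
by rewrite -cat_cons cat_uniq u1 h3.
Qed.

(** A path from [o] is stopped at its first vertex on a simple path from [y] to [x]; each edge used
    before that has an endpoint off the simple path. *)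
Lemma tripod w o x y : cn w o x -> cn w o y ->
  exists s z, [/\ path (oadj w) y s, uniq (y :: s), last y s = x, z \in y :: s &
    cn (res [predC pedges y s] w) o z].
Proof.
move=> hx hy; have /cn_simple[s [ps ls us]] : cn w y x.
  by apply: cn_trans hx; rewrite cn_sym.
have /cn_simple[t [pt lt ut]] := hy.
exists s; case: (path_split (mem (y :: s)) o t) => [h|[t1 [t2 [et h1 h2]]]].
  by have := allP h (last o t) (mem_last _ _); rewrite /= lt mem_head.
exists (last o t1); split=> //; apply/cnP; exists t1; split=> //.
move: pt; rewrite et cat_path => /andP[p1 _]; apply: path_res p1 _ => e.
move=> /mem_pedges[a [b [-> ha _]]]; apply/negP => /mem_pedges_edge /andP[h _].
by have := allP h2 _ ha; rewrite /= h.
Qed.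

(** Changing edges with no endpoint in this set can neither enlarge nor shrink it. This is the
    hypothesis of [EE_explore] for explorations started at [B], and with [B] a point for the
    exploration of a cluster. *)
Lemma hit_determined w w' B :
  res (touch (hit w B)) w = res (touch (hit w B)) w' -> hit w' B =1 hit w B.
Proof.
move=> h; have hw a b : hit w B a || hit w B b -> w (edge a b) = w' (edge a b).
  by move=> hab; have := congr1 (@^~ (edge a b)) h; rewrite /res touch_edge hab !andbT.
move=> x; apply/idP/idP => /hitP[y [By]].
  rewrite cn_sym => hyx; have hy : hit w B y by apply/hitP; exists y; rewrite cn_refl.
  move: x hyx; apply: cn_ind => // a b _ _ ha /andP[adjab wab].
  by refine (hit_cn _ ha); apply: cn_edge; rewrite oadjC /oadj adjab hw ?ha //.
move=> hxy; apply/hitP; exists y; split=> //; refine (cn_local _ hxy) => a b ca cb.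
rewrite hw //; apply/orP; left; apply/hitP; exists y; split=> //.
by refine (cn_trans _ hxy); rewrite cn_sym.
Qed.

Lemma cn_determined w w' o :
  res (touch (cn w o)) w = res (touch (cn w o)) w' -> cn w' o =1 cn w o.
Proof.
have e (v : V * V -> bool) : hit v (pred1 o) = cn v o.
  by apply/funext => x; rewrite hit_pred1 cn_sym.
by move=> h x; rewrite -!e; apply: hit_determined; rewrite !e.
Qed.

Hypothesis nbI : forall x, x \notin nb x.

Lemma adj_neq x y : adj nb x y -> x != y.
Proof. by apply: contraTneq => ->; rewrite /adj (negbTE (nbI y)). Qed.

Lemma path_oadj_adj w x s : path (oadj w) x s -> path (adj nb) x s.
Proof. by rewrite path_oadj => /andP[]. Qed.

Lemma path_oadj_all w x s : path (oadj w) x s -> all w (pedges x s).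
Proof. by rewrite path_oadj => /andP[]. Qed.

Lemma uniq_cycle_parts (v y : V) c s1 s2 (A : V -> bool) :
  uniq (v :: c) -> uniq (last v c :: s1 ++ s2) -> all (predC A) (belast v c) ->
  (forall x, x \in last v c :: s1 ++ s2 -> A x) -> uniq (s2 ++ v :: c ++ s1).
Proof.
move=> u1 u2 hb hA.
have hp : perm_eq (s2 ++ v :: c ++ s1) (belast v c ++ last v c :: s1 ++ s2).
  rewrite -[v :: c ++ s1]cat_cons lastI perm_catC -cat_rcons -!catA.
  by rewrite perm_refl.
rewrite (perm_uniq hp) cat_uniq u2 andbT; move: u1; rewrite lastI rcons_uniq => /andP[_ ->].
rewrite andTb.
apply/hasPn => x /hA Ax; apply/negP => /(allP hb) /=; by rewrite Ax.
Qed.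

                                                                                   
                                                                                     
                                     
(** Here [w] carries the cluster of [o] and [w'] an arm from [v] that reaches [B] only by meeting
    that cluster. Follow the arm along [c] to the first meeting point [z], return inside the cluster
    from [z] to [u] along [s1 ++ s2], and close up with the edge [u v]. The connection from [o]
    joins the return path at [y], which serves as base point. In each configuration the path and the
    remaining connection use disjoint edges. *)
Lemma cycle_key w w' o u v B :
  cn w o u -> hit w' B v -> ~~ hitoff (cn w o) w' B v ->
  adj nb u v -> ~~ w (edge u v) -> ~~ w' (edge u v) ->
  exists y s2 c s1, let s := s2 ++ v :: c ++ s1 in let z := last v c in
  [/\ path (adj nb) y s, last y s = y, uniq s & (2 < size s)%N] /\
  [/\ last y s2 = u, all w' (pedges v c), hit (res [predC pedges v c] w') B z,
      all w (pedges z (s1 ++ s2)) & cn (res [predC pedges z (s1 ++ s2)] w) o y] /\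
  uniq (pedges v c) /\ uniq (pedges z (s1 ++ s2)).
Proof.
move=> ou /hitP[b [Bb vb]] hn uv nw nw'.
case: (first_hit (cn w o) vb) => [/andP[h1 h2]|[c [pc uc Az hb zb]]].
  by case/negP: hn; rewrite /hitoff h1; apply/hitP; exists b.
have [s [y [ps us ls hy oy]]] := tripod ou Az.
case/splitPl: hy ps us ls oy => s1 s2 ly ps us ls oy.
have hA x : x \in last v c :: s1 ++ s2 -> cn w o x.
  by move=> hx; apply: cn_trans Az (path_cn ps hx).
have us' := uniq_cycle_parts y uc us hb hA.
move: (ps) ls; rewrite cat_path last_cat ly => /andP[p1 p2] ls.
exists y, s2, c, s1 => /=; split; last first.
  split; last by split; exact: uniq_pedges.
  split=> //; [exact: path_oadj_all pc| |exact: path_oadj_all ps].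
  by apply/hitP; exists b.
split=> //.
- rewrite cat_path (path_oadj_adj p2) ls /= uv cat_path (path_oadj_adj pc).
  exact: path_oadj_adj p1.
- by rewrite last_cat /= last_cat ly.
rewrite size_cat /= size_cat.
(* A cycle with at most two vertices would force [u = v] or make the edge [u v] open in one of the
   configurations. *)
case: c s1 s2 pc {us us' hb zb oy hA} ps p1 p2 ly ls Az uc => [|c1 [|c2 c]] s1 s2 pc ps p1 p2 ly ls Az uc /=; last by clear; lia.
- case: s1 ly p1 ps => [|a [|a' s1]] /= ly p1 ps; last by clear; lia.
    rewrite -ly in p2 ls *; case: s2 p2 ls {ps} => [|a' [|a'' s2]] /=; last by clear; lia.
      by move=> _ hu; move: (adj_neq uv); rewrite hu eqxx.
    by move=> /andP[/andP[_ ha] _] hu; move: nw; rewrite -hu edgeC ha.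
  rewrite -ly in ls p2 *; case: s2 p2 ls {ps} => [|a' s2] /=; last by clear; lia.
  by move=> _ hu; move: p1 nw => /andP[/andP[_ ha] _]; rewrite -hu edgeC ha.
- case: s1 ly p1 ps => [|a s1] /= ly p1 ps; last by clear; lia.
  rewrite -ly in ls p2 *; case: s2 p2 ls {ps} => [|a' s2] /=; last by clear; lia.
  by move=> _ hu; move: pc nw' => /= /andP[/andP[_ ha] _]; rewrite -hu edgeC ha.
Qed.

(** The same collision between two arms leaving [z]: the arm of [v2] meets the [w1]-cluster of [v1]
    at [x] and goes on to [B2] from there, while the arm of [v1] leaves the return path [d] towards
    [B1] at [y]. Since [z] is isolated in both configurations, it is not met again by the two
    paths. *)
Lemma cycle_key2 w1 w2 z v1 v2 B1 B2 :
  adj nb z v1 -> adj nb z v2 -> v1 != v2 ->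
  hit w1 B1 v1 -> hit w2 B2 v2 -> ~~ hitoff (cn w1 v1) w2 B2 v2 ->
  (forall a, ~~ w1 (edge z a)) -> (forall a, ~~ w2 (edge z a)) ->
  exists c d y, let s := v2 :: c ++ rcons d z in let x := last v2 c in
  [/\ path (adj nb) z s, last z s = z, uniq s & (2 < size s)%N] /\
  [/\ last x d = v1, all w2 (pedges v2 c), hit (res [predC pedges v2 c] w2) B2 x,
      all w1 (pedges x d) & y \in x :: d /\ hit (res [predC pedges x d] w1) B1 y] /\
  uniq (pedges v2 c) /\ uniq (pedges x d).
Proof.
move=> a1 a2 v12 /hitP[b1 [Bb1 vb1]] /hitP[b2 [Bb2 vb2]] hn n1 n2.
case: (first_hit (cn w1 v1) vb2) => [/andP[h1 h2]|[c [pc uc Az hb zb]]].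
  by case/negP: hn; rewrite /hitoff h1; apply/hitP; exists b2.
have b1v1 : cn w1 b1 v1 by rewrite cn_sym.
have [d [y [pd ud ld hy oy]]] := tripod b1v1 (cn_trans b1v1 Az).
have hA x : x \in last v2 c :: d -> cn w1 v1 x.
  by move=> hx; apply: cn_trans Az (path_cn pd hx).
have nz w v x : (forall a, ~~ w (edge z a)) -> adj nb z v -> cn w v x -> x != z.
  move=> n av; move: x; apply: cn_ind; first by rewrite eq_sym adj_neq.
  move=> a b _ _ _ /andP[_ hab]; apply: contraTneq hab => ->; by rewrite edgeC n.
exists c, d, y => /=; split; last first.
  split; last by split; exact: uniq_pedges.
  split=> //; [exact: path_oadj_all pc| |exact: path_oadj_all pd|].
    by apply/hitP; exists b2.
  by split=> //; apply/hitP; exists b1; split=> //; rewrite cn_sym.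
have hp : perm_eq (v2 :: c ++ rcons d z) (z :: (d ++ v2 :: c ++ [::])).
  by rewrite cats0 -cat_cons -rcons_cat perm_rcons perm_cons perm_catC.
split.
- rewrite a2 cat_path (path_oadj_adj pc) rcons_path (path_oadj_adj pd) ld /=.
  by rewrite nbC.
- by rewrite last_cat last_rcons.
- rewrite -[_ && _]/(uniq (v2 :: c ++ rcons d z)) (perm_uniq hp) cons_uniq; apply/andP; split.
    rewrite cats0 mem_cat negb_or; apply/andP; split.
      apply/negP => zd; have := nz _ _ _ n1 a1 (hA z _); rewrite eqxx inE zd orbT => h.
      by have := h isT.
    by apply/negP => zc; have := nz _ _ _ n2 a2 (path_cn pc zc); rewrite eqxx.
  by apply: (@uniq_cycle_parts v2 v2 c [::] d (cn w1 v1)).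
rewrite size_cat size_rcons; case: c d pc pd ld {hp hA ud uc hb zb hy oy Az} => [|c1 c] [|d1 d] //=; try by clear; lia.
by move=> _ _ h; rewrite h eqxx in v12.
Qed.

Definition fork z v1 v2 : seq (V * V) := [:: edge z v1; edge z v2].

Definition close_fork z v1 v2 w := res [predC fork z v1 v2] w.

(** The fork at [z] is the only way from [o] to [B]: with both its edges closed the cluster [K] of
    [o] still contains [z] but misses [B], and behind them two arms, disjoint from [K] and from each
    other, reach [B]. *)
Definition branch w o B z v1 v2 : bool :=
  let K := cn (close_fork z v1 v2 w) o in
  [&& w (edge z v1), w (edge z v2), K z, ~~ hit (close_fork z v1 v2 w) B o,
      hitoff K w B v1 & hitoff (fun x => K x || cn (off K w) v1 x) w B v2].

Lemma fork_edge z v1 v2 a b : edge a b \in fork z v1 v2 -> (a == z) || (b == z).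
Proof.
rewrite !inE => /orP[] /eqP /edge_inj[] [-> ->]; by rewrite eqxx ?orbT.
Qed.

Lemma close_fork_edge z v1 v2 w a b : w (edge a b) -> a != z -> b != z -> close_fork z v1 v2 w (edge a b).
Proof.
move=> h ha hb; rewrite /close_fork /res h /=; apply/negP => /fork_edge.
by rewrite (negbTE ha) (negbTE hb).
Qed.

(** The two arms are vertex-disjoint, so at least one of them avoids [t]. *)
Lemma branch_side w o B z v1 v2 t : branch w o B z v1 v2 ->
  exists v (A : V -> bool), [/\ v = v1 \/ v = v2, A z, hitoff A w B v & ~~ cn (off A w) v t].
Proof.
case/and5P => h1 h2 h3 h4 /andP[h5 h6]; set K := cn _ o in h3 h5 h6.
case: (boolP (cn (off K w) v1 t)) => ht; last by exists v1, K; split=> //; left.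
exists v2, (fun x => K x || cn (off K w) v1 x); split=> //; [by right|by rewrite h3|].
apply/negP => h; have /andP[hv2 _] := h6.
by have := cn_off_notin hv2 h; rewrite ht orbT.
Qed.

(** An arm of [z] that avoids [z'] survives closing the fork at [z']. *)
Lemma branch_transfer w o B z z' (v1' v2' : V) v A :
  z != z' -> cn (close_fork z' v1' v2' w) o z -> adj nb z v -> w (edge z v) ->
  hitoff A w B v -> ~~ cn (off A w) v z' -> hit (close_fork z' v1' v2' w) B o.
Proof.
move=> zz' oz zv wzv /andP[_ /hitP[b [Bb vb]]] nz'.
have vz' : v != z' by apply: contraNneq nz' => <-; exact: cn_refl.
apply/hitP; exists b; split=> //; apply: (cn_trans oz); apply: (@cn_trans _ v).
  by apply: cn_edge; rewrite /oadj zv close_fork_edge.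
refine (cn_local _ vb) => a c ca cc; rewrite off_edge => /and3P[wac _ _].
by apply: close_fork_edge => //; apply: contraNneq nz' => <-.
Qed.

Lemma branch_same w o B z v1 v2 v1' v2' v A :
  adj nb z v -> w (edge z v) -> branch w o B z v1 v2 -> v != v1 -> v != v2 ->
  A z -> hitoff A w B v -> False.
Proof.
move=> zv wzv /and5P[_ _ Kz hn _] n1 n2 Az /andP[_ /hitP[b [Bb vb]]].
case/negP: hn; apply/hitP; exists b; split=> //; apply: (cn_trans Kz); apply: (@cn_trans _ v).
  apply: cn_edge; rewrite /oadj zv /close_fork /res wzv /= !inE negb_or.
  have nv : z != v by exact: adj_neq.
  by apply/andP; split; apply/eqP => /edge_inj[] [h1 h2];
    rewrite ?h2 ?eqxx ?h1 in n1 n2 nv *; rewrite ?h2 ?eqxx in n1 n2 nv.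
refine (cn_local _ vb) => a c ca cc; rewrite off_edge => /and3P[wac na nc].
by apply: close_fork_edge => //; [apply: contraNneq na => ->|apply: contraNneq nc => ->].
Qed.

(** Suppose z and z' differ. By [branch_side] and [branch_transfer], [o] cannot reach either of them
    once the fork at the other is closed, since the closed configuration must miss [B]. But then the
    cluster containing [z] with the fork at [z] closed never visits [z'], so it survives closing the
    fork at [z'], a contradiction. At a common vertex a third arm is excluded by [branch_same]. *)
Lemma branch_unique w o B z v1 v2 z' (v1' v2' : V) :
  adj nb z v1 -> adj nb z v2 -> adj nb z' v1' -> adj nb z' v2' -> v1' != v2' ->
  branch w o B z v1 v2 -> branch w o B z' v1' v2' ->
  z' = z /\ ((v1' = v1 /\ v2' = v2) \/ (v1' = v2 /\ v2' = v1)).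
Proof.
move=> a1 a2 a1' a2' nv' hb hb'.
have aux y u1 u2 y' u1' u2' : adj nb y u1 -> adj nb y u2 -> branch w o B y u1 u2 ->
    branch w o B y' u1' u2' -> y != y' -> ~~ cn (close_fork y' u1' u2' w) o y.
  move=> b1 b2 hby hby' nyy'; apply/negP => oy.
  have [v [A [hv Ay hA nA]]] := branch_side y' hby.
  have hav : adj nb y v by case: hv => ->.
  have hwv : w (edge y v) by case/and5P: hby => ? ? *; case: hv => ->.
  have := branch_transfer (v1' := u1') (v2' := u2') nyy' oy hav hwv hA nA.
  by case/and5P: hby' => _ _ _ /negbTE ->.
have zz : z' = z.
  apply/eqP; apply: contraT => nz.
  have n1 := aux _ _ _ _ _ _ a1' a2' hb' hb nz.
  have n2 : ~~ cn (close_fork z' v1' v2' w) o z by apply: aux a1 a2 hb hb' _; rewrite eq_sym.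
  case/negP: n2; case/and5P: hb => _ _ Kz _ _; refine (cn_local _ Kz) => a b ca cb /andP[wab _].
  by apply: close_fork_edge => //; apply: contraNneq n1 => <-.
rewrite zz in a1' a2' hb' *; split=> //.
have h1 : v1' = v1 \/ v1' = v2.
  case: (eqVneq v1' v1) => [|n1]; first by left.
  case: (eqVneq v1' v2) => [|n2]; first by right.
  exfalso; case/and5P: (hb') => w1 _ Kz _ /andP[hh _].
  exact: branch_same hb n1 n2 Kz hh.
have h2 : v2' = v1 \/ v2' = v2.
  case: (eqVneq v2' v1) => [|n1]; first by left.
  case: (eqVneq v2' v2) => [|n2]; first by right.
  exfalso; case/and5P: (hb') => _ w2 Kz _ /andP[_ hh].
  by apply: (branch_same _ _ a2' w2 hb n1 n2 _ hh); rewrite ?Kz.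
by case: h1 h2 nv' => -> [] ->; rewrite ?eqxx //; tauto.
Qed.

Lemma branch_hit w o B z v1 v2 : adj nb z v1 -> branch w o B z v1 v2 -> hit w B o.
Proof.
move=> zv /and5P[w1 _ Kz _ /andP[/andP[_ h] _]].
have c1 : cn w o z by apply: cn_mono Kz => e /andP[].
have c2 : cn w z v1 by apply: cn_edge; rewrite /oadj zv.
by apply: hit_cn (cn_trans c1 c2) (hit_mono _ h) => e /andP[].
Qed.

End Conn.

                                                      

(** * Elementary inequalities *)

Section RealAux.
Context {R : realType}.
Implicit Types (a b c x y : R).

Lemma cauchy_schwarz_seq (I : Type) (r : seq I) (F G : I -> R) :
  (\sum_(i <- r) F i * G i) ^+ 2 <= (\sum_(i <- r) F i ^+ 2) * (\sum_(i <- r) G i ^+ 2).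
Proof.
elim: r => [|i r IH]; first by rewrite !big_nil expr0n mulr0.
rewrite !big_cons; set S := \sum_(j <- r) F j * G j in IH *.
set A := \sum_(j <- r) F j ^+ 2 in IH *; set B := \sum_(j <- r) G j ^+ 2 in IH *.
have A0 : 0 <= A by apply: sumr_ge0 => j _; exact: sqr_ge0.
have B0 : 0 <= B by apply: sumr_ge0 => j _; exact: sqr_ge0.
suff : 2 * (F i * G i * S) <= F i ^+ 2 * B + G i ^+ 2 * A by nra.
apply: le_trans (ler_norm _) _; rewrite -[leRHS]ger0_norm; last first.
  by rewrite addr_ge0 // mulr_ge0 // sqr_ge0.
rewrite -ler_sqr ?nnegrE // !real_normK ?num_real //.
have h : (F i * G i) ^+ 2 * S ^+ 2 <= (F i * G i) ^+ 2 * (A * B).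
  by rewrite ler_wpM2l ?sqr_ge0.
apply: le_trans (_ : 4 * ((F i * G i) ^+ 2 * (A * B)) <= _); first by nra.
have := sqr_ge0 (F i ^+ 2 * B - G i ^+ 2 * A); nra.
Qed.

Lemma bernoulli_ge a n : 0 <= a -> 1 + n%:R * a <= (1 + a) ^+ n.
Proof.
move=> a0; elim: n => [|n IH]; first by rewrite mul0r addr0 expr0.
rewrite exprS -natr1; have : 0 <= (n%:R : R) by [].
nra.
Qed.

Lemma natr_archi a : exists n : nat, a < n%:R.
Proof.
exists (Num.truncn `|a|).+1; apply: le_lt_trans (ler_norm a) _.
by rewrite truncnS_gt.
Qed.

Lemma expr_small (k e : R) : 0 <= k < 1 -> 0 < e ->
  exists L : nat, (0 < L)%N /\ forall n, (L <= n)%N -> (n ^ 2)%:R * k ^+ n <= e.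
Proof.
move=> /andP[k0 k1] e0; case: (eqVneq k 0) => [->|kn0].
  by exists 1%N; split=> // -[//|n] _; rewrite expr0n mulr0 ltW.
have kp : 0 < k by rewrite lt_def kn0.
(* Bernoulli's inequality for the inverse of the fourth root of [k] yields k^n <= (n t)^(-4), which
   beats n^2. *)
pose u := Num.sqrt (Num.sqrt k).
have u4 : u ^+ 4 = k.
  rewrite /u (_ : 4 = 2 * 2)%N // exprM sqr_sqrtr ?sqrtr_ge0 // sqr_sqrtr //.
have up : 0 < u by rewrite !sqrtr_gt0.
have u1 : u < 1.
  rewrite ltNge; apply/negP => h; have : 1 <= u ^+ 4 by exact: exprn_ege1.
  by rewrite u4 leNgt k1.
pose t := u^-1 - 1; have t0 : 0 < t by rewrite subr_gt0 invf_gt1.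
have [L hL] := natr_archi (1 / (e * t ^+ 4)).
exists L.+1; split=> // n hn.
have n0 : 0 < (n%:R : R) by rewrite ltr0n; apply: leq_trans hn.
have h1 : u ^+ n <= (n%:R * t)^-1.
  rewrite -[leLHS]invrK lef_pV2 ?posrE ?invr_gt0 ?exprn_gt0 ?mulr_gt0 //.
  rewrite -exprVn (_ : u^-1 = 1 + t); last by rewrite /t; ring.
  by apply: le_trans (bernoulli_ge n (ltW t0)); rewrite lerDr.
have h2 : k ^+ n <= (n%:R * t) ^- 4.
  rewrite -u4 -exprM mulnC exprM -exprVn lerXn2r ?nnegrE ?exprn_ge0 ?invr_ge0 ?mulr_ge0 // ltW //.
apply: le_trans (_ : n%:R ^+ 2 * (n%:R * t) ^- 4 <= _).
  by rewrite natrX ler_wpM2l ?sqr_ge0.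
have n1 : 1 <= (n%:R : R) by rewrite ler1n; apply: leq_trans hn.
have -> : n%:R ^+ 2 * (n%:R * t) ^- 4 = (n%:R ^+ 2)^-1 * (t ^+ 4)^-1 :> R.
  by field; rewrite !gt_eqF.
rewrite -invfM invf_ple ?posrE ?mulr_gt0 ?exprn_gt0 //.
move: hL; rewrite div1r invfM ltr_pdivrMr ?exprn_gt0 // => hL.
apply: le_trans (ltW hL) _; rewrite ler_wpM2r ?exprn_ge0 ?(ltW t0) //.
have : L%:R <= (n%:R : R) by rewrite ler_nat ltnW.
nra.
Qed.

Lemma expr_to0 (k e : R) : 0 <= k < 1 -> 0 < e -> exists M, k ^+ M <= e.
Proof.
move=> hk e0; have [L [L0 /(_ L (leqnn L)) h]] := expr_small hk e0; exists L.
apply: le_trans h; rewrite ler_peMl ?exprn_ge0 ?ler1n ?expn_gt0 ?L0 //.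
by case/andP: hk.
Qed.

Lemma sum_geometric_le (k : R) M : 0 <= k < 1 -> \sum_(m < M) k ^+ m <= (1 - k)^-1.
Proof.
move=> /andP[k0 k1]; rewrite -[leRHS]mul1r ler_pdivlMr ?subr_gt0 //.
have -> : (\sum_(m < M) k ^+ m) * (1 - k) = 1 - k ^+ M.
  by rewrite -opprB mulrN mulrC -subrX1 opprB.
by rewrite lerBlDr lerDl exprn_ge0.
Qed.

Lemma le_sum_seq1 (I : eqType) (r : seq I) (F : I -> R) i :
  (forall j, 0 <= F j) -> i \in r -> F i <= \sum_(j <- r) F j.
Proof.
move=> F0 ir; rewrite (big_rem i) //= lerDl; exact: sumr_ge0.
Qed.

Lemma sum_delta (I : eqType) (r : seq I) (F : I -> R) i : uniq r ->
  \sum_(j <- r) (i == j)%:R * F j = (i \in r)%:R * F i.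
Proof.
move=> ur; case: (boolP (i \in r)) => hi; first by rewrite mul1r; exact: big_pick.
rewrite mul0r big_seq big1 // => j jr; case: eqVneq => [hij|_]; last by rewrite mul0r.
by rewrite hij jr in hi.
Qed.

End RealAux.

(** * Counting walks: powers of the adjacency operator *)

Section Walks.
Context {R : realType} {V : countType}.
Variables (nb : V -> seq V) (d : nat).
Hypothesis nbU : forall x, uniq (nb x).
Hypothesis nbI : forall x, x \notin nb x.
Hypothesis nbC : forall x y, adj nb x y = adj nb y x.
Hypothesis nbd : forall x, size (nb x) = d.
Implicit Types (x y z : V).

Fixpoint apow (m : nat) x y : R :=
  if m is m'.+1 then \sum_(z <- nb x) apow m' z y else (x == y)%:R.

Lemma apow_ge0 m x y : 0 <= apow m x y.
Proof. by elim: m x => [|m IH] x //=; apply: sumr_ge0. Qed.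

Lemma sum_nb_cst x (c : R) : \sum_(z <- nb x) c = d%:R * c.
Proof. by rewrite big_const_seq count_predT nbd iter_addr addr0 mulr_natl. Qed.

Lemma srwE n x y : srw nb n x y = d%:R ^- n * apow n x y.
Proof.
elim: n x => [|n IH] x /=; first by rewrite expr0 invr1 mul1r.
rewrite nbd mulr_sumr; apply: eq_bigr => z _.
by rewrite IH exprS invfM mulrA.
Qed.

Lemma apow_le m x y : apow m x y <= d%:R ^+ m.
Proof.
elim: m x => [|m IH] x /=; first by rewrite expr0 lern1 leq_b1.
by rewrite exprS -(sum_nb_cst x); apply: ler_sum.
Qed.

Lemma apow_recr m x y : apow m.+1 x y = \sum_(z <- nb y) apow m x z.
Proof.
elim: m x => [|m IH] x.
  rewrite /=; have e u v : \sum_(z <- nb u) ((z == v)%:R : R) = (adj nb u v)%:R.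
    rewrite -[RHS]mulr1 /adj -(sum_delta (fun=> 1) v (nbU u)).
    by apply: eq_bigr => z _; rewrite mulr1 eq_sym.
  by rewrite e nbC -e; apply: eq_bigr => z _; rewrite eq_sym.
rewrite -[LHS]/(\sum_(z <- nb x) apow m.+1 z y).
by rewrite (eq_bigr _ (fun z _ => IH z)) exchange_big.
Qed.

Lemma apowC m x y : apow m x y = apow m y x.
Proof.
elim: m x y => [|m IH] x y; first by rewrite /= eq_sym.
by rewrite apow_recr /=; apply: eq_bigr => z _.
Qed.

Fixpoint supp (m : nat) x : seq V :=
  if m is m'.+1 then undup (flatten [seq supp m' z | z <- nb x]) else [:: x].

Lemma suppP m x y : y \notin supp m x -> apow m x y = 0.
Proof.
elim: m x => [|m IH] x /=; first by rewrite inE eq_sym => /negbTE->.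
rewrite mem_undup => /flattenP h; rewrite big_seq big1 // => z hz; apply: IH.
by apply/negP => hy; apply: h; exists (supp m z) => //; apply: map_f.
Qed.

Lemma apowD_sub U m n x y : uniq U -> (forall z, z \notin U -> apow m x z = 0) ->
  apow (m + n) x y = \sum_(z <- U) apow m x z * apow n z y.
Proof.
move=> uU; elim: m x => [|m IH] x hU.
  rewrite add0n /= sum_delta //; case: (boolP (x \in U)) => [|/hU /=]; first by rewrite mul1r.
  by move/eqP; rewrite eqxx oner_eq0.
rewrite addSn /=; transitivity (\sum_(z <- nb x) \sum_(u <- U) apow m z u * apow n u y).
  rewrite big_seq [RHS]big_seq; apply: eq_bigr => z hz; apply: IH => u /hU /= h.
  apply/eqP; rewrite eq_le apow_ge0 andbT -h.
  by apply: (le_sum_seq1 (F := fun z => apow m z u)) => // j; exact: apow_ge0.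
by rewrite exchange_big; apply: eq_bigr => u _; rewrite mulr_suml.
Qed.

Lemma apowD_le U m n x y : uniq U ->
  \sum_(z <- U) apow m x z * apow n z y <= apow (m + n) x y.
Proof.
move=> uU; pose W := undup (U ++ supp m x).
rewrite (@apowD_sub W m n x y) ?undup_uniq //; last first.
  by move=> z; rewrite mem_undup mem_cat negb_or => /andP[_ /suppP].
rewrite (perm_big [seq z <- W | z \in U]) /=; last first.
  apply: uniq_perm => //; first exact/filter_uniq/undup_uniq.
  by move=> z; rewrite mem_filter mem_undup mem_cat; case: (z \in U).
rewrite big_filter [leRHS](bigID (mem U)) /= lerDl.
by apply: sumr_ge0 => z _; rewrite mulr_ge0 ?apow_ge0.
Qed.

Lemma apow_mul_le m n x y z : apow m x z * apow n z y <= apow (m + n) x y.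
Proof. by have := @apowD_le [:: z] m n x y isT; rewrite big_seq1. Qed.

(** Cauchy-Schwarz for the rows A^m(x,.) and A^n(y,.), over a finite set supporting both; symmetry
    turns the squares into return counts. *)
Lemma apow_cs m n x y : apow (m + n) x y ^+ 2 <= apow m.*2 x x * apow n.*2 y y.
Proof.
pose U := undup (supp m x ++ supp n y).
have uU : uniq U by exact: undup_uniq.
have hx z : z \notin U -> apow m x z = 0.
  by rewrite mem_undup mem_cat negb_or => /andP[/suppP].
have hy z : z \notin U -> apow n y z = 0.
  by rewrite mem_undup mem_cat negb_or => /andP[_ /suppP].
rewrite (apowD_sub _ _ uU hx) -!addnn (apowD_sub _ _ uU hx) (apowD_sub _ _ uU hy).
rewrite (eq_bigr (fun z => apow m x z * apow n y z)); last by move=> z _; rewrite (apowC n z).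
apply: le_trans (cauchy_schwarz_seq _ _ _) _.
rewrite (eq_bigr (fun z => apow m x z * apow m z x)); last by move=> z _; rewrite (apowC m z) expr2.
by rewrite [X in _ * X](eq_bigr (fun z => apow n y z * apow n z y)) // => z _; rewrite (apowC n z) expr2.
Qed.

Lemma apow_path x s : path (adj nb) x s -> 0 < apow (size s) x (last x s).
Proof.
elim: s x => [|y s IH] x /=; first by rewrite eqxx.
move=> /andP[hxy ps]; apply: lt_le_trans (IH _ ps) _.
by apply: (le_sum_seq1 (F := fun z => apow (size s) z (last y s))) => // z; exact: apow_ge0.
Qed.

Lemma apow_total m x U : uniq U -> {subset supp m x <= U} -> \sum_(y <- U) apow m x y = d%:R ^+ m.
Proof.
move=> uU; elim: m x => [|m IH] x sU.
  rewrite expr0 /= (eq_bigr (fun y => (x == y)%:R * 1)); last by move=> y _; rewrite mulr1.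
  by rewrite sum_delta // sU ?mulr1 // inE.
rewrite /= exchange_big /= exprS -(sum_nb_cst x) big_seq [RHS]big_seq.
apply: eq_bigr => z hz; apply: IH => u hu; apply: sU; rewrite /= mem_undup.
by apply/flattenP; exists (supp m z) => //; apply: map_f.
Qed.

End Walks.

(** * Non-backtracking walks against the Green function of the adjacency operator *)

Section NonBacktracking.
Context {R : realType} {V : countType}.
Variables (nb : V -> seq V) (d : nat).
Hypothesis nbU : forall x, uniq (nb x).
Hypothesis nbC : forall x y, adj nb x y = adj nb y x.
Hypothesis nbd : forall x, size (nb x) = d.
Implicit Types (x y z : V) (a : option V) (s r : R).

(** Walks are recorded without their starting vertex; [a] is the vertex just left, to which the next
    step may not return, and [None] at the start. *)
Fixpoint nbl a (n : nat) x : seq (seq V) :=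
  if n is n'.+1 then
    flatten [seq [seq z :: l | l <- nbl (Some x) n' z] | z <- nb x & Some z != a]
  else [:: [::]].

Fixpoint nbc a (n : nat) x y : R :=
  if n is n'.+1 then \sum_(z <- nb x | Some z != a) nbc (Some x) n' z y
  else (x == y)%:R.

Lemma nbc_ge0 a n x y : 0 <= nbc a n x y.
Proof. by elim: n a x => [|n IH] a x //=; apply: sumr_ge0. Qed.

Lemma nbcE a n x y : \sum_(l <- nbl a n x) (last x l == y)%:R = nbc a n x y.
Proof.
elim: n a x => [|n IH] a x /=; first by rewrite big_seq1.
rewrite big_flatten /= big_map big_filter; apply: eq_bigr => z _.
by rewrite big_map -IH.
Qed.

Lemma nbl_simple a n x l : path (adj nb) x l -> size l = n -> uniq (x :: l) ->
  (if l is y :: _ then Some y != a else true) -> l \in nbl a n x.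
Proof.
elim: n a x l => [|n IH] a x [|y l] //= /andP[hxy pl] [sl] /andP[hx hu] ha.
apply/flattenP; exists [seq y :: l' | l' <- nbl (Some x) n y].
  by apply: (map_f (fun z => [seq z :: l' | l' <- nbl (Some x) n z])); rewrite mem_filter ha.
apply: map_f; apply: IH => //; case: l hx {pl sl hu} => [//|z l].
by rewrite !inE !negb_or => /and3P[_ hz _]; apply: contra hz => /eqP[->].
Qed.

Lemma nbl_cycle n x l : path (adj nb) x l -> size l = n -> uniq l -> last x l = x ->
  (2 < n)%N -> l \in nbl None n x.
Proof.
case: l => [|y l]; first by move=> _ <-.
move=> /= /andP[hxy pl]; case: n => [//|n] [sl] /andP[hy hu] ll n2.
apply/flattenP; exists [seq y :: l' | l' <- nbl (Some x) n y].
  by apply: (map_f (fun z => [seq z :: l' | l' <- nbl (Some x) n z])); rewrite mem_filter.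
apply: map_f; apply: nbl_simple => //; first by rewrite /= hy.
case: l pl sl hy hu ll => [//|z l] _ sl _ /= /andP[hz _] ll.
case: l sl hz ll => [|u l] /= sl hz ll; first by move: n2; rewrite -sl.
by apply: contra hz => /eqP[->]; rewrite -{1}ll mem_last.
Qed.

Lemma nbc_split n x z y : adj nb x z ->
  nbc None n.+1 z y = nbc (Some x) n.+1 z y + nbc (Some z) n x y.
Proof.
move=> hxz /=; rewrite (bigD1_seq x) //=; last by rewrite -[_ \in _]/(adj nb z x) nbC.
by rewrite addrC; congr (_ + _); apply: eq_bigl => u.
Qed.

Lemma nbc_succ n x y : \sum_(z <- nb x) nbc (Some x) n z y = nbc None n.+1 x y.
Proof. by []. Qed.

Lemma nbc_rec0 x y : \sum_(z <- nb x) nbc None 1 z y = nbc None 2 x y + d%:R * nbc None 0 x y.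
Proof.
rewrite -(sum_nb_cst nbd x) -nbc_succ -big_split /=.
by rewrite big_seq [RHS]big_seq; apply: eq_bigr => z hz; rewrite -[LHS]/(nbc None 1 z y) (nbc_split 0 y hz).
Qed.

(** Prepend [x] to a walk starting at a neighbour [z]. If its first step is not to [x], the result
    is non-backtracking; otherwise cancel the two steps, and the remaining walk from [x] arises once
    for each [z] other than its own first step, which is d-1 times. *)
Lemma nbc_rec n x y : \sum_(z <- nb x) nbc None n.+2 z y =
  nbc None n.+3 x y + (d%:R - 1) * nbc None n.+1 x y.
Proof.
transitivity (\sum_(z <- nb x) (nbc (Some x) n.+2 z y + (nbc None n.+1 x y - nbc (Some x) n z y))).
  rewrite big_seq [RHS]big_seq; apply: eq_bigr => z hz.
  rewrite (nbc_split n.+1 y hz); congr (_ + _).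
  rewrite (nbc_split (x := z) n y); last by rewrite nbC.
  by rewrite addrK.
rewrite big_split /= nbc_succ sumrB /= (sum_nb_cst nbd) nbc_succ.
by rewrite mulrBl mul1r.
Qed.

Section Weights.
Variable s : R.

(** The transpose of the recursion: it gives the coefficients of A applied to the sum of g_n B_n.
    Accordingly [gw M] lists the coefficients, in the family B_n, of the sum of s^m A^m over m <=
    M. *)
Definition gstep (g : nat -> R) (n : nat) : R :=
  (if n is n'.+1 then g n' else 0) + (if n is 0 then d%:R * g 1%N else (d%:R - 1) * g n.+1).

Fixpoint gw (M n : nat) : R :=
  if M is M'.+1 then (n == 0)%:R + s * gstep (gw M') n else (n == 0)%:R.

Lemma gw_supp M n : (M < n)%N -> gw M n = 0.
Proof.
elim: M n => [|M IH] [|n] //= h.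
by rewrite /gstep !IH ?mulr0 ?addr0 ?add0r ?mulr0 //; lia.
Qed.

Lemma gw_ge0 M n : 0 <= s -> (0 < d)%N -> 0 <= gw M n.
Proof.
move=> s0 d0; elim: M n => [|M IH] n /=; first by [].
rewrite addr_ge0 // mulr_ge0 // /gstep addr_ge0 //; case: n => [|n] //.
  by rewrite mulr_ge0.
by rewrite mulr_ge0 // subr_ge0 ler1n.
Qed.

Lemma gstep_sum (g : nat -> R) K x y :
  \sum_(n < K.+2) nbc None n x y * gstep g n =
  \sum_(n < K.+2) g n * (\sum_(z <- nb x) nbc None n z y)
  - nbc None K.+2 x y * g K.+1 + (d%:R - 1) * nbc None K.+1 x y * g K.+2.
Proof.
elim: K => [|K IH].
  rewrite !big_ord_recl !big_ord0 /= /bump /= -/(nbc None 1 _ _).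
  rewrite -[X in g 1%N * X]/(\sum_(z <- nb x) nbc None 1 z y) nbc_rec0 /gstep /=; ring.
rewrite big_ord_recr IH [in RHS]big_ord_recr /= nbc_rec /gstep /=; ring.
Qed.

Lemma gw_sum M K x y : (M < K)%N ->
  \sum_(n < K) nbc None n x y * gw M n = \sum_(m < M.+1) s ^+ m * apow nb m x y.
Proof.
move=> MK; have ext K' : (M < K')%N ->
    \sum_(n < K') nbc None n x y * gw M n = \sum_(n < M.+1) nbc None n x y * gw M n.
  move=> h; rewrite [RHS](big_ord_widen K' (fun n => nbc None n x y * gw M n)) //.
  rewrite [LHS](bigID (fun n : 'I_K' => (n < M.+1)%N)) /= [X in _ + X]big1 ?addr0 //.
  by move=> n; rewrite -leqNgt => hn; rewrite gw_supp ?mulr0.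
rewrite (ext K MK) {K MK ext}.
have H K' : (M < K')%N -> forall x, \sum_(n < K') nbc None n x y * gw M n =
    \sum_(m < M.+1) s ^+ m * apow nb m x y.
  elim: M K' => [|M IH] K' hK {}x.
    case: K' hK => [//|K'] _; rewrite big_ord_recl big1 ?addr0 => [|i _]; last by rewrite mulr0.
    by rewrite big_ord_recl big_ord0 /= mulr1 expr0 mul1r addr0.
  case: K' hK => [//|[//|K']] hK.
  rewrite [RHS]big_ord_recl expr0 mul1r.
  rewrite (eq_bigr (fun n : 'I_K'.+2 => nbc None n x y * ((n : nat) == 0)%:R +
      s * (nbc None n x y * gstep (gw M) n))); last by move=> n _ /=; ring.
  rewrite big_split /= -mulr_sumr gstep_sum !gw_supp ?mulr0 ?subr0 ?addr0; [|lia|lia].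
  congr (_ + _).
    rewrite big_ord_recl big1 ?addr0 /= ?mulr1 // => i _; by rewrite mulr0.
  rewrite (eq_bigr (fun n : 'I_K'.+2 => \sum_(z <- nb x) nbc None n z y * gw M n)); last first.
    by move=> n _; rewrite mulrC mulr_suml.
  rewrite exchange_big /= (eq_bigr (fun z => \sum_(m < M.+1) s ^+ m * apow nb m z y)); last first.
    by move=> z _; apply: IH; lia.
  rewrite exchange_big mulr_sumr; apply: eq_bigr => m _ /=.
  by rewrite -mulr_sumr mulrA exprS.
exact: H.
Qed.

(** Induction on [M]. The sequence r^n solves the limiting recursion for n >= 1 because
    s(1+(d-1)r^2) = r, and is a subsolution at n = 0. The sequence r'^n is multiplied by exactly
    [lam] for n >= 1 and by at most [lam] at n = 0, where r' <= 1 is used; it dominates the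
    truncation error. *)
Lemma gw_lower r r' M n : (0 < d)%N -> 0 < r -> r < r' -> r' <= 1 ->
  s = r / (1 + (d%:R - 1) * r ^+ 2) ->
  r ^+ n - (s * (1 + (d%:R - 1) * r' ^+ 2) / r') ^+ M * r' ^+ n <= gw M n.
Proof.
move=> d0 r0 rr' r1 es; set q := d%:R - 1 in es *; set lam := s * _ / _.
have q0 : 0 <= q by rewrite subr_ge0 ler1n.
have s0 : 0 < s.
  by rewrite es divr_gt0 // ltr_wpDr // mulr_ge0 // sqr_ge0.
have r'0 : 0 < r' by apply: lt_trans rr'.
have lam0 : 0 <= lam by rewrite divr_ge0 ?mulr_ge0 ?addr_ge0 ?mulr_ge0 ?sqr_ge0 // ltW.
elim: M n => [|M IH] n.
  rewrite expr0 mul1r; case: n => [|n]; first by rewrite !expr0 subrr.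
  by rewrite subr_le0 lerXn2r ?nnegrE // ltW.
case: n => [|n]; rewrite /= /gstep /= -/q.
  have := IH 1%N; rewrite !expr1 !expr0 mulr1 add0r => h.
  have dq : d%:R = q + 1 :> R by rewrite subrK.
  have e1 : lam ^+ M.+1 = lam ^+ M * (s * (1 + q * r' ^+ 2) / r') by rewrite exprSr.
  have h2 : (q + 1) * r' <= (1 + q * r' ^+ 2) / r'.
    rewrite ler_pdivlMr //; nra.
  have lM : 0 <= lam ^+ M by rewrite exprn_ge0.
  rewrite e1 dq; apply: le_trans (_ : 1 + s * ((q + 1) * (r - lam ^+ M * r')) <= _); last first.
    by rewrite lerD2l ler_wpM2l ?(ltW s0) // ler_wpM2l // addr_ge0.
  have : s * lam ^+ M * ((q + 1) * r') <= s * lam ^+ M * ((1 + q * r' ^+ 2) / r').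
    by rewrite ler_wpM2l // mulr_ge0 // ltW.
  have hs : 0 <= s * ((q + 1) * r).
    by apply: mulr_ge0; [exact: ltW|apply: mulr_ge0; [exact: addr_ge0|exact: ltW]].
  lra.
rewrite add0r; apply: le_trans (_ : s * ((r ^+ n - lam ^+ M * r' ^+ n) +
    q * (r ^+ n.+2 - lam ^+ M * r' ^+ n.+2)) <= _); last first.
  by rewrite ler_wpM2l ?(ltW s0) // lerD // ler_wpM2l.
rewrite le_eqVlt; apply/orP; left; apply/eqP.
have es' : s * (1 + q * r ^+ 2) = r.
  by rewrite es divfK // gt_eqF // ltr_wpDr // mulr_ge0 // sqr_ge0.
have el : lam * r' = s * (1 + q * r' ^+ 2) by rewrite /lam divfK // gt_eqF.
have e2 : r ^+ n.+1 = r ^+ n * (s * (1 + q * r ^+ 2)) by rewrite es' exprSr.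
have e3 : lam ^+ M.+1 * r' ^+ n.+1 = lam ^+ M * r' ^+ n * (s * (1 + q * r' ^+ 2)).
  by rewrite -el !exprSr; ring.
by rewrite e2 e3 !exprSr; ring.
Qed.

(** A truncated form of the identity that the sum of r^n B_n is (1-r^2) times the inverse of 1 +
    (d-1)r^2 - rA. The condition (d-1) r r' < 1 is equivalent to lam < 1, so for [M] large every
    coefficient with n < K is at least half of r^n. *)
Lemma nbc_le_apow r r' K : (0 < d)%N -> 0 < r -> r < r' -> r' <= 1 ->
  (d%:R - 1) * (r * r') < 1 ->
  s = r / (1 + (d%:R - 1) * r ^+ 2) ->
  exists M, forall x y, \sum_(n < K) nbc None n x y * r ^+ n <=
    2 * \sum_(m < M) s ^+ m * apow nb m x y.
Proof.
move=> d0 r0 rr' r1 hq es; set q := d%:R - 1 in hq es.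
have q0 : 0 <= q by rewrite subr_ge0 ler1n.
have r'0 : 0 < r' by apply: lt_trans rr'.
have den (b : R) : 0 < 1 + q * b ^+ 2 by rewrite ltr_wpDr // mulr_ge0 // sqr_ge0.
have s0 : 0 < s by rewrite es divr_gt0.
pose lam := s * (1 + q * r' ^+ 2) / r'.
have lam0 : 0 <= lam by rewrite /lam divr_ge0 ?mulr_ge0 ?ltW.
have lam1 : lam < 1.
  rewrite /lam ltr_pdivrMr // mul1r es mulrAC ltr_pdivrMr //.
  have : 0 < (r' - r) * (1 - q * (r * r')) by rewrite mulr_gt0 ?subr_gt0.
  nra.
have [M0 hM0] : exists M0, lam ^+ M0 <= r ^+ K / 2.
  by apply: expr_to0; rewrite ?lam0 // divr_gt0 ?exprn_gt0.
pose M := (M0 + K)%N; have KM : (K <= M.+1)%N by rewrite leqW // leq_addl.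
exists M.+1 => x y.
have r1' : r <= 1 by apply: le_trans r1; exact: ltW.
have hlam : lam ^+ M <= r ^+ K / 2.
  apply: le_trans hM0; rewrite /M exprD ler_piMr ?exprn_ge0 //.
  by apply: exprn_ile1 => //; exact: ltW.
apply: le_trans (_ : 2 * (\sum_(n < M.+1) nbc None n x y * gw M n) <= _); last by rewrite (gw_sum x y (ltnSn M)).
rewrite mulr_sumr.
rewrite (big_ord_widen M.+1 (fun n => nbc None n x y * r ^+ n)); last exact: KM.
rewrite big_mkcond /=; apply: ler_sum => n _; case: ifP => hn; last first.
  by rewrite !mulr_ge0 ?nbc_ge0 ?gw_ge0 // ltW.
rewrite mulrCA ler_wpM2l ?nbc_ge0 //.
apply: le_trans (_ : 2 * (r ^+ n - lam ^+ M * r' ^+ n) <= _); last first.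
  by rewrite ler_pM2l //; exact: gw_lower.
suff : lam ^+ M * r' ^+ n <= r ^+ n / 2 by lra.
apply: le_trans (_ : lam ^+ M * 1 <= _).
  by rewrite ler_wpM2l ?exprn_ge0 // exprn_ile1 // ltW.
rewrite mulr1; apply: le_trans hlam _; rewrite ler_pM2r ?invr_gt0 //.
by apply: ler_wiXn2l => //; [exact: ltW|exact: ltnW].
Qed.

End Weights.
End NonBacktracking.

(** * Walk counts bounded by the spectral radius *)

Section SpectralRadius.
Import numFieldNormedType.Exports.
Context {R : realType} {V : countType}.
Variables (nb : V -> seq V) (d : nat).
Hypothesis nbU : forall x, uniq (nb x).
Hypothesis nbI : forall x, x \notin nb x.
Hypothesis nbC : forall x y, adj nb x y = adj nb y x.
Hypothesis nbd : forall x, size (nb x) = d.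
Hypothesis nbconn : graph_connected nb.
Hypothesis d0 : (0 < d)%N.
Implicit Types (x y z : V) (rho : R).

Local Notation apow := (@apow R V nb).
Let ret x n : R := apow n.*2 x x.

Let dR0 : 0 < (d%:R : R). Proof. by rewrite ltr0n. Qed.

Lemma ret_gt0 x n : 0 < ret x n.
Proof.
have h1 : 0 < ret x 1.
  rewrite /ret /=; have [z hz] : exists z, z \in nb x.
    by case e: (nb x) (nbd x) => [|z l] h; [move: d0; rewrite -h|exists z; rewrite mem_head].
  apply: lt_le_trans (_ : \sum_(u <- nb z) ((u == x)%:R : R) <= _); last first.
    by apply: (le_sum_seq1 (F := fun z => \sum_(u <- nb z) ((u == x)%:R : R))) => // j; apply: sumr_ge0.
  apply: lt_le_trans (_ : ((x == x)%:R : R) <= _); first by rewrite eqxx.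
  apply: (le_sum_seq1 (F := fun u => ((u == x)%:R : R))) => //.
  by rewrite -[_ \in _]/(adj nb z x) nbC.
elim: n => [|n IH]; first by rewrite /ret /= eqxx.
apply: lt_le_trans (mulr_gt0 h1 IH) _.
by rewrite /ret (_ : n.+1.*2 = 1.*2 + n.*2)%N //; exact: apow_mul_le.
Qed.

Lemma ret_logconvex x n : ret x n.+1 ^+ 2 <= ret x n * ret x n.+2.
Proof.
rewrite /ret (_ : n.+1.*2 = n + n.+2)%N; last by rewrite -addnn; lia.
exact: apow_cs.
Qed.

(** Log-convexity and the value 1 at time zero make the roots nondecreasing, so the limit defining
    the spectral radius is an upper bound for all of them. *)
Lemma ret_root_mono x n : ret x n.+1 ^+ n.+2 <= ret x n.+2 ^+ n.+1.
Proof.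
have pos := ret_gt0 x; elim: n => [|n IH].
  have := ret_logconvex x 0; rewrite expr1 /ret /= eqxx mul1r; exact.
have hc : (ret x n.+2 ^+ 2) ^+ n.+2 <= (ret x n.+1 * ret x n.+3) ^+ n.+2.
  apply: lerXn2r; rewrite ?nnegrE ?sqr_ge0 //; last exact: ret_logconvex.
  by apply: mulr_ge0; exact: ltW.
rewrite -(ler_pM2l (exprn_gt0 n.+1 (pos n.+2))).
rewrite -exprD (_ : n.+1 + n.+3 = 2 * n.+2)%N; last by lia.
rewrite exprM; apply: le_trans hc _.
by rewrite exprMn ler_wpM2r // exprn_ge0 // ltW.
Qed.

Lemma spectral_radius_ret o : 0 < (spectral_radius nb o : R) /\
  forall n, ret o n.+1 <= (d%:R * spectral_radius nb o) ^+ n.+1.*2.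
Proof.
pose u (n : nat) : R := powR (srw nb n.*2.+2 o o) ((n.*2.+2)%:R^-1).
have srw_pos m : 0 < (srw nb m.*2 o o : R).
  by rewrite (srwE nbd) mulr_gt0 ?invr_gt0 ?exprn_gt0 ?ret_gt0.
have upow m : u m ^+ m.*2.+2 = srw nb m.+1.*2 o o.
  rewrite /u -powR_mulrn ?powR_ge0 // -powRrM mulVf ?pnatr_eq0 // powRr1 //.
  by rewrite ltW // -doubleS.
have u0 m : 0 <= u m by exact: powR_ge0.
have umono : nondecreasing_seq u.
  apply/nondecreasing_seqP => m.
  have h : (u m) ^+ (m.*2.+2 * m.+2) <= (u m.+1) ^+ (m.*2.+2 * m.+2).
    rewrite exprM upow (_ : (m.*2.+2 * m.+2 = m.+1.*2.+2 * m.+1)%N); last by rewrite -!mul2n; lia.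
    rewrite exprM upow !(srwE nbd) !exprMn -!exprVn -!exprM.
    rewrite (_ : (m.+1.*2 * m.+2 = m.+2.*2 * m.+1)%N); last by rewrite -!mul2n; lia.
    by rewrite ler_wpM2l ?exprn_ge0 ?invr_ge0 //; exact: ret_root_mono.
  by rewrite -(@ler_pXn2r _ (m.*2.+2 * m.+2)%N) ?nnegrE.
have u1 m : u m <= 1.
  rewrite -(@ler_pXn2r _ m.*2.+2) ?nnegrE // upow expr1n (srwE nbd) mulrC.
  by rewrite ler_pdivrMr ?exprn_gt0 // mul1r; exact: apow_le.
have ucv : cvgn u.
  by apply: nondecreasing_is_cvgn => //; exists 1 => _ [m _ <-].
have hl n : u n <= spectral_radius nb o by exact: nondecreasing_cvgn_le.
split=> [|n].
  by apply: lt_le_trans (hl 0%N); rewrite /u powR_gt0 // -doubleS.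
have e1 : ret o n.+1 = (d%:R * u n) ^+ n.+1.*2.
  by rewrite exprMn doubleS upow (srwE nbd) mulrA mulfV ?mul1r // gt_eqF // exprn_gt0.
rewrite e1; apply: lerXn2r; rewrite ?nnegrE.
- exact: mulr_ge0.
- by apply: mulr_ge0 => //; exact: le_trans (hl n).
- by rewrite ler_wpM2l.
Qed.

(** Connectivity moves the bound from [o] to [x] at the price of a constant [C].
    Supermultiplicativity of return counts removes it: the j-th power of the count is still at most
    [C] times the j-th power of the bound, for all j. *)
Lemma ret_le o rho x n : 0 < rho -> spectral_radius nb o <= rho ->
  ret x n <= (d%:R * rho) ^+ n.*2.
Proof.
move=> rho0 hrho; have [sr0 hsr] := spectral_radius_ret o.
have dr0 : 0 < d%:R * rho by rewrite mulr_gt0.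
have ho m : ret o m <= (d%:R * rho) ^+ m.*2.
  case: m => [|m]; first by rewrite /ret /= eqxx expr0.
  apply: le_trans (hsr m) _; apply: lerXn2r; rewrite ?nnegrE ?(ltW dr0) //.
    by apply: mulr_ge0 => //; exact: ltW.
  by rewrite ler_pM2l.
have [C [C0 hC]] : exists C : R, 0 < C /\ forall m, ret x m <= C * (d%:R * rho) ^+ m.*2.
  have [l [pl ll]] := nbconn o x.
  have hk := @apow_path R V nb o l pl; rewrite ll in hk; set k := size l in hk.
  pose a := apow k o x; have a0 : 0 < a by [].
  exists ((d%:R * rho) ^+ k.*2 / a ^+ 2); split; first by rewrite divr_gt0 ?exprn_gt0.
  move=> m; rewrite mulrAC ler_pdivlMr ?exprn_gt0 // -exprD.
  have h1 : a * ret x m <= apow (k + m.*2) o x by exact: apow_mul_le.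
  have h2 : apow (k + m.*2) o x * a <= ret o (k + m).
    rewrite /ret (_ : (k + m).*2 = k + m.*2 + k)%N; last by rewrite -!mul2n; lia.
    by rewrite /a (apowC nbU nbC k o x); exact: apow_mul_le.
  apply: le_trans (_ : ret o (k + m) <= _); last first.
    by rewrite -doubleD addnC; exact: ho.
  apply: le_trans h2; rewrite expr2 mulrA [ret x m * a]mulrC.
  by rewrite ler_wpM2r // ltW.
have sup j : ret x n ^+ j <= ret x (n * j).
  elim: j => [|j IH]; first by rewrite muln0 /ret /= eqxx expr0.
  rewrite exprS mulnS; apply: le_trans (_ : ret x n * ret x (n * j) <= _).
    by rewrite ler_wpM2l // ltW // ret_gt0.
  by rewrite /ret doubleD; exact: apow_mul_le.
rewrite leNgt; apply/negP => hlt.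
have p0 : 0 < (d%:R * rho) ^+ n.*2 by rewrite exprn_gt0.
pose t := (d%:R * rho) ^+ n.*2 / ret x n.
have t1 : 0 <= t < 1.
  by rewrite /t divr_ge0 ?(ltW p0) ?ltW ?ret_gt0 //= ltr_pdivrMr ?ret_gt0 // mul1r.
have c2 : 0 < (2 * C)^-1 by rewrite invr_gt0 mulr_gt0.
have [M hM] := expr_to0 t1 c2.
have h1 := le_trans (sup M) (hC (n * M)%N).
have h2 : (d%:R * rho) ^+ (n * M).*2 = ((d%:R * rho) ^+ n.*2) ^+ M.
  by rewrite -exprM -doubleMl.
have e2 : (d%:R * rho) ^+ n.*2 = t * ret x n by rewrite /t divfK // gt_eqF // ret_gt0.
move: h1; rewrite h2 e2 exprMn mulrA ler_pMl ?exprn_gt0 ?ret_gt0 // leNgt => /negP; apply.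
by apply: le_lt_trans (ler_wpM2l (ltW C0) hM) _; rewrite invfM mulrCA mulfV ?gt_eqF // mulr1 invf_lt1 // ltr1n.
Qed.

(** Even times follow from Cauchy-Schwarz. At odd times the first step is summed over d neighbours,
    and d instead of d rho accounts for the division by [rho]. *)
Lemma apow_spectral o rho x y m : 0 < rho -> rho <= 1 -> spectral_radius nb o <= rho ->
  apow m x y <= (d%:R * rho) ^+ m / rho.
Proof.
move=> rho0 rho1 hrho; have hret := ret_le _ _ rho0 hrho.
have dr0 : 0 < d%:R * rho by rewrite mulr_gt0.
have heven k u v : apow k.*2 u v <= (d%:R * rho) ^+ k.*2.
  have e0 : 0 <= (d%:R * rho) ^+ k.*2 by apply: exprn_ge0; exact: ltW.
  rewrite -(@ler_pXn2r _ 2) ?nnegrE ?apow_ge0 //.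
  have := apow_cs (R := R) nbU nbC k k u v; rewrite addnn => h; apply: le_trans h _.
  by rewrite expr2; apply: ler_pM; rewrite ?apow_ge0 //; exact: hret.
have inv1 : 1 <= rho^-1 by rewrite invf_ge1.
rewrite -(odd_double_half m); case: (odd m) => /=; rewrite ?add0n ?add1n.
  apply: le_trans (_ : \sum_(z <- nb x) (d%:R * rho) ^+ (m./2).*2 <= _).
    by apply: ler_sum => z _.
  rewrite (sum_nb_cst nbd) exprS mulrAC (_ : d%:R * rho * _ = d%:R) //.
  by rewrite mulfK // gt_eqF.
apply: le_trans (heven _ _ _) _; rewrite ler_peMr // exprn_ge0 // ltW //.
Qed.

(** With degree at most 2 there are at most two non-backtracking walks of each length, so walks of
    length m end in a set of at most 2(m+1) vertices. Cauchy-Schwarz then gives d^(2m) <= 2(m+1) (d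
    rho)^(2m) for all m, which is impossible for rho < 1. *)
Lemma degree_ge3 o rho : 0 < rho -> rho < 1 -> spectral_radius nb o <= rho -> (3 <= d)%N.
Proof.
move=> rho0 rho1 hrho; rewrite leqNgt; apply/negP => d3.
have nblS n a x : a \in nb x -> (size (nbl nb (Some a) n x) <= 1)%N.
  elim: n a x => [//|n IH] a x hax /=.
  have hs : (size [seq z <- nb x | Some z != Some a] <= 1)%N.
    rewrite size_filter; have := count_predC (pred1 a) (nb x).
    rewrite nbd count_uniq_mem // hax (eq_count (a2 := fun z => Some z != Some a)) //.
    by move: d3; lia.
  case e: [seq z <- nb x | Some z != Some a] hs => [|z [|z' l]] //= _.
  rewrite cats0 size_map; apply: IH.
  have : z \in [seq z <- nb x | Some z != Some a] by rewrite e mem_head.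
  by rewrite mem_filter => /andP[_]; rewrite -[_ \in nb x]/(adj nb x z) nbC.
have nblN n x : (size (nbl nb None n x) <= 2)%N.
  case: n => [//|n] /=; rewrite size_flatten /shape -map_comp.
  apply: (@leq_trans (sumn [seq 1%N | z <- [seq z <- nb x | Some z != None]])).
    have : {subset [seq z <- nb x | Some z != None] <= nb x} by move=> z; rewrite mem_filter.
    elim: [seq z <- nb x | _] => [//|z l IH] hl /=; rewrite size_map leq_add //.
      by apply: nblS; have := hl z (mem_head _ _); rewrite -[_ \in nb x]/(adj nb x z) nbC.
    by apply: IH => u hu; apply: hl; rewrite inE hu orbT.
  rewrite (_ : sumn _ = size [seq z <- nb x | Some z != None]); last first.
    by elim: [seq z <- nb x | _] => //= z l ->.
  by rewrite size_filter (leq_trans (count_size _ _)) // nbd; lia.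
pose U m : seq V := undup (flatten [seq [seq last o l | l <- nbl nb None n o] | n <- iota 0 m.+1]).
have sU m : (size (U m) <= 2 * m.+1)%N.
  apply: leq_trans (size_undup _) _; rewrite size_flatten /shape -map_comp.
  rewrite -{2}(size_iota 0 m.+1); elim: (iota 0 m.+1) => [//|n l IH] /=.
  by rewrite mulnS leq_add // size_map.
have hU m y : y \notin U m -> apow m o y = 0.
  move=> hy; have h := @gw_sum R V nb d nbU nbC nbd 1 m m.+1 o y (ltnSn m).
  have h0 : \sum_(n < m.+1) nbc nb None n o y * gw d (1 : R) m n = 0.
    apply: big1 => n _; rewrite -(nbcE nb None n o y) big_seq big1 ?mul0r // => l hl.
    case: eqVneq => // hly; case/negP: hy; rewrite mem_undup; apply/flattenP.
    exists [seq last o l | l <- nbl nb None n o]; last by rewrite -hly; exact: map_f.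
    by apply: (map_f (fun n => [seq last o l | l <- nbl nb None n o])); rewrite mem_iota /= add0n.
  move: h; rewrite h0 big_ord_recr /= expr1n mul1r => /esym/eqP.
  rewrite addr_eq0 => /eqP hh; apply/eqP; rewrite eq_le apow_ge0 andbT -oppr_ge0 -hh.
  by apply: sumr_ge0 => i _; rewrite expr1n mul1r apow_ge0.
have hm m : 1 <= (2 * m.+1)%:R * rho ^+ m.*2.
  have uU : uniq (U m) by exact: undup_uniq.
  have tot : \sum_(y <- U m) apow m o y = d%:R ^+ m.
    pose W := undup (U m ++ supp nb m o).
    rewrite -(@apow_total R V nb d nbd m o W) ?undup_uniq //; last first.
      by move=> z hz; rewrite mem_undup mem_cat hz orbT.
    rewrite (perm_big [seq z <- W | z \in U m]) /=; last first.
      apply: uniq_perm => //; first exact/filter_uniq/undup_uniq.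
      by move=> z; rewrite mem_filter (mem_undup (U m ++ _)) mem_cat; case: (z \in U m).
    rewrite big_filter [RHS](bigID (mem (U m))) /= [X in _ + X]big1 ?addr0 //.
    by move=> z /hU.
  have := cauchy_schwarz_seq (U m) (fun y => apow m o y) (fun=> 1).
  rewrite (eq_bigr (fun y => apow m o y)); last by move=> y _; rewrite mulr1.
  rewrite tot [X in _ * X](eq_bigr (fun=> 1)); last by move=> y _; rewrite expr1n.
  rewrite big_const_seq count_predT iter_addr addr0 => hcs.
  have hret : \sum_(y <- U m) apow m o y ^+ 2 <= (d%:R * rho) ^+ m.*2.
    apply: le_trans (ret_le o m rho0 hrho); rewrite /ret -addnn.
    apply: le_trans (_ : \sum_(z <- U m) apow m o z * apow m z o <= _); last exact: apowD_le.
    by apply: ler_sum => y _; rewrite (apowC nbU nbC m y o) expr2.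
  have dm : 0 < (d%:R : R) ^+ m.*2 by rewrite exprn_gt0.
  rewrite -(ler_pM2l dm) mulr1 -{1}muln2 exprM; apply: le_trans hcs _.
  apply: le_trans (_ : (d%:R * rho) ^+ m.*2 * (2 * m.+1)%:R <= _).
    apply: ler_pM => //; first by apply: sumr_ge0 => y _; exact: sqr_ge0.
    by rewrite ler_nat.
  by rewrite exprMn mulrAC -mulrA.
have rho01 : 0 <= rho < 1 by rewrite (ltW rho0).
have e8 : (0 : R) < 1 / 8 by [].
have [L [L0 hL]] := expr_small rho01 e8.
have hL2 : (L <= L.+1.*2)%N by rewrite -addnn; lia.
have h1 := hm L.+1; have h2 := hL _ hL2.
have h3 : ((2 * L.+2)%:R : R) <= (L.+1.*2 ^ 2)%:R.
  by rewrite ler_nat -mul2n -mulnn; nia.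
have h4 : 0 <= rho ^+ L.+1.*2 by rewrite exprn_ge0 // ltW.
by have := le_trans h1 (le_trans (ler_wpM2r h4 h3) h2); lra.
Qed.

End SpectralRadius.

(** * The Green function, its triangle sum, and the uniform choice of window and girth *)

Section Green.
Context {R : realType} {V : countType}.
Variable nb : V -> seq V.

Definition green (s : R) M x y : R := \sum_(m < M) s ^+ m * apow nb m x y.

(** Summing over [x] and [y] glues three walks into one closed walk at [o] of length i+j+k, whose
    weight decays geometrically in each index. *)
Lemma green_triangle (nbU : forall x, uniq (nb x)) (nbC : forall x y, adj nb x y = adj nb y x)
    (s th c : R) M o X Y : 0 <= s -> 0 <= th < 1 -> 0 <= c ->
  (forall m, s ^+ m * apow nb m o o <= th ^+ m * c) -> uniq X -> uniq Y ->
  \sum_(x <- X) \sum_(y <- Y) green s M o x * green s M x y * green s M y o <=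
  (1 - th) ^- 3 * c.
Proof.
move=> s0 hth c0 hc uX uY.
have e1 : \sum_(x <- X) \sum_(y <- Y) green s M o x * green s M x y * green s M y o =
  \sum_(i < M) \sum_(j < M) \sum_(k < M) s ^+ (i + j + k) *
    (\sum_(x <- X) apow nb i o x * \sum_(y <- Y) apow nb j x y * apow nb k y o).
  transitivity (\sum_(x <- X) \sum_(y <- Y) \sum_(i < M) \sum_(j < M) \sum_(k < M)
     s ^+ (i + j + k) * (apow nb i o x * (apow nb j x y * apow nb k y o))).
    apply: eq_bigr => x _; apply: eq_bigr => y _.
    rewrite /green !mulr_suml; apply: eq_bigr => i _.
    rewrite [X in X * _]mulr_sumr mulr_suml; apply: eq_bigr => j _.
    by rewrite mulr_sumr; apply: eq_bigr => k _; rewrite !exprD; ring.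
  under eq_bigr => x _ do rewrite exchange_big /=.
  rewrite exchange_big /=; apply: eq_bigr => i _.
  under eq_bigr => x _ do rewrite exchange_big /=.
  rewrite exchange_big /=; apply: eq_bigr => j _.
  under eq_bigr => x _ do rewrite exchange_big /=.
  rewrite exchange_big /=; apply: eq_bigr => k _.
  rewrite mulr_sumr; apply: eq_bigr => x _.
  by rewrite -mulr_sumr -mulr_sumr.
rewrite e1; apply: le_trans (_ : \sum_(i < M) \sum_(j < M) \sum_(k < M) th ^+ i * th ^+ j * th ^+ k * c <= _).
  apply: ler_sum => i _; apply: ler_sum => j _; apply: ler_sum => k _.
  rewrite -!exprD; apply: le_trans (hc _); rewrite ler_wpM2l ?exprn_ge0 //.
  rewrite -addnA; apply: le_trans (_ : \sum_(x <- X) apow nb i o x * apow nb (j + k) x o <= _).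
    by apply: ler_sum => x _; rewrite ler_wpM2l ?apow_ge0 //; exact: apowD_le.
  exact: apowD_le.
have -> : \sum_(i < M) \sum_(j < M) \sum_(k < M) th ^+ i * th ^+ j * th ^+ k * c =
    (\sum_(i < M) th ^+ i) ^+ 3 * c.
  transitivity (\sum_(i < M) \sum_(j < M) th ^+ i * th ^+ j * (\sum_(k < M) th ^+ k) * c).
    apply: eq_bigr => i _; apply: eq_bigr => j _.
    by rewrite mulr_sumr mulr_suml.
  transitivity (\sum_(i < M) th ^+ i * (\sum_(k < M) th ^+ k) * (\sum_(k < M) th ^+ k) * c).
    by apply: eq_bigr => i _; rewrite -!mulr_suml -mulr_sumr.
  by rewrite -!mulr_suml !exprS expr0 mulr1 mulrA.
rewrite ler_wpM2r // -exprVn lerXn2r ?nnegrE ?invr_ge0 //.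
- by apply: sumr_ge0 => i _; rewrite exprn_ge0 //; case/andP: hth.
- by rewrite subr_ge0 ltW //; case/andP: hth.
- exact: sum_geometric_le.
Qed.

End Green.

                                                                                           
                                                                                     
(** [e] depends only on [rho], and [L] only on [rho] and [eta]. Three rates over d-1 are used: 1+2e
    ends the percolation window, 1+3e is the rate at which the Green function is still summable, and
    1+4e is the auxiliary rate of [gw_lower]. The gap between the first two gives a geometric factor
    that absorbs n^2 and makes the tail beyond [L] small. *)
Lemma walk_bounds (R : realType) (rho : R) : rho < 1 ->
  exists e : R, 0 < e <= 1 / 10 /\ forall eta : R, 0 < eta -> exists L : nat, (0 < L)%N /\
  forall (V : countType) (nb : V -> seq V) (o : V),
  simple_graph nb -> graph_connected nb -> infinite_graph V -> regular nb ->
  spectral_radius nb o <= rho ->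
  exists d : nat, [/\ forall x, size (nb x) = d, (3 <= d)%N,
    forall K z, \sum_(n < K | (L <= n)%N) (n ^ 2)%:R * ((1 + 2 * e) / (d%:R - 1)) ^+ n *
       nbc nb None n z z <= eta &
    exists s C : R, [/\ 0 <= s,
      forall K, exists M, forall x y, \sum_(n < K) nbc nb None n x y * ((1 + 2 * e) / (d%:R - 1)) ^+ n
        <= 2 * green nb s M x y &
      forall M X Y, uniq X -> uniq Y ->
        \sum_(x <- X) \sum_(y <- Y) green nb s M o x * green nb s M x y * green nb s M y o <= C]].
Proof.
(* Raising the bound to at least 1/2 keeps it below 1 and allows division by it. *)
move=> rho1; pose rh : R := Num.max rho (1 / 2).
have rh0 : 0 < rh by rewrite lt_max; apply/orP; right.
have rh1 : rh < 1 by rewrite gt_max rho1 /=; lra.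
pose e := (1 - rh) / 10; have rh12 : 1 / 2 <= rh by rewrite le_max lexx orbT.
have e0 : 0 < e by rewrite divr_gt0 // subr_gt0.
have e1 : e <= 1 / 20 by rewrite /e; lra.
pose th := (1 + 3 * e) * rh.
have th01 : 0 <= th < 1 by rewrite /th /e; nra.
exists e; split; first by rewrite e0 /=; lra.
move=> eta eta0; pose ka := (1 + 2 * e) / (1 + 3 * e).
have ka01 : 0 <= ka < 1.
  by rewrite /ka divr_ge0 ?ltr_pdivrMr ?mul1r //=; lra.
pose C0 := 2 * ((1 - th)^-1 / rh).
have C00 : 0 < C0 by rewrite mulr_gt0 // divr_gt0 // invr_gt0 subr_gt0; case/andP: th01.
have ec : 0 < eta / C0 by rewrite divr_gt0.
have [L [L0 hL]] := expr_small ka01 ec.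
exists L; split=> // V nb o [nbU [nbI nbC]] nbconn ninf [d nbd] hsr0.
have hsr : spectral_radius nb o <= rh by rewrite le_max hsr0.
have nbA x y : adj nb x y = adj nb y x by exact: nbC.
have d0 : (0 < d)%N.
  rewrite lt0n; apply/negP => /eqP d0; apply: ninf.
  apply: (@sub_finite_set _ _ [set o]%classic); last exact: finite_set1.
  move=> y _ /=; have [l [pl <-]] := nbconn o y.
  by case: l pl => //= z l; rewrite /adj; have := nbd o; rewrite d0 => /size0nil ->.
have d3 : (3 <= d)%N by exact: (degree_ge3 nbU nbA nbd nbconn d0 rh0 rh1 hsr).
exists d; pose q : R := d%:R - 1.
have q2 : 2 <= q.
  by rewrite /q lerBrDr (_ : 2 + 1 = 3%:R :> R) ?ler_nat //; ring.
have q0 : 0 < q by lra.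
pose r := (1 + 3 * e) / q; pose r' := (1 + 4 * e) / q.
have r0 : 0 < r by rewrite divr_gt0 //; lra.
have r'1 : r' <= 1 by rewrite /r' ler_pdivrMr // mul1r; lra.
have rr' : r < r' by rewrite ltr_pM2r ?invr_gt0 //; lra.
have hq : (d%:R - 1) * (r * r') < 1.
  rewrite -/q /r /r' (_ : _ * _ = (1 + 3 * e) * (1 + 4 * e) / q); last by field; rewrite gt_eqF.
  by rewrite ltr_pdivrMr // mul1r; nra.
pose s := r / (1 + q * r ^+ 2).
have den : 0 < 1 + q * r ^+ 2 by rewrite ltr_wpDr // mulr_ge0 ?sqr_ge0 // ltW.
have s0 : 0 <= s by rewrite ltW // divr_gt0.
(* s d <= 1+3e because s = (1+3e)/(q+(1+3e)^2) and d = q+1. *)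
have sd : s * (d%:R * rh) <= th.
  rewrite /th mulrA ler_wpM2r ?(ltW rh0) //.
  have rq : r * q = 1 + 3 * e by rewrite /r divfK // gt_eqF.
  have sq : s * (q + (1 + 3 * e) ^+ 2) = 1 + 3 * e.
    rewrite -rq (_ : q + (r * q) ^+ 2 = (1 + q * r ^+ 2) * q); last by ring.
    by rewrite mulrA /s divfK // gt_eqF.
  apply: le_trans (_ : s * (q + (1 + 3 * e) ^+ 2) <= _); last by rewrite sq.
  rewrite ler_wpM2l // (_ : d%:R = q + 1); last by rewrite /q subrK.
  by rewrite lerD2l; nra.
have hap m x y : s ^+ m * apow nb m x y <= th ^+ m * rh^-1.
  apply: le_trans (_ : s ^+ m * ((d%:R * rh) ^+ m / rh) <= _).
    rewrite ler_wpM2l ?exprn_ge0 //.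
    exact: (apow_spectral nbU nbA nbd nbconn d0 x y m rh0 (ltW rh1) hsr).
  rewrite mulrA -exprMn ler_wpM2r ?invr_ge0 ?(ltW rh0) //.
  apply: lerXn2r; rewrite ?nnegrE //; last by case/andP: th01.
  by apply: mulr_ge0 => //; apply: mulr_ge0 => //; exact: ltW.
have hr K : exists M, forall x y, \sum_(n < K) nbc nb None n x y * r ^+ n <= 2 * green nb s M x y.
  by have [M hM] := nbc_le_apow nbU nbA nbd K d0 r0 rr' r'1 hq (erefl s); exists M.
have gr M x y : 2 * green nb s M x y <= C0.
  rewrite /C0 ler_pM2l //; apply: le_trans (_ : \sum_(m < M) th ^+ m * rh^-1 <= _).
    by apply: ler_sum => m _.
  by rewrite -mulr_suml ler_wpM2r ?invr_ge0 ?(ltW rh0) //; exact: sum_geometric_le.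
have pr : (1 + 2 * e) / q = ka * r.
  by rewrite /ka /r mulrA divfK // gt_eqF //; lra.
split=> //.
  move=> K z; rewrite -/q pr.
  apply: le_trans (_ : \sum_(n < K) eta / C0 * (nbc nb None n z z * r ^+ n) <= _).
    rewrite big_mkcond; apply: ler_sum => n _; case: ifP => hn; last first.
      by rewrite mulr_ge0 ?(ltW ec) // mulr_ge0 ?nbc_ge0 // exprn_ge0 // ltW.
    have -> : (n ^ 2)%:R * (ka * r) ^+ n * nbc nb None n z z =
        (n ^ 2)%:R * ka ^+ n * (nbc nb None n z z * r ^+ n) by rewrite exprMn; ring.
    apply: ler_wpM2r; last exact: hL.
    by rewrite mulr_ge0 ?nbc_ge0 // exprn_ge0 // ltW.
  rewrite -mulr_sumr; have [M hM] := hr K.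
  apply: le_trans (_ : eta / C0 * C0 <= _); last by rewrite divfK // gt_eqF.
  by rewrite ler_wpM2l ?(ltW ec) //; exact: le_trans (hM _ _) (gr _ _ _).
exists s, ((1 - th) ^- 3 * rh^-1); split=> //.
  move=> K; have [M hM] := hr K; exists M => x y; apply: le_trans (hM x y).
  apply: ler_sum => n _; rewrite ler_wpM2l ?nbc_ge0 //.
  rewrite -/q lerXn2r ?nnegrE ?(ltW r0) //.
    by rewrite divr_ge0 ?(ltW q0) //; lra.
  by rewrite /r ler_pM2r ?invr_gt0 //; lra.
move=> M X Y uX uY; apply: green_triangle => //.
by rewrite invr_ge0 ltW.
Qed.

                       

(** * Percolation in a finite set of vertices: clusters, monotonicity, automorphisms *)

Section Volume.
Context {V : countType}.
Variable nb : V -> seq V.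
Hypothesis nbU : forall x, uniq (nb x).
Hypothesis nbI : forall x, x \notin nb x.
Hypothesis nbC : forall x y, adj nb x y = adj nb y x.
Implicit Types (X Y : seq V) (w : V * V -> bool) (x y z v o : V).

Definition E X : seq (V * V) :=
  [seq (x, y) | x <- X, y <- [seq y <- nb x | (y \in X) && (pickle x < pickle y)%N]].

Lemma bedgesE o n : bedges nb o n = E (Defs.ball nb o n).
Proof. by []. Qed.

Lemma E_uniq X : uniq X -> uniq (E X).
Proof.
move=> uX; apply: allpairs_uniq_dep => //.
  by move=> x _; apply: filter_uniq.
by move=> [a b] [c e] _ _ [-> ->].
Qed.

Lemma mem_E X x y : ((x, y) \in E X) =
  [&& adj nb x y, x \in X, y \in X & (pickle x < pickle y)%N].
Proof.
apply/allpairsPdep/idP => [[a [b [ha hb [-> ->]]]]|/and4P[h1 h2 h3 h4]].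
  by move: hb; rewrite mem_filter /adj ha => /andP[/andP[-> ->] ->].
by exists x, y; rewrite mem_filter h2 h3 h4.
Qed.

Lemma edge_E X x y : (edge x y \in E X) = [&& adj nb x y, x \in X & y \in X].
Proof.
rewrite /edge; case: ltngtP => h; rewrite mem_E ?h ?andbT //.
  by rewrite nbC; congr (_ && _); exact: andbC.
have -> : x = y by exact: (pcan_inj pickleK h).
by rewrite ltnn !andbF /adj (negbTE (nbI y)).
Qed.

Lemma E_edge X e : e \in E X -> exists x y, [/\ e = edge x y, adj nb x y, x \in X & y \in X].
Proof.
case: e => x y; rewrite mem_E => /and4P[h1 h2 h3 h4].
by exists x, y; rewrite /edge h4.
Qed.

Lemma E_sub X Y : {subset X <= Y} -> {subset E X <= E Y}.
Proof.
move=> h e /E_edge[x [y [-> h1 /h h2 /h h3]]].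
by rewrite edge_E h1 h2 h3.
Qed.

Lemma oadj_in X w x y : subc w (E X) -> oadj nb w x y -> (x \in X) && (y \in X).
Proof. by move=> h /andP[_ /h]; rewrite edge_E => /and3P[_ -> ->]. Qed.

Lemma cn_in X w x y : subc w (E X) -> x \in X -> cn nb w x y -> y \in X.
Proof.
move=> h hx; move: y; apply: cn_ind => // a b _ _ _ hab.
by case/andP: (oadj_in h hab).
Qed.

Lemma cn_in_sym X w x y : subc w (E X) -> y \in X -> cn nb w x y -> x \in X.
Proof. by move=> h hy; rewrite cn_sym //; exact: cn_in. Qed.

Definition clus X w o : seq V := [seq y <- X | cn nb w o y].

Definition csize X w o : nat := size (clus X w o).

Lemma mem_clus X w o y : subc w (E X) -> o \in X -> (y \in clus X w o) = cn nb w o y.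
Proof.
move=> h ho; rewrite mem_filter; case: (boolP (cn nb w o y)) => // hc.
by rewrite (cn_in h ho hc).
Qed.

Lemma csizeE X w o : csize X w o = (\sum_(y <- X) cn nb w o y)%N.
Proof. by rewrite /csize /clus size_filter -sum1_count big_mkcond; apply: eq_bigr => y _; case: cn. Qed.

Lemma csize_mono X w w' o : lec w w' -> (csize X w o <= csize X w' o)%N.
Proof.
move=> h; rewrite !csizeE; apply: leq_sum => y _.
by case: (boolP (cn nb w o y)) => // /(cn_mono h) ->.
Qed.

Lemma csize_vol X Y w o : uniq X -> uniq Y -> {subset X <= Y} -> subc w (E X) -> o \in X ->
  csize Y w o = csize X w o.
Proof.
move=> uX uY h hw ho; apply: perm_size; apply: uniq_perm; rewrite ?filter_uniq //.
move=> y; rewrite !mem_filter; case: (boolP (cn nb w o y)) => //= hc.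
by rewrite (cn_in hw ho hc) h // (cn_in hw ho hc).
Qed.

Section Expect.
Context {R : realType}.
Implicit Types (p : R) (f : (V * V -> bool) -> R).

Definition EX p X f : R := EE p (E X) f.

Lemma EX_mono_vol p X Y f : 0 <= p <= 1 -> uniq X -> uniq Y -> {subset X <= Y} -> incr f ->
  EX p X f <= EX p Y f.
Proof.
by move=> hp uX uY h; apply: EE_es_mono; rewrite ?E_uniq //; exact: E_sub.
Qed.

Lemma incr_cn x y : incr (fun w => (cn nb w x y)%:R : R).
Proof. by move=> w w' h; rewrite ler_nat; case: (boolP (cn nb w x y)) => // /(cn_mono h) ->. Qed.

Lemma incr_hit B x : incr (fun w => (hit nb w B x)%:R : R).
Proof. by move=> w w' h; rewrite ler_nat; case: (boolP (hit nb w B x)) => // /(hit_mono h) ->. Qed.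

Lemma incr_csize (phi : nat -> R) X o : {homo phi : m n / (m <= n)%N >-> m <= n} ->
  incr (fun w => phi (csize X w o)).
Proof. by move=> hphi w w' h; apply: hphi; exact: csize_mono. Qed.

Lemma EX_csize_mono p (phi : nat -> R) X Y o : 0 <= p <= 1 -> uniq X -> uniq Y ->
  {subset X <= Y} -> o \in X -> {homo phi : m n / (m <= n)%N >-> m <= n} ->
  EX p X (fun w => phi (csize X w o)) <= EX p Y (fun w => phi (csize Y w o)).
Proof.
move=> hp uX uY h ho hphi.
apply: le_trans (_ : EX p X (fun w => phi (csize Y w o)) <= _).
  by rewrite le_eqVlt; apply/orP; left; apply/eqP; apply: EE_ext => w hw; rewrite (csize_vol uX uY h).
by apply: EX_mono_vol => //; exact: incr_csize.
Qed.

Lemma EX_csizeE p X o :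
  EX p X (fun w => (csize X w o)%:R) = \sum_(y <- X) EX p X (fun w => (cn nb w o y)%:R).
Proof.
by rewrite -EE_sum; apply: EE_ext => w _; rewrite csizeE natr_sum.
Qed.

End Expect.

Section Automorphism.
Context {R : realType}.
Variable f : V -> V.
Hypothesis f_aut : automorphism nb f.

Let canon (e : V * V) := (pickle e.1 < pickle e.2)%N.
Let g (e : V * V) := edge (f e.1) (f e.2).

Let f_inj : injective f. Proof. by case: f_aut => /bij_inj. Qed.

Let g_edge x y : g (edge x y) = edge (f x) (f y).
Proof. by rewrite /g [edge x y]/edge; case: ifP => _ //=; rewrite edgeC. Qed.

Let g_inj : {in canon &, injective g}.
Proof.
move=> [a b] [c e] h1 h2 /edge_inj /= [] [/f_inj ea /f_inj eb]; first by rewrite ea eb.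
rewrite ea eb in h1; have := ltn_trans (h1 : (pickle e < pickle c)%N) (h2 : (pickle c < pickle e)%N).
by rewrite ltnn.
Qed.

Let EE_image (p : R) es (F : (V * V -> bool) -> R) : all canon es ->
  EE p (map g es) (fun w => F (fun e => canon e && w (g e))) =
  EE p es (fun w => F (fun e => canon e && w e)).
Proof.
elim: es F => [|e es IH] F /=; first by [].
move=> /andP[ce ces]; rewrite -(IH _ ces); congr (_ * _ + _).
have e1 w : (fun b : V * V => canon b && addc e w b) = addc e (fun b => canon b && w b).
  by apply/funext => x; rewrite /addc; case: eqVneq => [->|] //=; rewrite ce.
under [RHS]EE_ext => w _ do rewrite e1.
rewrite -(IH (fun w => F (addc e w)) ces); apply: EE_ext => w _; congr F.
apply/funext => x; rewrite /addc; case: (boolP (canon x)) => cx /=.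
  by rewrite (inj_in_eq g_inj).
by case: eqVneq => // hx; rewrite -hx (negbTE cx) in ce.
Qed.

Let adj_canon x y : adj nb x y -> canon (edge x y).
Proof.
move=> h; rewrite /canon /edge; case: (ltngtP (pickle x) (pickle y)) => [hp|hp|hp] /=; rewrite ?hp //.
have hxy : x = y by exact: (pcan_inj pickleK hp).
by move: h; rewrite hxy /adj (negbTE (nbI y)).
Qed.

(** An automorphism need not respect the orientation of edges by [pickle]. Configurations are
    therefore transported along [g], and only their values on canonically oriented pairs matter for
    connectivity. *)
Lemma EX_image p X (Phi : (V -> V -> bool) -> R) : uniq X ->
  EX p (map f X) (fun w => Phi (fun x y => cn nb w (f x) (f y))) =
  EX p X (fun w => Phi (cn nb w)).
Proof.
move=> uX; have [[f' fK f'K] fadj] := f_aut.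
have hperm : perm_eq (E (map f X)) (map g (E X)).
  have ca : {subset E X <= canon}.
    by move=> e /E_edge[x [y [-> h _ _]]]; rewrite /in_mem /= adj_canon.
  apply: uniq_perm; first by apply: E_uniq; rewrite map_inj_uniq.
    by rewrite map_inj_in_uniq ?E_uniq // => a b /ca ha /ca hb; exact: g_inj.
  move=> e; apply/idP/mapP => [/E_edge[x [y [-> h hx hy]]]|[e' /E_edge[x [y [-> h hx hy]]] ->]].
    exists (edge (f' x) (f' y)); last by rewrite g_edge !f'K.
    rewrite edge_E -fadj !f'K h /=.
    by case/mapP: hx => a ha ->; case/mapP: hy => b hb ->; rewrite !fK ha hb.
  by rewrite g_edge edge_E fadj h !mem_map ?hx.
have e1 w x y : cn nb w (f x) (f y) = cn nb (fun e => canon e && w (g e)) x y.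
  have oe u v : oadj nb w (f u) (f v) = oadj nb (fun e => canon e && w (g e)) u v.
    rewrite /oadj fadj g_edge; case: (boolP (adj nb u v)) => //= /adj_canon -> //.
  apply/cnP/cnP => [[s [ps ls]]|[s [ps ls]]].
    exists (map f' s); split; last by rewrite -[x]fK last_map ls fK.
    elim: s x ps {ls} => //= z s IH x /andP[h1 h2]; rewrite -oe f'K h1 /=.
    by apply: IH; rewrite f'K.
  exists (map f s); split; last by rewrite last_map ls.
  by elim: s x ps {ls} => //= z s IH x /andP[h1 h2]; rewrite oe h1 IH.
have e2 w x y : cn nb w x y = cn nb (fun e => canon e && w e) x y.
  have oe : oadj nb w =2 oadj nb (fun e => canon e && w e).
    by move=> u v; rewrite /oadj; case: (boolP (adj nb u v)) => //= /adj_canon -> .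
  by apply/cnP/cnP => -[s [ps ls]]; exists s; split=> //; move: ps; rewrite (eq_path oe).
rewrite /EX (EE_perm _ _ hperm).
transitivity (EE p (map g (E X)) (fun w => (fun w' => Phi (cn nb w')) (fun e => canon e && w (g e)))).
  by apply: EE_ext => w _; congr Phi; apply/funext => x; apply/funext => y.
rewrite (EE_image p (fun w' => Phi (cn nb w'))).
  by apply: EE_ext => w _; congr Phi; apply/funext => x; apply/funext => y; rewrite -e2.
by apply/allP => e /E_edge[x [y [-> h _ _]]]; exact: adj_canon.
Qed.

Lemma EX_csize_image p X (phi : nat -> R) v : uniq X ->
  EX p (map f X) (fun w => phi (csize (map f X) w (f v))) = EX p X (fun w => phi (csize X w v)).
Proof.
move=> uX; have := @EX_image p X (fun c => phi (\sum_(y <- X) c v y)%N) uX.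
move=> h; rewrite (_ : EX p X _ = EX p X (fun w => phi (\sum_(y <- X) cn nb w v y)%N)).
  by rewrite -h; apply: EE_ext => w _; rewrite csizeE big_map.
by apply: EE_ext => w _; rewrite csizeE.
Qed.

End Automorphism.

End Volume.

(** * The definitions of the statement as finite-volume expectations over balls *)

Section Frozen.
Context {V : countType}.
Variable nb : V -> seq V.
Hypothesis nbU : forall x, uniq (nb x).
Hypothesis nbI : forall x, x \notin nb x.
Hypothesis nbC : forall x y, adj nb x y = adj nb y x.
Implicit Types (X Y : seq V) (S : seq (V * V)) (w : V * V -> bool) (x y z v o : V).

Local Notation ball := (Defs.ball nb).

Lemma ball_uniq o n : uniq (ball o n).
Proof. by case: n => [//|n] /=; exact: undup_uniq. Qed.

Lemma ballS o n y : y \in ball o n.+1 <-> y \in ball o n \/ exists2 x, x \in ball o n & adj nb x y.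
Proof.
rewrite /= mem_undup mem_cat; split.
  by move=> /orP[|/flatten_mapP[x hx hy]]; [left|right; exists x].
case=> [->//|[x hx hy]]; apply/orP; right; apply/flatten_mapP; by exists x.
Qed.

Lemma ball_leq o m n : (m <= n)%N -> {subset ball o m <= ball o n}.
Proof.
move=> /subnK <-; elim: (n - m)%N => [//|k IH] y /IH hy.
by rewrite addSn; apply/ballS; left.
Qed.

Lemma center_in_ball o n : o \in ball o n.
Proof. by apply: (@ball_leq o 0 n) => //; rewrite inE. Qed.

Lemma ball_path o s : path (adj nb) o s -> last o s \in ball o (size s).
Proof.
elim/last_ind: s => [|s y IH]; first by rewrite inE.
rewrite rcons_path last_rcons size_rcons => /andP[/IH h1 h2].
by apply/ballS; right; exists (last o s).
Qed.

Lemma ball_exhaust o X : graph_connected nb -> exists n, {subset X <= ball o n}.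
Proof.
move=> hc; elim: X => [|x X [n hn]]; first by exists 0%N.
have [s [ps <-]] := hc o x; exists (maxn n (size s)) => y; rewrite inE => /orP[/eqP->|/hn].
  by apply: ball_leq (ball_path ps); exact: leq_maxr.
by apply: ball_leq; exact: leq_maxl.
Qed.

Definition radj S : rel V := fun a b => ((a, b) \in S) || ((b, a) \in S).

Lemma reachP S k (A : seq V) y :
  y \in reach S k A <-> exists a s, [/\ a \in A, path (radj S) a s, last a s = y & (size s <= k)%N].
Proof.
elim: k A => [|k IH] A /=.
  split=> [hy|[a [s [ha _ <-]]]]; first by exists y, [::].
  by case: s => [|b s].
set A' := undup _.
have hA' b : b \in A' <-> b \in A \/ exists2 a, a \in A & radj S a b.
  rewrite mem_undup !mem_cat; split.
    move=> /or3P[h|/mapP[e]|/mapP[e]]; first by left.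
      rewrite mem_filter => /andP[h1 h2] ->; right; exists e.1 => //.
      by rewrite /radj -surjective_pairing h2.
    rewrite mem_filter => /andP[h1 h2] ->; right; exists e.2 => //.
    by rewrite /radj -surjective_pairing h2 orbT.
  case=> [->//|[a ha /orP[h|h]]]; apply/or3P.
    by apply: Or32; apply/mapP; exists (a, b); rewrite ?mem_filter //= ha.
  by apply: Or33; apply/mapP; exists (b, a); rewrite ?mem_filter //= ha.
rewrite IH; split=> [[a [s [/hA' ha ps ls ss]]]|[a [s [ha ps ls ss]]]].
  case: ha => [ha|[b hb hab]]; first by exists a, s; rewrite (leq_trans ss).
  by exists b, (a :: s); rewrite /= hab.
case: s ps ls ss => [|b s] /= => [_ <- _|/andP[hab ps] ls ss].
  by exists a, [::]; split=> //; apply/hA'; left.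
by exists b, s; split=> //; apply/hA'; right; exists a.
Qed.

Lemma reach_uniq S k (A : seq V) : uniq A -> uniq (reach S k A).
Proof. by elim: k A => [//|k IH] A _ /=; apply: IH; exact: undup_uniq. Qed.

(** [cl] runs one round per edge of [S]; a simple path uses distinct edges, so these rounds
    suffice. *)
Lemma mem_cl S X x y : {subset S <= E nb X} -> (y \in cl S x) = cn nb (fun e => e \in S) x y.
Proof.
move=> hS; have hadj a b : radj S a b = oadj nb (fun e => e \in S) a b.
  rewrite /radj /oadj; apply/orP/andP.
    case=> h; have := hS _ h; rewrite mem_E // => /and4P[h1 _ _ h2].
      by rewrite h1 /edge h2.
    by rewrite nbC h1 edgeC /edge h2.
  by rewrite /edge; case: ifP => _ [_ h]; [left|right].
apply/idP/idP.
  move=> /reachP[a [s [ha ps ls _]]]; move: ha ps ls; rewrite inE => /eqP -> ps ls.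
  by apply/cnP; exists s; split=> //; move: ps; rewrite (eq_path hadj).
move=> /cn_simple[s [ps ls us]]; apply/reachP; exists x, s; split=> //.
- by rewrite inE.
- by rewrite (eq_path hadj).
rewrite -(size_pedges x); apply: uniq_leq_size; first exact: uniq_pedges.
by move: ps; rewrite path_oadj => /andP[_ /allP].
Qed.

Lemma size_cl S X o : uniq X -> {subset S <= E nb X} -> o \in X ->
  size (cl S o) = csize nb X (fun e => e \in S) o.
Proof.
move=> uX hS ho; apply: perm_size; apply: uniq_perm.
- by apply: reach_uniq.
- exact: filter_uniq.
by move=> y; rewrite (mem_cl _ _ hS) mem_clus.
Qed.

Section Expectation.
Context {R : realType}.
Implicit Types (p : R).

Lemma Ex_EE p es acc (f : seq (V * V) -> R) g :
  (forall S, {subset S <= es ++ acc} -> f S = g (fun e => e \in S)) ->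
  Ex p es acc f = EE p es (fun w => g (fun e => w e || (e \in acc))).
Proof.
elim: es acc => [|e es IH] acc h /=.
  by rewrite h //; congr g; apply/funext.
rewrite !IH => [|S hS|S hS]; last 2 first.
- by apply: h => a /hS; rewrite !(mem_cat, inE); case: (a == e); case: (a \in es).
- by apply: h => a /hS; rewrite !(mem_cat, inE); case: (a == e); case: (a \in es).
congr (_ * _ + _); apply: EE_ext => w _; congr g; apply/funext => x.
by rewrite /addc inE orbCA orbA.
Qed.

Lemma Ex_EX p X (f : seq (V * V) -> R) g :
  (forall S, {subset S <= E nb X} -> f S = g (fun e => e \in S)) ->
  Ex p (E nb X) [::] f = EX nb p X g.
Proof.
move=> h; rewrite (@Ex_EE p _ _ _ g); last by move=> S; rewrite cats0; exact: h.
by apply: EE_ext => w _; congr g; apply/funext => e; rewrite orbF.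
Qed.

Lemma Pr_cn o p n x y :
  Pr nb o p n (fun S => y \in cl S x) = EX nb p (ball o n) (fun w => (cn nb w x y)%:R).
Proof. by apply: Ex_EX => S hS; rewrite (mem_cl _ _ hS). Qed.

Lemma has_cl S X (Q : pred V) x : {subset S <= E nb X} ->
  has Q (cl S x) = hit nb (fun e => e \in S) Q x.
Proof.
move=> hS; apply/hasP/hitP => [[y]|[y [Qy hy]]].
  by rewrite (mem_cl _ _ hS) => hy Qy; exists y.
by exists y; rewrite ?(mem_cl _ _ hS).
Qed.

Lemma Pr_hit o p n (Q : pred V) x :
  Pr nb o p n (fun S => has Q (cl S x)) = EX nb p (ball o n) (fun w => (hit nb w Q x)%:R).
Proof. by apply: Ex_EX => S hS; rewrite (has_cl _ _ hS). Qed.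

Lemma Pr_has_hit o p n (Q : pred V) X :
  Pr nb o p n (fun S => has (fun x => has Q (cl S x)) X) =
  EX nb p (ball o n) (fun w => (has (hit nb w Q) X)%:R).
Proof.
apply: Ex_EX => S hS; congr ((nat_of_bool _)%:R); apply: eq_has => x.
exact: (has_cl _ _ hS).
Qed.

Lemma Ex_size o p n :
  Ex p (bedges nb o n) [::] (fun S => (size (cl S o))%:R) =
  EX nb p (ball o n) (fun w => (csize nb (ball o n) w o)%:R) :> R.
Proof.
rewrite bedgesE; apply: Ex_EX => S hS.
by rewrite (size_cl (ball_uniq o n) hS (center_in_ball o n)).
Qed.

Lemma Pr_size o p n k :
  Pr nb o p n (fun S => (k <= size (cl S o))%N) =
  EX nb p (ball o n) (fun w => (k <= csize nb (ball o n) w o)%N%:R).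
Proof.
apply: Ex_EX => S hS.
by rewrite (size_cl (ball_uniq o n) hS (center_in_ball o n)).
Qed.

End Expectation.
End Frozen.

                   

(** Covers with one proof an average over a random target set and a sum over single targets. *)
Definition poslin (R : realType) (T : Type) (Lam : (T -> R) -> R) : Prop :=
  [/\ forall f g : T -> R, (forall t, f t <= g t) -> Lam f <= Lam g,
      forall (I : Type) (r : seq I) (F : T -> I -> R),
        Lam (fun t => \sum_(i <- r) F t i) = \sum_(i <- r) Lam (F^~ i) &
      forall a (f : T -> R), Lam (fun t => a * f t) = a * Lam f].

Lemma poslin_EE (R : realType) (T : eqType) (h : R) (vs : seq T) : 0 <= h <= 1 -> poslin (EE h vs).
Proof.
move=> hh; split=> [f g hfg|I r F|a f]; [exact: EE_le|exact: EE_sum|exact: EEZ].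
Qed.

Lemma poslin_sum (R : realType) (T : Type) (ts : seq T) : poslin (fun f : T -> R => \sum_(t <- ts) f t).
Proof.
split=> [f g hfg|I r F|a f]; [exact: ler_sum|exact: exchange_big|by rewrite mulr_sumr].
Qed.

(** * The expected weight of colliding connections *)

Section Cycles.
Context {V : countType}.
Variable nb : V -> seq V.
Hypothesis nbU : forall x, uniq (nb x).
Hypothesis nbI : forall x, x \notin nb x.
Hypothesis nbC : forall x y, adj nb x y = adj nb y x.
Variable L : nat.
Hypothesis nbL : girth_ge nb L.
Hypothesis L0 : (0 < L)%N.
Implicit Types (X Y l : seq V) (w : V * V -> bool) (x y z v o : V) (i j n : nat).

                                                                                       
                                             
(** A collision is coded by the base point [y], the cycle [l] read from [y], the position [i] of [v]
    in [l] and the length [j] of the outgoing path from [v] to [z]. The return path runs from [z]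
    through [y] to [u]. The pairs (i,j) are the source of the factor n^2. *)
Definition cyc_u y l i : V := last y (take i l).
Definition cyc_v y l i : V := nth y l i.
Definition cyc_out l i j : seq V := take j (drop i.+1 l).
Definition cyc_z y l i j : V := last (cyc_v y l i) (cyc_out l i j).
Definition cyc_back l i j : seq V := drop (i.+1 + j) l ++ take i l.

Definition cyc K y : seq (seq V) :=
  flatten [seq [seq l <- nbl nb None n y | last y l == y] | n <- [seq n <- iota 0 K | (L <= n)%N]].

Definition sq n : seq (nat * nat) := [seq (i, j) | i <- iota 0 n, j <- iota 0 n].

Lemma mem_sq n i j : ((i, j) \in sq n) = (i < n)%N && (j < n)%N.
Proof.
apply/allpairsP/andP => [[[a b] /= [h1 h2 [-> ->]]]|[h1 h2]].
  by move: h1 h2; rewrite !mem_iota !add0n.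
by exists (i, j); rewrite /= !mem_iota.
Qed.

Lemma size_sq n : size (sq n) = (n ^ 2)%N.
Proof. by rewrite size_allpairs size_iota. Qed.

Lemma size_nbl a n x l : l \in nbl nb a n x -> size l = n.
Proof.
elim: n a x l => [|n IH] a x l /=; first by rewrite inE => /eqP->.
by move=> /flattenP[s /mapP[z _ ->] /mapP[l' /IH hl' ->]] /=; rewrite hl'.
Qed.

(** This is where the girth enters: a simple cycle has length at least [L]. *)
Lemma mem_cyc K y l : path (adj nb) y l -> last y l = y -> uniq l -> (2 < size l)%N ->
  (size l < K)%N -> l \in cyc K y.
Proof.
move=> pl ll ul sl sK; apply/flattenP.
exists [seq l' <- nbl nb None (size l) y | last y l' == y]; last first.
  by rewrite mem_filter ll eqxx /=; exact: nbl_cycle.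
apply: (map_f (fun n => [seq l' <- nbl nb None n y | last y l' == y])).
rewrite mem_filter mem_iota leq0n add0n sK !andbT; apply: nbL => //.
case: l pl ll {ul sl sK} => //= a l /andP[ha pl] ll.
by rewrite rcons_path pl ll.
Qed.

Lemma cyc_sizes l i j : (i < size l)%N ->
  (size (cyc_out l i j) + size (cyc_back l i j) = (size l).-1)%N.
Proof.
move=> hi; rewrite /cyc_out /cyc_back size_cat size_drop !size_take size_drop hi.
by case: ifP => h; clear -hi h; lia.
Qed.

Lemma pedges_in X w x s : subc w (E nb X) -> x \in X -> all w (pedges x s) -> {subset x :: s <= X}.
Proof.
move=> hw; elim: s x => [|y s IH] x hx /=.
  by move=> _ u; rewrite inE => /eqP->.
move=> /andP[/hw]; rewrite edge_E // => /and3P[_ _ hy] /(IH _ hy) h u.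
by rewrite inE => /orP[/eqP->|/h].
Qed.

Section Expect.
Context {R : realType}.
Variables (p : R) (X : seq V).
Hypothesis hp : 0 <= p <= 1.
Hypothesis uX : uniq X.
Let K := (size X).+1.

Definition cyc_sum (G : V -> seq V -> nat * nat -> R) : R :=
  \sum_(y <- X) \sum_(l <- cyc K y) \sum_(ij <- sq (size l)) G y l ij.

Lemma cyc_sum_ge (G : V -> seq V -> nat * nat -> R) y l ij :
  (forall y l ij, 0 <= G y l ij) -> y \in X -> l \in cyc K y -> ij \in sq (size l) ->
  G y l ij <= cyc_sum G.
Proof.
move=> G0 hy hl hij.
apply: le_trans (le_sum_seq1 (F := fun ij => G y l ij) (G0 y l) hij) _.
apply: le_trans (le_sum_seq1 (F := fun l => \sum_(ij <- sq (size l)) G y l ij) _ hl) _.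
  by move=> l'; apply: sumr_ge0.
apply: (le_sum_seq1 (F := fun y => \sum_(l <- cyc K y) \sum_(ij <- sq (size l)) G y l ij)) => //.
by move=> y'; apply: sumr_ge0 => l' _; apply: sumr_ge0.
Qed.

Lemma cyc_sum_EE q (T : eqType) (es : seq T) (G : V -> seq V -> nat * nat -> (T -> bool) -> R) :
  EE q es (fun t => cyc_sum (fun y l ij => G y l ij t)) =
  cyc_sum (fun y l ij => EE q es (G y l ij)).
Proof.
rewrite /cyc_sum EE_sum; apply: eq_bigr => y _; rewrite EE_sum; apply: eq_bigr => l _.
by rewrite EE_sum.
Qed.

Lemma cyc_sum_le (G G' : V -> seq V -> nat * nat -> R) :
  (forall y l i j, y \in X -> (i < size l)%N -> G y l (i, j) <= G' y l (i, j)) ->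
  cyc_sum G <= cyc_sum G'.
Proof.
move=> hG; rewrite /cyc_sum big_seq [leRHS]big_seq; apply: ler_sum => y hy.
apply: ler_sum => l _; rewrite big_seq [leRHS]big_seq; apply: ler_sum => -[i j].
by rewrite mem_sq => /andP[hi _]; exact: hG.
Qed.

Definition okc y l i j : bool :=
  uniq (pedges (cyc_v y l i) (cyc_out l i j)) &&
  uniq (pedges (cyc_z y l i j) (cyc_back l i j)).

Definition cyc_term o B w w' y l i j : R :=
  (okc y l i j)%:R *
  ((all w' (pedges (cyc_v y l i) (cyc_out l i j)))%:R *
   (hit nb (res [predC pedges (cyc_v y l i) (cyc_out l i j)] w') B (cyc_z y l i j))%:R) *
  ((all w (pedges (cyc_z y l i j) (cyc_back l i j)))%:R *
   (cn nb (res [predC pedges (cyc_z y l i j) (cyc_back l i j)] w) o y)%:R).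

Lemma cyc_term_ge0 o B w w' y l i j : 0 <= cyc_term o B w w' y l i j.
Proof. by rewrite /cyc_term !mulr_ge0. Qed.

Lemma cycle_union o u v B w w' : o \in X -> v \in X -> adj nb u v ->
  subc w (E nb X) -> subc w' (E nb X) -> ~~ w (edge u v) -> ~~ w' (edge u v) ->
  (cn nb w o u && hit nb w' B v && ~~ hitoff nb (cn nb w o) w' B v)%:R <=
  cyc_sum (fun y l ij => ((cyc_u y l ij.1 == u) && (cyc_v y l ij.1 == v))%:R *
     cyc_term o B w w' y l ij.1 ij.2).
Proof.
move=> oX vX uv sw sw' nw nw'.
set G := fun y l ij => _ * _.
have G0 y l ij : 0 <= G y l ij by rewrite mulr_ge0 ?cyc_term_ge0.
case: (boolP (_ && _)) => [/andP[/andP[ou hv] hn]|_]; last first.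
  by apply: sumr_ge0 => y _; apply: sumr_ge0 => l _; apply: sumr_ge0.
have [y [s2 [c [s1 [[h1 h2 h3 h4] [[h5 h6 h7 h8 h9] [h10 h11]]]]]]] :=
  cycle_key nbC nbI ou hv hn uv nw nw'.
set l := s2 ++ v :: c ++ s1 in h1 h2 h3 h4.
have e1 : take (size s2) l = s2 by rewrite /l take_size_cat.
have e2 : cyc_v y l (size s2) = v by rewrite /cyc_v /l nth_cat ltnn subnn.
have e3 : drop (size s2).+1 l = c ++ s1.
  by rewrite /l -cat_rcons drop_size_cat // size_rcons.
have e4 : cyc_out l (size s2) (size c) = c by rewrite /cyc_out e3 take_size_cat.
have e5 : cyc_back l (size s2) (size c) = s1 ++ s2.
  by rewrite /cyc_back e1 addnC -drop_drop e3 drop_size_cat.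
have e6 : cyc_z y l (size s2) (size c) = last v c by rewrite /cyc_z e2 e4.
have oy : cn nb w o y by apply: (cn_mono _ h9); exact: res_le.
have yX : y \in X by exact: cn_in sw oX oy.
have zX : last v c \in X by apply: (pedges_in sw' vX h6); exact: mem_last.
have lX : {subset l <= X}.
  move=> a; rewrite /l mem_cat inE mem_cat => /or4P[ha|/eqP->//|ha|ha].
  - by apply: (pedges_in sw zX h8); rewrite inE mem_cat ha !orbT.
  - by apply: (pedges_in sw' vX h6); rewrite inE ha orbT.
  - by apply: (pedges_in sw zX h8); rewrite inE mem_cat ha !orbT.
have lK : (size l < K)%N by rewrite ltnS; exact: uniq_leq_size.
have hin : (size s2, size c) \in sq (size l).
  by rewrite mem_sq /l size_cat /= size_cat; clear; apply/andP; split; lia.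
apply: le_trans (cyc_sum_ge G0 yX (mem_cyc h1 h2 h3 h4 lK) hin).
rewrite /G /= /cyc_u e1 e2 h5 !eqxx mul1r /cyc_term /okc e6 e2 e4 e5.
by rewrite h6 h7 h8 h9 h10 h11 !mulr1.
Qed.

(** A union bound over the cycles of [cycle_union]. The outgoing edges are open in [w'] and the
    return edges in [w], together all edges of the cycle except [u v], whence the exponent. The arm
    continuing from [z] is bounded by [m], and the connection from [o] to [y], weighted by the
    decreasing [W], is decoupled by [EE_open_decr]. *)
Lemma cycle_expect (T : Type) (Lam : (T -> R) -> R) (Bf : T -> V -> bool) es1 es2 o u v
    (W : (V * V -> bool) -> R) (m : R) : poslin Lam ->
  uniq es1 -> uniq es2 -> {subset es1 <= E nb X} -> {subset es2 <= E nb X} ->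
  o \in X -> v \in X -> adj nb u v -> edge u v \notin es1 -> edge u v \notin es2 ->
  decr W -> (forall w, 0 <= W w) -> 0 <= m ->
  (forall z, Lam (fun g => EE p es2 (fun w' => (hit nb w' (Bf g) z)%:R)) <= m) ->
  Lam (fun g => EE p es1 (fun w => EE p es2 (fun w' =>
    (cn nb w o u && hit nb w' (Bf g) v && ~~ hitoff nb (cn nb w o) w' (Bf g) v)%:R * W w))) <=
  cyc_sum (fun y l ij => ((cyc_u y l ij.1 == u) && (cyc_v y l ij.1 == v))%:R *
     (p ^+ (size l).-1 * (m * EE p es1 (fun w => (cn nb w o y)%:R * W w)))).
Proof.
move=> [Lle Lsum LZ] u1 u2 s1 s2 oX vX uv n1 n2 dW W0 m0 hm; have /andP[p0 p1] := hp.
have Lge0 (f : T -> R) : (forall t, 0 <= f t) -> 0 <= Lam f.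
  move=> f0; apply: le_trans (Lle (fun t => 0 * f t) f _); first by rewrite LZ mul0r.
  by move=> t; rewrite mul0r.
pose key y l i : R := ((cyc_u y l i == u) && (cyc_v y l i == v))%:R.
apply: le_trans (_ : Lam (fun g => EE p es1 (fun w => EE p es2 (fun w' =>
   cyc_sum (fun y l ij => key y l ij.1 * (cyc_term o (Bf g) w w' y l ij.1 ij.2 * W w))))) <= _).
  apply: Lle => g; apply: EE_le => // w hw; apply: EE_le => // w' hw'.
  have sw : subc w (E nb X) by move=> e /hw /s1.
  have sw' : subc w' (E nb X) by move=> e /hw' /s2.
  have nw : ~~ w (edge u v) by apply: contra n1 => /hw.
  have nw' : ~~ w' (edge u v) by apply: contra n2 => /hw'.
  apply: le_trans (ler_wpM2r (W0 w) (cycle_union (Bf g) oX vX uv sw sw' nw nw')) _.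
  rewrite /cyc_sum mulr_suml; apply: ler_sum => y _; rewrite mulr_suml; apply: ler_sum => l _.
  by rewrite mulr_suml; apply: ler_sum => ij _; rewrite mulrA.
pose G g y l ij := EE p es1 (fun w => EE p es2 (fun w' =>
   key y l ij.1 * (cyc_term o (Bf g) w w' y l ij.1 ij.2 * W w))).
rewrite (_ : Lam _ = cyc_sum (fun y l ij => Lam (fun g => G g y l ij))); last first.
  rewrite (_ : (fun g => _) = fun g => cyc_sum (G g)); last first.
    by apply/funext => g; under EE_ext => w _ do rewrite cyc_sum_EE; rewrite cyc_sum_EE.
  rewrite /cyc_sum Lsum; apply: eq_bigr => y _; rewrite Lsum; apply: eq_bigr => l _.
  by rewrite Lsum.
apply: cyc_sum_le => y l i j yX hi /=.
set P1 := pedges (cyc_v y l i) (cyc_out l i j).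
set P2 := pedges (cyc_z y l i j) (cyc_back l i j).
set z := cyc_z y l i j.
pose a := EE p es1 (fun w => (all w P2)%:R * ((cn nb (res [predC P2] w) o y)%:R * W w)).
rewrite (_ : Lam _ = key y l i * ((okc y l i j)%:R *
    (Lam (fun g => EE p es2 (fun w' => (all w' P1)%:R * (hit nb (res [predC P1] w') (Bf g) z)%:R)) * a)));
  last first.
  rewrite (mulrC (Lam _)) -!LZ; congr Lam; apply/funext => g; rewrite /G /a.
  rewrite -EEZr -!EEZ; apply: EE_ext => w _.
  rewrite -!EEZ; apply: EE_ext => w' _.
  by rewrite /cyc_term -/P1 -/P2 -/z; ring.
rewrite ler_wpM2l //.
case: (boolP (okc y l i j)) => [/andP[ok1 ok2]|_]; last first.
  rewrite mul0r mulr_ge0 ?exprn_ge0 // mulr_ge0 //; apply: EE_ge0 => // w _.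
  by rewrite mulr_ge0.
rewrite mul1r -(cyc_sizes j hi) exprD mulrACA.
apply: ler_pM.
- by apply: Lge0 => g; apply: EE_ge0 => // w _; rewrite mulr_ge0.
- by apply: EE_ge0 => // w _; rewrite !mulr_ge0.
- apply: le_trans (_ : p ^+ size P1 * Lam (fun g => EE p es2 (fun w' => (hit nb w' (Bf g) z)%:R)) <= _).
    rewrite -LZ; apply: Lle => g; apply: EE_open_incr => //; exact: incr_hit.
  by rewrite size_pedges ler_wpM2l ?exprn_ge0.
- have := EE_open_decr hp u1 ok2 (incr_cn (R := R) nb o y) dW (fun w => ler0n _ _) W0.
  by rewrite size_pedges.
Qed.

(** A coded cycle determines its edge (u,v), so summing over edges is free and leaves closed
    non-backtracking walks at [y] with n^2 markings. The edge that was not paid for accounts for the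
    factor 1/pm. *)
Lemma cyc_sum_total (D : seq (V * V)) (Xy : V -> R) (pm eta c : R) : uniq D ->
  0 < pm -> p <= pm -> (forall y, 0 <= Xy y) -> 0 <= c ->
  (forall z, \sum_(n < K | (L <= n)%N) (n ^ 2)%:R * pm ^+ n * nbc nb None n z z <= eta) ->
  \sum_(uv <- D) cyc_sum (fun y l ij => ((cyc_u y l ij.1 == uv.1) && (cyc_v y l ij.1 == uv.2))%:R *
     (p ^+ (size l).-1 * (c * Xy y))) <=
  c * (eta / pm) * \sum_(y <- X) Xy y.
Proof.
move=> uD pm0 ppm X0 c0 heta; have /andP[p0 p1] := hp.
rewrite /cyc_sum exchange_big /= mulr_sumr; apply: ler_sum => y _.
rewrite exchange_big /=.
apply: le_trans (_ : \sum_(l <- cyc K y) (size l ^ 2)%:R * (pm ^+ size l / pm) * (c * Xy y) <= _).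
  rewrite big_seq [leRHS]big_seq; apply: ler_sum => l hl.
  rewrite exchange_big /= -size_sq -mulrA mulr_natl.
  have cst (b : R) : b *+ size (sq (size l)) = \sum_(ij <- sq (size l)) b.
    by rewrite big_const_seq count_predT iter_addr addr0.
  rewrite cst.
  apply: ler_sum => -[i j] _ /=.
  rewrite -mulr_suml; apply: le_trans (_ : 1 * (p ^+ (size l).-1 * (c * Xy y)) <= _).
    apply: ler_wpM2r; first by rewrite mulr_ge0 ?exprn_ge0 // mulr_ge0.
    rewrite (eq_bigr (fun uv : V * V => ((cyc_u y l i, cyc_v y l i) == uv)%:R * 1)); last first.
      by move=> [a b] _; rewrite mulr1 xpair_eqE.
    by rewrite sum_delta // mulr1 lern1 leq_b1.
  rewrite mul1r; apply: ler_wpM2r; first exact: mulr_ge0.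
  have l0 : (0 < size l)%N.
    move: hl => /flattenP[s /mapP[n]]; rewrite mem_filter => /andP[hn _] ->.
    by rewrite mem_filter => /andP[_ /size_nbl] ->; exact: leq_trans hn.
  rewrite -{2}(prednK l0) exprS mulrAC mulfV ?gt_eqF // mul1r.
  by apply: lerXn2r; rewrite ?nnegrE // ltW.
rewrite -mulr_suml (_ : c * (eta / pm) * Xy y = eta * (c * Xy y / pm)); last by ring.
rewrite (_ : \sum_(l <- cyc K y) (size l ^ 2)%:R * (pm ^+ size l / pm) =
    (\sum_(n < K | (L <= n)%N) (n ^ 2)%:R * pm ^+ n * nbc nb None n y y) / pm); last first.
  rewrite /cyc big_flatten big_map big_filter.
  have -> : iota 0 K = index_iota 0 K by rewrite /index_iota subn0.
  rewrite big_mkord mulr_suml.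
  apply: eq_bigr => n _; rewrite big_filter -(nbcE nb None n y y) mulr_sumr mulr_suml.
  rewrite big_mkcond big_seq [RHS]big_seq; apply: eq_bigr => l /size_nbl ->.
  by case: (last y l == y) => /=; [ring|rewrite mulr0 mul0r].
rewrite mulrAC -mulrA; apply: ler_wpM2r => //.
by rewrite divr_ge0 ?mulr_ge0 // ltW.
Qed.

End Expect.
End Cycles.

                            

(** * Counting degrees in a cluster: at least one expected exit from every finite set *)

Section Boundary.
Context {R : realType} {V : countType}.
Variables (nb : V -> seq V) (d : nat).
Hypothesis nbU : forall x, uniq (nb x).
Hypothesis nbI : forall x, x \notin nb x.
Hypothesis nbC : forall x y, adj nb x y = adj nb y x.
Hypothesis nbd : forall x, size (nb x) = d.
Implicit Types (X Y l : seq V) (w : V * V -> bool) (x y z v o : V) (i j n : nat).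

Definition del (e : V * V) w := res (predC1 e) w.

Lemma del_edge e w x y : del e w (edge x y) = w (edge x y) && (edge x y != e).
Proof. by []. Qed.

Lemma cn_del w o x y : adj nb x y ->
  cn nb w o x = cn nb (del (edge x y) w) o x ||
    (w (edge x y) && cn nb (del (edge x y) w) o y).
Proof.
move=> xy; set w' := del _ _.
have le' : lec w' w by move=> e /andP[].
apply/idP/orP => [|[h|/andP[h1 h2]]]; last 2 first.
- exact: cn_mono h.
- apply: (cn_trans (cn_mono le' h2)); apply: cn_edge; by rewrite /oadj nbC xy edgeC.
move=> h; suff H b : cn nb w o b -> cn nb w' o b ||
    (w (edge x y) && (cn nb w' o x || cn nb w' o y)).
  by case/orP: (H _ h) => [->|/andP[-> /orP[]->]]; [left|left|right].
move: b; apply: cn_ind => [|a b _ _ ha /andP[hab wab]]; first by rewrite cn_refl.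
have [e1|ne] := eqVneq (edge a b) (edge x y).
  case/orP: ha => [ha|/andP[-> ->]]; last by rewrite orbT.
  rewrite -e1 wab /=; case: (edge_inj e1) => -[<- _]; by rewrite ha ?orbT.
case/orP: ha => [ha|->]; last by rewrite orbT.
by rewrite (cn_trans ha) // cn_edge // /oadj hab /w' del_edge wab.
Qed.

Lemma entrance_unique w o x x' y : adj nb x y -> adj nb x' y ->
  w (edge x y) -> cn nb (del (edge x y) w) o x -> ~~ cn nb (del (edge x y) w) o y ->
  ~~ cn nb (del (edge x' y) w) o y -> x = x'.
Proof.
move=> xy xy' wxy h1 h2 h3; apply/eqP; apply: contraT => nxx.
case/negP: h3; apply: (@cn_trans _ _ _ x).
  refine (cn_local _ h1) => a b ca cb; rewrite !del_edge => /andP[-> _] /=.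
  by apply/eqP => /edge_inj[] [ea eb];
    [rewrite eb in cb; rewrite cb in h2|rewrite ea in ca; rewrite ca in h2].
apply: cn_edge; rewrite /oadj xy del_edge wxy /=.
apply: contra nxx => /eqP /edge_inj[] [-> //].
by move=> hy; move: xy'; rewrite /adj hy (negbTE (nbI _)).
Qed.

Section FiniteVolume.
Variables (p : R) (X : seq V) (o : V).
Hypothesis hp : 0 <= p <= 1.
Hypothesis uX : uniq X.
Hypothesis oX : o \in X.

Local Notation EXX := (EX nb p X).
Let t x : R := EXX (fun w => (cn nb w o x)%:R).
Let a x y : R := EXX (fun w => (cn nb (del (edge x y) w) o x)%:R).
Let c x y : R := EXX (fun w => (cn nb (del (edge x y) w) o x && cn nb (del (edge x y) w) o y)%:R).

Let EE_edge x y (g : (V * V -> bool) -> R) : edge x y \in E nb X ->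
  EXX (fun w => (w (edge x y))%:R * g (del (edge x y) w)) = p * EXX (fun w => g (del (edge x y) w)).
Proof.
move=> he; have u1 : uniq [:: edge x y] by [].
have s1 : {subset [:: edge x y] <= E nb X} by move=> e; rewrite inE => /eqP->.
have := EE_open_eq g hp (E_uniq nbU uX) u1 s1; rewrite expr1.
have e1 w : res [predC [:: edge x y]] w = del (edge x y) w.
  by congr res; apply/funext => e; rewrite /= inE.
under EE_ext => w _ do rewrite e1 /= andbT.
by under [X in _ = _ * X]EE_ext => w _ do rewrite e1.
Qed.

(** Either [o] reaches [x] without the edge [x y], or only through it from [y]; [c x y] removes the
    overlap, which requires a cycle. *)
Let t_split x y : adj nb x y -> x \in X -> y \in X -> t x = a x y + p * (a y x - c x y).
Proof.
move=> xy hx hy; have he : edge x y \in E nb X by rewrite edge_E // xy hx hy.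
have -> : p * (a y x - c x y) = EXX (fun w => (w (edge x y))%:R *
   ((cn nb (del (edge x y) w) o y)%:R -
    (cn nb (del (edge x y) w) o x && cn nb (del (edge x y) w) o y)%:R)).
  rewrite (EE_edge (fun w => (cn nb w o y)%:R - (cn nb w o x && cn nb w o y)%:R) he).
  by rewrite /EX EEB /a edgeC.
rewrite /t /a -EED; apply: EE_ext => w _; rewrite (cn_del w o xy).
case: (cn nb (del _ _) o x); case: (w _); case: (cn nb (del _ _) o y); rewrite /=; ring.
Qed.

(** Each term is the probability that [x y] is an open bridge through which [o] enters [y]; there is
    at most one such edge, and none if [y = o]. *)
Let entrance y : y \in X ->
  \sum_(x <- nb y | x \in X) p * (a x y - c x y) <= t y - (y == o)%:R.
Proof.
move=> hy.
have -> : \sum_(x <- nb y | x \in X) p * (a x y - c x y) =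
  EXX (fun w => \sum_(x <- nb y | x \in X) (w (edge x y))%:R *
    (cn nb (del (edge x y) w) o x && ~~ cn nb (del (edge x y) w) o y)%:R).
  rewrite /EX EE_sum big_seq_cond [RHS]big_seq_cond; apply: eq_bigr => x /andP[hx xX].
  have xy : adj nb x y by rewrite nbC.
  have he : edge x y \in E nb X by rewrite edge_E // xy xX hy.
  symmetry; apply: (etrans (EE_edge (fun w => (cn nb w o x && ~~ cn nb w o y)%:R) he)).
  congr (p * _); symmetry.
  rewrite /a /c -EEB; apply: EE_ext => w _.
  by case: (cn nb _ o x); case: (cn nb _ o y); rewrite /= ?subrr ?subr0.
rewrite lerBrDr.
have -> : (y == o)%:R = EXX (fun=> (y == o)%:R) by rewrite /EX EE_cst.
rewrite -EED; apply: EE_le => // w _.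
have [->|nyo] := eqVneq y o.
  rewrite big1 ?add0r ?ler_nat ?cn_refl // => x _.
  by rewrite cn_refl andbF mulr0.
rewrite addr0; pose G x := w (edge x y) && (cn nb (del (edge x y) w) o x && ~~ cn nb (del (edge x y) w) o y).
have -> : \sum_(x <- nb y | x \in X) (w (edge x y))%:R *
    (cn nb (del (edge x y) w) o x && ~~ cn nb (del (edge x y) w) o y)%:R =
    \sum_(x <- nb y | x \in X) (G x)%:R :> R.
  by apply: eq_bigr => x _; rewrite /G; case: (w _); rewrite ?mul1r ?mul0r.
case: (boolP (has G (nb y))) => [/hasP[x hx Gx]|/hasPn hG]; last first.
  by rewrite big_seq_cond big1 // => x /andP[/hG /negbTE ->].
have xy : adj nb x y by rewrite nbC.
case/and3P: (Gx) => h1 h2 h3.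
have -> : cn nb w o y.
  apply: (@cn_trans _ _ _ x); first by apply: (cn_mono _ h2) => e /andP[].
  by apply: cn_edge; rewrite /oadj xy.
rewrite (bigID (pred1 x)) /= [X in _ + X]big_seq_cond [X in _ + X]big1 ?addr0; last first.
  move=> x' /and3P[hx' _ nxx]; case Gx': (G x') => //; case/and3P: Gx' => h1' h2' h3'.
  have xy' : adj nb x' y by rewrite nbC.
  by move: nxx; rewrite -(entrance_unique xy xy' h1 h2 h3 h3') eqxx.
rewrite big_mkcond /= -[leRHS](mulr1 1) -[leRHS]mulr1.
apply: le_trans (_ : \sum_(i <- nb y) (x == i)%:R * 1 <= _).
  apply: ler_sum => i _; rewrite eq_sym; case: (x == i); rewrite ?andbF // mulr1.
  by case: ifP => // _; rewrite lern1 leq_b1.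
by rewrite sum_delta // !mulr1 lern1 leq_b1.
Qed.

Let pairs : seq (V * V) := [seq (x, y) | x <- X, y <- [seq y <- nb x | y \in X]].

Let pairs_uniq : uniq pairs.
Proof.
apply: allpairs_uniq_dep => //; first by move=> x _; apply: filter_uniq.
by move=> [? ?] [? ?] _ _ [-> ->].
Qed.

Let mem_pairs x y : ((x, y) \in pairs) = [&& x \in X, y \in X & adj nb x y].
Proof.
apply/allpairsPdep/idP => [[x' [y' [hx hy [-> ->]]]]|/and3P[h1 h2 h3]].
  by move: hy; rewrite mem_filter hx => /andP[-> hy]; rewrite /adj hy.
by exists x, y; rewrite mem_filter h2.
Qed.

Let sum_pairs (F : V -> V -> R) :
  \sum_(xy <- pairs) F xy.1 xy.2 = \sum_(x <- X) \sum_(y <- nb x | y \in X) F x y.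
Proof.
rewrite big_allpairs_dep /=; apply: eq_bigr => x _.
by rewrite big_filter.
Qed.

Let sum_pairsC (F : V -> V -> R) :
  \sum_(xy <- pairs) F xy.1 xy.2 = \sum_(xy <- pairs) F xy.2 xy.1.
Proof.
rewrite [RHS](perm_big [seq (xy.2, xy.1) | xy <- pairs]) /=.
  by rewrite big_map.
apply: uniq_perm => //.
  by rewrite map_inj_uniq // => -[? ?] [? ?] /= [-> ->].
move=> [x y]; rewrite mem_pairs; apply/idP/mapP => [/and3P[h1 h2 h3]|[[x' y']]].
  by exists (y, x); rewrite // mem_pairs h1 h2 nbC h3.
by rewrite mem_pairs => /and3P[h1 h2 h3] [-> ->]; rewrite h1 h2 nbC h3.
Qed.

(** Summing [t_split] over oriented pairs in [X] gives d T - Out = (1+p) A - p C, and summing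
    [entrance] gives p (A - C) <= T - 1. Eliminate A. On a tree C vanishes. *)
Lemma boundary_identity :
  (1 + p) + (p * (d%:R - 1) - 1) * (\sum_(x <- X) t x) <=
  p * (\sum_(x <- X) t x * (count (fun y => y \notin X) (nb x))%:R) +
  p * \sum_(xy <- pairs) c xy.1 xy.2.
Proof.
have /andP[p0 p1] := hp.
set T := \sum_(x <- X) t x; set C := \sum_(xy <- pairs) _; set Out := \sum_(x <- X) _.
pose A := \sum_(xy <- pairs) a xy.1 xy.2.
have cC x y : c x y = c y x by rewrite /c edgeC; apply: EE_ext => w _; rewrite andbC.
have h1 : d%:R * T - Out = (1 + p) * A - p * C.
  have -> : d%:R * T - Out = \sum_(xy <- pairs) t xy.1.
    rewrite (sum_pairs (fun x _ => t x)) /T /Out mulr_sumr -sumrB; apply: eq_bigr => x _.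
    rewrite big_const_seq iter_addr addr0 -[RHS]mulr_natr [d%:R * _]mulrC -mulrBr; congr (_ * _).
    have := count_predC (mem X) (nb x); rewrite nbd => <-.
    have -> : count (predC (mem X)) (nb x) = count (fun y => y \notin X) (nb x) by exact: eq_count.
    by rewrite natrD addrK.
  have -> : \sum_(xy <- pairs) t xy.1 =
      \sum_(xy <- pairs) (a xy.1 xy.2 + p * (a xy.2 xy.1 - c xy.1 xy.2)).
    rewrite big_seq [RHS]big_seq; apply: eq_bigr => -[x y]; rewrite mem_pairs => /and3P[hx hy xy] /=.
    exact: t_split.
  rewrite big_split /= -mulr_sumr sumrB /= -(sum_pairsC a) -/A -/C; ring.
have h2 : p * (A - C) <= T - 1.
  have -> : p * (A - C) = \sum_(y <- X) \sum_(x <- nb y | x \in X) p * (a x y - c x y).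
    rewrite /A (sum_pairsC a) (sum_pairs (fun x y => a y x)) /C (sum_pairs c) -sumrB mulr_sumr.
    apply: eq_bigr => y _; rewrite -sumrB mulr_sumr; apply: eq_bigr => x _.
    by rewrite (cC x y).
  apply: le_trans (_ : \sum_(y <- X) (t y - (y == o)%:R) <= _).
    by rewrite big_seq [leRHS]big_seq; apply: ler_sum => y hy; exact: entrance.
  rewrite sumrB -/T lerD2l lerN2.
  rewrite (eq_bigr (fun y => (o == y)%:R * 1)) ?sum_delta ?oX ?mulr1 // => y _.
  by rewrite mulr1 eq_sym.
nra.
Qed.

Variable L : nat.
Hypothesis nbL : girth_ge nb L.
Hypothesis L0 : (0 < L)%N.

(** If [o] is joined to both ends of a deleted edge, there is a collision in the sense of
    [cycle_expect], so C <= (eta/pm) T. As p <= pm, this error is absorbed by the excess p(d-1) - 1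
    >= e. *)
Lemma boundary_ge1 (pm e eta : R) : 0 < pm -> p <= pm -> eta <= e ->
  (forall z, \sum_(n < (size X).+1 | (L <= n)%N) (n ^ 2)%:R * pm ^+ n * nbc nb None n z z <= eta) ->
  1 + e <= p * (d%:R - 1) ->
  1 <= p * \sum_(x <- X) EXX (fun w => (cn nb w o x)%:R) *
         (count (fun y => y \notin X) (nb x))%:R.
Proof.
move=> pm0 ppm ee heta pd; have /andP[p0 p1] := hp.
have hid := boundary_identity; set T := \sum_(x <- X) t x in hid; set C := \sum_(xy <- pairs) _ in hid.
have t0 x : 0 <= t x by apply: EE_ge0.
have T0 : 0 <= T by apply: sumr_ge0.
have hC : C <= 1 * (eta / pm) * T.
  apply: le_trans (cyc_sum_total L0 hp pairs_uniq pm0 ppm t0 ler01 heta).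
  rewrite /C big_seq [leRHS]big_seq; apply: ler_sum => -[x y].
  rewrite mem_pairs => /and3P[hx hy xy] /=.
  pose es1 := [seq e <- E nb X | e != edge x y].
  have ues1 : uniq es1 by exact/filter_uniq/E_uniq.
  have ses1 : {subset es1 <= E nb X} by move=> f; rewrite mem_filter => /andP[].
  have nes1 : edge x y \notin es1 by rewrite mem_filter eqxx.
  have hh0 : 0 <= (0 : R) <= 1 by rewrite lexx ler01.
  (* Trivial targets: every vertex is one, so the collision just says that [y] lies in the cluster
     of [o]. *)
  have hm z : EE (0 : R) ([::] : seq V) (fun g => EE p es1 (fun w' =>
     (hit nb w' ((fun _ : V -> bool => xpredT : V -> bool) g) z)%:R)) <= 1.
    rewrite /=; apply: le_trans (_ : EE p es1 (fun=> 1) <= _); last by rewrite EE_cst.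
    by apply: EE_le => // w _; rewrite lern1 leq_b1.
  have := cycle_expect nbI nbC nbL hp (poslin_EE _ hh0) ues1 ues1 ses1 ses1 oX hy xy nes1 nes1
     (W := fun=> 1) (fun _ _ _ => lexx _) (fun=> ler01) ler01 hm.
  rewrite /= => hce; apply: le_trans (le_trans hce _).
    rewrite /c /EX (EE_filter p (E nb X) (fun e => e != edge x y)
       (fun w => (cn nb w o x && cn nb w o y)%:R)) -/es1.
    apply: EE_le => // w _; rewrite -(EE_cst p es1 (_%:R)); apply: EE_le => // w' _.
    rewrite mulr1 ler_nat; case: (boolP (cn nb w o x)) => //= _.
    case: (boolP (cn nb w o y)) => //= ny; rewrite (_ : hit nb w' predT y) /=; last first.
      by apply/hitP; exists y; rewrite cn_refl.
    by rewrite /hitoff ny.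
  rewrite /cyc_sum; apply: ler_sum => z _; apply: ler_sum => l _; apply: ler_sum => ij _.
  rewrite ler_wpM2l // ler_wpM2l ?exprn_ge0 // !mul1r.
  apply: le_trans (_ : EE p es1 (fun w => (cn nb w o z)%:R) <= _).
    by apply: EE_le => // w _; rewrite mulr1.
  by apply: EE_es_mono => //; [exact: E_uniq|exact: incr_cn].
have hpC : p * C <= e * T.
  apply: le_trans (_ : p * (1 * (eta / pm) * T) <= _); first by rewrite ler_wpM2l.
  rewrite mul1r mulrA ler_wpM2r //.
  have eta0 : 0 <= eta.
    by apply: le_trans (heta o); apply: sumr_ge0 => n _; rewrite !mulr_ge0 ?nbc_ge0 ?exprn_ge0 // ltW.
  apply: le_trans ee; rewrite mulrCA ler_piMr // ler_pdivrMr // mul1r //.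
have hT := ler_wpM2r T0 pd; rewrite -/C in hid.
set Out := \sum_(x <- X) _ in hid *.
have hT2 : e * T <= (p * (d%:R - 1) - 1) * T by rewrite ler_wpM2r // lerBrDr addrC.
lra.
Qed.

End FiniteVolume.
End Boundary.

(** * Growth of the connection probability from lower bounds on expected exits *)

Section Sharpness.
Context {R : realType} {V : countType}.
Variables (nb : V -> seq V).
Hypothesis nbU : forall x, uniq (nb x).
Hypothesis nbI : forall x, x \notin nb x.
Hypothesis nbC : forall x y, adj nb x y = adj nb y x.
Implicit Types (X Y S l : seq V) (w : V * V -> bool) (x y z v o : V) (i j n : nat).

(** Expected number of open edges leaving [S] from the cluster of [o] inside [S]. Values below 1
    force a finite susceptibility on transitive graphs; a lower bound over all [S] and a range of
    parameters forces percolation. *)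
Definition phi (p : R) S o : R := p * \sum_(x <- S) EX nb p S (fun w => (cn nb w o x)%:R) *
   (count (fun y => y \notin S) (nb x))%:R.

Lemma sum_count (I : Type) (r : seq I) (P : pred I) : (count P r)%:R = \sum_(i <- r) (P i)%:R :> R.
Proof. by rewrite -sum1_count natr_sum big_mkcond; apply: eq_bigr => i _; case: (P i). Qed.

Definition inside S w := res (fun e => ~~ touch (fun x => x \notin S) e) w.

Lemma inside_edge S w x y : inside S w (edge x y) = [&& w (edge x y), x \in S & y \in S].
Proof. by rewrite /inside /res touch_edge negb_or !negbK. Qed.

Lemma EX_inside p S Y (f : (V * V -> bool) -> R) : uniq S -> uniq Y -> {subset S <= Y} ->
  EX nb p Y (fun w => f (inside S w)) = EX nb p S f.
Proof.
move=> uS uY sSY; rewrite /EX (EE_filter p _ (fun e => ~~ touch (fun x => x \notin S) e)).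
apply: EE_perm; apply: uniq_perm; [exact/filter_uniq/E_uniq|exact: E_uniq|move=> e].
rewrite mem_filter; apply/andP/idP => [[h /E_edge[x [y [ee xy hx hy]]]]|/E_edge[x [y [-> xy hx hy]]]].
  by move: h; rewrite ee touch_edge negb_or !negbK => /andP[h1 h2]; rewrite edge_E // xy h1 h2.
by rewrite touch_edge hx hy /= edge_E // xy !sSY.
Qed.

Section Growth.
Variables (Y : seq V) (o : V) (Out : V -> bool).
Hypothesis uY : uniq Y.
Hypothesis oY : o \in Y.
Hypothesis Yclosed : forall x, x \in Y -> ~~ Out x -> {subset nb x <= Y}.

Let f (p : R) := EX nb p Y (fun w => (hit nb w Out o)%:R).
Let unhit w : seq V := [seq x <- Y | ~~ hit nb w Out x].

Let unhit_determined w w' : subc w (E nb Y) -> subc w' (E nb Y) ->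
  res (touch (fun x => x \notin unhit w)) w = res (touch (fun x => x \notin unhit w)) w' ->
  unhit w' = unhit w.
Proof.
move=> sw sw' h.
have hh : res (touch (hit nb w Out)) w = res (touch (hit nb w Out)) w'.
  apply/funext => e; have := congr1 (@^~ e) h; rewrite /res.
  case: (boolP (e \in E nb Y)) => [/E_edge[x [y [-> _ hx hy]]]|ne] _.
    have := congr1 (@^~ (edge x y)) h; rewrite /res !touch_edge !mem_filter hx hy !andbT.
    by rewrite !negbK.
  case we: (w e); first by rewrite sw in ne.
  by case we': (w' e); first by rewrite sw' in ne.
by apply: eq_filter => x; rewrite (hit_determined nbC hh).
Qed.

(** Explore from [Out]. The set S of vertices not reaching it is revealed by the edges touching its
    complement, so percolation inside S is fresh. If [o] lies in S, every edge from the cluster of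
    [o] in S to the complement is pivotal, and their expected number is phi(S)/p. *)
Lemma pivotal_lower p c : 0 <= p <= 1 ->
  (forall S, uniq S -> o \in S -> {subset S <= Y} -> c <= phi p S o) ->
  c * (1 - f p) <=
  \sum_(e <- E nb Y) EX nb p Y (fun w => (hit nb (addc e w) Out o)%:R - (hit nb (del e w) Out o)%:R).
Proof.
move=> hp hc; have /andP[p0 p1] := hp.
pose G w x y : R := [&& o \in unhit w, x \in unhit w, y \notin unhit w & cn nb (inside (unhit w) w) o x]%:R.
have sw_out w x : subc w (E nb Y) -> x \in unhit w -> {subset nb x <= Y}.
  move=> sw; rewrite mem_filter => /andP[hx xY]; apply: Yclosed => //.
  by apply: contra hx => ox; apply/hitP; exists x; rewrite cn_refl.
apply: (@le_trans _ _ (EX nb p Y (fun w => \sum_(x <- Y) \sum_(y <- nb x) G w x y))).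
  have -> : EX nb p Y (fun w => \sum_(x <- Y) \sum_(y <- nb x) G w x y) =
    EX nb p Y (fun w => (fun S w' => (o \in S)%:R * \sum_(x <- Y) (x \in S)%:R *
       ((count (fun y => y \notin S) (nb x))%:R * (cn nb w' o x)%:R)) (unhit w) (inside (unhit w) w)).
    apply: EE_ext => w _; rewrite mulr_sumr; apply: eq_bigr => x _.
    rewrite sum_count mulr_suml !mulr_sumr; apply: eq_bigr => y _.
    by rewrite /G -!mulnb !natrM; ring.
  rewrite /EX (EE_explore p (K := unhit) (Q := fun S => touch (fun x => x \notin S))
    (fun S w' => (o \in S)%:R * \sum_(x <- Y) (x \in S)%:R *
       ((count (fun y => y \notin S) (nb x))%:R * (cn nb w' o x)%:R)) unhit_determined).
  have -> : c * (1 - f p) = EE p (E nb Y) (fun w => (o \in unhit w)%:R * c).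
    rewrite EEZr mulrC; congr (_ * c); rewrite /f /EX -[X in X - _](EE_cst p (E nb Y) 1) -EEB.
    apply: EE_ext => w _; rewrite mem_filter oY andbT.
    by case: hit; rewrite ?subrr ?subr0.
  apply: EE_le => // w hw; rewrite EEZ; case: (boolP (o \in unhit w)) => [ho|_]; last by rewrite !mul0r.
  rewrite !mul1r EE_sum.
  have uS : uniq (unhit w) by exact: filter_uniq.
  have sS : {subset unhit w <= Y} by move=> x; rewrite mem_filter => /andP[].
  apply: le_trans (hc _ uS ho sS) _; rewrite /phi.
  (* Pivotality ignores the state of the edge, so the factor [p] in [phi] is bounded by 1. *)
  apply: le_trans (_ : 1 * \sum_(x <- unhit w) EX nb p (unhit w) (fun w => (cn nb w o x)%:R) *
   (count (fun y => y \notin unhit w) (nb x))%:R <= _).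
    apply: ler_wpM2r => //; apply: sumr_ge0 => x _; rewrite mulr_ge0 //.
    by apply: EE_ge0.
  rewrite mul1r {1}/unhit big_filter big_mkcond big_seq [leRHS]big_seq; apply: ler_sum => x xY.
  rewrite EEZ EEZ mem_filter xY andbT; case: ifP => _; last by rewrite mul0r.
  rewrite mul1r mulrC -(EX_inside p (fun w' => (cn nb w' o x)%:R) uS uY sS) /EX lexx //.
rewrite /EX -EE_sum; apply: EE_le => // w hw.
have le1 e : (0 : R) <= (hit nb (addc e w) Out o)%:R - (hit nb (del e w) Out o)%:R.
  rewrite subr_ge0; apply: incr_hit => e'; rewrite /del /res /addc => /andP[-> _].
  by rewrite orbT.
apply: (@le_trans _ _ (\sum_(e <- E nb Y) \sum_(xy <- [:: (e.1, e.2); (e.2, e.1)]) G w xy.1 xy.2)).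
  rewrite /E big_allpairs_dep /=.
  under [leRHS]eq_bigr => x _ do rewrite big_filter.
  rewrite (eq_bigr (fun x => \sum_(y <- nb x | y \in Y) G w x y)); last first.
    move=> x _; rewrite [RHS]big_mkcond big_seq [RHS]big_seq; apply: eq_bigr => y hy.
    case: ifP => // /negP hyY; rewrite /G; case: (boolP (x \in unhit w)) => hx; last by rewrite andbF.
    by case: hyY; apply: sw_out hx _ hy.
  have spl x : \sum_(y <- nb x | y \in Y) G w x y =
      \sum_(y <- nb x | (y \in Y) && (pickle x < pickle y)%N) G w x y +
      \sum_(y <- nb x | (y \in Y) && (pickle y < pickle x)%N) G w x y.
    rewrite (bigID (fun y => (pickle x < pickle y)%N)) /=; congr (_ + _).
    rewrite big_seq_cond [RHS]big_seq_cond; apply: eq_bigl => y.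
    case: (boolP (y \in nb x)) => //= hy; congr (_ && _).
    rewrite -leqNgt leq_eqVlt; case: eqVneq => //= hpq.
    have hxy : y = x by exact: (pcan_inj pickleK hpq).
    by move: hy; rewrite hxy (negbTE (nbI x)).
  rewrite (eq_bigr _ (fun x _ => spl x)) big_split /=.
  have sw2 : \sum_(x <- Y) \sum_(y <- nb x | (y \in Y) && (pickle y < pickle x)%N) G w x y =
     \sum_(x <- Y) \sum_(y <- nb x | (y \in Y) && (pickle x < pickle y)%N) G w y x.
    have cv (P : V -> V -> bool) (F : V -> V -> R) :
      \sum_(x <- Y) \sum_(y <- nb x | (y \in Y) && P x y) F x y =
      \sum_(x <- Y) \sum_(y <- Y | adj nb x y && P x y) F x y.
      apply: eq_bigr => x _; rewrite -[LHS]big_filter -[RHS]big_filter; apply: perm_big; apply: uniq_perm.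
      - exact: filter_uniq.
      - exact: filter_uniq.
      by move=> y; rewrite !mem_filter -/(adj nb x y); case: (y \in Y); case: adj; case: P.
    apply: (etrans (cv (fun x y => (pickle y < pickle x)%N) (G w))).
    apply: etrans; last by symmetry; exact: (cv (fun x y => (pickle x < pickle y)%N) (fun x y => G w y x)).
    rewrite (exchange_big_dep predT) //=; apply: eq_bigr => x _; apply: eq_bigl => y.
    by rewrite nbC.
  rewrite sw2 -big_split /=; apply: ler_sum => x _; rewrite -big_split /=; apply: ler_sum => y _.
  by rewrite !big_cons big_nil addr0.
rewrite big_seq [leRHS]big_seq; apply: ler_sum => -[x0 y0]; rewrite mem_E => /and4P[aa hx0 hy0 pxy].
set e := (x0, y0); have ea : edge x0 y0 = e by rewrite /edge pxy.
have eb : edge y0 x0 = e by rewrite edgeC.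
have ab : adj nb y0 x0 by rewrite nbC.
have key x y : edge x y = e -> adj nb x y -> G w x y = 1 ->
   (hit nb (addc e w) Out o)%:R - (hit nb (del e w) Out o)%:R = 1 :> R /\ G w y x = 0.
  move=> exy xy /eqP; rewrite /G pnatr_eq1 eqb1 => /and4P[h1 h2 h3 h4].
  rewrite (negbTE h3) /= andbF; split=> //.
  have yY : y \in Y by apply: (sw_out w x) => //.
  have hy : hit nb w Out y by move: h3; rewrite mem_filter yY andbT negbK.
  have cox : cn nb w o x by apply: (cn_mono _ h4) => e' /andP[].
  have nho : ~~ hit nb w Out o by move: h1; rewrite mem_filter => /andP[].
  have -> : hit nb (del e w) Out o = false.
    by apply/negbTE; apply: contra nho; apply: hit_mono => e' /andP[].
  have la : lec w (addc e w) by move=> e' he'; rewrite /addc he' orbT.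
  suff -> : hit nb (addc e w) Out o by rewrite subr0.
  apply: hit_cn (cn_trans (cn_mono la cox) _) (hit_mono la hy); apply: cn_edge.
  by rewrite /oadj xy /addc exy eqxx.
rewrite !big_cons big_nil addr0 /=.
have G01 x y : G w x y = 0 \/ G w x y = 1 by rewrite /G; case: (_ && _); [right|left].
case: (G01 x0 y0) => [g1|g1]; last by have [-> ->] := key _ _ ea aa g1; rewrite g1 addr0.
case: (G01 y0 x0) => [g2|g2]; last by have [-> _] := key _ _ eb ab g2; rewrite g1 g2 add0r.
by rewrite g1 g2 addr0.
Qed.

Lemma dct_growth (a b c : R) : 0 <= a -> a < b -> b <= 1 -> 0 <= c ->
  (forall p S, a <= p <= b -> uniq S -> o \in S -> {subset S <= Y} -> c <= phi p S o) ->
  (b - a) * c * (1 - f b) <= f b.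
Proof.
move=> a0 ab b1 c0 hc.
have [q /andP[aq qb] hq] := russo_mvt (fun w => (hit nb w Out o)%:R) ab (E_uniq nbU uY).
have q01 : 0 <= q <= 1 by lra.
have fmono : f q <= f b by apply: EE_mono; [lra|lra|lra|exact: incr_hit].
have h := pivotal_lower (c := c) q01 (fun S uS oS sS => hc q S _ uS oS sS).
have fa : 0 <= f a by apply: EE_ge0 => //; lra.
apply: le_trans (_ : f b - f a <= _); last by rewrite lerBlDr lerDl.
rewrite /f /EX hq -mulrA ler_wpM2l ?subr_ge0 ?(ltW ab) //.
apply: le_trans (h _); last by rewrite (ltW aq) (ltW qb).
by rewrite ler_wpM2l // lerD2l lerN2.
Qed.

End Growth.
End Sharpness.

Lemma le_sum_subset (R : realType) (I : eqType) (F G : seq I) (f : I -> R) :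
  uniq F -> {subset F <= G} -> (forall i, 0 <= f i) ->
  \sum_(i <- F) f i <= \sum_(i <- G) f i.
Proof.
move=> uF sFG f0; elim: F G uF sFG => [|x F IH] G /=.
  by move=> _ _; rewrite big_nil; apply: sumr_ge0.
move=> /andP[xF uF] sFG; have xG : x \in G by apply: sFG; rewrite mem_head.
rewrite big_cons (big_rem x xG) /= lerD2l; apply: IH => // y yF.
apply: rem_mem; first by apply: contraNneq xF => <-.
by apply: sFG; rewrite inE yF orbT.
Qed.

(** * Infinite volume: two-point function, percolation probability, critical parameter *)

Section Critical.
Import numFieldNormedType.Exports.
Context {R : realType} {V : countType}.
Variables (nb : V -> seq V) (o : V).
Hypothesis nbU : forall x, uniq (nb x).
Hypothesis nbI : forall x, x \notin nb x.
Hypothesis nbC : forall x y, adj nb x y = adj nb y x.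
Hypothesis nbconn : graph_connected nb.
Implicit Types (X Y l : seq V) (w : V * V -> bool) (x y z v : V) (i j n : nat) (p q : R).

Local Notation ball := (Defs.ball nb o).

(** Union bound over simple open paths, which are non-backtracking walks with distinct edges. *)
Lemma two_point_walks p X x y : 0 <= p <= 1 -> uniq X -> x \in X ->
  EX nb p X (fun w => (cn nb w x y)%:R) <= \sum_(n < (size X).+1) nbc nb None n x y * p ^+ n.
Proof.
move=> hp uX xX; have /andP[p0 p1] := hp.
pose G w n : R := \sum_(l <- nbl nb None n x) (last x l == y)%:R * ((uniq (pedges x l))%:R * (all w (pedges x l))%:R).
apply: le_trans (_ : EX nb p X (fun w => \sum_(n < (size X).+1) G w n) <= _).
  apply: EE_le => // w hw.
  have G0 n : 0 <= G w n by apply: sumr_ge0 => l _; rewrite !mulr_ge0.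
  case: (boolP (cn nb w x y)) => [/cn_simple[s [ps ls us]]|_]; last by apply: sumr_ge0.
  have sX : {subset x :: s <= X} by apply: (pedges_in nbI nbC hw xX); exact: path_oadj_all ps.
  have ss : (size s < (size X).+1)%N by rewrite ltnS ltnW //; exact: (uniq_leq_size us sX).
  apply: le_trans (_ : G w (Ordinal ss) <= _); last by rewrite (bigD1 (Ordinal ss)) //= lerDl sumr_ge0.
  rewrite /G /=; have hs : s \in nbl nb None (size s) x.
    by apply: nbl_simple => //; [exact: path_oadj_adj ps|case: (s)].
  apply: le_trans (le_sum_seq1 _ hs); last by move=> l; rewrite !mulr_ge0.
  by rewrite ls eqxx (uniq_pedges us) (path_oadj_all ps) !mulr1.
rewrite /EX EE_sum; apply: ler_sum => n _; rewrite EE_sum -nbcE mulr_suml.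
rewrite big_seq [leRHS]big_seq; apply: ler_sum => l /size_nbl sl.
rewrite EEZ ler_wpM2l // EEZ; case: (boolP (uniq _)) => [ul|_]; last by rewrite mul0r exprn_ge0.
by rewrite mul1r -sl -(size_pedges x); apply: EE_all_le => //; exact: E_uniq.
Qed.

Let f p n : R := Pr nb o p n.+1 (fun S => has (fun v => v \notin ball n) (cl S o)).

Let fE p n : f p n = EX nb p (ball n.+1) (fun w => (hit nb w (fun v => v \notin ball n) o)%:R).
Proof. exact: Pr_hit. Qed.

Let f01 p n : 0 <= p <= 1 -> 0 <= f p n <= 1.
Proof.
move=> hp; rewrite fE; apply/andP; split; first by apply: EE_ge0.
by apply: EE_le_cst => // w _; rewrite lern1 leq_b1.
Qed.

Lemma theta_le p n : 0 <= p <= 1 -> theta nb o p <= f p n.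
Proof.
move=> hp; apply: ge_inf; last by exists n.
by exists 0 => _ [m _ <-]; case/andP: (f01 m hp).
Qed.

Lemma theta_ge p c : (forall n, c <= f p n) -> c <= theta nb o p.
Proof. by move=> h; apply: lb_le_inf; [exists (f p 0), 0%N|move=> _ [n _ <-]; exact: h]. Qed.

Lemma theta_le_Pinf p : 0 <= p <= 1 -> theta nb o p <= Pinf nb o p.
Proof.
move=> hp; rewrite /Pinf.
set A := [set inf _ | m in _].
have Aub : has_ubound A.
  exists 1 => _ [m _ <-]; apply: le_trans (_ : Pr nb o p (m + 0).+1
      (fun S => has (fun x => has (fun v => v \notin ball (m + 0)) (cl S x)) (ball m)) <= _).
    apply: ge_inf; last by exists 0%N.
    by exists 0 => _ [n _ <-]; rewrite Pr_has_hit //; apply: EE_ge0.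
  by rewrite Pr_has_hit //; apply: EE_le_cst => // w _; rewrite lern1 leq_b1.
apply: ub_le_sup => //; exists 0%N => //; congr inf.
apply/seteqP; split=> _ [n _ <-]; exists n => //.
  by rewrite add0n !Pr_has_hit // Pr_hit //; apply: EE_ext => w _; rewrite /= orbF.
by rewrite add0n !Pr_has_hit // Pr_hit //; apply: EE_ext => w _; rewrite /= orbF.
Qed.

Let Pc_set : set R := [set p : R | 0 <= p <= 1 /\ 0 < Pinf nb o p].

Lemma p_c_le p : 0 <= p <= 1 -> 0 < Pinf nb o p -> p_c nb o <= p.
Proof.
move=> hp h; apply: ge_inf; last by split.
by exists 0 => q [/andP[]].
Qed.

Lemma p_c_ge p : Pc_set !=set0 -> (forall q, 0 <= q <= 1 -> 0 < Pinf nb o q -> p <= q) -> p <= p_c nb o.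
Proof. by move=> h0 h; apply: lb_le_inf => // q [h1 h2]; exact: h. Qed.

(** In each ball [dct_growth] has the form k(1-F) <= F with k <= 1, hence F >= k/2; the bound does
    not depend on the ball. *)
Lemma theta_growth a b c : 0 <= a -> a < b -> b <= 1 -> 0 <= c <= 1 ->
  (forall p (S : seq V), a <= p <= b -> uniq S -> o \in S -> c <= phi nb p S o) ->
  (b - a) * c / 2 <= theta nb o b.
Proof.
move=> a0 ab b1 /andP[c0 c1] hc; apply: theta_ge => n.
have Yc x : x \in ball n.+1 -> ~~ (x \notin ball n) -> {subset nb x <= ball n.+1}.
  by move=> _; rewrite negbK => hx y hy; apply/ballS; right; exists x.
have hb : 0 <= b <= 1 by rewrite b1 andbT (le_trans a0) // ltW.
have := dct_growth nbU nbI nbC (ball_uniq nb o n.+1) (center_in_ball nb o n.+1) Yc a0 ab b1 c0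
  (fun p S hp uS oS _ => hc p S hp uS oS).
have := f01 n hb; rewrite fE; set F := EX _ _ _ _ => /andP[F0 F1].
have k0 : 0 <= (b - a) * c by rewrite mulr_ge0 // subr_ge0 ltW.
have k1 : (b - a) * c <= 1 by apply: mulr_ile1; rewrite ?subr_ge0 ?(ltW ab) //; lra.
nra.
Qed.

(** A finite partial sum of the triangle is a limit of finite-volume sums over balls. The truncation
    [M] may depend on the ball, but [C] does not; three factors 2 give 8. *)
Lemma tau_triangle p s C : 0 <= p <= 1 -> 0 <= s ->
  (forall n, exists M, forall x y, x \in ball n ->
     EX nb p (ball n) (fun w => (cn nb w x y)%:R) <= 2 * green nb s M x y) ->
  (forall M X Y, uniq X -> uniq Y ->
    \sum_(x <- X) \sum_(y <- Y) green nb s M o x * green nb s M x y * green nb s M y o <= C) ->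
  triangle_condition nb o p.
Proof.
move=> hp s0 hM hC; pose u x y n : R := Pr nb o p n (fun S => y \in cl S x).
have uE x y n : u x y n = EX nb p (ball n) (fun w => (cn nb w x y)%:R) by exact: Pr_cn.
have u0 x y n : 0 <= u x y n by rewrite uE; apply: EE_ge0.
have u1 x y n : u x y n <= 1.
  by rewrite uE; apply: EE_le_cst => // w _; rewrite lern1 leq_b1.
have umono x y : nondecreasing_seq (u x y).
  move=> m n mn; rewrite !uE; apply: EX_mono_vol => //; try exact: ball_uniq.
    exact: ball_leq.
  exact: incr_cn.
have ucv x y : u x y @ \oo --> tau nb o p x y.
  by apply: nondecreasing_cvgn => //; exists 1 => _ [n _ <-].
have tau0 x y : 0 <= tau nb o p x y.
  apply: le_trans (u0 x y 0%N) _; apply: ub_le_sup; last by exists 0%N.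
  by exists 1 => _ [n _ <-]; exact: u1.
have C0 : 0 <= C.
  by have := hC 0%N [::] [::] isT isT; rewrite big_nil.
have bound (F : seq (V * V)) : uniq F ->
    \sum_(xy <- F) tau nb o p o xy.1 * tau nb o p xy.1 xy.2 * tau nb o p xy.2 o <= 8 * C.
  move=> uF; pose g n : R := \sum_(xy <- F) u o xy.1 n * u xy.1 xy.2 n * u xy.2 o n.
  have gcv : g n @[n --> \oo] -->
      \sum_(xy <- F) tau nb o p o xy.1 * tau nb o p xy.1 xy.2 * tau nb o p xy.2 o.
    rewrite /g; elim: (F) => [|xy l IH].
      by under eq_cvg do rewrite big_nil; rewrite big_nil; exact: cvg_cst.
    under eq_cvg do rewrite big_cons.
    rewrite big_cons; apply: cvgD => //.
    by apply: cvgM; [apply: cvgM|]; exact: ucv.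
  apply: (cvgr_to_le gcv).
  have [N hN] := ball_exhaust o (map fst F ++ map snd F) nbconn.
  exists N => // n /= Nn; have [M hMn] := hM n.
  pose X := undup (map fst F); pose Y := undup (map snd F).
  have sX x : x \in X -> x \in ball n.
    by rewrite mem_undup => hx; apply: (ball_leq Nn); apply: hN; rewrite mem_cat hx.
  have sY y : y \in Y -> y \in ball n.
    by rewrite mem_undup => hy; apply: (ball_leq Nn); apply: hN; rewrite mem_cat hy orbT.
  pose G (x y : V) : R := u o x n * u x y n * u y o n.
  have G0 xy : 0 <= G xy.1 xy.2 by rewrite /G !mulr_ge0.
  apply: le_trans (_ : \sum_(xy <- [seq (x, y) | x <- X, y <- Y]) G xy.1 xy.2 <= _).
    apply: le_sum_subset => // -[x y] hxy; apply/allpairsP; exists (x, y); split=> //=.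
      by rewrite mem_undup; apply/mapP; exists (x, y).
    by rewrite mem_undup; apply/mapP; exists (x, y).
  rewrite big_allpairs_dep /=.
  apply: le_trans (_ : 8 * \sum_(x <- X) \sum_(y <- Y)
      green nb s M o x * green nb s M x y * green nb s M y o <= _); last first.
    by rewrite ler_pM2l //; apply: hC; exact: undup_uniq.
  rewrite mulr_sumr big_seq [leRHS]big_seq; apply: ler_sum => x hx.
  rewrite mulr_sumr big_seq [leRHS]big_seq; apply: ler_sum => y hy.
  have b1 : u o x n <= 2 * green nb s M o x by rewrite uE; apply: hMn; exact: center_in_ball.
  have b2 : u x y n <= 2 * green nb s M x y by rewrite uE; apply: hMn; exact: sX.
  have b3 : u y o n <= 2 * green nb s M y o by rewrite uE; apply: hMn; exact: sY.
  apply: le_trans (_ : (2 * green nb s M o x) * (2 * green nb s M x y) * (2 * green nb s M y o) <= _).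
    by apply: ler_pM => //; [exact: mulr_ge0|exact: ler_pM].
  by rewrite le_eqVlt; apply/orP; left; apply/eqP; ring.
rewrite /triangle_condition; apply: le_lt_trans (_ : ((8 * C)%:E < +oo)%E); last exact: ltry.
apply: ge_ereal_sup => _ [A [finA _] <-].
rewrite fsbig_finite //= sumEFin lee_fin.
by apply: bound; exact: finmap.fset_uniq.
Qed.

End Critical.

(** * The triangle condition at p_c *)

Section PartOne.
Context {R : realType} {V : countType}.
Variables (nb : V -> seq V) (o : V) (d L : nat) (e eta : R).
Hypothesis nbU : forall x, uniq (nb x).
Hypothesis nbI : forall x, x \notin nb x.
Hypothesis nbC : forall x y, adj nb x y = adj nb y x.
Hypothesis nbconn : graph_connected nb.
Hypothesis nbd : forall x, size (nb x) = d.
Hypothesis d3 : (3 <= d)%N.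
Hypothesis nbL : girth_ge nb L.
Hypothesis L0 : (0 < L)%N.
Hypothesis he : 0 < e <= 1 / 10.
Hypothesis heta : eta <= e.
Let pm : R := (1 + 2 * e) / (d%:R - 1).
Hypothesis loops : forall K z, \sum_(n < K | (L <= n)%N) (n ^ 2)%:R * pm ^+ n *
  nbc nb None n z z <= eta.

Lemma degree_pred_ge2 : 2 <= d%:R - 1 :> R.
Proof. by rewrite lerBrDr (_ : 2 + 1 = 3%:R :> R) ?ler_nat //; ring. Qed.

Lemma window_bounds : 0 < pm <= 6 / 10.
Proof.
have /andP[e0 e1] := he; have q2 := degree_pred_ge2; have q0 : 0 < d%:R - 1 :> R by lra.
by rewrite /pm divr_gt0 ?ler_pdivrMr //=; lra.
Qed.

Lemma phi_window p (S : seq V) : (1 + e) / (d%:R - 1) <= p <= pm -> uniq S -> o \in S -> 1 <= phi nb p S o.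
Proof.
move=> /andP[p1 p2] uS oS; have /andP[m0 m1] := window_bounds.
have /andP[e0 e1] := he; have q2 := degree_pred_ge2; have q0 : 0 < d%:R - 1 :> R by lra.
have p0 : 0 <= p by apply: le_trans p1; rewrite divr_ge0 //; lra.
have hp : 0 <= p <= 1 by rewrite p0 /=; lra.
apply: (boundary_ge1 nbU nbI nbC nbd hp uS oS nbL L0 m0 p2 heta) => //.
by rewrite -ler_pdivrMr.
Qed.

(** [phi] is at least 1 on the interval from (1+e)/(d-1) to [pm], whose positive length is the gain
    in [theta_growth]. This places p_c inside the window. *)
Lemma theta_pm_gt0 : 0 < theta nb o pm.
Proof.
have /andP[m0 m1] := window_bounds.
have /andP[e0 e1] := he; have q2 := degree_pred_ge2; have q0 : 0 < d%:R - 1 :> R by lra.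
have a0 : 0 <= (1 + e) / (d%:R - 1) :> R by rewrite divr_ge0 //; lra.
have ab : (1 + e) / (d%:R - 1) < pm by rewrite /pm ltr_pM2r ?invr_gt0 //; lra.
have b1 : pm <= 1 by lra.
have c01 : 0 <= (1 : R) <= 1 by rewrite ler01 lexx.
apply: lt_le_trans (theta_growth nbU nbI nbC a0 ab b1 c01 phi_window).
by rewrite mulr1 divr_gt0 // subr_gt0.
Qed.

Lemma p_c_bounds : 0 <= (p_c nb o : R) <= pm.
Proof.
have /andP[m0 m1] := window_bounds.
have hpm : 0 <= pm <= 1 by lra.
have hP : 0 < Pinf nb o pm.
  apply: lt_le_trans theta_pm_gt0 _.
  by apply: theta_le_Pinf.
apply/andP; split; last exact: p_c_le.
by apply: p_c_ge => [|q /andP[]//]; exists pm.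
Qed.

Lemma critical_triangle s C : 0 <= s ->
  (forall K, exists M, forall x y, \sum_(n < K) nbc nb None n x y * pm ^+ n <= 2 * green nb s M x y) ->
  (forall M X Y, uniq X -> uniq Y ->
    \sum_(x <- X) \sum_(y <- Y) green nb s M o x * green nb s M x y * green nb s M y o <= C) ->
  triangle_condition nb o (p_c (R := R) nb o).
Proof.
move=> s0 hM hC; have /andP[c0 cm] := p_c_bounds; have /andP[m0 m1] := window_bounds.
have hp : 0 <= (p_c nb o : R) <= 1 by rewrite c0 /=; lra.
apply: (tau_triangle nbU nbI nbC nbconn hp s0 _ hC) => n.
have [M hMn] := hM (size (Defs.ball nb o n)).+1; exists M => x y hx.
apply: le_trans (two_point_walks nbU nbI nbC y hp (ball_uniq _ _ _) hx) _.
apply: le_trans (hMn x y); apply: ler_sum => k _; rewrite ler_wpM2l ?nbc_ge0 //.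
by apply: lerXn2r; rewrite ?nnegrE // ltW.
Qed.

End PartOne.

                   

(** * Sprinkling: exploring a cluster and adding independent edges *)

Section Explore.
Context {R : realType} {V : countType}.
Variables (nb : V -> seq V) (d : nat).
Hypothesis nbU : forall x, uniq (nb x).
Hypothesis nbI : forall x, x \notin nb x.
Hypothesis nbC : forall x y, adj nb x y = adj nb y x.
Hypothesis nbd : forall x, size (nb x) = d.
Implicit Types (X Y : seq V) (w : V * V -> bool) (o x y z u t v : V) (i j k l n : nat) (p q : R).

Lemma last_exit w (A : V -> bool) v x : A v -> cn nb w v x ->
  A x \/ exists u t, [/\ A u, ~~ A t, oadj nb w u t & cn nb (off A w) t x].
Proof.
move=> Av hvx; have hxv : cn nb w x v by rewrite cn_sym.
case: (first_hit A hxv) => [/andP[nx h]|[s [ps us Al hb _]]].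
  by have := cn_off_notin nx h; rewrite Av.
case/lastP: s ps us Al hb => [|s u] ps us Al hb; first by left.
right; exists u, (last x s); move: ps Al hb; rewrite rcons_path last_rcons belast_rcons.
move=> /andP[ps ht] Au /= /andP[nx hs].
have hall : all (predC A) (x :: s) by rewrite /= nx.
split=> //; first exact: (allP hall _ (mem_last x s)).
  by rewrite oadjC.
rewrite cn_sym //; apply/cnP; exists s; split=> //; exact: path_off.
Qed.

Definition orc w w' : V * V -> bool := fun e => w e || w' e.

Lemma off_orc A w w' : off A (orc (off A w) w') = off A (orc w w').
Proof.
by apply/funext => e; rewrite /off /orc /res; case: (w e); case: (predC _ e); rewrite ?andbF.
Qed.

(** The edge [u t] touches [A], so its sprinkled state is independent of everything seen by
    [off A]. *)
Lemma fresh_edge p q es (A : V -> bool) u t (g : (V * V -> bool) -> R) : 0 <= p <= 1 -> 0 <= q <= 1 ->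
  uniq es -> A u -> incr g -> (forall w, 0 <= g w) ->
  EE p es (fun w => EE q es (fun w' => (w' (edge u t))%:R * g (off A (orc w w')))) <=
  q * EE (p + (1 - p) * q) es g.
Proof.
move=> hp hq ues Au ig g0; rewrite EE_sprinkle -EEZ; apply: EE_le => // w _.
have e1 w' : off A (orc w (res [predC [:: edge u t]] w')) = off A (orc w w').
  apply/funext => e; rewrite /off /orc /res /= inE; case: eqVneq => [->|]; rewrite ?andbT //.
  by rewrite /touch -/(touch A _) touch_edge Au /= !andbF.
have u1 : uniq [:: edge u t] by [].
have := EE_open hq ues u1 (fun w' => g0 (off A (orc w w'))); rewrite expr1 => h.
apply: le_trans (_ : q * EE q es (fun w' => g (off A (orc w w'))) <= _); last first.
  rewrite ler_wpM2l //; first by case/andP: hq.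
  by apply: EE_le => // w' _; apply: ig => e /andP[].
rewrite (_ : EE q es (fun w' => g (off A (orc w w'))) =
  EE q es (fun w' => g (off A (orc w (res [predC [:: edge u t]] w'))))); last first.
  by apply: EE_ext => w' _; rewrite e1.
apply: le_trans h; rewrite le_eqVlt; apply/orP; left; apply/eqP.
by apply: EE_ext => w' _; rewrite e1 /= andbT.
Qed.

Lemma fresh_edge1 p es (A : V -> bool) u t (g : (V * V -> bool) -> R) : 0 <= p <= 1 ->
  uniq es -> A u -> incr g -> (forall w, 0 <= g w) ->
  EE p es (fun w => (w (edge u t))%:R * g (off A w)) <= p * EE p es g.
Proof.
move=> hp ues Au ig g0; have h0 : 0 <= (0 : R) <= 1 by rewrite lexx ler01.
have := fresh_edge t h0 hp ues Au ig g0; rewrite subr0 mul1r add0r => h.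
apply: le_trans h; rewrite -[leLHS](EE_cst 0 es); apply: EE_le => // w hw.
have -> : EE p es (fun w' => (w' (edge u t))%:R * g (off A w')) <=
  EE p es (fun w' => (w' (edge u t))%:R * g (off A (orc w w'))); last by [].
by apply: EE_le => // w' _; rewrite ler_wpM2l //; apply: ig => e /andP[h1 h2];
  rewrite /off /res /orc h1 orbT.
Qed.

Lemma clus_determined X v w w' : v \in X -> subc w (E nb X) -> subc w' (E nb X) ->
  res (touch (mem (clus nb X w v))) w = res (touch (mem (clus nb X w v))) w' ->
  clus nb X w' v = clus nb X w v.
Proof.
move=> vX sw sw' h.
have hh : res (touch (cn nb w v)) w = res (touch (cn nb w v)) w'.
  apply/funext => e; have := congr1 (@^~ e) h; rewrite /res.
  case: (boolP (e \in E nb X)) => [/E_edge[x [y [-> _ hx hy]]]|ne] _.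
    have := congr1 (@^~ (edge x y)) h; rewrite /res !touch_edge /= !mem_filter hx hy !andbT.
    by [].
  case we: (w e); first by rewrite sw in ne.
  by case we': (w' e); first by rewrite sw' in ne.
by apply: eq_filter => x; rewrite (cn_determined nbC hh).
Qed.

(** Follow the path after its last visit to the original cluster K. The exit edge leads out of K, so
    it was closed in [w] and must have been opened by [w']. *)
Lemma sprinkle_cover X w w' v y : subc w (E nb X) -> subc w' (E nb X) -> v \in X ->
  cn nb (orc w w') v y ->
  y \in clus nb X w v \/ exists u t, [/\ u \in clus nb X w v, t \in nb u, t \in X, w' (edge u t) &
     cn nb (off (mem (clus nb X w v)) (orc w w')) t y].
Proof.
move=> sw sw' vX hy; set K := clus nb X w v.
have sww : subc (orc w w') (E nb X) by move=> e /orP[/sw|/sw'].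
have vK : v \in K by rewrite mem_clus // cn_refl.
case: (last_exit vK hy) => [h|[u [t [uK tK /andP[ut hut] h]]]]; first by left.
right; exists u, t; split=> //.
  by move/sww: hut; rewrite edge_E // => /and3P[].
case/orP: hut => // hw; have uK' : u \in K by [].
suff tK' : t \in K by case/negP: tK.
rewrite /K mem_clus //; rewrite /K mem_clus // in uK'.
by apply: (cn_trans uK'); apply: cn_edge; rewrite /oadj ut.
Qed.

Lemma sum_mem_clus X w v : (\sum_(y <- X) (y \in clus nb X w v) <= size (clus nb X w v))%N.
Proof.
rewrite -/(csize nb X w v) csizeE; apply: leq_sum => y _; rewrite mem_filter.
by case: (cn nb w v y); rewrite // leq_b1.
Qed.

Lemma sprinkle_explore p q X v (F : seq V -> (V * V -> bool) -> (V * V -> bool) -> R)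
    (B : seq V -> R) : 0 <= p <= 1 -> v \in X ->
  (forall (A : seq V) w w', F A (off (mem A) w) w' = F A w w') ->
  (forall A : seq V, EE p (E nb X) (fun w => EE q (E nb X) (F A w)) <= B A) ->
  EE p (E nb X) (fun w => EE q (E nb X) (F (clus nb X w v) w)) <=
  EE p (E nb X) (fun w => B (clus nb X w v)).
Proof.
move=> hp vX hF hB.
pose Phi (A : seq V) (w : V * V -> bool) : R := EE q (E nb X) (F A w).
have -> : EE p (E nb X) (fun w => EE q (E nb X) (F (clus nb X w v) w)) =
   EE p (E nb X) (fun w => Phi (clus nb X w v) (off (mem (clus nb X w v)) w)).
  by apply: EE_ext => w _; apply: EE_ext => w' _; rewrite hF.
rewrite (EE_explore p (K := fun w => clus nb X w v) (Q := fun A => touch (mem A)) Phi); last first.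
  by move=> w w'; exact: clus_determined.
apply: EE_le => // w _; apply: le_trans (hB _).
rewrite le_eqVlt; apply/orP; left; apply/eqP.
by apply: EE_ext => w' _; apply: EE_ext => w'' _; rewrite hF.
Qed.

Lemma sum_seq_cst (I : Type) (r : seq I) (c : R) : \sum_(i <- r) c = (size r)%:R * c.
Proof. by rewrite big_const_seq count_predT iter_addr addr0 mulr_natl. Qed.

Lemma sum_nb_in (X : seq V) u (c : R) : 0 <= c -> \sum_(t <- nb u | t \in X) c <= d%:R * c.
Proof.
move=> c0; rewrite -(sum_nb_cst nbd u) big_mkcond; apply: ler_sum => t _.
by case: ifP.
Qed.

(** A vertex of the old cluster has at most d exits, each opened with probability at most [q] and
    followed by a fresh cluster of mean size at most [M]. *)
Lemma sprinkle_size p q X v (M : R) : 0 <= p <= 1 -> 0 <= q <= 1 -> uniq X -> v \in X -> 0 <= M ->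
  (forall t, t \in X -> EX nb (p + (1 - p) * q) X (fun w => (csize nb X w t)%:R) <= M) ->
  EX nb (p + (1 - p) * q) X (fun w => (csize nb X w v)%:R) <=
  EX nb p X (fun w => (csize nb X w v)%:R) * (1 + d%:R * q * M).
Proof.
move=> hp hq uX vX M0 hM; have /andP[q0 q1] := hq.
pose F (A : seq V) (w w' : V * V -> bool) : R := (size A)%:R + \sum_(u <- A) \sum_(t <- nb u | t \in X)
  (w' (edge u t))%:R * (csize nb X (off (mem A) (orc w w')) t)%:R.
apply: le_trans (_ : EE p (E nb X) (fun w => EE q (E nb X) (F (clus nb X w v) w)) <= _).
  rewrite /EX EE_sprinkle; apply: EE_le => // w hw; apply: EE_le => // w' hw'.
  rewrite /F; set K := clus nb X w v.
  rewrite csizeE natr_sum.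
  apply: le_trans (_ : \sum_(y <- X) ((y \in K)%:R + \sum_(u <- K) \sum_(t <- nb u | t \in X)
     (w' (edge u t))%:R * (cn nb (off (mem K) (orc w w')) t y)%:R) <= _).
    apply: ler_sum => y _.
    have S0 : 0 <= \sum_(u <- K) \sum_(t <- nb u | t \in X)
      (w' (edge u t))%:R * (cn nb (off (mem K) (orc w w')) t y)%:R :> R.
      by apply: sumr_ge0 => u _; apply: sumr_ge0 => t _; rewrite mulr_ge0.
    case: (boolP (cn nb _ v y)) => [hy|_]; last by rewrite addr_ge0.
    case: (sprinkle_cover hw hw' vX hy) => [->|[u [t [uK tu tX htu hty]]]].
      by rewrite lerDl.
    apply: ler_wpDl => //.
    apply: le_trans (le_sum_seq1 (F := fun u => \sum_(t <- nb u | t \in X)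
      (w' (edge u t))%:R * (cn nb (off (mem K) (orc w w')) t y)%:R) _ uK); last first.
      by move=> u'; apply: sumr_ge0 => t' _; rewrite mulr_ge0.
    rewrite big_mkcond /=.
    apply: le_trans (le_sum_seq1 (F := fun t => if t \in X then
      (w' (edge u t))%:R * (cn nb (off (mem K) (orc w w')) t y)%:R else 0) _ tu); last first.
      by move=> t'; case: ifP => // _; rewrite mulr_ge0.
    by rewrite tX htu hty mulr1.
  rewrite big_split /=; apply: lerD.
    by rewrite -natr_sum ler_nat; exact: sum_mem_clus.
  rewrite exchange_big; apply: ler_sum => u _; rewrite exchange_big; apply: ler_sum => t _ /=.
  by rewrite -mulr_sumr csizeE natr_sum.
apply: le_trans (sprinkle_explore (B := fun A => (size A)%:R * (1 + d%:R * q * M)) hp vX _ _) _.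
- by move=> A w w'; rewrite /F off_orc.
- move=> A; under EE_ext => w _ do rewrite /F EED EE_cst EE_sum.
  rewrite EED EE_cst EE_sum mulrDr mulr1 lerD2l.
  apply: le_trans (_ : \sum_(u <- A) d%:R * q * M <= _); last first.
    by rewrite sum_seq_cst.
  rewrite big_seq [leRHS]big_seq; apply: ler_sum => u uA.
  under EE_ext => w _ do rewrite EE_sum.
  rewrite EE_sum -mulrA; apply: le_trans (sum_nb_in X u _); last exact: mulr_ge0.
  apply: ler_sum => t tX.
  have ig : incr (fun w => (csize nb X w t)%:R : R).
    by move=> w w' h; rewrite ler_nat; exact: csize_mono.
  apply: le_trans (fresh_edge (A := mem A) t hp hq (E_uniq nbU uX) uA ig (fun w => ler0n _ _)) _.
  by rewrite ler_wpM2l //; exact: hM.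
by rewrite /EX -EEZr.
Qed.

(** If the old cluster has fewer than [l] vertices and no opened exit leads to a cluster of size at
    least [j], the new cluster has fewer than l(1+dj) vertices. The second failure is estimated by a
    union bound over exits, truncated at 1. *)
Lemma sprinkle_tail p q X v (b : R) l j k : 0 <= p <= 1 -> 0 <= q <= 1 -> uniq X -> v \in X -> 0 <= b ->
  (forall t, t \in X -> EX nb (p + (1 - p) * q) X (fun w => (j <= csize nb X w t)%N%:R) <= b) ->
  (l * (1 + d * j) <= k)%N ->
  EX nb (p + (1 - p) * q) X (fun w => (k <= csize nb X w v)%N%:R) <=
  EX nb p X (fun w => (l <= csize nb X w v)%N%:R) +
  EX nb p X (fun w => Num.min 1 (d%:R * q * b * (csize nb X w v)%:R)).
Proof.
move=> hp hq uX vX b0 hb lk; have /andP[q0 q1] := hq.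
pose G (A : seq V) w w' : bool := has (fun u => has (fun t => [&& t \in X, w' (edge u t) &
  (j <= csize nb X (off (mem A) (orc w w')) t)%N]) (nb u)) A.
pose F (A : seq V) w w' : R := (l <= size A)%N%:R + (G A w w')%:R.
apply: le_trans (_ : EE p (E nb X) (fun w => EE q (E nb X) (F (clus nb X w v) w)) <= _).
  rewrite /EX EE_sprinkle; apply: EE_le => // w hw; apply: EE_le => // w' hw'.
  rewrite /F; set K := clus nb X w v.
  case: (leqP l (size K)) => hl; first by apply: ler_wpDr => //; rewrite lern1 leq_b1.
  rewrite add0r ler_nat; case: (boolP (k <= _)%N) => // hk.
  case: (boolP (G K w w')) => // /hasPn nG; exfalso; move: hk; apply/negP; rewrite -ltnNge.
  apply: (@leq_ltn_trans (size K + \sum_(u <- K) \sum_(t <- nb u) j)%N); last first.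
    rewrite (eq_bigr (fun=> (d * j)%N)); last first.
      by move=> u _; rewrite big_const_seq count_predT nbd iter_addn_0 mulnC.
    rewrite big_const_seq count_predT iter_addn_0.
    by apply: leq_trans lk; clear -hl; nia.
  apply: (@leq_trans (\sum_(y <- X) ((y \in K) + \sum_(u <- K) \sum_(t <- nb u | (t \in X) && w' (edge u t))
     cn nb (off (mem K) (orc w w')) t y))%N).
    rewrite csizeE; apply: leq_sum => y _.
    case: (boolP (cn nb _ v y)) => // hy.
    case: (sprinkle_cover hw hw' vX hy) => [->//|[u [t [uK tu tX htu hty]]]].
    rewrite addn_gt0; apply/orP; right.
    rewrite (big_rem u uK) /= addn_gt0; apply/orP; left.
    by rewrite (big_rem t tu) /= tX htu hty.
  rewrite big_split /=; apply: leq_add; first exact: sum_mem_clus.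
  rewrite exchange_big big_seq [leqRHS]big_seq; apply: leq_sum => u uK.
  rewrite exchange_big big_mkcond big_seq [leqRHS]big_seq; apply: leq_sum => t tu /=.
  case: ifP => // /andP[tX htu]; have /hasPn /(_ t tu) := nG u uK.
  by rewrite tX htu /= -ltnNge csizeE => /ltnW.
apply: le_trans (sprinkle_explore (B := fun A => (l <= size A)%N%:R +
   Num.min 1 (d%:R * q * b * (size A)%:R)) hp vX _ _) _.
- by move=> A w w'; rewrite /F /G off_orc.
- move=> A; under EE_ext => w _ do rewrite /F EED EE_cst.
  rewrite EED EE_cst lerD2l le_min; apply/andP; split.
    by apply: EE_le_cst => // w _; apply: EE_le_cst => // w' _; rewrite lern1 leq_b1.
  apply: le_trans (_ : EE p (E nb X) (fun w => EE q (E nb X) (fun w' =>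
    \sum_(u <- A) \sum_(t <- nb u | t \in X) (w' (edge u t))%:R *
      (j <= csize nb X (off (mem A) (orc w w')) t)%N%:R)) <= _).
    apply: EE_le => // w _; apply: EE_le => // w' _.
    case: (boolP (G A w w')) => [/hasP[u uA /hasP[t tu /and3P[tX h1 h2]]]|_]; last first.
      by apply: sumr_ge0 => u _; apply: sumr_ge0 => t _; rewrite mulr_ge0.
    apply: le_trans (le_sum_seq1 (F := fun u => \sum_(t <- nb u | t \in X) (w' (edge u t))%:R *
      (j <= csize nb X (off (mem A) (orc w w')) t)%N%:R) _ uA); last first.
      by move=> u'; apply: sumr_ge0 => t' _; rewrite mulr_ge0.
    rewrite big_mkcond /=.
    apply: le_trans (le_sum_seq1 (F := fun t => if t \in X then (w' (edge u t))%:R *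
      (j <= csize nb X (off (mem A) (orc w w')) t)%N%:R else 0) _ tu); last first.
      by move=> t'; case: ifP => // _; rewrite mulr_ge0.
    by rewrite tX h1 h2 mulr1.
  under EE_ext => w _ do rewrite EE_sum.
  rewrite EE_sum.
  apply: le_trans (_ : \sum_(u <- A) d%:R * q * b <= _); last first.
    by rewrite sum_seq_cst mulrC.
  rewrite big_seq [leRHS]big_seq; apply: ler_sum => u uA.
  under EE_ext => w _ do rewrite EE_sum.
  rewrite EE_sum -mulrA; apply: le_trans (sum_nb_in X u _); last exact: mulr_ge0.
  apply: ler_sum => t tX.
  have ig : incr (fun w => (j <= csize nb X w t)%N%:R : R).
    move=> w w' h; rewrite ler_nat; case: (leqP j (csize nb X w t)) => // hj.
    by rewrite (leq_trans hj) // csize_mono.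
  apply: le_trans (fresh_edge (A := mem A) t hp hq (E_uniq nbU uX) uA ig (fun w => ler0n _ _)) _.
  by rewrite ler_wpM2l //; exact: hb.
by rewrite /EX -EED.
Qed.

End Explore.

(** * The Simon-Lieb inequality for mean cluster sizes *)

Section Subcritical.
Context {R : realType} {V : countType}.
Variables (nb : V -> seq V) (d : nat).
Hypothesis nbU : forall x, uniq (nb x).
Hypothesis nbI : forall x, x \notin nb x.
Hypothesis nbC : forall x y, adj nb x y = adj nb y x.
Hypothesis nbd : forall x, size (nb x) = d.
Implicit Types (X Y : seq V) (w : V * V -> bool) (o x y z u t v : V) (i j k l n : nat) (p q : R).

Local Notation ball := (Defs.ball nb).

Definition chi_le p (B : R) := forall X v, uniq X -> v \in X ->
  EX nb p X (fun w => (csize nb X w v)%:R) <= B.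

Lemma incr_csizeR X v : incr (fun w => (csize nb X w v)%:R : R).
Proof. by move=> w w' h; rewrite ler_nat; exact: csize_mono. Qed.

(** Explore the cluster of [v] inside [S]. Any other vertex of the full cluster is reached through a
    last exit from it along an edge leaving [S], beyond which the configuration is fresh; the
    expected number of such open exits is at most [phi nb p S v]. *)
Lemma exit_bound p X v (S : seq V) (M : R) : 0 <= p <= 1 -> uniq X -> v \in X -> uniq S -> v \in S ->
  0 <= M -> (forall t, t \in X -> EX nb p X (fun w => (csize nb X w t)%:R) <= M) ->
  EX nb p X (fun w => (csize nb X w v)%:R) <= (size S)%:R + phi nb p S v * M.
Proof.
move=> hp uX vX uS vS M0 hM; have /andP[p0 p1] := hp.
pose K w := [seq y <- X | cn nb (inside S w) v y].
(* Only edges with both ends in [S] are revealed, so the edges leaving [S] are still fresh. *)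
pose Q (A : seq V) e := touch (mem A) e && ~~ touch (fun x => x \notin S) e.
have KS w : {subset K w <= S}.
  move=> y; rewrite mem_filter => /andP[+ _]; move: y; apply: cn_ind => // a b _ _ _ /andP[_].
  by rewrite inside_edge => /and3P[].
have sw_inside w : subc w (E nb X) -> subc (inside S w) (E nb X) by move=> h e /andP[/h].
have vK w : v \in K w by rewrite mem_filter cn_refl.
have memK w y : subc w (E nb X) -> (y \in K w) = cn nb (inside S w) v y.
  by move=> hw; rewrite /K -/(clus nb X (inside S w) v) mem_clus //; exact: sw_inside.
have Kdet w w' : subc w (E nb X) -> subc w' (E nb X) ->
    res (Q (K w)) w = res (Q (K w)) w' -> K w' = K w.
  move=> sw sw' h; rewrite /K -!/(clus nb X (inside S _) v).
  apply: (clus_determined nbC vX (sw_inside _ sw) (sw_inside _ sw')).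
  apply/funext => e; have := congr1 (@^~ e) h; rewrite /res /Q /inside /res.
  rewrite -/(clus nb X (inside S w) v) -/(K w) /=.
  by case: (touch (mem (K w)) e); case: (touch _ e); rewrite ?andbT ?andbF.
pose Phi (A : seq V) (w : V * V -> bool) : R := (size A)%:R +
  \sum_(u <- A) \sum_(t <- nb u | (t \in X) && (t \notin S)) (w (edge u t))%:R * (csize nb X (off (mem A) w) t)%:R.
have offr (A : seq V) w : off (mem A) (res (predC (Q A)) w) = off (mem A) w.
  apply/funext => e; rewrite /off /res /Q /=.
  by case: (touch (mem A) e); rewrite ?andbF ?andbT.
apply: (@le_trans _ _ (EE p (E nb X) (fun w => Phi (K w) (res (predC (Q (K w))) w)))).
  apply: EE_le => // w hw; rewrite /Phi offr csizeE natr_sum.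
  apply: le_trans (_ : \sum_(y <- X) ((y \in K w)%:R + \sum_(u <- K w) \sum_(t <- nb u | (t \in X) && (t \notin S))
     (res (predC (Q (K w))) w (edge u t))%:R * (cn nb (off (mem (K w)) w) t y)%:R) <= _).
    apply: ler_sum => y _.
    have S0 : 0 <= \sum_(u <- K w) \sum_(t <- nb u | (t \in X) && (t \notin S))
      (res (predC (Q (K w))) w (edge u t))%:R * (cn nb (off (mem (K w)) w) t y)%:R :> R.
      by apply: sumr_ge0 => u _; apply: sumr_ge0 => t _; rewrite mulr_ge0.
    case: (boolP (cn nb _ v y)) => [hy|_]; last by rewrite addr_ge0.
    case: (last_exit nbC (vK w) hy) => [yK|[u [t [uK tK /andP[ut hut] hty]]]].
      by rewrite (_ : y \in K w) // lerDl.
    have uK' : u \in K w by [].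
    have tX : t \in X by move/hw: hut; rewrite edge_E // => /and3P[].
    have tS : t \notin S.
      apply: contra tK => tS; suff h : t \in K w by [].
      rewrite memK //; rewrite memK // in uK'; apply: cn_trans uK' _; apply: cn_edge.
      by rewrite /oadj ut inside_edge hut tS (KS w) // memK //.
    apply: ler_wpDl => //.
    apply: le_trans (le_sum_seq1 (F := fun u => \sum_(t <- nb u | (t \in X) && (t \notin S))
      (res (predC (Q (K w))) w (edge u t))%:R * (cn nb (off (mem (K w)) w) t y)%:R) _ uK'); last first.
      by move=> u'; apply: sumr_ge0 => t' _; rewrite mulr_ge0.
    rewrite big_mkcond /=.
    apply: le_trans (le_sum_seq1 (F := fun t => if (t \in X) && (t \notin S) then
      (res (predC (Q (K w))) w (edge u t))%:R * (cn nb (off (mem (K w)) w) t y)%:R else 0) _ ut); last first.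
      by move=> t'; case: ifP => // _; rewrite mulr_ge0.
    by rewrite tX tS hty /res hut /= /Q !touch_edge tS orbT andbF mulr1.
  rewrite big_split /=; apply: lerD.
    by rewrite -natr_sum ler_nat /K -/(clus nb X (inside S w) v); exact: sum_mem_clus.
  rewrite exchange_big; apply: ler_sum => u _; rewrite exchange_big; apply: ler_sum => t _ /=.
  by rewrite -mulr_sumr csizeE natr_sum.
rewrite (EE_explore p Phi Kdet).
pose c u : R := (count (fun t => t \notin S) (nb u))%:R.
apply: (@le_trans _ _ (EE p (E nb X) (fun w => (size S)%:R + \sum_(u <- X) (u \in K w)%:R * (c u * (p * M))))).
  apply: EE_le => // w hw; rewrite /Phi EED EE_cst; apply: lerD.
    by rewrite ler_nat; apply: uniq_leq_size => //; exact: filter_uniq.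
  rewrite EE_sum {1}/K big_filter big_mkcond big_seq [leRHS]big_seq; apply: ler_sum => u uX'.
  rewrite mem_filter uX' andbT; case: ifP => hu; last by rewrite mul0r.
  rewrite mul1r EE_sum; apply: le_trans (_ : \sum_(t <- nb u | (t \in X) && (t \notin S)) p * M <= _).
    apply: ler_sum => t /andP[tX tS].
    have uK : mem (K w) u by rewrite /= mem_filter hu.
    apply: le_trans (_ : EE p (E nb X) (fun w' => (w' (edge u t))%:R *
        (csize nb X (off (mem (K w)) w') t)%:R) <= _).
      apply: EE_le => // w' _; rewrite offr ler_wpM2r // ler_nat.
      by rewrite /res; case: (w' _); rewrite // leq_b1.
    apply: le_trans (fresh_edge1 (A := mem (K w)) t hp (E_uniq nbU uX) uK (incr_csizeR X t)
      (fun _ => ler0n _ _)) _.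
    by rewrite ler_wpM2l //; exact: hM.
  rewrite /c sum_count mulr_suml big_mkcond; apply: ler_sum => t _.
  case: (t \in S); rewrite ?andbF ?mul0r //= andbT mul1r; case: ifP => // _.
  by rewrite mulr_ge0.
rewrite EED EE_cst lerD2l EE_sum /phi.
apply: (@le_trans _ _ (\sum_(u <- X) (u \in S)%:R * (EX nb p S (fun w => (cn nb w v u)%:R) * c u * (p * M)))).
  apply: ler_sum => u _; case: (boolP (u \in S)) => [uS'|nuS]; last first.
    rewrite mul0r; apply: EE_le_cst => // w _.
    case: (boolP (u \in K w)) => [/KS uS'|_]; last by rewrite mul0r.
    by rewrite uS' in nuS.
  rewrite mul1r EEZr -mulrA; apply: ler_wpM2r; first by rewrite mulr_ge0 ?mulr_ge0.
  apply: le_trans (_ : EE p (E nb X) (fun w => (cn nb (inside S w) v u)%:R) <= _).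
    by apply: EE_le => // w _; rewrite ler_nat mem_filter; case: (cn nb _ v u) => //=; case: (_ \in _).
  rewrite (EE_filter p _ (fun e => ~~ touch (fun x => x \notin S) e) (fun w => (cn nb w v u)%:R)).
  apply: EE_es_mono => //; [exact/filter_uniq/E_uniq|exact: E_uniq| |exact: incr_cn].
  move=> e; rewrite mem_filter => /andP[he /E_edge[x [y [ee xy _ _]]]].
  move: he; rewrite ee touch_edge negb_or !negbK => /andP[hx hy].
  by rewrite edge_E // xy hx hy.
pose f u : R := EX nb p S (fun w => (cn nb w v u)%:R) * c u.
have f0 u : 0 <= f u by rewrite mulr_ge0 //; apply: EE_ge0.
apply: (@le_trans _ _ (\sum_(u <- [seq u <- X | u \in S]) f u * (p * M))).
  rewrite big_filter [leRHS]big_mkcond; apply: ler_sum => u _.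
  by rewrite /f; case: (u \in S); rewrite ?mul1r ?mul0r.
set T := \sum_(x <- S) _; rewrite -mulr_suml (_ : p * T * M = T * (p * M)); last by ring.
rewrite ler_wpM2r ?mulr_ge0 //.
apply: le_sum_subset => //; first exact: filter_uniq.
by move=> u; rewrite mem_filter => /andP[].
Qed.

End Subcritical.

Lemma seq_argmax (R : realType) (I : eqType) (r : seq I) (F : I -> R) i : i \in r ->
  exists2 j, j \in r & forall k, k \in r -> F k <= F j.
Proof.
elim: r i => [//|a r IH] i _; case: r IH => [|b r] IH.
  by exists a; rewrite ?mem_head // => k; rewrite inE => /eqP->.
have [j jr hj] := IH b (mem_head _ _); case: (leP (F j) (F a)) => h.
  exists a; first exact: mem_head.
  by move=> k; rewrite inE => /orP[/eqP->//|/hj hk]; exact: le_trans hk h.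
exists j; first by rewrite inE jr orbT.
by move=> k; rewrite inE => /orP[/eqP->|/hj//]; exact: ltW.
Qed.

(** * Sharpness and the lower bound for the susceptibility on transitive graphs *)

Section Transitive.
Context {R : realType} {V : countType}.
Variables (nb : V -> seq V) (d : nat) (o : V).
Hypothesis nbU : forall x, uniq (nb x).
Hypothesis nbI : forall x, x \notin nb x.
Hypothesis nbC : forall x y, adj nb x y = adj nb y x.
Hypothesis nbd : forall x, size (nb x) = d.
Hypothesis nbT : transitive_graph nb.
Implicit Types (X Y : seq V) (w : V * V -> bool) (x y z u t v : V) (i j k l n : nat) (p q : R).

Lemma csize_transport X v : uniq X -> v \in X ->
  exists Y, [/\ uniq Y, o \in Y & forall p (g : nat -> R),
    EX nb p X (fun w => g (csize nb X w v)) = EX nb p Y (fun w => g (csize nb Y w o))].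
Proof.
move=> uX vX; have [f [fa fv]] := nbT v o; have [fb _] := fa.
exists (map f X); split.
- by rewrite map_inj_uniq //; exact: bij_inj fb.
- by rewrite -fv; exact: map_f.
by move=> p g; rewrite -fv (EX_csize_image nbU nbI nbC fa).
Qed.

Lemma phi_transport (f : V -> V) p (S : seq V) v : automorphism nb f -> uniq S ->
  phi nb p (map f S) (f v) = phi nb p S v.
Proof.
move=> fa uS; have [fb fadj] := fa; have fi := bij_inj fb; have [f' fK f'K] := fb.
rewrite /phi big_map; congr (p * _); apply: eq_bigr => x _; congr (_ * _).
  by rewrite -(EX_image nbU nbI nbC fa p (fun c => (c v x)%:R)).
have hp : perm_eq (nb (f x)) (map f (nb x)).
  apply: uniq_perm => //; first by rewrite map_inj_uniq.
  move=> y; apply/idP/mapP => [hy|[z hz ->]].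
    exists (f' y); last by rewrite f'K.
    by rewrite -[_ \in _]/(adj nb x (f' y)) -fadj f'K.
  by rewrite -[_ \in _]/(adj nb (f x) (f z)) fadj.
rewrite (permP hp) count_map; congr (_%:R); apply: eq_count => y /=.
by rewrite mem_map.
Qed.

Lemma phi_mono p q (S : seq V) v : 0 <= p -> p <= q -> q <= 1 -> phi nb p S v <= phi nb q S v.
Proof.
move=> p0 pq q1; rewrite /phi; apply: ler_pM => //.
  by apply: sumr_ge0 => x _; rewrite mulr_ge0 //; apply: EE_ge0 => //; rewrite p0 (le_trans pq).
apply: ler_sum => x _; apply: ler_wpM2r => //; apply: EE_mono => //; exact: incr_cn.
Qed.

Lemma chi_le_of_origin p (B : R) :
  (forall X, uniq X -> o \in X -> EX nb p X (fun w => (csize nb X w o)%:R) <= B) -> chi_le nb p B.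
Proof.
move=> h X v uX vX; have [Y [uY oY hY]] := csize_transport uX vX.
by rewrite (hY p (fun k => k%:R)); exact: h.
Qed.

Lemma chi_ge1 p X v : 0 <= p <= 1 -> uniq X -> v \in X ->
  1 <= EX nb p X (fun w => (csize nb X w v)%:R).
Proof.
move=> hp uX vX; rewrite -[leLHS](EE_cst p (E nb X)); apply: EE_le => // w hw.
rewrite ler1n; case e: (csize nb X w v) => //.
by move/size0nil: e => e; have := mem_clus nbI nbC v hw vX; rewrite e cn_refl.
Qed.

(** Apply [exit_bound] at the vertex of [X] with the largest mean cluster size M, using a translate
    of [S]. Then M <= |S| + phi M, a bound that does not depend on [X]. *)
Lemma phi_lt1_chi p (S : seq V) : 0 <= p <= 1 -> uniq S -> o \in S -> phi nb p S o < 1 ->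
  exists B, chi_le nb p B.
Proof.
move=> hp uS oS hS; exists ((size S)%:R / (1 - phi nb p S o)) => X v uX vX.
have [u uX' hu] := seq_argmax (fun u => EX nb p X (fun w => (csize nb X w u)%:R)) vX.
apply: le_trans (hu v vX) _; set M := EX _ _ _ _ in hu *.
have M0 : 0 <= M by apply: EE_ge0.
have [f [fa fo]] := nbT o u.
have ufS : uniq (map f S) by rewrite map_inj_uniq //; case: fa => /bij_inj.
have ufS' : u \in map f S by rewrite -fo; exact: map_f.
have := exit_bound nbU nbI nbC hp uX uX' ufS ufS' M0 hu.
rewrite (_ : phi nb p (map f S) u = phi nb p S o); last by rewrite -fo phi_transport.
rewrite size_map -/M => h.
rewrite ler_pdivlMr ?subr_gt0 // mulrBr mulr1 lerBlDr.
by rewrite [M * _]mulrC.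
Qed.

(** If some [S] has phi < 1, the previous lemma applies. Otherwise phi >= 1 at all larger parameters
    as well, and [theta_growth] would give percolation strictly below p_c. *)
Lemma chi_finite_below p : 0 <= p -> p < p_c nb o -> p_c nb o <= (1 : R) -> exists B, chi_le nb p B.
Proof.
move=> p0 ppc pc1; have [[S [uS oS hS]]|hno] :=
    pselect (exists S : seq V, [/\ uniq S, o \in S & phi nb p S o < 1]).
  by apply: phi_lt1_chi uS oS hS; rewrite p0 ltW // (lt_le_trans ppc).
have hall (S : seq V) : uniq S -> o \in S -> 1 <= phi nb p S o.
  by move=> uS oS; rewrite leNgt; apply/negP => h; apply: hno; exists S.
pose b := (p + p_c nb o) / 2.
have pb : p < b by rewrite /b; lra.
have b1 : b <= 1 by rewrite /b; lra.
have bpc : b < p_c nb o by rewrite /b; lra.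
have c01 : 0 <= (1 : R) <= 1 by rewrite ler01 lexx.
have hb : 0 <= b <= 1 by rewrite b1 andbT; lra.
have th : 0 < theta nb o b.
  apply: lt_le_trans (theta_growth nbU nbI nbC p0 pb b1 c01 _).
    by rewrite mulr1 divr_gt0 // subr_gt0.
  move=> q S /andP[pq qb] uS oS; apply: le_trans (hall S uS oS) _.
  by apply: phi_mono => //; exact: le_trans qb b1.
have : p_c nb o <= b.
  apply: p_c_le => //; exact: lt_le_trans th (theta_le_Pinf o nbC hb).
by rewrite leNgt bpc.
Qed.

Local Notation ball := (Defs.ball nb o).

Lemma exit_size (X : seq V) w m n x v : subc w (E nb X) -> x \in X -> x \in ball m ->
  v \notin ball (m + n) -> cn nb w x v -> (n.+1 <= csize nb X w x)%N.
Proof.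
move=> hw xX xm vout xv; have [s [ps ls us]] := cn_simple xv.
have ext : forall s' x' k, x' \in ball k -> path (adj nb) x' s' -> last x' s' \in ball (k + size s').
  elim=> [|y s' IH] x' k hx' /=; first by rewrite addn0.
  move=> /andP[hxy ps']; rewrite addnS -addSn; apply: IH => //.
  by apply/ballS; right; exists x'.
have hsn : (n < size s)%N.
  rewrite ltnNge; apply/negP => hs; case/negP: vout; rewrite -ls.
  apply: (@ball_leq _ nb o (m + size s)); first by rewrite leq_add2l.
  by apply: ext => //; exact: path_oadj_adj ps.
apply: leq_trans (_ : size (x :: s) <= _)%N; first by rewrite /= ltnW.
apply: uniq_leq_size => // y hy; rewrite (mem_clus nbI nbC y hw xX).
exact: path_cn ps hy.
Qed.

(** A cluster going from the ball of radius m beyond radius m+n has more than n vertices; Markov's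
    inequality finishes. *)
Lemma Pinf_le0 q (B : R) : 0 <= q <= 1 -> chi_le nb q B -> Pinf nb o q <= 0.
Proof.
move=> hq hB; apply: ge_sup; first by eexists; exists 0%N.
move=> _ [m _ <-].
have B0 : 0 <= B.
  by apply: le_trans (hB [:: o] o isT (mem_head _ _)); apply: EE_ge0.
have bnd n : Pr nb o q (m + n).+1 (fun S => has (fun x => has (fun v => v \notin ball (m + n)) (cl S x)) (ball m))
    <= (size (ball m))%:R * (B / n.+1%:R).
  rewrite Pr_has_hit //; set X := ball (m + n).+1.
  have uX : uniq X by exact: ball_uniq.
  have sX x : x \in ball m -> x \in X by apply: ball_leq; rewrite leqW // leq_addr.
  apply: le_trans (_ : EX nb q X (fun w => \sum_(x <- ball m) (csize nb X w x)%:R / n.+1%:R) <= _).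
    apply: EE_le => // w hw; case: (boolP (has _ _)) => [/hasP[x xm /hitP[v [vout xv]]]|_]; last first.
      by apply: sumr_ge0 => x _; rewrite divr_ge0.
    apply: le_trans (le_sum_seq1 (F := fun x => (csize nb X w x)%:R / n.+1%:R) _ xm); last first.
      by move=> x'; rewrite divr_ge0.
    by rewrite ler_pdivlMr // mul1r ler_nat; exact: exit_size (hw) (sX x xm) xm vout xv.
  rewrite /EX EE_sum -sum_seq_cst big_seq [leRHS]big_seq; apply: ler_sum => x xm.
  by rewrite EEZr ler_wpM2r ?invr_ge0 //; apply: hB => //; exact: sX.
apply/ler_addgt0Pr => e e0; rewrite add0r.
have [n hn] := natr_archi ((size (ball m))%:R * B / e).
apply: le_trans (_ : Pr nb o q (m + n).+1 (fun S => has (fun x => has (fun v => v \notin ball (m + n)) (cl S x)) (ball m)) <= _).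
  apply: ge_inf; last by exists n.
  by exists 0 => _ [k _ <-]; rewrite Pr_has_hit //; apply: EE_ge0.
apply: le_trans (bnd n) _; rewrite mulrA ler_pdivrMr //.
rewrite ltr_pdivrMr // in hn.
have h2 : n%:R * e <= e * n.+1%:R by rewrite [leRHS]mulrC ler_wpM2r ?(ltW e0) // ler_nat.
exact: le_trans (ltW hn) h2.
Qed.

Lemma chi_le_mono p q (B : R) : 0 <= p -> p <= q -> q <= 1 -> chi_le nb q B -> chi_le nb p B.
Proof.
move=> p0 pq q1 h X v uX vX; apply: le_trans (h X v uX vX); apply: EE_mono => //.
exact: incr_csizeR.
Qed.

Lemma finite_chi_le_pc p (B : R) : (exists r : R, 0 <= r <= 1 /\ 0 < Pinf nb o r) ->
  0 <= p <= 1 -> chi_le nb p B -> p <= p_c nb o.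
Proof.
move=> [r0 hr0] /andP[p0 p1] hB; apply: p_c_ge; first by exists r0.
move=> q hq Pq; rewrite leNgt; apply/negP => qp; have /andP[q0 q1] := hq.
have := Pinf_le0 hq (chi_le_mono q0 (ltW qp) p1 hB).
by rewrite leNgt Pq.
Qed.

Hypothesis d0 : (0 < d)%N.

(** With q = 1/(11 d B) one has d q B = 1/11, so the largest mean M after sprinkling satisfies M <=
    B + M/11. *)
Lemma chi_sprinkle p (B : R) : 0 <= p <= 1 -> 1 <= B -> chi_le nb p B ->
  chi_le nb (p + (1 - p) * (11 * d%:R * B)^-1) (11 / 10 * B).
Proof.
move=> hp B1 hB X v uX vX; set q := (_)^-1.
have dR : 0 < d%:R :> R by rewrite ltr0n.
have d1 : 1 <= d%:R :> R by rewrite ler1n.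
have den : 1 <= 11 * d%:R * B by nra.
have hq : 0 <= q <= 1.
  by rewrite /q invr_ge0 invf_le1; [rewrite den andbT; lra|lra].
have [u uX' hu] := seq_argmax (fun u => EX nb (p + (1 - p) * q) X (fun w => (csize nb X w u)%:R)) vX.
apply: le_trans (hu v vX) _; set M := EX _ _ _ _ in hu *.
have hpq : 0 <= p + (1 - p) * q <= 1 by case/andP: hp => p0 p1; case/andP: hq => q0 q1; apply/andP; split; nra.
have M0 : 0 <= M by apply: EE_ge0.
have := sprinkle_size nbU nbI nbC nbd hp hq uX uX' M0 hu; rewrite -/M => h.
have h2 : M <= B * (1 + d%:R * q * M).
  by apply: le_trans h _; rewrite ler_wpM2r ?addr_ge0 ?mulr_ge0 ?(ltW dR) //;
    [case/andP: hq|exact: hB].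
have e1 : B * (d%:R * q) = 1 / 11.
  by rewrite /q; field; rewrite !gt_eqF //; lra.
have : M <= B + M / 11.
  by rewrite (_ : B + M / 11 = B * (1 + d%:R * q * M)) // mulrDr mulr1 mulrA e1; lra.
lra.
Qed.

(** Sprinkling of order 1/(dB) keeps the susceptibility finite, so p_c lies at least that far away.
    Since 1-p >= 4/10, the constant is 11/(4/10), rounded up to 28. *)
Lemma gamma_lower_bound p (B : R) : (exists r : R, 0 <= r <= 1 /\ 0 < Pinf nb o r) ->
  0 <= p <= 6 / 10 -> 1 <= B -> chi_le nb p B -> 1 / (28 * d%:R) <= B * (p_c nb o - p).
Proof.
move=> hr /andP[p0 p6] B1 hB; have hp : 0 <= p <= 1 by rewrite p0 /=; lra.
have h := chi_sprinkle hp B1 hB.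
have d1 : 1 <= d%:R :> R by rewrite ler1n.
have den : 1 <= 11 * d%:R * B by nra.
have q01 : 0 < (11 * d%:R * B)^-1 <= 1.
  by rewrite invr_gt0 invf_le1; [rewrite den andbT; lra|lra].
have /andP[q0 q1] := q01.
have hpq : 0 <= p + (1 - p) * (11 * d%:R * B)^-1 <= 1 by apply/andP; split; nra.
have := finite_chi_le_pc hr hpq h.
rewrite -lerBrDl => hh.
have : 1 / 28 / d%:R <= B * (p_c nb o - p).
  apply: le_trans (ler_wpM2l (_ : 0 <= B) hh); last by lra.
  rewrite (_ : B * ((1 - p) * (11 * d%:R * B)^-1) = (1 - p) / 11 / d%:R); last first.
    by field; rewrite !gt_eqF //; lra.
  by rewrite ler_pM2r ?invr_gt0 //; lra.
by apply: le_trans; rewrite le_eqVlt; apply/orP; left; apply/eqP; field; rewrite gt_eqF //; lra.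
Qed.

End Transitive.

                                       

(** * Sums over edges as sums over oriented pairs *)

Section OrientedPairs.
Context {R : realType} {V : countType}.
Variables (nb : V -> seq V).
Hypothesis nbU : forall x, uniq (nb x).
Hypothesis nbI : forall x, x \notin nb x.
Hypothesis nbC : forall x y, adj nb x y = adj nb y x.
Implicit Types (X Y : seq V) (w : V * V -> bool) (x y z u t v o : V).

Definition opairs X : seq (V * V) := [seq (x, y) | x <- X, y <- [seq y <- nb x | y \in X]].

Lemma opairs_uniq X : uniq X -> uniq (opairs X).
Proof.
move=> uX; apply: allpairs_uniq_dep => //; first by move=> x _; apply: filter_uniq.
by move=> [? ?] [? ?] _ _ [-> ->].
Qed.

Lemma mem_opairs X x y : ((x, y) \in opairs X) = [&& x \in X, y \in X & adj nb x y].
Proof.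
apply/allpairsPdep/idP => [[x' [y' [hx hy [-> ->]]]]|/and3P[h1 h2 h3]].
  by move: hy; rewrite mem_filter hx => /andP[-> hy]; rewrite /adj hy.
by exists x, y; rewrite mem_filter h2.
Qed.

Lemma sum_opairs X (F : V -> V -> R) :
  \sum_(xy <- opairs X) F xy.1 xy.2 = \sum_(x <- X) \sum_(y <- nb x | y \in X) F x y.
Proof. by rewrite big_allpairs_dep /=; apply: eq_bigr => x _; rewrite big_filter. Qed.

Lemma sum_E X (F : V -> V -> R) : uniq X ->
  \sum_(e <- E nb X) (F e.1 e.2 + F e.2 e.1) = \sum_(xy <- opairs X) F xy.1 xy.2.
Proof.
move=> uX; pose sw (e : V * V) := (e.2, e.1).
have uS : uniq (map sw (E nb X)).
  by rewrite map_inj_uniq ?E_uniq // => -[? ?] [? ?] [-> ->].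
rewrite big_split /= -(big_map sw xpredT (fun e => F e.1 e.2)) -big_cat /=.
apply: perm_big; apply: uniq_perm; last 1 first.
- move=> [x y]; rewrite mem_cat mem_opairs mem_E; apply/orP/and3P.
    case=> [/and4P[-> -> -> _]//|/mapP[[a b]]].
    by rewrite mem_E => /and4P[h1 h2 h3 _] [-> ->]; rewrite nbC.
  move=> [hx hy hxy]; case: (ltngtP (pickle x) (pickle y)) => h.
  - by left; rewrite hxy hx hy.
  - by right; apply/mapP; exists (y, x); rewrite // mem_E nbC hxy hx hy h.
  - have exy : x = y by exact: (pcan_inj pickleK h).
    by move: hxy; rewrite exy /adj (negbTE (nbI y)).
- rewrite cat_uniq E_uniq // uS andbT; apply/hasPn => -[x y] /mapP[[a b]].
  rewrite mem_E => /and4P[_ _ _ h] [-> ->]; apply/negP; rewrite mem_E => /and4P[_ _ _].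
  by rewrite ltnNge ltnW.
- exact: opairs_uniq.
Qed.

End OrientedPairs.

(** * Growth of the susceptibility and the upper bound for gamma *)

Section DifferentialInequality.
Context {R : realType} {V : countType}.
Variables (nb : V -> seq V) (d : nat).
Hypothesis nbU : forall x, uniq (nb x).
Hypothesis nbI : forall x, x \notin nb x.
Hypothesis nbC : forall x y, adj nb x y = adj nb y x.
Hypothesis nbd : forall x, size (nb x) = d.
Variable L : nat.
Hypothesis nbL : girth_ge nb L.
Hypothesis L0 : (0 < L)%N.
Implicit Types (X Y : seq V) (w : V * V -> bool) (x y z u t v o : V) (i j k l n : nat) (p q : R).

(** Sufficient for [x] to join the cluster of [o] when the edge [u v] is opened, and suited to
    exploration in two independent stages. *)
Definition new_pair w o u v x : bool := cn nb w o u && hitoff nb (cn nb w o) w (pred1 x) v.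

Lemma new_pair_gain w o u v x : adj nb u v -> new_pair (del (edge u v) w) o u v x ->
  ~~ cn nb (del (edge u v) w) o v /\
  (cn nb (addc (edge u v) w) o x && ~~ cn nb (del (edge u v) w) o x).
Proof.
move=> uv; set w' := del _ w => /andP[ou /andP[nv]]; rewrite hit_pred1 => hx.
split=> //; rewrite (cn_off_notin nv hx) andbT.
have le' : lec w' (addc (edge u v) w) by move=> e /andP[h _]; rewrite /addc h orbT.
apply: (cn_trans (cn_mono le' ou)); apply: (@cn_trans _ _ _ v).
  by apply: cn_edge; rewrite /oadj uv /addc eqxx.
by apply: cn_mono hx => e /off_le; exact: le'.
Qed.

Lemma pivotal_csize X w o u v : adj nb u v ->
  \sum_(x <- X) (new_pair (del (edge u v) w) o u v x)%:R +
  \sum_(x <- X) (new_pair (del (edge u v) w) o v u x)%:R <=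
  (csize nb X (addc (edge u v) w) o)%:R - (csize nb X (del (edge u v) w) o)%:R :> R.
Proof.
move=> uv; rewrite !csizeE !natr_sum -big_split -sumrB; apply: ler_sum => x _ /=.
have vu : adj nb v u by rewrite nbC.
have le' : lec (del (edge u v) w) (addc (edge u v) w) by move=> e /andP[h _]; rewrite /addc h orbT.
case: (boolP (new_pair _ o u v x)) => [h1|_].
  have [nv /andP[-> /negbTE->]] := new_pair_gain uv h1; rewrite subr0.
  case: (boolP (new_pair _ o v u x)) => [/andP[h2 _]|_]; last by rewrite addr0.
  by rewrite h2 in nv.
case: (boolP (new_pair _ o v u x)) => [h2|_].
  rewrite edgeC in h2 *.
  by have [_ /andP[-> /negbTE->]] := new_pair_gain vu h2; rewrite subr0 add0r.
by rewrite addr0 subr_ge0; exact: incr_cn.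
Qed.

(** After the cluster of [o] has been revealed, the arm from [v] lives on untouched edges, so it may
    be drawn from an independent configuration. *)
Lemma new_pair_indep p X es o u v x : {subset es <= E nb X} -> o \in X -> u \in X -> v \in X ->
  EE p es (fun w => (new_pair w o u v x)%:R) =
  EE p es (fun w => EE p es (fun w' =>
    (cn nb w o u && hitoff nb (cn nb w o) w' (pred1 x) v)%:R)).
Proof.
move=> ses oX uX vX.
have sub w : subc w es -> subc w (E nb X) by move=> h e /h /ses.
pose Phi (A : seq V) w : R := ((u \in A) && hitoff nb (mem A) w (pred1 x) v)%:R.
have off2 (A : V -> bool) w : off A (off A w) = off A w.
  by apply/funext => e; rewrite /off /res; case: (predC _ e); rewrite ?andbF ?andbT.
have hK w : subc w es -> forall y, (y \in clus nb X w o) = cn nb w o y.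
  by move=> /sub hw y; rewrite mem_clus.
have hKf w : subc w es -> (mem (clus nb X w o) : V -> bool) = cn nb w o.
  by move=> hw; apply/funext => y; rewrite -hK.
transitivity (EE p es (fun w => Phi (clus nb X w o) (off (mem (clus nb X w o)) w))).
  apply: EE_ext => w hw; rewrite /Phi /new_pair hK // /hitoff off2 hKf //.
rewrite (EE_explore p (K := fun w => clus nb X w o) (Q := fun A => touch (mem A)) Phi); last first.
  by move=> w w' /sub sw /sub sw'; exact: clus_determined.
apply: EE_ext => w hw; apply: EE_ext => w' _.
by rewrite /Phi hK // /hitoff -/(off _ w') off2 hKf.
Qed.

Variables (pm eta : R).
Hypothesis pm0 : 0 < pm.
Hypothesis loops : forall K z,
  \sum_(n < K | (L <= n)%N) (n ^ 2)%:R * pm ^+ n * nbc nb None n z z <= eta.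

Section Volume.
Variables (p B : R) (X : seq V) (o : V).
Hypothesis hp : 0 <= p <= 1.
Hypothesis ppm : p <= pm.
Hypothesis hB : chi_le nb p B.
Hypothesis uX : uniq X.
Hypothesis oX : o \in X.

Let es u v : seq (V * V) := [seq e <- E nb X | e != edge u v].
Let ues u v : uniq (es u v). Proof. exact/filter_uniq/E_uniq. Qed.
Let ses u v : {subset es u v <= E nb X}. Proof. by move=> f; rewrite mem_filter => /andP[]. Qed.
Let nes u v : edge u v \notin es u v. Proof. by rewrite mem_filter eqxx. Qed.
Let a u v : R := EE p (es u v) (fun w => (cn nb w o u)%:R).
Let chi_off u v : R := \sum_(x <- X) EE p (es u v) (fun w => (cn nb w v x)%:R).
Let corr u v : R := \sum_(x <- X) EE p (es u v) (fun w => EE p (es u v) (fun w' =>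
    (cn nb w o u && hit nb w' (pred1 x) v && ~~ hitoff nb (cn nb w o) w' (pred1 x) v)%:R)).
Let B0 : 0 <= B. Proof. by apply: le_trans (hB uX oX); apply: EE_ge0. Qed.

(** [cycle_expect] with the sum over target vertices [x] as functional; one factor [B] bounds the
    arm beyond the collision, the other the connections from [o] to base points. *)
Lemma corr_total : \sum_(uv <- opairs nb X) corr uv.1 uv.2 <= B ^+ 2 * (eta / pm).
Proof.
pose t y := EX nb p X (fun w => (cn nb w o y)%:R).
have t0 y : 0 <= t y by apply: EE_ge0.
have eta0 : 0 <= eta.
  by have := loops 0%N o; rewrite big_ord0.
have tB : \sum_(y <- X) t y <= B by rewrite -EX_csizeE //; exact: hB.
apply: le_trans (_ : B * (eta / pm) * \sum_(y <- X) t y <= _); last first.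
  rewrite (_ : B ^+ 2 * (eta / pm) = B * (eta / pm) * B); last by ring.
  by rewrite ler_wpM2l // mulr_ge0 // divr_ge0 // ltW.
apply: le_trans (cyc_sum_total L0 hp (opairs_uniq nbU uX) pm0 ppm t0 B0 (loops _)).
rewrite big_seq [leRHS]big_seq; apply: ler_sum => -[u v].
rewrite mem_opairs // => /and3P[hu hv uv] /=.
have hm z : \sum_(x <- X) EE p (es u v) (fun w' => (hit nb w' (pred1 x) z)%:R) <= B.
  rewrite (eq_bigr (fun x => EE p (es u v) (fun w => (cn nb w z x)%:R))); last first.
    by move=> x _; apply: EE_ext => w _; rewrite hit_pred1.
  rewrite -EE_sum; case: (boolP (z \in X)) => zX.
    apply: le_trans (hB uX zX).
    under EE_ext => w _ do rewrite -natr_sum -csizeE.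
    by apply: EE_es_mono => //; [exact: E_uniq|exact: incr_csizeR].
  apply: EE_le_cst => // w hw; rewrite big_seq big1 // => x xX.
  case: (boolP (cn nb w z x)) => // h; case/negP: zX.
  have sw : subc w (E nb X) by move=> e /hw; exact: ses.
  exact: (cn_in_sym nbI nbC sw xX h).
have := cycle_expect nbI nbC nbL hp (poslin_sum R X) (ues u v) (ues u v) (@ses u v) (@ses u v) oX hv uv
   (nes u v) (nes u v) (W := fun=> 1) (fun _ _ _ => lexx _) (fun=> ler01) B0 hm.
rewrite /= => hce; apply: le_trans (le_trans hce _).
  apply: ler_sum => x _; apply: EE_le => // w _; apply: EE_le => // w' _.
  by rewrite mulr1.
rewrite /cyc_sum; apply: ler_sum => z _; apply: ler_sum => l _; apply: ler_sum => ij _.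
rewrite ler_wpM2l // ler_wpM2l ?exprn_ge0 //; first by case/andP: hp.
rewrite ler_wpM2l // /t.
apply: le_trans (_ : EE p (es u v) (fun w => (cn nb w o z)%:R) <= _).
  by apply: EE_le => // w _; rewrite mulr1.
by apply: EE_es_mono => //; [exact: E_uniq|exact: incr_cn].
Qed.

Lemma chi_off_ge u v : adj nb u v -> u \in X -> v \in X ->
  EX nb p X (fun w => (csize nb X w v)%:R) - p * B <= chi_off u v.
Proof.
move=> uv uX' vX; rewrite lerBlDr /chi_off EX_csizeE //.
have vu : adj nb v u by rewrite nbC.
have offE z x : EE p (es u v) (fun w => (cn nb w z x)%:R) =
    EX nb p X (fun w => (cn nb (del (edge u v) w) z x)%:R).
  by rewrite /EX (EE_filter p _ (predC1 (edge u v)) (fun w => (cn nb w z x)%:R)).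
apply: le_trans (_ : \sum_(x <- X) (EE p (es u v) (fun w => (cn nb w v x)%:R) +
    p * EX nb p X (fun w => (cn nb (del (edge u v) w) u x)%:R)) <= _).
  apply: ler_sum => x _.
  have u1 : uniq [:: edge u v] by [].
  have delE w : res [predC [:: edge u v]] w = del (edge u v) w.
    by congr res; apply/funext => e; rewrite /= inE.
  have h := EE_open hp (E_uniq nbU uX) u1 (g := fun w => (cn nb w u x)%:R) (fun w => ler0n _ _).
  apply: le_trans (_ : EX nb p X (fun w => (cn nb (del (edge u v) w) v x)%:R) +
     EX nb p X (fun w => (all w [:: edge u v])%:R * (cn nb (res [predC [:: edge u v]] w) u x)%:R) <= _).
    rewrite /EX -EED; apply: EE_le => // w _; rewrite delE /= andbT.
    rewrite (cn_sym nbC w v x) (cn_del nbC w x vu) (edgeC v u) !(cn_sym nbC _ x).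
    rewrite -natrM -natrD ler_nat.
    by case: (cn nb _ v x); case: (w _); case: (cn nb _ u x).
  rewrite offE lerD2l; apply: le_trans h _; rewrite expr1 /EX.
  by under EE_ext => w _ do rewrite delE.
rewrite big_split /= lerD2l -mulr_sumr ler_wpM2l //; first by case/andP: hp.
apply: le_trans (hB uX uX'); rewrite EX_csizeE //; apply: ler_sum => x _.
by apply: EE_le => // w _; apply: incr_cn => e /andP[].
Qed.

Lemma pair_lower u v : adj nb u v -> u \in X -> v \in X ->
  a u v * chi_off u v - corr u v <=
  \sum_(x <- X) EE p (es u v) (fun w => (new_pair w o u v x)%:R).
Proof.
move=> uv uX' vX; rewrite /chi_off /corr mulr_sumr -sumrB; apply: ler_sum => x _.
rewrite (new_pair_indep p x (@ses u v) oX uX' vX) // -EEZr lerBlDr -EED; apply: EE_le => // w _.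
rewrite -EEZ -EED; apply: EE_le => // w' _; rewrite hit_pred1 // -natrM mulnb -natrD ler_nat.
by case: (cn nb w o u); case: (cn nb w' v x); case: (hitoff _ _ _ _ _).
Qed.

(** At most one edge at [u] has the property that deleting it separates [u] from [o]. *)
Lemma exits_ge u : u \in X -> {subset nb u <= X} ->
  (d%:R - 1) * EX nb p X (fun w => (cn nb w o u)%:R) <= \sum_(v <- nb u) a u v.
Proof.
move=> uX' nX.
have -> : \sum_(v <- nb u) a u v =
    EX nb p X (fun w => \sum_(v <- nb u) (cn nb (del (edge u v) w) o u)%:R).
  rewrite /EX EE_sum; apply: eq_bigr => v _.
  by rewrite (EE_filter p _ (predC1 (edge u v)) (fun w => (cn nb w o u)%:R)).
rewrite -EEZ; apply: EE_le => // w _.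
case: (boolP (cn nb w o u)) => [ou|_]; last by rewrite mulr0; apply: sumr_ge0.
rewrite mulr1 lerBlDr; pose G v := ~~ cn nb (del (edge u v) w) o u.
have -> : d%:R = \sum_(v <- nb u) ((cn nb (del (edge u v) w) o u)%:R + (G v)%:R) :> R.
  rewrite (eq_bigr (fun=> 1)); first by rewrite sum_seq_cst nbd mulr1.
  by move=> v _; rewrite /G; case: (cn nb _ o u); rewrite ?addr0 ?add0r.
rewrite big_split /= lerD2l.
case: (boolP (has G (nb u))) => [/hasP[v0 hv0 G0]|/hasPn hG]; last first.
  by rewrite big_seq big1 // => v /hG /negbTE ->.
apply: le_trans (_ : \sum_(v <- nb u) (v0 == v)%:R * 1 <= _); last first.
  by rewrite sum_delta // mulr1 lern1 leq_b1.
rewrite big_seq [leRHS]big_seq; apply: ler_sum => v hv; rewrite mulr1 ler_nat.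
case: (boolP (G v)) => // Gv; rewrite lt0b; apply/eqP.
have vu : adj nb v u by rewrite nbC.
have v0u : adj nb v0 u by rewrite nbC.
move: ou; rewrite (cn_del nbC w o (hv0 : adj nb u v0)) (negbTE G0) /= => /andP[w0 c0].
by apply: (entrance_unique nbI v0u vu (w := w) (o := o)); rewrite 1?(edgeC _ u).
Qed.

(** The tree computation with errors. Each vertex of the cluster of [o] has d-1 edges beyond which
    an independent cluster can be attached; its mean size is at least A - pB, where pB pays for
    deleting the edge, and collisions cost B^2 eta/pm. The vertices [u] range over the smaller
    volume [Y] so that all their neighbours lie in [X]. *)
Lemma an_volume (Y : seq V) (A : R) : uniq Y -> {subset Y <= X} ->
  (forall u, u \in Y -> {subset nb u <= X}) ->
  (forall u v, u \in Y -> v \in nb u -> A <= EX nb p X (fun w => (csize nb X w v)%:R)) ->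
  A <= \sum_(u <- Y) EX nb p X (fun w => (cn nb w o u)%:R) -> p * B <= A -> (0 < d)%N ->
  (d%:R - 1) * A * (A - p * B) - B ^+ 2 * (eta / pm) <=
  \sum_(e <- E nb X) EX nb p X (fun w => (csize nb X (addc e w) o)%:R - (csize nb X (res (predC1 e) w) o)%:R).
Proof.
move=> uY sYX nYX hA hY pBA d0.
pose F u v : R := \sum_(x <- X) EE p (es u v) (fun w => (new_pair w o u v x)%:R).
have F0 u v : 0 <= F u v by apply: sumr_ge0 => x _; apply: EE_ge0.
have a0 u v : 0 <= a u v by apply: EE_ge0.
have d1 : 0 <= d%:R - 1 :> R by rewrite subr_ge0 ler1n.
apply: (@le_trans _ _ (\sum_(xy <- opairs nb X) F xy.1 xy.2)); last first.
  rewrite -sum_E // big_seq [leRHS]big_seq; apply: ler_sum => -[x y].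
  rewrite mem_E => /and4P[xy _ _ lt] /=.
  have ee : (x, y) = edge x y by rewrite /edge lt.
  have hF u v : \sum_(z <- X) EE p (es x y) (fun w => (new_pair w o u v z)%:R) =
     EX nb p X (fun w => \sum_(z <- X) (new_pair (del (edge x y) w) o u v z)%:R).
    rewrite -EE_sum; symmetry.
    exact: (EE_filter p (E nb X) (predC1 (edge x y)) (fun w => \sum_(z <- X) (new_pair w o u v z)%:R)).
  rewrite ee /F (_ : es y x = es x y); last by rewrite /es edgeC.
  rewrite !hF -EED.
  by apply: EE_le => // w _; exact: pivotal_csize.
pose Fm u v : R := a u v * (A - p * B).
apply: (@le_trans _ _ (\sum_(u <- Y) \sum_(v <- nb u) Fm u v - \sum_(uv <- opairs nb X) corr uv.1 uv.2)).
  apply: lerB; last exact: corr_total.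
  apply: le_trans (_ : \sum_(u <- Y) (d%:R - 1) * EX nb p X (fun w => (cn nb w o u)%:R) * (A - p * B) <= _).
    rewrite -mulr_suml -mulr_sumr ler_wpM2r ?subr_ge0 // ler_wpM2l //.
  rewrite big_seq [leRHS]big_seq; apply: ler_sum => u uY'; rewrite /Fm -mulr_suml.
  by rewrite ler_wpM2r ?subr_ge0 //; apply: exits_ge => //; [exact: sYX|exact: nYX].
rewrite lerBlDr -big_split /= (sum_opairs nb X (fun u v => F u v + corr u v)).
apply: le_trans (_ : \sum_(u <- [seq u <- X | u \in Y]) \sum_(v <- nb u | v \in X) Fm u v <= _).
  rewrite le_eqVlt; apply/orP; left; apply/eqP.
  have hp' : perm_eq Y [seq u <- X | u \in Y].
    apply: uniq_perm => //; first exact: filter_uniq.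
    by move=> u; rewrite mem_filter andbC; case: (boolP (u \in Y)) => [/sYX->|]; rewrite ?andbF.
  rewrite (perm_big _ hp') /= big_seq [RHS]big_seq; apply: eq_bigr => u.
  rewrite mem_filter => /andP[/nYX hu _]; rewrite big_seq [RHS]big_seq_cond.
  by apply: eq_bigl => v; case: (boolP (v \in nb u)) => // /hu ->.
have corr0 u v : 0 <= corr u v.
  by apply: sumr_ge0 => x _; apply: EE_ge0 => // w _; apply: EE_ge0.
rewrite big_filter big_mkcond big_seq [leRHS]big_seq; apply: ler_sum => u uX'.
case: ifP => [uY'|_]; last by apply: sumr_ge0 => v _; rewrite addr_ge0.
rewrite big_seq_cond [leRHS]big_seq_cond; apply: ler_sum => v /andP[uv vX].
rewrite -lerBlDr; apply: le_trans (pair_lower uv uX' vX); rewrite lerB // ler_wpM2l //.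
by apply: le_trans (chi_off_ge uv uX' vX); rewrite lerB //; exact: hA uv.
Qed.

End Volume.

Hypothesis nbT : transitive_graph nb.

(** Add to [Y] a translate of it rooted at each of its neighbours; monotonicity in the volume gives
    the comparison there. *)
Lemma transitive_hull o (Y : seq V) : uniq Y -> o \in Y -> exists X, [/\ uniq X, {subset Y <= X},
  forall u, u \in Y -> {subset nb u <= X} &
  forall p (g : nat -> R) u v, 0 <= p <= 1 -> {homo g : m n / (m <= n)%N >-> m <= n} ->
    u \in Y -> v \in nb u ->
    EX nb p Y (fun w => g (csize nb Y w o)) <= EX nb p X (fun w => g (csize nb X w v))].
Proof.
move=> uY oY; have [F hF] := choice (nbT o).
pose X := undup (Y ++ flatten [seq map (F v) Y | v <- flatten (map nb Y)]).
have sT u v : u \in Y -> v \in nb u -> {subset map (F v) Y <= X}.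
  move=> hu hv x hx; rewrite mem_undup mem_cat; apply/orP; right; apply/flattenP.
  exists (map (F v) Y) => //; apply/mapP; exists v => //; apply/flattenP.
  by exists (nb u) => //; exact: map_f.
have vT v : v \in map (F v) Y by rewrite -{1}(hF v).2 map_f.
exists X; split=> //; first exact: undup_uniq.
- by move=> x hx; rewrite mem_undup mem_cat hx.
- by move=> u hu v hv; apply: (sT u) (vT v).
move=> p g u v hp hg hu hv; have [fa fv] := hF v; have [fb _] := fa.
rewrite -(EX_csize_image nbU nbI nbC fa p g o uY) fv; apply: EX_csize_mono => //.
- by rewrite map_inj_uniq //; exact: bij_inj fb.
- exact: undup_uniq.
- exact: sT hu hv.
Qed.

Lemma an_step o p0 p1 (A B : R) (Y : seq V) : 0 <= p0 -> p0 < p1 -> p1 <= pm -> p1 <= 1 ->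
  chi_le nb p1 B -> uniq Y -> o \in Y -> A <= EX nb p0 Y (fun w => (csize nb Y w o)%:R) ->
  p1 * B <= A -> (0 < d)%N ->
  A + (p1 - p0) * ((d%:R - 1) * A * (A - p1 * B) - B ^+ 2 * (eta / pm)) <= B.
Proof.
move=> h0 h01 h1m h1 hB uY oY hA pBA d0.
have [X [uX sYX nYX hX]] := transitive_hull uY oY.
have oX := sYX _ oY.
have [c /andP[c0 c1] hc] := russo_mvt (fun w => (csize nb X w o)%:R : R) h01 (E_uniq nbU uX).
have hcp : 0 <= c <= 1 by lra.
have cB : chi_le nb c B by apply: chi_le_mono hB; lra.
have B0 : 0 <= B by apply: le_trans (hB _ _ uX oX); apply: EE_ge0 => //; lra.
have A0 : 0 <= A by apply: le_trans pBA; rewrite mulr_ge0 //; lra.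
have hAc : A <= EX nb c Y (fun w => (csize nb Y w o)%:R).
  by apply: le_trans hA _; apply: EE_mono; [lra|lra|lra|exact: incr_csizeR].
have cBA : c * B <= A by apply: le_trans pBA; rewrite ler_wpM2r // ltW.
have cpm : c <= pm by lra.
have h : (d%:R - 1) * A * (A - c * B) - B ^+ 2 * (eta / pm) <=
    (EE p1 (E nb X) (fun w => (csize nb X w o)%:R) - EE p0 (E nb X) (fun w => (csize nb X w o)%:R)) / (p1 - p0).
  rewrite hc [leRHS]mulrAC mulfV ?mul1r; last by rewrite subr_eq0 gt_eqF.
  apply: (an_volume hcp cpm cB uX oX uY sYX nYX _ _ cBA d0) => [u v hu hv|].
    apply: le_trans hAc _; apply: (hX c (fun k => k%:R) u v) => // m n mn.
    by rewrite ler_nat.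
  apply: le_trans hAc _; rewrite EX_csizeE //; apply: ler_sum => u _.
  by apply: EX_mono_vol => //; exact: incr_cn.
rewrite ler_pdivlMr ?subr_gt0 // mulrC in h.
have hX1 : EE p1 (E nb X) (fun w => (csize nb X w o)%:R) <= B by exact: hB.
have hX0 : A <= EE p0 (E nb X) (fun w => (csize nb X w o)%:R).
  apply: le_trans hA _; apply: (EX_csize_mono nbU nbI nbC (phi := fun k => k%:R)) => //; first lra.
  by move=> m n mn; rewrite ler_nat.
have d1 : 0 <= d%:R - 1 :> R by rewrite subr_ge0 ler1n.
have hAB : (d%:R - 1) * A * (A - p1 * B) <= (d%:R - 1) * A * (A - c * B).
  by apply: ler_wpM2l; [exact: mulr_ge0|rewrite lerB // ler_wpM2r // ltW].
have hm := ler_wpM2l (_ : 0 <= p1 - p0) (lerB hAB (lexx (B ^+ 2 * (eta / pm)))).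
have {}hm := hm (ltW (_ : 0 < p1 - p0)); rewrite subr_gt0 in hm; have {}hm := hm h01.
lra.
Qed.

(** The susceptibility as a supremum over all finite volumes, a genuine supremum as soon as some
    bound [chi_le] is known. *)
Definition chiR o p : R := sup [set x | exists X : seq V, [/\ uniq X, o \in X &
  x = EX nb p X (fun w => (csize nb X w o)%:R)]].

Section FiniteChi.
Variables (o : V) (p B0 : R).
Hypothesis hp : 0 <= p <= 1.
Hypothesis hB0 : chi_le nb p B0.

Let hs : has_sup [set x | exists X : seq V, [/\ uniq X, o \in X &
  x = EX nb p X (fun w => (csize nb X w o)%:R)]].
Proof.
split; first by exists (EX nb p [:: o] (fun w => (csize nb [:: o] w o)%:R)); exists [:: o]; rewrite mem_head.
by exists B0 => _ [X [uX oX ->]]; exact: hB0.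
Qed.

Lemma chi_le_chiR : chi_le nb p (chiR o p).
Proof.
apply: (chi_le_of_origin nbU nbI nbC (o := o) nbT) => X uX oX; apply: sup_upper_bound hs _ _.
by exists X.
Qed.

Lemma chiR_le (B : R) : chi_le nb p B -> chiR o p <= B.
Proof.
by move=> h; apply: ge_sup; [case: hs|move=> _ [X [uX oX ->]]; exact: h].
Qed.

Lemma chiR_ge1 : 1 <= chiR o p.
Proof.
apply: le_trans (chi_le_chiR (X := [:: o]) isT (mem_head _ _)).
by apply: chi_ge1 => //; rewrite mem_head.
Qed.

Lemma chiR_adherent (e : R) : 0 < e -> exists Y : seq V, [/\ uniq Y, o \in Y &
  chiR o p - e <= EX nb p Y (fun w => (csize nb Y w o)%:R)].
Proof.
move=> e0; have [_ [X [uX oX ->]] h] := sup_adherent e0 hs.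
by exists X; split=> //; exact: ltW.
Qed.

End FiniteChi.

Hypothesis d0 : (0 < d)%N.

Lemma an_chi o p0 p1 B1 : 0 <= p0 -> p0 < p1 -> p1 <= pm -> p1 <= 1 -> chi_le nb p1 B1 ->
  p1 * chiR o p1 < chiR o p0 ->
  chiR o p0 + (p1 - p0) * ((d%:R - 1) * chiR o p0 * (chiR o p0 - p1 * chiR o p1) -
     chiR o p1 ^+ 2 * (eta / pm)) <= chiR o p1.
Proof.
move=> h0 h01 h1m h1 hB1; set F0 := chiR o p0; set F1 := chiR o p1 => hF.
have hp1 : 0 <= p1 <= 1 by lra.
have hp0 : 0 <= p0 <= 1 by lra.
have hB0 : chi_le nb p0 B1 by apply: chi_le_mono hB1; lra.
have F01 : 1 <= F0 by exact: chiR_ge1 hB0.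
have d1 : 0 <= d%:R - 1 :> R by rewrite subr_ge0 ler1n.
pose D : R := d%:R - 1.
apply/ler_addgt0Pr => e e0.
pose K := 1 + (p1 - p0) * (D * (2 * F0)).
have K1 : 1 <= K by rewrite /K lerDl !mulr_ge0 //; lra.
pose t := Num.min (e / K) (F0 - p1 * F1).
have t0 : 0 < t by rewrite /t lt_min divr_gt0 ?subr_gt0 //; lra.
have tK : t * K <= e.
  have : t <= e / K by rewrite /t ge_min lexx.
  by rewrite ler_pdivlMr //; lra.
have tF : t <= F0 - p1 * F1 by rewrite /t ge_min lexx orbT.
have [Y [uY oY hY]] := chiR_adherent o hB0 t0.
have F1le := chi_le_chiR o hB1.
have tF' : p1 * F1 <= F0 - t by lra.
have := an_step h0 h01 h1m h1 F1le uY oY hY tF' d0.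
rewrite -/F0 -/F1 -/D => hs; set Q := F1 ^+ 2 * _ in hs *.
have pF : 0 <= p1 * F1.
  by rewrite mulr_ge0 //; [lra|apply: le_trans (chiR_ge1 o hp1 hB1); lra].
have hm : D * F0 * (F0 - p1 * F1) - t * (D * (2 * F0)) <= D * (F0 - t) * (F0 - t - p1 * F1).
  have -> : D * F0 * (F0 - p1 * F1) - t * (D * (2 * F0)) = D * (F0 * (F0 - p1 * F1) - t * (2 * F0)) by ring.
  rewrite -[leRHS]mulrA; apply: ler_wpM2l => //; nra.
have hm2 := ler_wpM2l (_ : 0 <= p1 - p0) (lerB hm (lexx Q)).
have {}hm2 := hm2 (ltac:(lra)).
have eK : t * K = t + (p1 - p0) * (t * (D * (2 * F0))) by rewrite /K; ring.
have e3 : (p1 - p0) * (D * F0 * (F0 - p1 * F1) - t * (D * (2 * F0)) - Q) =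
   (p1 - p0) * (D * F0 * (F0 - p1 * F1) - Q) - (p1 - p0) * (t * (D * (2 * F0))) by ring.
lra.
Qed.

Hypothesis pm6 : pm <= 6 / 10.
Hypothesis eta_small : eta <= 1 / 20.
Hypothesis d3 : (2 < d)%N.
Hypothesis pmd : 1 <= pm * (d%:R - 1).

(** With p1 <= 6/10 and F1 <= (11/10) F0, the factor F0 - p1 F1 is at least (34/100) F0. The cycle
    error is at most 1/20 of D F1^2 with D = d-1 >= 2, so F1 - F0 is at least (p1 - p0) (11/30)
    F0^2; dividing by F0 F1 leaves 1/3. *)
Lemma an_small_step o p0 p1 B1 : 0 <= p0 -> p0 < p1 -> p1 <= pm -> chi_le nb p1 B1 ->
  chiR o p1 <= 11 / 10 * chiR o p0 ->
  (p1 - p0) / 3 <= (chiR o p0)^-1 - (chiR o p1)^-1.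
Proof.
move=> h0 h01 h1m hB1 hr.
have [pm06 pmD pmp he] : [/\ pm <= 6 / 10, 1 <= pm * (d%:R - 1), 0 < pm & eta <= 1 / 20] by [].
have h1 : p1 <= 1 by lra.
have hp1 : 0 <= p1 <= 1 by lra.
have hp0 : 0 <= p0 <= 1 by lra.
have hB0 : chi_le nb p0 B1 by apply: chi_le_mono hB1; lra.
have F01 : 1 <= chiR o p0 by exact: chiR_ge1 hB0.
have F11 : 1 <= chiR o p1 by exact: chiR_ge1 hB1.
have d2 : 2 <= d%:R - 1 :> R by rewrite lerBrDr -(natrD _ 2 1) ler_nat.
set D : R := d%:R - 1 in d2 pmD.
set F0 := chiR o p0 in hr F01 *; set F1 := chiR o p1 in hr F11 *.
have p1F : p1 * F1 <= 6 / 10 * (11 / 10 * F0) by apply: ler_pM; lra.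
have hh : p1 * F1 < F0 by lra.
have := an_chi h0 h01 h1m h1 hB1 hh; rewrite -/F0 -/F1 -/D.
have eta0 : 0 <= eta by have := loops 0%N o; rewrite big_ord0.
have etapm : eta / pm <= D / 20.
  rewrite ler_pdivrMr //; nra.
have Q1 : F1 ^+ 2 * (eta / pm) <= (11 / 10 * F0) ^+ 2 * (D / 20).
  apply: ler_pM => //; rewrite ?exprn_ge0 ?divr_ge0 //; try lra.
  by apply: lerXn2r; rewrite ?nnegrE; lra.
have Q2 : D * F0 * (34 / 100 * F0) <= D * F0 * (F0 - p1 * F1).
  by apply: ler_wpM2l; [apply: mulr_ge0; lra|lra].
have Q3 : F0 ^+ 2 * (11 / 30) <= D * F0 * (34 / 100 * F0) - (11 / 10 * F0) ^+ 2 * (D / 20).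
  have -> : D * F0 * (34 / 100 * F0) - (11 / 10 * F0) ^+ 2 * (D / 20) =
     D * F0 ^+ 2 * (34 / 100 - 121 / 2000) by field.
  have := sqr_ge0 F0; nra.
set W := D * F0 * (F0 - p1 * F1) - _ => hW.
have hW2 : F0 ^+ 2 * (11 / 30) <= W by rewrite /W; lra.
have hW3 : (p1 - p0) * (F0 ^+ 2 * (11 / 30)) <= F1 - F0.
  apply: le_trans (_ : (p1 - p0) * W <= _); last by lra.
  by apply: ler_wpM2l => //; lra.
have -> : F0^-1 - F1^-1 = (F1 - F0) / (F0 * F1) by field; apply/andP; split; apply: lt0r_neq0; lra.
rewrite ler_pdivlMr; last by apply: mulr_gt0; lra.
apply: le_trans hW3; rewrite -mulrA ler_wpM2l //; first lra.
rewrite expr2; nra.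
Qed.

(** 1/chi decreases at rate at least 1/3: any interval below p_c is cut into steps so short that chi
    grows by a factor at most 11/10 in each, and [an_small_step] is summed. *)
Lemma gamma_upper_bound o : 0 <= (p_c nb o : R) -> p_c nb o <= pm -> forall p, 0 <= p -> p < p_c nb o ->
  chiR o p * (p_c nb o - p) <= 3.
Proof.
move=> pc0 pcm p p0 ppc.
have pm06 := pm6.
have pc1 : p_c nb o <= (1 : R) by lra.
have fin q : 0 <= q -> q < p_c nb o -> exists B, chi_le nb q B.
  by move=> q0 qpc; exact: (chi_finite_below nbU nbI nbC nbT q0 qpc pc1).
have step q : p < q -> q < p_c nb o -> (q - p) / 3 <= (chiR o p)^-1 - (chiR o q)^-1.
  move=> pq qpc; have q0 : 0 <= q by lra.
  have [Bq hBq] := fin q q0 qpc.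
  have hq : 0 <= q <= 1 by lra.
  have Fq1 := chiR_ge1 o hq hBq.
  set Fq := chiR o q in Fq1 *.
  have dR : 1 <= d%:R :> R by rewrite ler1n.
  (* 4/10 bounds 1 - r from below, so [chi_sprinkle] covers a step of length [s]. As [Fq] dominates
     the susceptibility up to [q], one length serves all steps. *)
  pose s : R := 4 / 10 * (11 * d%:R * Fq)^-1.
  have sp : 0 < s.
    by rewrite /s mulr_gt0 // invr_gt0; nra.
  have [n hn] := natr_archi ((q - p) / s).
  suff H m : forall r : R, 0 <= r -> r < q -> q - r <= m%:R * s -> (q - r) / 3 <= (chiR o r)^-1 - Fq^-1.
    by apply: (H n) => //; rewrite ltr_pdivrMr // in hn; exact: ltW.
  elim: m => [|m IH] r r0 rq; first by rewrite mul0r; lra.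
  move=> hr.
  have [Br hBr] : exists B, chi_le nb r B by apply: fin => //; lra.
  have hr1 : 0 <= r <= 1 by lra.
  have Fr1 := chiR_ge1 o hr1 hBr.
  have FrFq : chiR o r <= Fq.
    apply: (chiR_le o hBr); apply: chi_le_mono (chi_le_chiR o hBq); lra.
  set Fr := chiR o r in Fr1 FrFq *.
  pose r' := Num.min q (r + s).
  have r'q : r' <= q by rewrite /r' ge_min lexx.
  have rr' : r < r' by rewrite /r' lt_min rq /=; lra.
  have r's : r' <= r + s by rewrite /r' ge_min lexx orbT.
  have [Br' hBr'] : exists B, chi_le nb r' B by apply: fin; lra.
  have ratio : chiR o r' <= 11 / 10 * Fr.
    apply: (chiR_le o hBr').
    have hs := chi_sprinkle nbU nbI nbC nbd d0 hr1 Fr1 (chi_le_chiR o hBr).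
    have X0 : 0 < 11 * d%:R * Fr by nra.
    have X1 : 1 <= 11 * d%:R * Fr by nra.
    have inv01 : 0 < (11 * d%:R * Fr)^-1 <= 1.
      by rewrite invr_gt0 X0 invf_le1.
    have sle : s <= (1 - r) * (11 * d%:R * Fr)^-1.
      rewrite /s; apply: ler_pM; rewrite ?invr_ge0; try nra.
      rewrite lef_pV2 ?posrE //; nra.
    apply: chi_le_mono hs; [lra|lra|].
    case/andP: inv01 => i0 i1; nra.
  have st := an_small_step r0 rr' (_ : r' <= pm) hBr' ratio.
  have {}st := st (ltac:(lra)); rewrite -/Fr in st.
  have [e|ne] := eqVneq r' q; first by rewrite e -/Fq in st; lra.
  have r'q2 : r' < q by rewrite lt_neqAle ne.
  have e2 : r' = r + s.
    by move: ne; rewrite /r'; case: leP => // ?; rewrite eqxx.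
  have := IH r' _ r'q2 _.
  have -> : q - r' <= m%:R * s by rewrite -natr1 mulrDl mul1r in hr; lra.
  move=> /(_ (ltac:(lra)) isT); lra.
have [Bp hBp] := fin p p0 ppc.
have hp1 : 0 <= p <= 1 by lra.
have Fp1 := chiR_ge1 o hp1 hBp; set F := chiR o p in step Fp1 *.
rewrite leNgt; apply/negP => hgt.
have i3 : F^-1 < (p_c nb o - p) / 3.
  rewrite -[F^-1]mul1r ltr_pdivrMr; lra.
have Fi : 0 < F^-1 by rewrite invr_gt0; lra.
(* At this parameter, still below p_c, the decrease would leave no room for a positive 1/chi. *)
pose q := p + 3 * F^-1.
have q2 : q < p_c nb o by rewrite /q; lra.
have pq : p < q by rewrite /q; lra.
have [Bq hBq] := fin q (ltac:(lra)) q2.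
have hq : 0 <= q <= 1 by lra.
have Fq1 := chiR_ge1 o hq hBq.
have := step q pq q2; have : 0 < (chiR o q)^-1 by rewrite invr_gt0; lra.
rewrite /q; lra.
Qed.

End DifferentialInequality.

                                                 

(** * Green vertices: an independent random set of targets of density h *)

Section Ghosts.
Context {R : realType} {V : countType}.
Variables (nb : V -> seq V).
Hypothesis nbU : forall x, uniq (nb x).
Hypothesis nbI : forall x, x \notin nb x.
Hypothesis nbC : forall x y, adj nb x y = adj nb y x.
Implicit Types (X Y C : seq V) (w : V * V -> bool) (A B : V -> bool) (x y z u t v o : V) (p q h : R).

Lemma EE_none (T : eqType) p (es C : seq T) : 0 <= p <= 1 -> uniq es -> uniq C -> {subset C <= es} ->
  EE p es (fun g => (~~ has g C)%:R) = (1 - p) ^+ size C.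
Proof.
move=> hp ues; elim: C => [|c C IH] /=.
  by rewrite EE_cst expr0.
move=> /andP[cC uC] sC; have sC' : {subset C <= es} by move=> x hx; rewrite sC // inE hx orbT.
have u1 : uniq [:: c] by [].
have s1 : {subset [:: c] <= es} by move=> x; rewrite inE => /eqP->; rewrite sC // mem_head.
have r1 g : (~~ has (res [predC [:: c]] g) C)%:R = (~~ has g C)%:R :> R.
  congr (~~ _)%:R; apply: eq_in_has => x hx; rewrite /res /= inE.
  by case: eqVneq => [e|]; rewrite ?andbT //; rewrite -e hx in cC.
have := EE_open_eq (fun g => (~~ has g C)%:R) hp ues u1 s1; rewrite expr1.
under [X in _ = _ * X]EE_ext => g _ do rewrite r1.
under EE_ext => g _ do rewrite r1.
rewrite IH // => h; rewrite exprS mulrBl mul1r -h -(IH uC sC') -EEB; apply: EE_ext => g _.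
by rewrite /= andbT; case: (g c); case: (has g C); rewrite /= ?mul1r ?mul0r ?subrr ?subr0.
Qed.

Lemma hit_has X w B x : subc w (E nb X) -> x \in X -> hit nb w B x = has B (clus nb X w x).
Proof.
move=> hw xX; apply/hitP/hasP => [[y [By hy]]|[y hy By]]; exists y => //.
  by rewrite mem_clus.
by split=> //; rewrite -(mem_clus nbI nbC y hw xX).
Qed.

Lemma hitoff_outside A w B v : hitoff nb A w (res (predC A) B) v = hitoff nb A w B v.
Proof.
rewrite /hitoff; case: (boolP (A v)) => //= nv; apply/hitP/hitP => -[y [By hy]]; exists y; split=> //.
  by case/andP: By.
by rewrite /res By /=; exact: cn_off_notin hy.
Qed.

Lemma hit_inside w B v : hit nb w (res (cn nb w v) B) v = hit nb w B v.
Proof.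
by apply/hitP/hitP => -[y [By hy]]; exists y; split=> //; [case/andP: By|rewrite /res By hy].
Qed.

Lemma hitoff_inside A w B v : hitoff nb A w (res (cn nb (off A w) v) B) v = hitoff nb A w B v.
Proof. by rewrite /hitoff hit_inside. Qed.

Lemma off_off A w : off A (off A w) = off A w.
Proof. by apply/funext => e; rewrite /off /res -andbA andbb. Qed.

Lemma offU A (C : V -> bool) w : off (fun x => A x || C x) w = off C (off A w).
Proof.
apply/funext => e; rewrite /off /res /touch /= -andbA; congr (_ && _).
by rewrite !negb_or; case: (A e.1); case: (A e.2); case: (C e.1); case: (C e.2).
Qed.

Section Factor.
Variables (p h : R) (X : seq V) (es : seq (V * V)) (o z v1 v2 : V).
Hypothesis hh : 0 <= h <= 1.
Hypothesis uX : uniq X.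
Hypothesis ses : {subset es <= E nb X}.
Hypothesis oX : o \in X.
Hypothesis v1X : v1 \in X.

Local Notation EG := (EE h X).

Definition arms A w : V -> bool := fun x => A x || cn nb (off A w) v1 x.

(** The event [branch] once the two fork edges have been taken out of the configuration. *)
Definition three_way w (g : V -> bool) : bool :=
  [&& cn nb w o z, ~~ hit nb w g o, hitoff nb (cn nb w o) w g v1 &
      hitoff nb (arms (cn nb w o) w) w g v2].

(** For fixed edges the requirements concern green vertices in three disjoint sets: the cluster of
    [o], the arm of [v1] outside it, and the arm of [v2] outside both. *)
Lemma ghost_factor A w : subc w (E nb X) -> A = cn nb w o ->
  EG (fun g => (three_way w g)%:R) =
  (cn nb w o z)%:R * (1 - h) ^+ csize nb X w o *
   (EG (fun g => (hitoff nb A w g v1)%:R) * EG (fun g => (hitoff nb (arms A w) w g v2)%:R)).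
Proof.
move=> sw eA.
have dis : arms A w v2 = false -> forall y, cn nb (off (arms A w) w) v2 y -> ~~ arms A w y.
  by move=> /negbT nv y; exact: cn_off_notin.
have e0 : EG (fun g => (~~ hit nb w g o)%:R) = (1 - h) ^+ csize nb X w o.
  under EE_ext => g _ do rewrite (hit_has _ sw oX).
  by rewrite EE_none ?filter_uniq // => x; rewrite mem_filter => /andP[].
rewrite -mulrA -e0.
have e1 : EG (fun g => (hitoff nb A w g v1)%:R * (hitoff nb (arms A w) w g v2)%:R) =
  EG (fun g => (hitoff nb A w g v1)%:R) * EG (fun g => (hitoff nb (arms A w) w g v2)%:R).
  have hr g : hitoff nb (arms A w) w (res (predC (cn nb (off A w) v1)) g) v2 = hitoff nb (arms A w) w g v2.
    rewrite -hitoff_outside -[RHS]hitoff_outside; congr (hitoff _ _ _ _ _).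
    apply/funext => y; rewrite /res /arms /=; case: (A y); case: (cn nb _ v1 y);
      by rewrite /= ?andbF ?andbT.
  have := EE_indep h X (cn nb (off A w) v1) (fun g => (hitoff nb A w g v1)%:R)
    (fun g => (hitoff nb (arms A w) w g v2)%:R).
  under EE_ext => g _ do rewrite hitoff_inside hr.
  under [X in _ = X * _]EE_ext => g _ do rewrite hitoff_inside.
  by under [X in _ = _ * X]EE_ext => g _ do rewrite hr.
rewrite -e1.
have hr A' g : (forall y, A y -> A' y) -> hitoff nb A' w (res (predC A) g) v2 = hitoff nb A' w g v2.
  move=> hA; rewrite -hitoff_outside -[RHS]hitoff_outside; congr (hitoff _ _ _ _ _).
  apply/funext => y; rewrite /res /=; case: (boolP (A' y)); rewrite ?andbF ?andbT //= => ny.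
  by case: (boolP (A y)) => [/hA yA|_]; rewrite ?andbT //; rewrite yA in ny.
have := EE_indep h X A (fun g => (~~ hit nb w g o)%:R)
    (fun g => (hitoff nb A w g v1)%:R * (hitoff nb (arms A w) w g v2)%:R).
have hin g : hit nb w (res A g) o = hit nb w g o by rewrite eA hit_inside.
have harm g : hitoff nb (arms A w) w (res (predC A) g) v2 = hitoff nb (arms A w) w g v2.
  by apply: hr => y Ay; rewrite /arms Ay.
under EE_ext => g _ do rewrite hin hitoff_outside harm.
under [X in _ = X * _]EE_ext => g _ do rewrite hin.
under [X in _ = _ * X]EE_ext => g _ do rewrite hitoff_outside harm.
move=> <-; rewrite -EEZ; apply: EE_ext => g _; rewrite /three_way -eA.
by rewrite -!mulnb !natrM.
Qed.

Lemma arms_hitoff A w w' g :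
  hitoff nb (arms A w) w' g v2 = ~~ A v2 && hitoff nb (cn nb (off A w) v1) (off A w') g v2.
Proof. by rewrite /hitoff offU negb_or andbA. Qed.

                                                                                             
                                                                      
(** Explore the cluster of [o], then the arm of [v1] off it, then the arm of [v2] off both. After
    each stage the remaining edges are fresh, so the three pieces may be read in independent
    configurations. *)
Lemma explore_arms :
  EE p es (fun w => EG (fun g => (three_way w g)%:R)) =
  EE p es (fun w => EE p es (fun w1 => EE p es (fun w2 =>
    (cn nb w o z)%:R * (1 - h) ^+ csize nb X w o *
     (EG (fun g => (hitoff nb (cn nb w o) w1 g v1)%:R) *
      EG (fun g => (hitoff nb (arms (cn nb w o) w1) w2 g v2)%:R))))).
Proof.
have sub w : subc w es -> subc w (E nb X) by move=> hw e /hw /ses.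
have hKf w : subc w es -> cn nb w o = mem (clus nb X w o).
  by move=> hw; apply/funext => y /=; rewrite mem_clus //; exact: sub.
pose Phi (A : seq V) w : R := (z \in A)%:R * (1 - h) ^+ size A *
   (EG (fun g => (hitoff nb (mem A) w g v1)%:R) * EG (fun g => (hitoff nb (arms (mem A) w) w g v2)%:R)).
have Phi_off (A : seq V) w : Phi A (off (mem A) w) = Phi A w.
  rewrite /Phi; congr (_ * (_ * _)); apply: EE_ext => g _; first by rewrite /hitoff off_off.
  by rewrite /arms !off_off /hitoff !offU off_off.
transitivity (EE p es (fun w => Phi (clus nb X w o) (off (mem (clus nb X w o)) w))).
  apply: EE_ext => w hw; rewrite Phi_off (ghost_factor (sub w hw) (esym (hKf w hw))) /Phi.
  by rewrite mem_clus //; exact: sub.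
rewrite (EE_explore p (K := fun w => clus nb X w o) (Q := fun A : seq V => touch (mem A)) Phi); last first.
  by move=> w w' /sub sw /sub sw'; exact: clus_determined.
apply: EE_ext => w hw; rewrite (hKf w hw); set A := clus nb X w o.
have -> : (fun w1 => EE p es (fun w2 => (mem A z)%:R * (1 - h) ^+ csize nb X w o *
     (EG (fun g => (hitoff nb (mem A) w1 g v1)%:R) * EG (fun g => (hitoff nb (arms (mem A) w1) w2 g v2)%:R)))) =
   fun w1 => (z \in A)%:R * (1 - h) ^+ size A * EE p es (fun w2 =>
     EG (fun g => (hitoff nb (mem A) w1 g v1)%:R) * EG (fun g => (hitoff nb (arms (mem A) w1) w2 g v2)%:R)).
  by apply/funext => w1; rewrite -EEZ.
rewrite [RHS]EEZ.
apply: etrans (EE_ext p (fun w1 _ => Phi_off A w1)) _; rewrite /Phi EEZ; congr (_ * _).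
pose Psi (C : seq V) w2 : R := EG (fun g => (~~ (v1 \in A) && has g C)%:R) *
   EG (fun g => (hitoff nb (fun x => (x \in A) || (x \in C)) w2 g v2)%:R).
pose K1 w1 := clus nb X (off (mem A) w1) v1.
have subo w1 : subc w1 es -> subc (off (mem A) w1) (E nb X).
  by move=> h1 e /off_le /(sub _ h1).
have PsiE w1 w2 : subc w1 es -> Psi (K1 w1) w2 =
  EG (fun g => (hitoff nb (mem A) w1 g v1)%:R) * EG (fun g => (hitoff nb (arms (mem A) w1) w2 g v2)%:R).
  move=> hw1; rewrite /Psi; congr (_ * _); apply: EE_ext => g _.
    by rewrite /hitoff (hit_has _ (subo _ hw1) v1X).
  congr ((hitoff _ _ _ _ _)%:R); apply/funext => x; rewrite /arms /K1.
  by rewrite (mem_clus nbI nbC x (subo _ hw1) v1X).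
have Psi_off (C : seq V) w2 : Psi C (off (mem C) w2) = Psi C w2.
  rewrite /Psi; congr (_ * _); apply: EE_ext => g _; rewrite /hitoff; congr ((_ && hit _ _ _ _)%:R).
  apply/funext => e; rewrite /off /res /touch /=.
  by case: (w2 e); case: (e.1 \in A); case: (e.2 \in A); case: (e.1 \in C); case: (e.2 \in C).
transitivity (EE p es (fun w1 => Psi (K1 w1) (off (mem (K1 w1)) w1))).
  by apply: EE_ext => w1 h1; rewrite Psi_off PsiE.
rewrite (EE_explore p (K := K1) (Q := fun C : seq V => touch (mem C)) Psi); last first.
  move=> w1 w2 h1 h2 he; apply: (clus_determined nbC v1X (subo _ h1) (subo _ h2)).
  apply/funext => e; have := congr1 (@^~ e) he; rewrite /res /off /res /K1.
  by case: (touch (mem (clus _ _ _ _)) e); rewrite ?andbT ?andbF // => ->.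
apply: EE_ext => w1 h1; apply: EE_ext => w2 _.
by apply: etrans (Psi_off (K1 w1) w2) _; exact: PsiE.
Qed.

End Factor.
End Ghosts.

Lemma EE_prod (R : realType) (S T : eqType) (p q : R) (es : seq S) (fs : seq T)
    (a : (S -> bool) -> R) (b : (T -> bool) -> R) :
  EE p es (fun x => EE q fs (fun y => a x * b y)) = EE p es a * EE q fs b.
Proof. by rewrite -EEZr; apply: EE_ext => x _; rewrite EEZ. Qed.

Lemma EE_exchange (R : realType) (S T : eqType) (p q : R) (es : seq S) (fs : seq T)
    (F : (S -> bool) -> (T -> bool) -> R) :
  EE p es (fun x => EE q fs (F x)) = EE q fs (fun y => EE p es (fun x => F x y)).
Proof. by elim: es F => [//|e es IH] F /=; rewrite !IH -!EEZ -EED. Qed.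

(** * Collisions between the two arms of a fork *)

Section TwoArmCycles.
Context {R : realType} {V : countType}.
Variables (nb : V -> seq V).
Hypothesis nbU : forall x, uniq (nb x).
Hypothesis nbI : forall x, x \notin nb x.
Hypothesis nbC : forall x y, adj nb x y = adj nb y x.
Variable L : nat.
Hypothesis nbL : girth_ge nb L.
Hypothesis L0 : (0 < L)%N.
Implicit Types (X Y l : seq V) (w : V * V -> bool) (x y z u t v o : V) (i j k n : nat) (p q h : R).

                                                                                    
(** A collision of arms is coded by the cycle [l] read from [z]: it starts at [v2], reaches the
    meeting point [x] after [j] further steps, and returns to [v1], its last vertex before [z]. The
    index [k] locates on the return path the vertex where the arm of [v1] leaves it. *)
Definition cyc2_out l j : seq V := take j (behead l).
Definition cyc2_back l j : seq V := take ((size l).-2 - j) (drop j (behead l)).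
Definition cyc2_x z l j : V := last (head z l) (cyc2_out l j).
Definition cyc2_y z l j k : V := nth z (cyc2_x z l j :: cyc2_back l j) k.
Definition cyc2_key z v1 v2 l j : bool :=
  [&& (j.+2 <= size l)%N, head z l == v2 & last z (take (size l).-1 l) == v1].

Definition cyc2_term z (B1 B2 : V -> bool) w1 w2 l j k : R :=
  (uniq (pedges (head z l) (cyc2_out l j)) && uniq (pedges (cyc2_x z l j) (cyc2_back l j)))%:R *
  (((all w1 (pedges (cyc2_x z l j) (cyc2_back l j)))%:R *
    (hit nb (res [predC pedges (cyc2_x z l j) (cyc2_back l j)] w1) B1 (cyc2_y z l j k))%:R) *
   ((all w2 (pedges (head z l) (cyc2_out l j)))%:R *
    (hit nb (res [predC pedges (head z l) (cyc2_out l j)] w2) B2 (cyc2_x z l j))%:R)).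

Definition cyc2_sum X z (G : seq V -> nat -> nat -> R) : R :=
  \sum_(l <- cyc nb L (size X).+1 z) \sum_(jk <- sq (size l)) G l jk.1 jk.2.

Lemma cyc2_term_ge0 z B1 B2 w1 w2 l j k : 0 <= cyc2_term z B1 B2 w1 w2 l j k.
Proof. by rewrite /cyc2_term !mulr_ge0. Qed.

Lemma cyc2_term_mono z B1 B2 w1 w2 w1' w2' l j k : lec w1 w1' -> lec w2 w2' ->
  cyc2_term z B1 B2 w1 w2 l j k <= cyc2_term z B1 B2 w1' w2' l j k.
Proof.
move=> h1 h2; have allm w w' (F : seq (V * V)) : lec w w' -> (all w F)%:R <= (all w' F)%:R :> R.
  by move=> h; rewrite ler_nat; case: (boolP (all w F)) => // hw; rewrite (sub_all h hw).
have hitm w w' (F : seq (V * V)) B x : lec w w' ->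
    (hit nb (res [predC F] w) B x)%:R <= (hit nb (res [predC F] w') B x)%:R :> R.
  by move=> h; apply: incr_hit => e /andP[/h he hF]; rewrite /res he.
rewrite ler_wpM2l //; apply: ler_pM; rewrite ?mulr_ge0 //;
  by apply: ler_pM => //; [exact: allm|exact: hitm].
Qed.

Lemma cyc2_union X z v1 v2 (B1 B2 : V -> bool) w1 w2 : z \in X -> v1 \in X -> v2 \in X ->
  adj nb z v1 -> adj nb z v2 -> v1 != v2 -> subc w1 (E nb X) -> subc w2 (E nb X) ->
  (forall a, ~~ w1 (edge z a)) -> (forall a, ~~ w2 (edge z a)) ->
  (hit nb w1 B1 v1 && hit nb w2 B2 v2 && ~~ hitoff nb (cn nb w1 v1) w2 B2 v2)%:R <=
  cyc2_sum X z (fun l j k => (cyc2_key z v1 v2 l j)%:R * cyc2_term z B1 B2 w1 w2 l j k).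
Proof.
move=> zX v1X v2X a1 a2 v12 s1 s2 n1 n2; set G := fun l j k => _ * _.
have G0 l j k : 0 <= G l j k by rewrite mulr_ge0 ?cyc2_term_ge0.
case: (boolP (_ && _)) => [/andP[/andP[h1 h2] hn]|_]; last first.
  by apply: sumr_ge0 => l _; apply: sumr_ge0.
have [c [d [y [[q1 q2 q3 q4] [[q5 q6 q7 q8 [q9 q10]] [q11 q12]]]]]] :=
  cycle_key2 nbC nbI a1 a2 v12 h1 h2 hn n1 n2.
set l := v2 :: c ++ rcons d z in q1 q2 q3 q4.
have sl : size l = (size c + size d).+2 by rewrite /l /= size_cat size_rcons addnS.
have e1 : cyc2_out l (size c) = c by rewrite /cyc2_out /= take_size_cat.
have e2 : cyc2_back l (size c) = d.
  rewrite /cyc2_back sl /= drop_size_cat // addKn -cats1 take_size_cat //.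
have e3 : cyc2_x z l (size c) = last v2 c by rewrite /cyc2_x e1.
have e4 : take (size l).-1 l = v2 :: c ++ d.
  by rewrite sl /= /l /= -rcons_cat -cats1 take_size_cat // size_cat.
have xX : last v2 c \in X by apply: (pedges_in nbI nbC s2 v2X q6); exact: mem_last.
have lX : {subset l <= X}.
  move=> a; rewrite /l inE mem_cat mem_rcons inE => /or4P[/eqP->//|ha|/eqP->//|ha].
    by apply: (pedges_in nbI nbC s2 v2X q6); rewrite inE ha orbT.
  by apply: (pedges_in nbI nbC s1 xX q8); rewrite inE ha orbT.
have lK : (size l < (size X).+1)%N by rewrite ltnS; exact: uniq_leq_size.
have hl := mem_cyc nbL q1 q2 q3 q4 lK.
have hy : (index y (last v2 c :: d) < (size d).+1)%N by change (index y (last v2 c :: d) < size (last v2 c :: d))%N; rewrite index_mem.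
have hjk : (size c, index y (last v2 c :: d)) \in sq (size l).
  by rewrite mem_sq sl; move: hy; clear; move=> hy; apply/andP; split; lia.
have ey : cyc2_y z l (size c) (index y (last v2 c :: d)) = y by rewrite /cyc2_y e3 e2 nth_index.
apply: le_trans (_ : G l (size c) (index y (last v2 c :: d)) <= _).
  rewrite /G /cyc2_term /cyc2_key ey e1 e2 e3 e4 sl /= !eqxx q11 q12 q8 q10 q6 q7 last_cat q5 eqxx.
  by rewrite !ltnS leq_addr /= !mulr1.
apply: le_trans (le_sum_seq1 (F := fun jk => G l jk.1 jk.2) (fun jk => G0 l jk.1 jk.2) hjk) _.
apply: (le_sum_seq1 (F := fun l => \sum_(jk <- sq (size l)) G l jk.1 jk.2)) => //.
by move=> l'; apply: sumr_ge0.
Qed.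

Variables (p h : R) (X : seq V).
Hypothesis hp : 0 <= p <= 1.
Hypothesis hh : 0 <= h <= 1.
Hypothesis uX : uniq X.
Variable B : R.
Hypothesis hB : forall x, x \in X -> EE h X (fun g => EX nb p X (fun w => (hit nb w g x)%:R)) <= B.
Hypothesis B0 : 0 <= B.

Local Notation EG := (EE h X).

Lemma ghost_le es x : uniq es -> {subset es <= E nb X} ->
  EG (fun g => EE p es (fun w => (hit nb w g x)%:R)) <= B.
Proof.
move=> ues ses; case: (boolP (x \in X)) => xX.
  apply: le_trans (hB xX); apply: EE_le => // g _; apply: EE_es_mono => //.
    exact: E_uniq.
  exact: incr_hit.
apply: EE_le_cst => // g hg; apply: EE_le_cst => // w hw.
case: (boolP (hit nb w g x)) => // /hitP[y [gy xy]]; case/negP: xX.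
have sw : subc w (E nb X) by move=> e /hw /ses.
have yX := hg y gy; exact: (cn_in_sym nbI nbC sw yX xy).
Qed.

(** All edges of the cycle except the two at [z] are paid for, and each arm continues to a green
    vertex at cost [B]. *)
Lemma cyc2_expect es z l j k : uniq es -> {subset es <= E nb X} -> (j.+2 <= size l)%N ->
  EG (fun g1 => EG (fun g2 => EE p es (fun w1 => EE p es (fun w2 => cyc2_term z g1 g2 w1 w2 l j k)))) <=
  p ^+ (size l - 2) * B ^+ 2.
Proof.
move=> ues ses hj; have /andP[p0 p1] := hp.
set P2 := pedges (head z l) (cyc2_out l j); set P1 := pedges (cyc2_x z l j) (cyc2_back l j).
pose F1 := EG (fun g1 => EE p es (fun w1 => (all w1 P1)%:R *
   (hit nb (res [predC P1] w1) g1 (cyc2_y z l j k))%:R)).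
pose F2 := EG (fun g2 => EE p es (fun w2 => (all w2 P2)%:R *
   (hit nb (res [predC P2] w2) g2 (cyc2_x z l j))%:R)).
rewrite (_ : EG _ = (uniq P2 && uniq P1)%:R * (F1 * F2)); last first.
  rewrite /F1 /F2 -EE_prod -EEZ; apply: EE_ext => g1 _; rewrite -EEZ; apply: EE_ext => g2 _.
  by rewrite -EE_prod -EEZ; apply: EE_ext => w1 _; rewrite -EEZ; apply: EE_ext => w2 _.
have sz : (size P1 + size P2 = size l - 2)%N.
  rewrite !size_pedges /cyc2_back /cyc2_out !size_take size_drop size_behead.
  by case: ifP => h1; case: ifP => h2; clear -hj h1 h2; lia.
case: (boolP (_ && _)) => [/andP[ok2 ok1]|_]; last by rewrite mul0r mulr_ge0 ?exprn_ge0.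
have half F x : uniq F -> EG (fun g => EE p es (fun w => (all w F)%:R *
   (hit nb (res [predC F] w) g x)%:R)) <= p ^+ size F * B.
  move=> uF; apply: le_trans (_ : p ^+ size F * EG (fun g => EE p es (fun w => (hit nb w g x)%:R)) <= _).
    rewrite -EEZ; apply: EE_le => // g _; apply: EE_open_incr => //; exact: incr_hit.
  by rewrite ler_wpM2l ?exprn_ge0 //; exact: ghost_le.
rewrite mul1r -sz exprD (_ : p ^+ size P1 * _ * _ = (p ^+ size P1 * B) * (p ^+ size P2 * B)); last by ring.
by apply: ler_pM; rewrite ?half //; apply: EE_ge0 => // g _; apply: EE_ge0 => // w _; rewrite mulr_ge0.
Qed.

Variables (pm eta : R).
Hypothesis pm0 : 0 < pm.
Hypothesis ppm : p <= pm.
Hypothesis loops : forall K z,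
  \sum_(n < K | (L <= n)%N) (n ^ 2)%:R * pm ^+ n * nbc nb None n z z <= eta.

Definition cyc2_bound z v1 v2 : R :=
  cyc2_sum X z (fun l j k => (cyc2_key z v1 v2 l j)%:R * (p ^+ (size l - 2) * B ^+ 2)).

Lemma cyc2_bound_ge0 z v1 v2 : 0 <= cyc2_bound z v1 v2.
Proof.
have /andP[p0 _] := hp; apply: sumr_ge0 => l _; apply: sumr_ge0 => jk _.
by rewrite mulr_ge0 // mulr_ge0 ?exprn_ge0.
Qed.

(** A coded cycle determines [v1] and [v2], and p^2 restores the two missing edges. *)
Lemma cyc2_total z : p ^+ 2 * \sum_(v1 <- nb z) \sum_(v2 <- nb z) cyc2_bound z v1 v2 <= eta * B ^+ 2.
Proof.
have /andP[p0 p1] := hp.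
have -> : \sum_(v1 <- nb z) \sum_(v2 <- nb z) cyc2_bound z v1 v2 =
  cyc2_sum X z (fun l j k => (\sum_(v1 <- nb z) \sum_(v2 <- nb z) (cyc2_key z v1 v2 l j)%:R) *
     (p ^+ (size l - 2) * B ^+ 2)).
  rewrite /cyc2_bound /cyc2_sum.
  under eq_bigr => v1 _ do rewrite exchange_big; rewrite exchange_big; apply: eq_bigr => l _ /=.
  under eq_bigr => v1 _ do rewrite exchange_big; rewrite exchange_big; apply: eq_bigr => jk _ /=.
  by rewrite mulr_suml; apply: eq_bigr => v1 _; rewrite mulr_suml.
apply: le_trans (_ : (\sum_(l <- cyc nb L (size X).+1 z) (size l ^ 2)%:R * pm ^+ size l) * B ^+ 2 <= _);
  last first.
  rewrite ler_wpM2r ?exprn_ge0 //; apply: le_trans (loops (size X).+1 z).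
  rewrite le_eqVlt; apply/orP; left; apply/eqP.
  rewrite /cyc big_flatten big_map big_filter.
  have -> : iota 0 (size X).+1 = index_iota 0 (size X).+1 by rewrite /index_iota subn0.
  rewrite big_mkord; apply: eq_bigr => n _; rewrite big_filter -(nbcE nb None n z z) mulr_sumr.
  rewrite big_mkcond big_seq [RHS]big_seq; apply: eq_bigr => l /size_nbl ->.
  by case: (last z l == z) => /=; [rewrite mulr1|rewrite mulr0].
rewrite mulr_suml mulr_sumr; apply: ler_sum => l _.
rewrite -size_sq -mulrA -sum_seq_cst mulr_sumr; apply: ler_sum => -[j k] _ /=.
case: (leqP j.+2 (size l)) => hj; last first.
  rewrite big1 ?mul0r ?mulr0; first by rewrite mulr_ge0 ?exprn_ge0 // ltW.
  by move=> v1 _; rewrite big1 // => v2 _; rewrite /cyc2_key leqNgt hj.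
have s1 : \sum_(v1 <- nb z) \sum_(v2 <- nb z) (cyc2_key z v1 v2 l j)%:R <= 1 :> R.
  apply: le_trans (_ : \sum_(v1 <- nb z) (last z (take (size l).-1 l) == v1)%:R * 1 <= _); last first.
    by rewrite sum_delta // mulr1 lern1 leq_b1.
  apply: ler_sum => v1 _; rewrite mulr1.
  apply: le_trans (_ : \sum_(v2 <- nb z) (head z l == v2)%:R * (last z (take (size l).-1 l) == v1)%:R <= _).
    apply: ler_sum => v2 _; rewrite -natrM ler_nat mulnb /cyc2_key hj /=.
    by case: (_ == v2); case: (_ == v1).
  by rewrite sum_delta // ler_piMl // lern1 leq_b1.
apply: le_trans (_ : p ^+ 2 * (1 * (p ^+ (size l - 2) * B ^+ 2)) <= _).
  by rewrite ler_wpM2l ?exprn_ge0 // ler_wpM2r // mulr_ge0 ?exprn_ge0.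
rewrite mul1r mulrA -exprD subnKC; last by apply: leq_trans hj.
rewrite ler_wpM2r ?exprn_ge0 //; apply: lerXn2r => //; rewrite nnegrE //; exact: ltW.
Qed.

End TwoArmCycles.

Lemma mul_lower (R : realType) (A B q1 q2 m1 m2 : R) : 0 <= A -> A <= B -> 0 <= q1 -> 0 <= q2 ->
  0 <= m1 -> 0 <= m2 -> A - q1 <= m1 -> A - q2 <= m2 -> A ^+ 2 - B * (q1 + q2) <= m1 * m2.
Proof.
move=> A0 AB hq1 hq2 n1 n2 h1 h2; have := mulr_ge0 n1 n2.
have [l1|l1] := leP q1 A; last by nra.
have [l2|l2] := leP q2 A; last by nra.
have : (A - q1) * (A - q2) <= m1 * m2 by apply: ler_pM; lra.
nra.
Qed.

(** Both arms reach green vertices, minus the cases where one of them needs the cluster of [o],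
    minus the collision of the arms, whose indicator is bounded by [C]. *)
Lemma arms_split (R : realType) (h1 h2 a1 a2 b2 : bool) (C : R) : (a1 && a2 && ~~ b2)%:R <= C ->
  h1%:R * h2%:R - (h1 && ~~ a1)%:R * h2%:R - h1%:R * (h2 && ~~ a2)%:R - C <= a1%:R * b2%:R.
Proof. by case: h1; case: h2; case: a1; case: a2; case: b2 => /= hC; lra. Qed.

(** * The expected number of forks, from below and from above *)

Section Branching.
Context {R : realType} {V : countType}.
Variables (nb : V -> seq V) (d : nat).
Hypothesis nbU : forall x, uniq (nb x).
Hypothesis nbI : forall x, x \notin nb x.
Hypothesis nbC : forall x y, adj nb x y = adj nb y x.
Hypothesis nbd : forall x, size (nb x) = d.
Variable L : nat.
Hypothesis nbL : girth_ge nb L.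
Hypothesis L0 : (0 < L)%N.
Implicit Types (Y l : seq V) (w : V * V -> bool) (x y z u t v o : V) (i j k n : nat).
Variables (p h : R) (X : seq V) (o : V).
Hypothesis hp : 0 <= p <= 1.
Hypothesis p_lt1 : p < 1.
Hypothesis hh : 0 <= h <= 1.
Hypothesis uX : uniq X.
Hypothesis oX : o \in X.
Variable B : R.
Hypothesis hB : forall x, x \in X -> EE h X (fun g => EX nb p X (fun w => (hit nb w g x)%:R)) <= B.
Variables (pm eta : R).
Hypothesis pm0 : 0 < pm.
Hypothesis ppm : p <= pm.
Hypothesis loops : forall K z,
  \sum_(n < K | (L <= n)%N) (n ^ 2)%:R * pm ^+ n * nbc nb None n z z <= eta.

Local Notation EG := (EE h X).
(** The price, by [EE_closed], of replacing percolation without the two fork edges by full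
    percolation. *)
Let c2 : R := (1 - p) ^- 2.
Let W w : R := (1 - h) ^+ csize nb X w o.
Let es z v1 v2 : seq (V * V) := [seq e <- E nb X | [predC fork z v1 v2] e].
Let ues z v1 v2 : uniq (es z v1 v2). Proof. exact/filter_uniq/E_uniq. Qed.
Let ses z v1 v2 : {subset es z v1 v2 <= E nb X}. Proof. by move=> f; rewrite mem_filter => /andP[]. Qed.
Let t z : R := EX nb p X (fun w => (cn nb w o z)%:R * W w).
Let T z v1 v2 : R := EE p (es z v1 v2) (fun w => (cn nb w o z)%:R * W w).
Let m z v1 v2 x : R := EE p (es z v1 v2) (fun w => EG (fun g => (hit nb w g x)%:R)).
Let r z v1 v2 v : R := EG (fun g => EE p (es z v1 v2) (fun w => EE p (es z v1 v2) (fun w1 =>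
  (cn nb w o z && hit nb w1 g v && ~~ hitoff nb (cn nb w o) w1 g v)%:R * W w))).

Let B0 : 0 <= B.
Proof. by apply: le_trans (hB oX); apply: EE_ge0 => // g _; apply: EE_ge0. Qed.
Let W0 w : 0 <= W w. Proof. by rewrite exprn_ge0 // subr_ge0; case/andP: hh. Qed.
Let Wdecr : decr W.
Proof.
move=> w w' hw; case/andP: hh => h0 h1; apply: ler_wiXn2l; rewrite ?subr_ge0 //.
  by rewrite gerBl.
exact: csize_mono.
Qed.
Let t0 z : 0 <= t z. Proof. by apply: EE_ge0 => // w _; rewrite mulr_ge0. Qed.
Let T0 z v1 v2 : 0 <= T z v1 v2. Proof. by apply: EE_ge0 => // w _; rewrite mulr_ge0. Qed.

(** The fork edges touch [K], which contains [z], so closing them does not affect the arms taken off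
    [K]. *)
Lemma branch_three_way w (g : V -> bool) z v1 v2 : branch nb w o g z v1 v2 =
  all w (fork z v1 v2) && three_way nb o z v1 v2 (res [predC fork z v1 v2] w) g.
Proof.
rewrite /branch /three_way -/(close_fork z v1 v2 w) /= andbT -andbA; congr (_ && (_ && _)).
case: (boolP (cn nb (close_fork z v1 v2 w) o z)) => //= Kz; congr (_ && _).
set K := cn nb (close_fork z v1 v2 w) o in Kz *.
have e1 : off K (close_fork z v1 v2 w) = off K w.
  apply/funext => e; rewrite /off /close_fork /res /=; case: (boolP (e \in fork z v1 v2)); rewrite ?andbT //.
  by rewrite !inE => /orP[]/eqP->; rewrite !touch_edge Kz /= !andbF.
by rewrite /arms /hitoff !e1 !(offU K (cn nb (off K w) v1)) e1.
Qed.

(** The main term is the product of three independent pieces: [o] joined to [z] with no green vertex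
    in its cluster ([T]), and two arm masses ([m]). The losses are an arm meeting the cluster of [o]
    ([r], times [B] for the other arm) and the arms meeting each other. *)
Lemma branch_lower z v1 v2 : z \in X -> v1 \in X -> v2 \in X ->
  adj nb z v1 -> adj nb z v2 -> v1 != v2 ->
  p ^+ 2 * (T z v1 v2 * (m z v1 v2 v1 * m z v1 v2 v2) - r z v1 v2 v1 * B - r z v1 v2 v2 * B -
     T z v1 v2 * cyc2_bound nb L p X B z v1 v2) <=
  EX nb p X (fun w => EG (fun g => (branch nb w o g z v1 v2)%:R)).
Proof.
move=> zX v1X v2X a1 a2 v12; set F := es z v1 v2; have uF : uniq F by exact: ues.
have sF : {subset F <= E nb X} by exact: ses.
have -> : EX nb p X (fun w => EG (fun g => (branch nb w o g z v1 v2)%:R)) =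
   p ^+ 2 * EE p F (fun w => EG (fun g => (three_way nb o z v1 v2 w g)%:R)).
  rewrite -(EE_filter p _ [predC fork z v1 v2] (fun w => EG (fun g => (three_way nb o z v1 v2 w g)%:R))).
  have uP : uniq (fork z v1 v2).
    rewrite /= andbT inE; apply/eqP => /edge_inj[[_ e]|[e1 e2]]; first by rewrite e eqxx in v12.
    by move: (adj_neq nbI a1); rewrite e2 eqxx.
  have sP : {subset fork z v1 v2 <= E nb X}.
    by move=> e; rewrite !inE => /orP[]/eqP->; rewrite edge_E // zX ?a1 ?a2.
  rewrite -(EE_open_eq (fun w => EG (fun g => (three_way nb o z v1 v2 w g)%:R)) hp (E_uniq nbU uX) uP sP).
  apply: EE_ext => w _; rewrite -EEZ; apply: EE_ext => g _.
  by rewrite branch_three_way -natrM mulnb.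
rewrite ler_wpM2l ?exprn_ge0 //; first by case/andP: hp.
rewrite (explore_arms nbI nbC p z v2 hh uX sF oX v1X).
pose k w : R := (cn nb w o z)%:R * W w.
pose H v w : R := EG (fun g => (hit nb w g v)%:R).
pose Rr v w w1 : R := EG (fun g => (hit nb w1 g v && ~~ hitoff nb (cn nb w o) w1 g v)%:R).
pose C g1 g2 w1 w2 : R := cyc2_sum nb L X z (fun l j k => (cyc2_key z v1 v2 l j)%:R * cyc2_term nb z g1 g2 w1 w2 l j k).
have k0 w : 0 <= k w by rewrite mulr_ge0.
have rE v : r z v1 v2 v = EE p F (fun w => k w * EE p F (Rr v w)).
  rewrite /r (EE_exchange _ _ _ _ (fun (g : V -> bool) w => EE p F (fun w1 =>
    (cn nb w o z && hit nb w1 g v && ~~ hitoff nb (cn nb w o) w1 g v)%:R * W w))).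
  apply: EE_ext => w _; rewrite (EE_exchange _ _ _ _ (fun (g : V -> bool) w1 =>
    (cn nb w o z && hit nb w1 g v && ~~ hitoff nb (cn nb w o) w1 g v)%:R * W w)).
  rewrite -EEZ; apply: EE_ext => w1 _.
  by rewrite -EEZ; apply: EE_ext => g _; rewrite -andbA -mulnb natrM mulrAC.
have mE v : m z v1 v2 v = EE p F (H v) by [].
have m0 v : 0 <= m z v1 v2 v by apply: EE_ge0 => // w _; apply: EE_ge0.
have mB v : m z v1 v2 v <= B.
  rewrite /m (EE_exchange _ _ _ _ (fun w g => (hit nb w g v)%:R)); exact: (ghost_le nbU nbI nbC hp hh uX hB B0 v uF sF).
have r0 v : 0 <= r z v1 v2 v.
  by rewrite rE; apply: EE_ge0 => // w _; rewrite mulr_ge0 //; apply: EE_ge0 => // w1 _; apply: EE_ge0.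
have bC : EE p F (fun w1 => EE p F (fun w2 => EG (fun g1 => EG (fun g2 => C g1 g2 w1 w2)))) <=
    cyc2_bound nb L p X B z v1 v2.
  have -> : EE p F (fun w1 => EE p F (fun w2 => EG (fun g1 => EG (fun g2 => C g1 g2 w1 w2)))) =
     EG (fun g1 => EG (fun g2 => EE p F (fun w1 => EE p F (C g1 g2 w1)))).
    apply: (etrans (y := EE p F (fun w1 => EG (fun g1 => EE p F (fun w2 => EG (fun g2 => C g1 g2 w1 w2)))))).
      by apply: EE_ext => w1 _; exact: (EE_exchange _ _ _ _ (fun w2 g1 => EG (fun g2 => C g1 g2 w1 w2))).
    rewrite (EE_exchange _ _ _ _ (fun w1 g1 => EE p F (fun w2 => EG (fun g2 => C g1 g2 w1 w2)))).
    apply: EE_ext => g1 _.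
    rewrite -(EE_exchange _ _ _ _ (fun w1 g2 => EE p F (C g1 g2 w1))).
    by apply: EE_ext => w1 _; exact: (EE_exchange _ _ _ _ (fun w2 g2 => C g1 g2 w1 w2)).
  rewrite /C /cyc2_bound /cyc2_sum.
  have sumE (I : Type) (s : seq I) (G : I -> (V -> bool) -> (V -> bool) -> (V * V -> bool) -> (V * V -> bool) -> R) :
    EG (fun g1 => EG (fun g2 => EE p F (fun w1 => EE p F (fun w2 => \sum_(i <- s) G i g1 g2 w1 w2)))) =
    \sum_(i <- s) EG (fun g1 => EG (fun g2 => EE p F (fun w1 => EE p F (fun w2 => G i g1 g2 w1 w2)))).
    rewrite -EE_sum; apply: EE_ext => g1 _; rewrite -EE_sum; apply: EE_ext => g2 _.
    by rewrite -EE_sum; apply: EE_ext => w1 _; rewrite -EE_sum.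
  rewrite sumE; apply: ler_sum => l _; rewrite sumE; apply: ler_sum => -[j k'] _ /=.
  rewrite (_ : EG _ = (cyc2_key z v1 v2 l j)%:R *
    EG (fun g1 => EG (fun g2 => EE p F (fun w1 => EE p F (fun w2 => cyc2_term nb z g1 g2 w1 w2 l j k'))))); last first.
    rewrite -EEZ; apply: EE_ext => g1 _; rewrite -EEZ; apply: EE_ext => g2 _.
    by rewrite -EEZ; apply: EE_ext => w1 _; rewrite -EEZ.
  case: (boolP (cyc2_key z v1 v2 l j)) => hk; last by rewrite !mul0r.
  by rewrite !mul1r; apply: (cyc2_expect nbU nbI nbC hp hh uX hB B0) => //; case/and3P: hk.
apply: (@le_trans _ _ (EE p F (fun w => EE p F (fun w1 => EE p F (fun w2 =>
   k w * (H v1 w1 * H v2 w2 - Rr v1 w w1 * H v2 w2 - H v1 w1 * Rr v2 w w2 -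
     EG (fun g1 => EG (fun g2 => C g1 g2 w1 w2)))))))).
  have -> : EE p F (fun w => EE p F (fun w1 => EE p F (fun w2 =>
     k w * (H v1 w1 * H v2 w2 - Rr v1 w w1 * H v2 w2 - H v1 w1 * Rr v2 w w2 -
     EG (fun g1 => EG (fun g2 => C g1 g2 w1 w2)))))) =
    T z v1 v2 * (m z v1 v2 v1 * m z v1 v2 v2) - r z v1 v2 v1 * m z v1 v2 v2 - r z v1 v2 v2 * m z v1 v2 v1 -
    T z v1 v2 * EE p F (fun w1 => EE p F (fun w2 => EG (fun g1 => EG (fun g2 => C g1 g2 w1 w2)))).
    have eT a : T z v1 v2 * a = EE p F (fun w => k w * a) by rewrite EEZr.
    have er v a : r z v1 v2 v * a = EE p F (fun w => k w * EE p F (Rr v w) * a) by rewrite EEZr rE.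
    rewrite !eT !er -!EEB; apply: EE_ext => w _; rewrite !mE.
    have -> : k w * EE p F (Rr v1 w) * EE p F (H v2) = k w * EE p F (fun w1 => EE p F (fun w2 => Rr v1 w w1 * H v2 w2)).
      by rewrite EE_prod mulrA.
    have -> : k w * EE p F (Rr v2 w) * EE p F (H v1) = k w * EE p F (fun w1 => EE p F (fun w2 => H v1 w1 * Rr v2 w w2)).
      by rewrite EE_prod mulrA mulrAC.
    rewrite -EE_prod -!mulrBr -!EEB -EEZ; apply: EE_ext => w1 _; rewrite -!EEB -EEZ.
    by apply: EE_ext => w2 _.
  have := ler_wpM2l (T0 z v1 v2) bC; have := ler_wpM2l (r0 v1) (mB v2); have := ler_wpM2l (r0 v2) (mB v1).
  lra.
apply: EE_le => // w hw; apply: EE_le => // w1 hw1; apply: EE_le => // w2 hw2.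
rewrite -/(W w) -/(k w) /k; case: (boolP (cn nb w o z)) => Kz; last by rewrite !mul0r.
rewrite !mul1r ler_wpM2l // /H /Rr -!EE_prod -!EEB; apply: EE_le => // g1 _.
rewrite -!EEB; apply: EE_le => // g2 _.
set K := cn nb w o in Kz *.
have sw1 : subc (off K w1) (E nb X) by move=> e /off_le /hw1 /sF.
have sw2 : subc (off K w2) (E nb X) by move=> e /off_le /hw2 /sF.
have nz (w' : V * V -> bool) a : ~~ off K w' (edge z a) by rewrite off_edge Kz andbF.
have hc : (hit nb (off K w1) g1 v1 && hit nb (off K w2) g2 v2 &&
    ~~ hitoff nb (cn nb (off K w1) v1) (off K w2) g2 v2)%:R <= C g1 g2 w1 w2.
  apply: le_trans (cyc2_union nbI nbC nbL g1 g2 zX v1X v2X a1 a2 v12 sw1 sw2 (nz w1) (nz w2)) _.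
  rewrite /C /cyc2_sum; apply: ler_sum => l _; apply: ler_sum => jk _; apply: ler_wpM2l => //.
  by apply: cyc2_term_mono; exact: off_le.
rewrite arms_hitoff /hitoff; apply: arms_split.
apply: le_trans hc; rewrite ler_nat /hitoff.
by case: (K v1); case: (K v2) => //=; rewrite ?andbF.
Qed.

Lemma fork_uniq z v1 v2 : adj nb z v1 -> v1 != v2 -> uniq (fork z v1 v2).
Proof.
move=> a1 v12; rewrite /= andbT inE; apply/eqP => /edge_inj[[_ e]|[e1 e2]].
  by rewrite e eqxx in v12.
by move: (adj_neq nbI a1); rewrite e2 eqxx.
Qed.

Let p0 : 0 <= p. Proof. by case/andP: hp. Qed.
Let c20 : 0 <= c2. Proof. by rewrite invr_ge0 exprn_ge0 // subr_ge0; case/andP: hp. Qed.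

Lemma cut_le z v1 v2 y : adj nb z v1 -> v1 != v2 ->
  EE p (es z v1 v2) (fun w => (cn nb w o y)%:R * W w) <= c2 * t y.
Proof.
move=> a1 v12; rewrite mulrC ler_pdivlMr ?exprn_gt0 ?subr_gt0 // mulrC.
have := EE_closed hp (E_uniq nbU uX) (fork_uniq a1 v12) (g := fun w => (cn nb w o y)%:R * W w)
  (fun w => mulr_ge0 (ler0n _ _) (W0 w)).
by rewrite (EE_filter p (E nb X) [predC fork z v1 v2] (fun w => (cn nb w o y)%:R * W w)).
Qed.

Let cs z v : R := cyc_sum nb L X (fun y l ij => ((cyc_u y l ij.1 == z) && (cyc_v y l ij.1 == v))%:R *
  (p ^+ (size l).-1 * (B * (c2 * t y)))).
Let cs0 z v : 0 <= cs z v.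
Proof.
apply: sumr_ge0 => y _; apply: sumr_ge0 => l _; apply: sumr_ge0 => ij _.
by rewrite !mulr_ge0 ?exprn_ge0.
Qed.
Let D : R := \sum_(y <- X) t y.

Lemma cut_correction z v1 v2 v : adj nb z v1 -> adj nb z v2 -> v1 != v2 -> v \in [:: v1; v2] -> v \in X ->
  r z v1 v2 v <= cs z v.
Proof.
move=> a1 a2 v12 hv vX; have zv : adj nb z v by move: hv; rewrite !inE => /orP[]/eqP->.
have ne : edge z v \notin es z v1 v2.
  rewrite mem_filter; apply/negP => /andP[/negP hn _]; apply: hn.
  by move: hv; rewrite !inE => /orP[]/eqP->; rewrite eqxx ?orbT.
have hm x : EG (fun g => EE p (es z v1 v2) (fun w' => (hit nb w' g x)%:R)) <= B.
  exact: (ghost_le nbU nbI nbC hp hh uX hB B0 x (ues z v1 v2) (@ses z v1 v2)).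
have := cycle_expect nbI nbC nbL hp (poslin_EE X hh) (Bf := fun g => g) (ues z v1 v2) (ues z v1 v2)
  (@ses z v1 v2) (@ses z v1 v2) oX vX zv ne ne Wdecr W0 B0 hm.
move=> hce; apply: le_trans hce _; apply: cyc_sum_le => y l i j _ _ /=.
by rewrite ler_wpM2l // ler_wpM2l ?exprn_ge0 // ler_wpM2l //; exact: cut_le.
Qed.

Lemma cs_total : \sum_(uv <- opairs nb X) cs uv.1 uv.2 <= B * (eta / pm) * (c2 * D).
Proof.
rewrite /D mulr_sumr; apply: (cyc_sum_total L0 hp (opairs_uniq nbU uX) pm0 ppm _ B0 (loops _)).
by move=> y; rewrite mulr_ge0.
Qed.

(** The part of the cycle sum in which the base point is [z] itself, that is, the arm from [v]
    returns to [z]. *)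
Let q z v : R := cyc_sum nb L X (fun y l ij => ((cyc_u y l ij.1 == z) && (cyc_v y l ij.1 == v))%:R *
  (p ^+ (size l).-1 * (B * (y == z)%:R))).
Let q0 z v : 0 <= q z v.
Proof.
apply: sumr_ge0 => y _; apply: sumr_ge0 => l _; apply: sumr_ge0 => ij _.
by rewrite !mulr_ge0 ?exprn_ge0.
Qed.

Lemma q_total z : z \in X -> \sum_(v <- nb z) q z v <= B * (eta / pm).
Proof.
move=> zX; have uD : uniq [seq (z, v) | v <- nb z] by rewrite map_inj_uniq // => x y [].
have := cyc_sum_total L0 hp (X := X) (Xy := fun y => (y == z)%:R) uD pm0 ppm (fun y => ler0n _ _) B0 (loops _).
rewrite big_map /=; move/le_trans; apply.
have em : 0 <= B * (eta / pm).
  by rewrite mulr_ge0 // divr_ge0 ?(ltW pm0) //; have := loops 0%N o; rewrite big_ord0.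
apply: ler_piMr => //; rewrite (eq_bigr (fun y => (z == y)%:R * 1)); last by move=> y _; rewrite mulr1 eq_sym.
by rewrite sum_delta // mulr1 lern1 leq_b1.
Qed.

(** Deleting the edge [z v] loses at most pB, the connections that pass through [z] along it.
    Deleting the other fork edge matters only if the arm meets [z], which closes a cycle through
    [z v]; this is [cycle_expect] with an empty first configuration, where the cluster of [z] is a
    point. *)
Lemma arm_mass A z v1 v2 v : z \in X -> v \in X -> adj nb z v1 -> adj nb z v2 -> v \in [:: v1; v2] ->
  A <= EG (fun g => EX nb p X (fun w => (hit nb w g v)%:R)) ->
  A - p * B - q z v <= m z v1 v2 v.
Proof.
move=> zX vX a1 a2 hv hA; have zv : adj nb z v by move: hv; rewrite !inE => /orP[]/eqP->.
pose e1 := [seq e <- E nb X | e != edge z v].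
have u1 : uniq e1 by exact/filter_uniq/E_uniq.
have s1 : {subset e1 <= E nb X} by move=> f; rewrite mem_filter => /andP[].
have n1 : edge z v \notin e1 by rewrite mem_filter eqxx.
have n0 : edge z v \notin ([::] : seq (V * V)) by [].
have un : uniq ([::] : seq (V * V)) by [].
have sn : {subset [::] <= E nb X} by [].
have hm x : EG (fun g => EE p e1 (fun w' => (hit nb w' g x)%:R)) <= B.
  exact: (ghost_le nbU nbI nbC hp hh uX hB B0 x u1 s1).
have := cycle_expect nbI nbC nbL hp (poslin_EE X hh) (Bf := fun g => g) un u1 sn s1
  (o := z) (u := z) zX vX zv n0 n1 (W := fun=> 1) (fun _ _ _ => lexx _) (fun=> ler01) B0 hm.
rewrite /=; set c0 := cn nb _ z; set lhs := EG _ => hce.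
have {}hce : lhs <= q z v.
  apply: le_trans hce _; apply: cyc_sum_le => y l i j _ _ /=.
  rewrite ler_wpM2l // ler_wpM2l ?exprn_ge0 // ler_wpM2l // mulr1 ler_nat.
  case: (boolP (c0 y)) => // /cnP[[|a s] [ps <-]]; first by rewrite /= eqxx.
  by move: ps => /= /andP[/andP[_]].
have c0z : c0 z by exact: cn_refl.
pose H1 := EG (fun g => EE p e1 (fun w => (hit nb w g v)%:R)).
have h1 : EG (fun g => EX nb p X (fun w => (hit nb w g v)%:R)) <= H1 + p * B.
  rewrite -lerBlDl.
  have e1E g x : EE p e1 (fun w => (hit nb w g x)%:R) = EX nb p X (fun w => (hit nb (del (edge z v) w) g x)%:R).
    by rewrite /EX (EE_filter p _ (predC1 (edge z v)) (fun w => (hit nb w g x)%:R)).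
  have := ler_wpM2l p0 (hm z); apply: le_trans; rewrite /H1 -EEB -EEZ; apply: EE_le => // g _.
  rewrite lerBlDl !e1E.
  have us : uniq [:: edge z v] by [].
  have delE w : res [predC [:: edge z v]] w = del (edge z v) w.
    by congr res; apply/funext => e; rewrite /= inE.
  have := EE_open hp (E_uniq nbU uX) us (g := fun w => (hit nb w g z)%:R) (fun w => ler0n _ _).
  rewrite expr1; under [X in _ <= _ * X]EE_ext => w _ do rewrite delE.
  move=> ho; rewrite -lerBlDl; apply: le_trans ho; rewrite /EX -EEB; apply: EE_le => // w _.
  rewrite lerBlDl delE /= andbT -natrM -natrD ler_nat.
  case: (boolP (hit nb w g v)) => // /hitP[y [gy]]; rewrite cn_sym // => yv.
  have vz : adj nb v z by rewrite nbC.
  move: yv; rewrite (cn_del nbC w y vz) (edgeC v z) => /orP[hy|/andP[we hy]].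
    by rewrite (_ : hit nb (del _ w) g v) //; apply/hitP; exists y; rewrite cn_sym.
  rewrite we (_ : hit nb (del _ w) g z) ?addn1 //; apply/hitP; exists y; by rewrite cn_sym.
suff h2 : H1 <= m z v1 v2 v + lhs by lra.
rewrite /H1 /m (EE_exchange _ _ _ _ (fun w g => (hit nb w g v)%:R)) -EED; apply: EE_le => // g _.
have e1E (f : (V * V -> bool) -> R) : EE p e1 f = EX nb p X (fun w => f (del (edge z v) w)).
  by rewrite /EX (EE_filter p _ (predC1 (edge z v)) f).
rewrite !e1E -(EE_filter p (E nb X) [predC fork z v1 v2] (fun w => (hit nb w g v)%:R)) -EED.
apply: EE_le => // w _; rewrite mulr1 -natrD ler_nat c0z /=.
case: (boolP (hit nb _ g v)) => //= _.
case: (boolP (hitoff nb c0 _ g v)) => [/andP[_ ho]|_]; last by rewrite addn1.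
rewrite addn0 lt0b; refine (hit_mono _ ho) => e /andP[/andP[we _] hto].
rewrite /res we /= !inE; apply/negP => /orP[]/eqP he; case/negP: hto;
  by rewrite he touch_edge c0z.
Qed.

(** A simple path to [z] uses only one neighbour, so at least (d-1)(d-2) ordered forks leave it
    intact; closing edges only increases the weight [W]. *)
Lemma exit_pairs z : (1 < d)%N ->
  (d%:R - 1) * (d%:R - 2) * t z <= \sum_(v1 <- nb z) \sum_(v2 <- nb z | v1 != v2) T z v1 v2.
Proof.
move=> d1.
have -> : \sum_(v1 <- nb z) \sum_(v2 <- nb z | v1 != v2) T z v1 v2 =
   EX nb p X (fun w => \sum_(v1 <- nb z) \sum_(v2 <- nb z | v1 != v2)
     (cn nb (close_fork z v1 v2 w) o z)%:R * W (close_fork z v1 v2 w)).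
  rewrite /EX EE_sum; apply: eq_bigr => v1 _; rewrite EE_sum; apply: eq_bigr => v2 _.
  by rewrite /T -(EE_filter p (E nb X) [predC fork z v1 v2] (fun w => (cn nb w o z)%:R * W w)).
rewrite -EEZ; apply: EE_le => // w _.
apply: le_trans (_ : \sum_(v1 <- nb z) \sum_(v2 <- nb z | v1 != v2)
     (cn nb (close_fork z v1 v2 w) o z)%:R * W w <= _); last first.
  apply: ler_sum => v1 _; apply: ler_sum => v2 _; rewrite ler_wpM2l //; apply: Wdecr => e /andP[] //.
case: (boolP (cn nb w o z)) => [hz|_]; last first.
  by rewrite mul0r mulr0; apply: sumr_ge0 => v1 _; apply: sumr_ge0 => v2 _; rewrite mulr_ge0.
rewrite mul1r.
(* [u] is the vertex before [z] on a simple open path from [o], or [z] itself if that path is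
   empty. *)
have [u hu] : exists u, forall v1 v2, v1 != u -> v2 != u -> cn nb (close_fork z v1 v2 w) o z.
  have [s [ps ls us]] := cn_simple hz; move: ps ls us; case/lastP: s => [|s x] ps ls us.
    by exists z => v1 v2 _ _; rewrite -ls cn_refl.
  exists (last o s) => v1 v2 n1 n2; apply/cnP; exists (rcons s x); split=> //.
  rewrite last_rcons in ls; rewrite ls in ps us *; apply: (path_res (F := fork z v1 v2) ps) => e he.
  apply/negP => hp'; move: us; rewrite -rcons_cons rcons_uniq => /andP[nz _].
  move: he; rewrite -cats1 pedges_cat mem_cat => /orP[he|].
    have [a [b [ee]]] := mem_pedges he; move: hp'; rewrite ee => /fork_edge /orP[]/eqP->.
      by move=> /mem_belast hb; rewrite hb in nz.
    by move=> _ hb; rewrite inE hb orbT in nz.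
  rewrite inE => /eqP ee; move: hp'; rewrite ee !inE => /orP[]/eqP/edge_inj[][h1 h2].
  - by rewrite -h1 mem_last in nz.
  - by rewrite h1 eqxx in n1.
  - by rewrite -h1 mem_last in nz.
  - by rewrite h1 eqxx in n2.
have W1 := W0 w.
pose I (a b : V) : R := (a == b)%:R.
apply: le_trans (_ : \sum_(v1 <- nb z) (1 - I u v1) * ((d%:R - 2) * W w) <= _).
  rewrite -mulr_suml sumrB -mulrA sum_seq_cst nbd mulr1.
  have : \sum_(v1 <- nb z) I u v1 <= 1.
    rewrite (eq_bigr (fun v1 => I u v1 * 1)); last by move=> v1 _; rewrite mulr1.
    by rewrite sum_delta // mulr1 lern1 leq_b1.
  move=> hI; rewrite ler_wpM2r ?lerB // mulr_ge0 // subr_ge0.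
  by rewrite (ler_nat R 2).
apply: ler_sum => v1 _; have [->|n1] := eqVneq v1 u.
  by rewrite /I eqxx subrr mul0r; apply: sumr_ge0 => v2 _; rewrite mulr_ge0.
rewrite /I eq_sym (negbTE n1) subr0 mul1r.
apply: le_trans (_ : \sum_(v2 <- nb z) (1 - I u v2 - I v1 v2) * W w <= _).
  rewrite -mulr_suml; apply: ler_wpM2r => //; rewrite !sumrB sum_seq_cst nbd mulr1.
  have hs a : \sum_(v <- nb z) I a v <= 1.
    rewrite (eq_bigr (fun v => I a v * 1)); last by move=> v _; rewrite mulr1.
    by rewrite sum_delta // mulr1 lern1 leq_b1.
  by have := hs u; have := hs v1; lra.
rewrite [leRHS]big_mkcond; apply: ler_sum => v2 _; rewrite /I.
have [e|n12] := eqVneq v1 v2.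
  by rewrite mulr_le0_ge0 // addrAC subrr add0r oppr_le0 ler0n.
rewrite subr0; have [e|n2] := eqVneq u v2; first by rewrite subrr mul0r mulr_ge0.
by rewrite subr0 hu // eq_sym.
Qed.

(** By [branch_unique] there is at most one fork, counted in its two orders, and only if the cluster
    of [o] contains a green vertex. *)
Lemma branch_count Y : uniq Y -> {subset Y <= X} ->
  \sum_(z <- Y) \sum_(v1 <- nb z) \sum_(v2 <- nb z | v1 != v2)
    EX nb p X (fun w => EG (fun g => (branch nb w o g z v1 v2)%:R)) <= 2 * B.
Proof.
move=> uY sY.
apply: (@le_trans _ _ (2 * EG (fun g => EX nb p X (fun w => (hit nb w g o)%:R)))); last first.
  by rewrite ler_wpM2l //; exact: hB.
rewrite (EE_exchange _ _ _ _ (fun g w => (hit nb w g o)%:R)) -EEZ.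
rewrite (_ : \sum_(z <- Y) _ = EX nb p X (fun w => EG (fun g =>
  \sum_(z <- Y) \sum_(v1 <- nb z) \sum_(v2 <- nb z | v1 != v2) (branch nb w o g z v1 v2)%:R))); last first.
  rewrite /EX; under [RHS]EE_ext => w _ do rewrite EE_sum.
  rewrite EE_sum; apply: eq_bigr => z _.
  under [RHS]EE_ext => w _ do rewrite EE_sum.
  rewrite EE_sum; apply: eq_bigr => v1 _.
  under [RHS]EE_ext => w _ do rewrite EE_sum.
  by rewrite EE_sum; apply: eq_bigr => v2 _.
apply: EE_le => // w _; rewrite -EEZ; apply: EE_le => // g _.
pose tr := [seq (z, e) | z <- Y, e <- [seq (v1, v2) | v1 <- nb z, v2 <- [seq v2 <- nb z | v1 != v2]]].
have utr : uniq tr.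
  apply: allpairs_uniq_dep => // [z _|[? ?] [? ?] _ _ /= [-> ->] //].
  apply: allpairs_uniq_dep => // [v1 _|[? ?] [? ?] _ _ /= [-> ->] //].
  exact: filter_uniq.
have -> : \sum_(z <- Y) \sum_(v1 <- nb z) \sum_(v2 <- nb z | v1 != v2) (branch nb w o g z v1 v2)%:R =
   \sum_(e <- tr) (branch nb w o g e.1 e.2.1 e.2.2)%:R :> R.
  rewrite big_allpairs_dep /=; apply: eq_bigr => z _.
  by rewrite big_allpairs_dep /=; apply: eq_bigr => v1 _; rewrite big_filter.
rewrite -natr_sum -natrM ler_nat.
pose br := [seq e <- tr | branch nb w o g e.1 e.2.1 e.2.2].
have -> : (\sum_(e <- tr) branch nb w o g e.1 e.2.1 e.2.2 = size br)%N.
  by rewrite /br size_filter -sum1_count [RHS]big_mkcond; apply: eq_bigr => e _; case: branch.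
have mtr e : e \in br -> [/\ adj nb e.1 e.2.1, adj nb e.1 e.2.2, e.2.1 != e.2.2 & branch nb w o g e.1 e.2.1 e.2.2].
  rewrite mem_filter => /andP[hb /allpairsPdep[z [v [_ hv ee]]]].
  move: hv => /allpairsPdep[v1 [v2 [h1]]]; rewrite mem_filter => /andP[h2 h3] ev.
  by move: hb; rewrite ee ev.
case ebr: br => [//|[z [v1 v2]] s].
have [|a1 a2 v12 hb] := mtr (z, (v1, v2)); first by rewrite ebr mem_head.
rewrite -ebr (branch_hit a1 hb) muln1.
apply: (@uniq_leq_size _ br [:: (z, (v1, v2)); (z, (v2, v1))]); first exact: filter_uniq.
move=> [z' [v1' v2']] he; have [b1 b2 v12' hb'] := mtr _ he.
have := branch_unique nbI a1 a2 b1 b2 v12' hb hb'; rewrite /= => -[-> [[-> ->]|[-> ->]]];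
  by rewrite !inE eqxx ?orbT.
Qed.

(** Summing [branch_lower] over the forks at vertices of [Y] against [branch_count]. With A and B
    close to M(h) and the cycle terms absorbed, the expectation of |C| (1-h)^|C| is at most a
    constant over M(h). As in [an_volume], the two volumes keep neighbours available. *)
Lemma branching_volume Y A : (2 < d)%N -> uniq Y -> {subset Y <= X} ->
  (forall u, u \in Y -> {subset nb u <= X}) -> p * B <= A -> A <= B ->
  (forall u v, u \in Y -> v \in nb u -> A <= EG (fun g => EX nb p X (fun w => (hit nb w g v)%:R))) ->
  p ^+ 2 * ((d%:R - 1) * (d%:R - 2)) * (A - p * B) ^+ 2 *
    (\sum_(z <- Y) EX nb p X (fun w => (cn nb w o z)%:R * (1 - h) ^+ csize nb X w o)) <=
  2 * B + (4 * p ^+ 2 * d%:R * (eta / pm) + eta) * (1 - p) ^- 2 * B ^+ 2 *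
    (\sum_(z <- X) EX nb p X (fun w => (cn nb w o z)%:R * (1 - h) ^+ csize nb X w o)).
Proof.
move=> d3 uY sYX nYX pBA AB hA; rewrite -/D -/c2.
rewrite (eq_bigr t) //.
have d1 : (1 < d)%N by apply: ltnW.
have dR : 0 <= d%:R :> R by [].
set A' := A - p * B; have A0 : 0 <= A' by rewrite subr_ge0.
have A'B : A' <= B by rewrite /A'; have := mulr_ge0 p0 B0; lra.
have eta0 : 0 <= eta by have := loops 0%N o; rewrite big_ord0.
set DY := \sum_(z <- Y) t z.
have DYD : DY <= D by apply: le_sum_subset.
have D0 : 0 <= D by apply: sumr_ge0.
have em : 0 <= eta / pm by rewrite divr_ge0 // ltW.
pose Q z v1 v2 := p ^+ 2 * (T z v1 v2 * A' ^+ 2 - B * (c2 * t z) * (q z v1 + q z v2) -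
   B * (cs z v1 + cs z v2)) - (c2 * t z) * (p ^+ 2 * cyc2_bound nb L p X B z v1 v2).
have step z v1 v2 : z \in Y -> v1 \in nb z -> v2 \in nb z -> v1 != v2 ->
    Q z v1 v2 <= EX nb p X (fun w => EG (fun g => (branch nb w o g z v1 v2)%:R)).
  move=> zY a1 a2 v12; have zX := sYX z zY; have v1X := nYX z zY _ a1; have v2X := nYX z zY _ a2.
  have i1 : v1 \in [:: v1; v2] by rewrite mem_head.
  have i2 : v2 \in [:: v1; v2] by rewrite !inE eqxx orbT.
  apply: le_trans (branch_lower zX v1X v2X a1 a2 v12).
  have m1 := arm_mass zX v1X a1 a2 i1 (hA z v1 zY a1).
  have m2 := arm_mass zX v2X a1 a2 i2 (hA z v2 zY a2).
  rewrite -/A' in m1 m2.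
  have n1 : 0 <= m z v1 v2 v1 by apply: EE_ge0 => // w _; apply: EE_ge0.
  have n2 : 0 <= m z v1 v2 v2 by apply: EE_ge0 => // w _; apply: EE_ge0.
  have r1 := cut_correction a1 a2 v12 i1 v1X.
  have r2 := cut_correction a1 a2 v12 i2 v2X.
  have hT := cut_le z a1 v12; rewrite -/(T z v1 v2) in hT.
  have hc : 0 <= cyc2_bound nb L p X B z v1 v2 by exact: cyc2_bound_ge0.
  have mm : A' ^+ 2 - B * (q z v1 + q z v2) <= m z v1 v2 v1 * m z v1 v2 v2.
    exact: mul_lower.
  rewrite /Q -[_ * (p ^+ 2 * _)]mulrCA -mulrBr ler_wpM2l ?exprn_ge0 //.
  have k1 := ler_wpM2l (T0 z v1 v2) mm.
  have k2 : T z v1 v2 * (B * (q z v1 + q z v2)) <= c2 * t z * (B * (q z v1 + q z v2)).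
    by rewrite ler_wpM2r // mulr_ge0 // addr_ge0.
  have k3 := ler_wpM2r hc hT.
  have k4 := ler_wpM2r B0 r1; have k5 := ler_wpM2r B0 r2.
  have e1 : T z v1 v2 * (A' ^+ 2 - B * (q z v1 + q z v2)) =
     T z v1 v2 * A' ^+ 2 - T z v1 v2 * (B * (q z v1 + q z v2)) by ring.
  have e2 : B * (c2 * t z) * (q z v1 + q z v2) = c2 * t z * (B * (q z v1 + q z v2)) by ring.
  have e3 : B * (cs z v1 + cs z v2) = cs z v1 * B + cs z v2 * B by ring.
  lra.
have dbl z (F : V -> R) : (forall v, 0 <= F v) ->
    \sum_(v1 <- nb z) \sum_(v2 <- nb z | v1 != v2) (F v1 + F v2) <= 2 * d%:R * \sum_(v <- nb z) F v.
  move=> F0; apply: le_trans (_ : \sum_(v1 <- nb z) \sum_(v2 <- nb z) (F v1 + F v2) <= _).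
    apply: ler_sum => v1 _; rewrite big_mkcond; apply: ler_sum => v2 _.
    by case: ifP => // _; rewrite addr_ge0.
  under eq_bigr => v1 _ do rewrite big_split /= sum_seq_cst nbd.
  by rewrite big_split /= -mulr_sumr sum_seq_cst nbd le_eqVlt; apply/orP; left; apply/eqP; ring.
have up : \sum_(z <- Y) \sum_(v1 <- nb z) \sum_(v2 <- nb z | v1 != v2) Q z v1 v2 <= 2 * B.
  apply: le_trans (branch_count uY sYX); rewrite big_seq [leRHS]big_seq; apply: ler_sum => z zY.
  rewrite big_seq [leRHS]big_seq; apply: ler_sum => v1 h1.
  rewrite big_seq_cond [leRHS]big_seq_cond; apply: ler_sum => v2 /andP[h2 h12].
  exact: step.
pose G z := p ^+ 2 * A' ^+ 2 * ((d%:R - 1) * (d%:R - 2)) * t z -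
   (2 * p ^+ 2 * d%:R * (eta / pm) + eta) * c2 * B ^+ 2 * t z -
   2 * p ^+ 2 * d%:R * B * \sum_(v <- nb z) cs z v.
have low z : z \in Y -> G z <= \sum_(v1 <- nb z) \sum_(v2 <- nb z | v1 != v2) Q z v1 v2.
  move=> zY; have zX := sYX z zY.
  rewrite (_ : \sum_(v1 <- nb z) _ = p ^+ 2 * A' ^+ 2 * (\sum_(v1 <- nb z) \sum_(v2 <- nb z | v1 != v2) T z v1 v2) -
     p ^+ 2 * B * (c2 * t z) * (\sum_(v1 <- nb z) \sum_(v2 <- nb z | v1 != v2) (q z v1 + q z v2)) -
     p ^+ 2 * B * (\sum_(v1 <- nb z) \sum_(v2 <- nb z | v1 != v2) (cs z v1 + cs z v2)) -
     c2 * t z * (p ^+ 2 * \sum_(v1 <- nb z) \sum_(v2 <- nb z | v1 != v2) cyc2_bound nb L p X B z v1 v2)); last first.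
    rewrite !mulr_sumr -!sumrB; apply: eq_bigr => v1 _; rewrite !mulr_sumr -!sumrB; apply: eq_bigr => v2 _.
    rewrite /Q; ring.
  have k1 := ler_wpM2l (_ : 0 <= p ^+ 2 * A' ^+ 2) (exit_pairs z d1).
  have {}k1 := k1 (mulr_ge0 (exprn_ge0 2 p0) (exprn_ge0 2 A0)).
  have k2 := ler_wpM2l (_ : 0 <= p ^+ 2 * B * (c2 * t z)) (dbl z (q z) (q0 z)).
  have {}k2 := k2 (mulr_ge0 (mulr_ge0 (exprn_ge0 2 p0) B0) (mulr_ge0 c20 (t0 z))).
  have k2' := ler_wpM2l (_ : 0 <= p ^+ 2 * B * (c2 * t z) * (2 * d%:R)) (q_total zX).
  have {}k2' := k2' (mulr_ge0 (mulr_ge0 (mulr_ge0 (exprn_ge0 2 p0) B0) (mulr_ge0 c20 (t0 z))) (mulr_ge0 (ler0n _ 2) dR)).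
  have k3 := ler_wpM2l (_ : 0 <= p ^+ 2 * B) (dbl z (cs z) (cs0 z)).
  have {}k3 := k3 (mulr_ge0 (exprn_ge0 2 p0) B0).
  have k4 := ler_wpM2l (_ : 0 <= c2 * t z) (cyc2_total nbU X hp B0 pm0 ppm loops z).
  have {}k4 := k4 (mulr_ge0 c20 (t0 z)).
  have k5 : p ^+ 2 * \sum_(v1 <- nb z) \sum_(v2 <- nb z | v1 != v2) cyc2_bound nb L p X B z v1 v2 <=
      p ^+ 2 * \sum_(v1 <- nb z) \sum_(v2 <- nb z) cyc2_bound nb L p X B z v1 v2.
    rewrite ler_wpM2l ?exprn_ge0 //; apply: ler_sum => v1 _; rewrite big_mkcond; apply: ler_sum => v2 _.
    by case: ifP => // _; exact: cyc2_bound_ge0.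
  have {}k5 := ler_wpM2l (mulr_ge0 c20 (t0 z)) k5.
  rewrite /G; move: k1 k2 k2' k3 k4 k5.
  move: (\sum_(v1 <- nb z) \sum_(v2 <- nb z | v1 != v2) T z v1 v2) => x1.
  move: (\sum_(v1 <- nb z) \sum_(v2 <- nb z | v1 != v2) (q z v1 + q z v2)) => x2.
  move: (\sum_(v1 <- nb z) \sum_(v2 <- nb z | v1 != v2) (cs z v1 + cs z v2)) => x3.
  move: (\sum_(v1 <- nb z) \sum_(v2 <- nb z | v1 != v2) cyc2_bound nb L p X B z v1 v2) => x4.
  move: (\sum_(v1 <- nb z) \sum_(v2 <- nb z) cyc2_bound nb L p X B z v1 v2) => x5.
  move: (\sum_(v <- nb z) q z v) (\sum_(v <- nb z) cs z v) (eta / pm) (t z) c2 => x6 x7 x8 x9 x10.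
  lra.
have {}low : \sum_(z <- Y) G z <= 2 * B.
  by apply: le_trans up; rewrite big_seq [leRHS]big_seq; apply: ler_sum.
have csY : \sum_(z <- Y) \sum_(v <- nb z) cs z v <= B * (eta / pm) * (c2 * D).
  apply: le_trans cs_total; rewrite (sum_opairs nb X cs).
  rewrite (eq_big_seq (fun z => \sum_(v <- nb z | v \in X) cs z v)); last first.
    move=> z zY; rewrite big_seq [RHS]big_seq_cond; apply: eq_bigl => v.
    by case: (boolP (v \in nb z)) => // /(nYX z zY) ->.
  by apply: le_sum_subset => // z; apply: sumr_ge0.
have GE : \sum_(z <- Y) G z = p ^+ 2 * A' ^+ 2 * ((d%:R - 1) * (d%:R - 2)) * DY -
   (2 * p ^+ 2 * d%:R * (eta / pm) + eta) * c2 * B ^+ 2 * DY -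
   2 * p ^+ 2 * d%:R * B * \sum_(z <- Y) \sum_(v <- nb z) cs z v.
  by rewrite /G /DY !sumrB -!mulr_sumr.
rewrite GE in low.
have k1 := ler_wpM2l (_ : 0 <= 2 * p ^+ 2 * d%:R * B) csY.
have {}k1 := k1 (mulr_ge0 (mulr_ge0 (mulr_ge0 (ler0n _ 2) (exprn_ge0 2 p0)) dR) B0).
have k2 := ler_wpM2l (_ : 0 <= (2 * p ^+ 2 * d%:R * (eta / pm) + eta) * c2 * B ^+ 2) DYD.
have {}k2 : (2 * p ^+ 2 * d%:R * (eta / pm) + eta) * c2 * B ^+ 2 * DY <=
  (2 * p ^+ 2 * d%:R * (eta / pm) + eta) * c2 * B ^+ 2 * D.
  apply: k2; rewrite mulr_ge0 ?exprn_ge0 // mulr_ge0 // addr_ge0 //; apply: mulr_ge0 => //.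
  by rewrite !mulr_ge0 ?exprn_ge0.
move: low k1 k2; move: (\sum_(z <- Y) _) (eta / pm) c2 => x1 x2 x3; lra.
Qed.

End Branching.

(** * Bounds for the probability that a cluster of given size contains a green vertex *)

Section PowerBounds.
Context {R : realType}.
Implicit Types (h k a b : R) (n : nat).

(** The probability that n vertices, green independently with probability [h], include a green
    one. *)
Definition fg h n : R := 1 - (1 - h) ^+ n.

Lemma fg_ge0 h n : 0 <= h <= 1 -> 0 <= fg h n.
Proof. by move=> /andP[h0 h1]; rewrite subr_ge0 exprn_ile1 // ?subr_ge0 // gerBl. Qed.

Lemma fg_le1 h n : 0 <= h <= 1 -> fg h n <= 1.
Proof. by move=> /andP[h0 h1]; rewrite gerBl exprn_ge0 // subr_ge0. Qed.

Lemma fg_homo h : 0 <= h <= 1 -> {homo fg h : m n / (m <= n)%N >-> m <= n}.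
Proof.
by move=> /andP[h0 h1] m n mn; rewrite lerD2l lerN2; apply: ler_wiXn2l; rewrite ?subr_ge0 // gerBl.
Qed.

Lemma fg_linear h n : 0 <= h <= 1 -> fg h n <= h * n%:R.
Proof.
move=> hh; have /andP[h0 h1] := hh; elim: n => [|n IH]; first by rewrite /fg expr0 subrr mulr0.
have := fg_le1 n hh; rewrite /fg in IH *; have -> : n.+1%:R = n%:R + 1 :> R by rewrite natr1.
rewrite exprS mulrDr mulr1 => f1.
have h2 : 0 <= h * (1 - (1 - h) ^+ n) <= h.
  have := fg_ge0 n hh; rewrite /fg => f0; apply/andP; split; nra.
have e : 1 - (1 - h) * (1 - h) ^+ n = (1 - (1 - h) ^+ n) + h * (1 - h) ^+ n by ring.
rewrite e; nra.
Qed.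

Lemma fg_double h n : 0 <= h -> 2 * h <= 1 -> fg (2 * h) n <= 2 * fg h n.
Proof.
move=> h0 h1; rewrite /fg; elim: n => [|n IH]; first by rewrite !expr0; lra.
have a1 : (1 - h) ^+ n <= 1 by apply: exprn_ile1; lra.
rewrite !exprS; nra.
Qed.

Lemma fg_diff k n : 0 <= k -> 2 * k <= 1 ->
  (1 - k) * (fg (2 * k) n - fg k n) <= k * (n%:R * (1 - k) ^+ n).
Proof.
move=> k0 k1; have e : fg (2 * k) n - fg k n = (1 - k) ^+ n - (1 - 2 * k) ^+ n by rewrite /fg; ring.
rewrite e; elim: n {e} => [|n IH]; first by rewrite !expr0 subrr mul0r !mulr0.
have b0 : 0 <= (1 - 2 * k) ^+ n by apply: exprn_ge0; lra.
have ab : (1 - 2 * k) ^+ n <= (1 - k) ^+ n by apply: lerXn2r; rewrite ?nnegrE; lra.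
have -> : n.+1%:R = n%:R + 1 :> R by rewrite natr1.
rewrite !exprS; set a := (1 - k) ^+ n in IH ab *; set b := (1 - 2 * k) ^+ n in IH b0 ab *.
have -> : (1 - k) * ((1 - k) * a - (1 - 2 * k) * b) = (1 - k) * ((1 - k) * (a - b)) + (1 - k) * k * b by ring.
have -> : k * ((n%:R + 1) * ((1 - k) * a)) = (1 - k) * (k * (n%:R * a)) + (1 - k) * k * a by ring.
apply: lerD; first by apply: ler_wpM2l => //; lra.
by apply: ler_wpM2l => //; apply: mulr_ge0; lra.
Qed.

End PowerBounds.

(** Here B = M(k), m = M(2k), and D is the mean of |C| (1-k)^|C| in the large volume. Since (99/100
    - 6/10)^2 >= 15/100 and the correction takes away at most 5/100, one gets P B D/10 <= 2 up to
    [dl], hence B D <= 20/P. The factor 1-k >= 1/2 doubles this to 40. *)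
Lemma mag_step_arith (R : realType) (P ka B D DY dl k m p cc : R) : 0 < cc -> cc <= P -> ka <= P / 20 ->
  0 < B -> B <= 1 -> 0 <= D -> 0 <= DY -> 0 < dl -> 0 < k -> 2 * k <= 1 -> p <= 6 / 10 ->
  P * (99 / 100 * B - p * B) ^+ 2 * DY <= 2 * B + ka * B ^+ 2 * D ->
  D - DY <= dl -> (1 - k) * (m - dl - B) <= k * D ->
  (m - B) * B <= 40 / cc * k + 3 * dl.
Proof.
move=> cc1 ccp1 corr1 B0 B1 D0 DY0 dl0 k0 k1 p6 main DYD Dlow.
have P0 : 0 < P by exact: lt_le_trans ccp1.
have m1 : P * (15 / 100 * B ^+ 2) * DY <= P * (99 / 100 * B - p * B) ^+ 2 * DY.
  apply: ler_wpM2r => //; apply: ler_wpM2l; first exact: ltW.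
  have : 39 / 100 * B <= 99 / 100 * B - p * B.
    have : p * B <= 6 / 10 * B by apply: ler_wpM2r => //; exact: ltW.
    lra.
  move=> hh; have b39 : 0 <= 39 / 100 * B by lra.
  have bA := le_trans b39 hh.
  apply: le_trans (_ : (39 / 100 * B) ^+ 2 <= _); first by rewrite (_ : (39 / 100 * B) ^+ 2 = 1521 / 10000 * B ^+ 2); [have := sqr_ge0 B; lra|field].
  by apply: lerXn2r; rewrite ?nnegrE.
have m2 : ka * B ^+ 2 * D <= P / 20 * B ^+ 2 * D by rewrite ler_wpM2r // ler_wpM2r // exprn_ge0 // ltW.
have m3 : P * (15 / 100 * B ^+ 2) * (D - dl) <= P * (15 / 100 * B ^+ 2) * DY.
  apply: ler_wpM2l; last lra.
  apply: mulr_ge0; first exact: ltW.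
  by have := sqr_ge0 B; lra.
have m4 : B * (P / 10 * B * D) <= B * (2 + 15 / 100 * P * B * dl).
  have -> : B * (P / 10 * B * D) = P * (15 / 100 * B ^+ 2) * D - P / 20 * B ^+ 2 * D by field.
  have -> : B * (2 + 15 / 100 * P * B * dl) = 2 * B + P * (15 / 100 * B ^+ 2) * dl by field.
  have e1 : P * (15 / 100 * B ^+ 2) * (D - dl) = P * (15 / 100 * B ^+ 2) * D - P * (15 / 100 * B ^+ 2) * dl by ring.
  lra.
rewrite ler_pM2l // in m4.
have kc : 0 <= 40 / cc * k by rewrite mulr_ge0 ?divr_ge0 //; lra.
set G := m - B.
have Ge : G - dl = m - dl - B by rewrite /G; ring.
have [Gle|Ggt] := leP G dl.
  have : G * B <= dl by apply: le_trans (_ : dl * B <= _); [rewrite ler_wpM2r // ltW|rewrite ler_piMr // ltW].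
  lra.
rewrite -Ge in Dlow.
have m5 : (G - dl) / 2 <= k * D.
  apply: le_trans Dlow; rewrite mulrC; apply: ler_wpM2r; lra.
have PB0 : 0 <= P / 10 * B by apply: mulr_ge0; lra.
have m6 := ler_wpM2l PB0 m5.
have m7 := ler_wpM2l (ltW k0) m4.
have m8 : B * (G - dl) * P <= (40 / P * k + 3 * k * B * dl) * P.
  have -> : (40 / P * k + 3 * k * B * dl) * P = 20 * (k * (2 + 15 / 100 * P * B * dl)).
    by field; rewrite gt_eqF.
  have e1 : B * (G - dl) * P = 20 * (P / 10 * B * ((G - dl) / 2)) by field.
  have e2 : P / 10 * B * (k * D) = k * (P / 10 * B * D) by ring.
  lra.
rewrite ler_pM2r // in m8.
have m9 : 40 / P * k <= 40 / cc * k.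
  apply: ler_wpM2r; first exact: ltW.
  by apply: ler_wpM2l; [lra|rewrite lef_pV2 ?posrE].
have m10 : 3 * k * B * dl <= 3 / 2 * dl.
  by apply: ler_wpM2r; [lra|nra].
have m11 : B * dl <= dl by rewrite ler_piMl // ltW.
have e3 : B * (G - dl) = G * B - B * dl by ring.
lra.
Qed.

(** * The square-root bound for the magnetization below p_c *)

Section Magnetization.
Context {R : realType} {V : countType}.
Variables (nb : V -> seq V) (d : nat).
Hypothesis nbU : forall x, uniq (nb x).
Hypothesis nbI : forall x, x \notin nb x.
Hypothesis nbC : forall x y, adj nb x y = adj nb y x.
Hypothesis nbd : forall x, size (nb x) = d.
Variable L : nat.
Hypothesis nbL : girth_ge nb L.
Hypothesis L0 : (0 < L)%N.
Hypothesis nbT : transitive_graph nb.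
Implicit Types (X Y : seq V) (w : V * V -> bool) (x y z u t v : V) (i j n : nat).
Variables (o : V) (p : R).
Hypothesis hp : 0 <= p <= 1.

Definition magX h X v : R := EX nb p X (fun w => fg h (csize nb X w v)).

Definition mag h : R := sup [set x | exists X : seq V, [/\ uniq X, o \in X & x = magX h X o]].

Lemma magX_vol h X Y v : 0 <= h <= 1 -> uniq X -> uniq Y -> {subset X <= Y} -> v \in X ->
  magX h X v <= magX h Y v.
Proof. by move=> hh uX uY s vX; apply: EX_csize_mono => //; exact: fg_homo. Qed.

Let hs h : 0 <= h <= 1 -> has_sup [set x | exists X : seq V, [/\ uniq X, o \in X & x = magX h X o]].
Proof.
move=> hh; split; first by exists (magX h [:: o] o), [:: o]; rewrite mem_head.
exists 1 => _ [X [uX oX ->]]; apply: EE_le_cst => // w _; exact: fg_le1.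
Qed.

Lemma magX_le h X v : 0 <= h <= 1 -> uniq X -> v \in X -> magX h X v <= mag h.
Proof.
move=> hh uX vX; have [Y [uY oY hY]] := csize_transport (R := R) o nbU nbI nbC nbT uX vX.
rewrite /magX hY; apply: sup_upper_bound (hs hh) _ _; by exists Y.
Qed.

Lemma mag_le h (C : R) : 0 <= h <= 1 -> (forall X, uniq X -> o \in X -> magX h X o <= C) -> mag h <= C.
Proof.
by move=> hh hC; apply: ge_sup; [case: (hs hh)|move=> _ [X [uX oX ->]]; exact: hC].
Qed.

Lemma mag_adherent h (e : R) : 0 <= h <= 1 -> 0 < e ->
  exists Y : seq V, [/\ uniq Y, o \in Y & mag h - e <= magX h Y o].
Proof.
move=> hh e0; have [_ [X [uX oX ->]] he] := sup_adherent e0 (hs hh).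
by exists X; split=> //; exact: ltW.
Qed.

Lemma mag_ge h : 0 <= h <= 1 -> h <= mag h.
Proof.
move=> hh; apply: le_trans (magX_le hh (isT : uniq [:: o]) (mem_head _ _)).
rewrite -[leLHS](EE_cst p (E nb [:: o])); apply: EE_le => // w hw.
apply: le_trans (_ : fg h 1 <= _); first by rewrite /fg expr1; lra.
apply: fg_homo => //; rewrite lt0n size_eq0; apply/eqP => e.
by have := mem_clus nbI nbC o hw (mem_head o [::]); rewrite e cn_refl.
Qed.

Lemma mag_ge0 h : 0 <= h <= 1 -> 0 <= mag h.
Proof. by move=> hh; apply: le_trans (mag_ge hh); case/andP: hh. Qed.

Lemma mag_le1 h : 0 <= h <= 1 -> mag h <= 1.
Proof.
by move=> hh; apply: mag_le => // X uX oX; apply: EE_le_cst => // w _; exact: fg_le1.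
Qed.

Lemma ghost_magX h X v : 0 <= h <= 1 -> uniq X -> v \in X ->
  EE h X (fun g => EX nb p X (fun w => (hit nb w g v)%:R)) = magX h X v.
Proof.
move=> hh uX vX; rewrite (EE_exchange _ _ _ _ (fun g w => (hit nb w g v)%:R)); apply: EE_ext => w hw.
rewrite /fg -(EE_none hh uX (C := clus nb X w v)) ?filter_uniq //; last first.
  by move=> x; rewrite mem_filter => /andP[].
rewrite -[X in X - _](EE_cst h X) -EEB; apply: EE_ext => g _; rewrite (hit_has nbI nbC g hw vX).
by case: has; rewrite ?subr0 ?subrr.
Qed.

Variable Bchi : R.
Hypothesis hchi : chi_le nb p Bchi.

Lemma mag_linear h : 0 <= h <= 1 -> mag h <= h * Bchi.
Proof.
move=> hh; have /andP[h0 h1] := hh; apply: mag_le => // X uX oX.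
apply: le_trans (_ : EX nb p X (fun w => h * (csize nb X w o)%:R) <= _).
  by apply: EE_le => // w _; exact: fg_linear.
by rewrite /EX EEZ ler_wpM2l //; exact: hchi.
Qed.

Variables (pm eta cc : R).
Hypothesis pm0 : 0 < pm.
Hypothesis ppm : p <= pm.
Hypothesis loops : forall K z,
  \sum_(n < K | (L <= n)%N) (n ^ 2)%:R * pm ^+ n * nbc nb None n z z <= eta.
Hypothesis d3 : (2 < d)%N.
Hypothesis p6 : p <= 6 / 10.
Hypothesis cc0 : 0 < cc.
Hypothesis ccp : cc <= p ^+ 2 * ((d%:R - 1) * (d%:R - 2)).
Hypothesis corr_small : (4 * p ^+ 2 * d%:R * (eta / pm) + eta) * (1 - p) ^- 2 <=
   p ^+ 2 * ((d%:R - 1) * (d%:R - 2)) / 20.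

(** The increment M(2k) - M(k) is at most of order k E[|C| (1-k)^|C|] by [fg_diff], and
    [branching_volume] bounds this expectation by a constant over M(k). *)
Lemma mag_step k : 0 < k -> 2 * k <= 1 -> (mag (2 * k) - mag k) * mag k <= 40 / cc * k.
Proof.
move=> k0 k1; have hk : 0 <= k <= 1 by lra.
have h2k : 0 <= 2 * k <= 1 by lra.
have [pl1 pl6 cc1 ccp1 corr1] : [/\ p < 1, p <= 6 / 10, 0 < cc, cc <= p ^+ 2 * ((d%:R - 1) * (d%:R - 2)) &
   (4 * p ^+ 2 * d%:R * (eta / pm) + eta) * (1 - p) ^- 2 <= p ^+ 2 * ((d%:R - 1) * (d%:R - 2)) / 20].
  by split=> //; apply: le_lt_trans p6 _; lra.
set B := mag k; have B0 : 0 < B by apply: lt_le_trans k0 (mag_ge hk).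
have B1 : B <= 1 by exact: mag_le1.
apply/ler_addgt0Pr => e e0; pose dl := e / 3.
have dl0 : 0 < dl by rewrite /dl; lra.
have B100 : 0 < B / 100 by lra.
(* Nearly optimal volumes for M(k), M(2k) and the susceptibility. The last one makes the part of D
   coming from vertices outside [Y] at most [dl]. *)
have [Y1 [uY1 oY1 hY1]] := mag_adherent hk B100.
have [Y2 [uY2 oY2 hY2]] := mag_adherent h2k dl0.
have [Y3 [uY3 oY3 hY3]] := chiR_adherent o hchi dl0.
pose Y := undup (Y1 ++ Y2 ++ Y3).
have uY : uniq Y by exact: undup_uniq.
have s1 : {subset Y1 <= Y} by move=> x hx; rewrite mem_undup mem_cat hx.
have s2 : {subset Y2 <= Y} by move=> x hx; rewrite mem_undup !mem_cat hx orbT.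
have s3 : {subset Y3 <= Y} by move=> x hx; rewrite mem_undup !mem_cat hx !orbT.
have oY := s1 _ oY1.
have {}hY1 := le_trans hY1 (magX_vol hk uY1 uY s1 oY1).
rewrite -/B in hY1.
have {}hY2 := le_trans hY2 (magX_vol h2k uY2 uY s2 oY2).
have {}hY3 : chiR nb o p - dl <= EX nb p Y (fun w => (csize nb Y w o)%:R).
  apply: le_trans hY3 _; apply: (EX_csize_mono nbU nbI nbC (phi := fun k => k%:R)) => //.
  by move=> m n mn; rewrite ler_nat.
have [X [uX sYX nYX hX]] := transitive_hull (R := R) nbU nbI nbC nbT uY oY.
have oX := sYX _ oY.
have hB x : x \in X -> EE k X (fun g => EX nb p X (fun w => (hit nb w g x)%:R)) <= B.
  by move=> xX; rewrite ghost_magX //; exact: magX_le.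
pose A := 99 / 100 * B.
have pBA : p * B <= A by rewrite /A; nra.
have AB : A <= B by rewrite /A; lra.
have hA u v : u \in Y -> v \in nb u -> A <= EE k X (fun g => EX nb p X (fun w => (hit nb w g v)%:R)).
  move=> hu hv; rewrite ghost_magX //; last exact: nYX hv.
  apply: le_trans (hX p (fg k) u v hp (fg_homo hk) hu hv); rewrite -/(magX k Y o) /A; lra.
have := branching_volume nbU nbI nbC nbd nbL L0 hp pl1 hk uX oX hB pm0 ppm loops d3 uY sYX nYX pBA AB hA.
set DY := \sum_(z <- Y) _; set D := \sum_(z <- X) _ => main.
pose N w : R := (csize nb X w o)%:R * (1 - k) ^+ csize nb X w o.
have DE : D = EX nb p X N.
  by rewrite /D -EE_sum; apply: EE_ext => w _; rewrite /N csizeE natr_sum mulr_suml.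
have DYD : D - DY <= dl.
  pose F z := EX nb p X (fun w => (cn nb w o z)%:R * (1 - k) ^+ csize nb X w o).
  pose G z := EX nb p X (fun w => (cn nb w o z)%:R).
  have FG z : F z <= G z.
    apply: EE_le => // w _; rewrite ler_piMr // exprn_ile1 //; lra.
  have spl (H : V -> R) : \sum_(z <- X) H z = \sum_(z <- Y) H z + \sum_(z <- X | z \notin Y) H z.
    rewrite (bigID (fun z => z \in Y)) /=; congr (_ + _); rewrite -big_filter; apply: perm_big.
    apply: uniq_perm; rewrite ?filter_uniq // => x; rewrite mem_filter.
    by case: (boolP (x \in Y)) => //= /sYX ->.
  rewrite /D /DY -/F (spl F) addrAC subrr add0r.
  apply: le_trans (_ : \sum_(z <- X | z \notin Y) G z <= _); first by apply: ler_sum.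
  have := spl G; rewrite -EX_csizeE // => e1.
  have c1 : EX nb p X (fun w => (csize nb X w o)%:R) <= chiR nb o p.
    exact: (chi_le_chiR nbU nbI nbC nbT o hchi uX oX).
  have c2 : EX nb p Y (fun w => (csize nb Y w o)%:R) <= \sum_(z <- Y) G z.
    by rewrite EX_csizeE //; apply: ler_sum => z _; apply: EX_mono_vol => //; exact: incr_cn.
  lra.
have Dlow : (1 - k) * (mag (2 * k) - dl - B) <= k * D.
  apply: le_trans (_ : (1 - k) * (magX (2 * k) X o - magX k X o) <= _).
    apply: ler_wpM2l; first lra.
    have := magX_vol h2k uY uX sYX oY; have := magX_le hk uX oX; rewrite -/B; lra.
  rewrite DE -[in leRHS]EEZ /magX /EX -EEB -EEZ; apply: EE_le => // w _.
  by apply: fg_diff; lra.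
have D0 : 0 <= D by apply: sumr_ge0 => z _; apply: EE_ge0 => // w _; rewrite mulr_ge0 // exprn_ge0 // subr_ge0; case/andP: hk.
have DY0 : 0 <= DY by apply: sumr_ge0 => z _; apply: EE_ge0 => // w _; rewrite mulr_ge0 // exprn_ge0 // subr_ge0; case/andP: hk.
have -> : e = 3 * dl by rewrite /dl mulrC divfK.
exact: (mag_step_arith cc1 ccp1 corr1 B0 B1 D0 DY0 dl0 k0 k1 pl6 main DYD Dlow).
Qed.

(** As M(2k) <= 2 M(k), the difference of squares is at most 3 M(k) (M(2k) - M(k)) when it is
    positive. *)
Lemma mag_sqr k : 0 < k -> 2 * k <= 1 -> mag (2 * k) ^+ 2 <= mag k ^+ 2 + 120 / cc * k.
Proof.
move=> k0 k1; have hk : 0 <= k <= 1 by lra.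
have B0 : 0 < mag k by apply: lt_le_trans k0 (mag_ge hk).
have dbl : mag (2 * k) <= 2 * mag k.
  apply: mag_le; first by lra.
  move=> X uX oX; apply: le_trans (_ : EX nb p X (fun w => 2 * fg k (csize nb X w o)) <= _).
    by apply: EE_le => // w _; apply: fg_double => //; exact: ltW.
  by rewrite /EX EEZ ler_wpM2l //; exact: magX_le.
have st := mag_step k0 k1.
have cc1 := cc0; have kc : 0 <= 40 / cc * k by rewrite mulr_ge0 ?divr_ge0 // ltW.
have -> : 120 / cc * k = 3 * (40 / cc * k) by ring.
have [G0|G0] := leP (mag (2 * k)) (mag k).
  have := mag_ge0 (_ : 0 <= 2 * k <= 1) => h0; have {}h0 := h0 (ltac:(lra)); nra.
nra.
Qed.

(** Telescope [mag_sqr] over h/2^n; the increments sum to at most 120 h/cc. Below p_c the starting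
    term M(h/2^n) <= h Bchi/2^n tends to zero, and [Bchi] does not enter the final bound. *)
Lemma mag_sqrt h : 0 <= h <= 1 -> mag h ^+ 2 <= 120 / cc * h.
Proof.
move=> hh; have /andP[h0 h1] := hh; have cc1 := cc0.
have C0 : 0 <= 120 / cc by rewrite divr_ge0 // ltW.
have [e|ne] := eqVneq h 0.
  rewrite e mulr0; have := mag_linear (_ : 0 <= (0 : R) <= 1); rewrite lexx ler01 mul0r => /(_ isT) m0.
  have := mag_ge0 (_ : 0 <= (0 : R) <= 1); rewrite lexx ler01 => /(_ isT) m1.
  have -> : mag 0 = 0 by apply/eqP; rewrite eq_le m0 m1.
  by rewrite expr2 mul0r.
have hpos : 0 < h by rewrite lt_neqAle eq_sym ne.
have it n : mag h ^+ 2 <= mag (h / 2 ^+ n) ^+ 2 + 120 / cc * (h - h / 2 ^+ n).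
  elim: n => [|n IH]; first by rewrite expr0 divr1 subrr mulr0 addr0.
  have pw : 0 < (2 : R) ^+ n.+1 by rewrite exprn_gt0.
  have e2 : h / 2 ^+ n = 2 * (h / 2 ^+ n.+1).
    by rewrite exprS; field; rewrite gt_eqF // exprn_gt0.
  have k0 : 0 < h / 2 ^+ n.+1 by rewrite divr_gt0.
  have k1 : 2 * (h / 2 ^+ n.+1) <= 1.
    by rewrite -e2 ler_pdivrMr ?exprn_gt0 // mul1r; apply: le_trans h1 _; apply: exprn_ege1; lra.
  rewrite e2 in IH; move: IH (mag_sqr k0 k1); move: (h / 2 ^+ n.+1) => k'.
  move: (mag _ ^+ 2) (mag _ ^+ 2) (mag _ ^+ 2) => a b c h1' h2'; nra.
apply/ler_addgt0Pr => e e0.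
have [n hn] := natr_archi ((h * Bchi) ^+ 2 / e).
have n2 : n.+1%:R <= (2 : R) ^+ n by rewrite -natrX ler_nat; exact: ltn_expl.
apply: le_trans (it n) _.
have pw : 1 <= (2 : R) ^+ n by apply: exprn_ege1; lra.
have q01 : 0 <= h / 2 ^+ n <= 1.
  have pw0 : 0 < (2 : R) ^+ n by exact: lt_le_trans pw.
  by rewrite divr_ge0 ?(ltW pw0) //= ler_pdivrMr // mul1r (le_trans h1).
have ml := mag_linear q01; have m0 := mag_ge0 q01.
have s1 : mag (h / 2 ^+ n) ^+ 2 <= (h / 2 ^+ n * Bchi) ^+ 2 by apply: lerXn2r; rewrite ?nnegrE // (le_trans m0).
have s2 : (h / 2 ^+ n * Bchi) ^+ 2 <= e.
  have -> : (h / 2 ^+ n * Bchi) ^+ 2 = (h * Bchi) ^+ 2 / (2 ^+ n) ^+ 2.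
    by field; rewrite gt_eqF //; lra.
  rewrite ler_pdivrMr; last by rewrite exprn_gt0 //; lra.
  rewrite ltr_pdivrMr // in hn; apply: le_trans (ltW hn) _.
  rewrite mulrC ler_wpM2l ?(ltW e0) //.
  apply: le_trans (_ : n.+1%:R <= _); first by rewrite ler_nat.
  by apply: le_trans n2 _; rewrite expr2 ler_peMr //; lra.
have s3 : 120 / cc * (h - h / 2 ^+ n) <= 120 / cc * h.
  by rewrite ler_wpM2l // gerBl; case/andP: q01.
lra.
Qed.

End Magnetization.

                           

(** (1-h)^n (1+hn) <= 1, so [fg h n] is at least x/(1+x) with x = hn, hence at least half of
    min(1,x). *)
Lemma min_le_fg (R : realType) (h : R) n : 0 <= h <= 1 -> Num.min 1 (h * n%:R) <= 2 * fg h n.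
Proof.
move=> hh; have /andP[h0 h1] := hh.
have key m : (1 - h) ^+ m * (1 + h * m%:R) <= 1.
  elim: m => [|m IH]; first by rewrite expr0 mulr0; lra.
  have a0 : 0 <= (1 - h) ^+ m by apply: exprn_ge0; lra.
  apply: le_trans IH; have -> : m.+1%:R = m%:R + 1 :> R by rewrite natr1.
  have m0 : 0 <= m%:R :> R by [].
  rewrite exprS (mulrC (1 - h)) -mulrA; apply: ler_wpM2l => //; nra.
have x0 : 0 <= h * n%:R by rewrite mulr_ge0.
have := key n; have := fg_le1 n hh; have := fg_ge0 n hh; rewrite /fg.
set a := (1 - h) ^+ n; set x := h * n%:R in x0 *; rewrite minElt => f0 f1 k.
by case: ltP => hx; nra.
Qed.

Lemma sqrtr_le_of_sqr (R : realType) (a b : R) : 0 <= a -> a ^+ 2 <= b -> a <= Num.sqrt b.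
Proof. by move=> a0 ab; rewrite -(ger0_norm a0) -sqrtr_sqr ler_wsqrtr. Qed.

(** * From the critical magnetization bound to the three exponents *)

Section Exponents.
Context {R : realType} {V : countType}.
Variables (nb : V -> seq V) (d : nat) (o : V).
Hypothesis nbU : forall x, uniq (nb x).
Hypothesis nbI : forall x, x \notin nb x.
Hypothesis nbC : forall x y, adj nb x y = adj nb y x.
Hypothesis nbd : forall x, size (nb x) = d.
Hypothesis nbT : transitive_graph nb.
Hypothesis nbconn : graph_connected nb.
Hypothesis d0 : (0 < d)%N.
Implicit Types (X Y : seq V) (w : V * V -> bool) (x y z u t v : V) (i j k l n : nat) (p q h : R).

Local Notation ball := (Defs.ball nb o).
Let pc : R := p_c nb o.
Hypothesis pc0 : 0 < pc.
Hypothesis pc6 : pc <= 6 / 10.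
Hypothesis hr : exists r : R, 0 <= r <= 1 /\ 0 < Pinf nb o r.

Lemma tail_le p k X v : 0 <= p <= 1 -> uniq X -> v \in X ->
  EX nb p X (fun w => (k <= csize nb X w v)%N%:R) <= cluster_tail nb o p k.
Proof.
move=> hp uX vX; have [Y [uY oY hY]] := csize_transport (R := R) o nbU nbI nbC nbT uX vX.
rewrite (hY p (fun n => (k <= n)%N%:R)); have [n hn] := ball_exhaust o Y nbconn.
apply: le_trans (EX_csize_mono nbU nbI nbC (phi := fun n => (k <= n)%N%:R) hp uY (ball_uniq nb o n) hn oY _) _.
  by move=> a b ab; rewrite ler_nat; case: (leqP k a) => // ka; rewrite (leq_trans ka ab).
apply: sup_upper_bound; last by exists n => //; rewrite Pr_size.
split; first by exists (Pr nb o p 0 (fun S => (k <= size (cl S o))%N)), 0%N.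
exists 1 => _ [m _ <-]; rewrite Pr_size //; apply: EE_le_cst => // w _.
by rewrite lern1 leq_b1.
Qed.

Lemma tail_adherent p k (e : R) : 0 <= p <= 1 -> 0 < e -> exists X, [/\ uniq X, o \in X &
  cluster_tail nb o p k - e <= EX nb p X (fun w => (k <= csize nb X w o)%N%:R)].
Proof.
move=> hp e0; have hs : has_sup [set Pr nb o p n (fun S => (k <= size (cl S o))%N) | n in [set: nat]].
  split; first by exists (Pr nb o p 0 (fun S => (k <= size (cl S o))%N)), 0%N.
  exists 1 => _ [m _ <-]; rewrite Pr_size //; apply: EE_le_cst => // w _.
  by rewrite lern1 leq_b1.
have [_ [n _ <-]] := sup_adherent e0 hs; rewrite Pr_size // => h.
by exists (ball n); split; [exact: ball_uniq|exact: center_in_ball|exact: ltW].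
Qed.

Lemma tail_ge0 p k : 0 <= p <= 1 -> 0 <= cluster_tail nb o p k.
Proof. by move=> hp; apply: le_trans (tail_le k hp (isT : uniq [:: o]) (mem_head _ _)); apply: EE_ge0. Qed.

Lemma theta_le_tail p k : 0 <= p <= 1 -> theta nb o p <= cluster_tail nb o p k.
Proof.
move=> hp; apply: le_trans (theta_le o nbC k hp) _; rewrite /= Pr_hit //.
have ob : o \in ball k.+1 by exact: center_in_ball.
apply: le_trans (tail_le k hp (ball_uniq nb o k.+1) ob); apply: EE_le => // w hw.
rewrite ler_nat; case: (boolP (hit _ _ _ _)) => // /hitP[v [hv ov]].
by rewrite (ltnW (exit_size nbI nbC (o := o) (m := 0) hw ob (mem_head _ _) hv ov)).
Qed.

(** The limit of the tails of the cluster size, an upper bound for [theta] expressed through sizes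
    so that [sprinkle_tail] applies. *)
Definition Tinf p : R := inf [set cluster_tail nb o p k | k in [set: nat]].

Lemma Tinf_le p k : 0 <= p <= 1 -> Tinf p <= cluster_tail nb o p k.
Proof.
by move=> hp; apply: ge_inf; [exists 0 => _ [j _ <-]; exact: tail_ge0|exists k].
Qed.

Lemma Tinf_adherent p (e : R) : 0 <= p <= 1 -> 0 < e -> exists k, cluster_tail nb o p k < Tinf p + e.
Proof.
move=> hp e0; have hi : has_inf [set cluster_tail nb o p k | k in [set: nat]].
  by split; [exists (cluster_tail nb o p 0), 0%N|exists 0 => _ [j _ <-]; exact: tail_ge0].
by have [_ [k _ <-] h] := inf_adherent e0 hi; exists k.
Qed.

Lemma theta_le_Tinf p : 0 <= p <= 1 -> theta nb o p <= Tinf p.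
Proof.
move=> hp; apply: lb_le_inf; first by exists (cluster_tail nb o p 0), 0%N.
by move=> _ [k _ <-]; exact: theta_le_tail.
Qed.

(** Above p_c every [phi] is at least 1, since otherwise the susceptibility would be finite.
    [theta_growth] from the midpoint of p_c and p gives a quarter of p - p_c. *)
Lemma beta_lower p : pc < p -> p <= 1 -> (p - pc) / 4 <= theta nb o p.
Proof.
move=> pcp p1; have pcc := pc0; pose a := (pc + p) / 2.
have a0 : 0 <= a by rewrite /a; lra.
have ap : a < p by rewrite /a; lra.
have c01 : 0 <= (1 : R) <= 1 by rewrite ler01 lexx.
have h := theta_growth nbU nbI nbC a0 ap p1 c01 _.
apply: le_trans (h _ _); first by rewrite /a; lra.
move=> q S /andP[aq qp] uS oS; rewrite leNgt; apply/negP => hS.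
have hq : 0 <= q <= 1 by lra.
have [B hB] := phi_lt1_chi nbU nbI nbC nbT hq uS oS hS.
have := finite_chi_le_pc nbI nbC hr hq hB; rewrite -/pc => hh.
by move: aq; rewrite /a; lra.
Qed.

Variable C : R.
Hypothesis C1 : 1 <= C.
Hypothesis crit : forall h X v, 0 <= h <= 1 -> uniq X -> v \in X ->
  EX nb pc X (fun w => fg h (csize nb X w v)) <= Num.sqrt (C * h).

Let hpc : 0 <= pc <= 1. Proof. by have := pc0; have := pc6; lra. Qed.

Lemma crit_min h X v : 0 <= h -> uniq X -> v \in X ->
  EX nb pc X (fun w => Num.min 1 (h * (csize nb X w v)%:R)) <= 2 * Num.sqrt (C * h).
Proof.
move=> h0 uX vX; have [h1|h1] := leP h 1.
  apply: le_trans (_ : EX nb pc X (fun w => 2 * fg h (csize nb X w v)) <= _).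
    by apply: EE_le => // w _; apply: min_le_fg; rewrite h0.
  by rewrite /EX EEZ ler_wpM2l //; apply: crit => //; rewrite h0.
apply: EE_le_cst => // w _; rewrite ge_min; apply/orP; left.
have : 1 <= Num.sqrt (C * h).
  by apply: sqrtr_le_of_sqr => //; rewrite expr1n; have := C1; nra.
lra.
Qed.

Lemma crit_tail k X v : (0 < k)%N -> uniq X -> v \in X ->
  EX nb pc X (fun w => (k <= csize nb X w v)%N%:R) <= 2 * Num.sqrt (C / k%:R).
Proof.
move=> k0 uX vX; have kR : 0 < k%:R :> R by rewrite ltr0n.
apply: le_trans (crit_min (h := k%:R^-1) _ uX vX); last by rewrite invr_ge0.
apply: EE_le => // w _; case: leqP => h; last by rewrite le_min ler01 mulr_ge0 // invr_ge0.
by rewrite le_min lexx /= mulrC ler_pdivlMr // mul1r ler_nat.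
Qed.

Lemma sqrt_small (e : R) : 0 < e -> exists l, (0 < l)%N /\ 2 * Num.sqrt (C / l%:R) <= e.
Proof.
move=> e0; have [n hn] := natr_archi (4 * C / e ^+ 2); exists n.+1; split=> //.
have nR : 0 < n.+1%:R :> R by rewrite ltr0n.
have e2 : 0 < e ^+ 2 by rewrite exprn_gt0.
have h : C / n.+1%:R <= (e / 2) ^+ 2.
  rewrite ler_pdivrMr // (_ : (e / 2) ^+ 2 = e ^+ 2 / 4); last by field.
  rewrite ltr_pdivrMr // in hn.
  have nn : n%:R <= n.+1%:R :> R by rewrite ler_nat.
  have := ler_wpM2r (ltW e2) nn; lra.
have : Num.sqrt (C / n.+1%:R) <= e / 2.
  by apply: le_trans (ler_wsqrtr h) _; rewrite sqrtr_sqr ger0_norm //; lra.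
lra.
Qed.

Lemma super_tail p j l X : pc < p -> p <= 1 -> (0 < l)%N -> uniq X -> o \in X ->
  EX nb p X (fun w => (l * (1 + d * j) <= csize nb X w o)%N%:R) <=
  2 * Num.sqrt (C / l%:R) +
  EX nb pc X (fun w => Num.min 1 (d%:R * ((p - pc) / (1 - pc)) * cluster_tail nb o p j * (csize nb X w o)%:R)).
Proof.
move=> pcp p1 l0 uX oX; have p6 := pc6; have p0 := pc0; set q := _ / (1 - pc).
have q0 : 0 <= q by rewrite /q divr_ge0; lra.
have q1 : q <= 1 by rewrite /q ler_pdivrMr; lra.
have hq : 0 <= q <= 1 by rewrite q0.
have hp : 0 <= p <= 1 by lra.
have e : pc + (1 - pc) * q = p by rewrite /q; field; rewrite gt_eqF //; lra.
have hb t : t \in X -> EX nb (pc + (1 - pc) * q) X (fun w => (j <= csize nb X w t)%N%:R) <= cluster_tail nb o p j.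
  by move=> tX; rewrite e; exact: tail_le.
have := sprinkle_tail nbU nbI nbC nbd hpc hq uX oX (tail_ge0 j hp) hb (leqnn (l * (1 + d * j))).
rewrite e; move/le_trans; apply; rewrite lerD2r; exact: crit_tail.
Qed.

(** Sprinkle from p_c with q = (p - p_c)/(1 - p_c). The tail of the critical cluster vanishes as l
    grows, and the truncated mean with h = d q times the j-tail at [p] is at most 2 sqrt(C h) by the
    critical bound. *)
Lemma Tinf_sqr p j : pc < p -> p <= 1 ->
  Tinf p ^+ 2 <= 4 * (C * (d%:R * ((p - pc) / (1 - pc)) * cluster_tail nb o p j)).
Proof.
move=> pcp p1; have p6 := pc6; have p0 := pc0; have hp : 0 <= p <= 1 by lra.
have q0 : 0 <= (p - pc) / (1 - pc) by rewrite divr_ge0; lra.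
set hh := d%:R * _ * _; have h0 : 0 <= hh by rewrite /hh mulr_ge0 ?tail_ge0 // mulr_ge0.
have Ch : 0 <= C * hh by rewrite mulr_ge0 //; have := C1; lra.
have T0 : 0 <= Tinf p by apply: lb_le_inf; [exists (cluster_tail nb o p 0), 0%N|move=> _ [k _ <-]; exact: tail_ge0].
suff h : Tinf p <= 2 * Num.sqrt (C * hh).
  have -> : 4 * (C * hh) = (2 * Num.sqrt (C * hh)) ^+ 2 by rewrite exprMn sqr_sqrtr //; ring.
  by apply: lerXn2r; rewrite ?nnegrE // (le_trans T0).
apply/ler_addgt0Pr => e e0; have e2 : 0 < e / 2 by lra.
have [l [l0 hl]] := sqrt_small e2.
apply: le_trans (Tinf_le (l * (1 + d * j)) hp) _.
have [X [uX oX hX]] := tail_adherent (l * (1 + d * j)) hp e2.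
have := super_tail j pcp p1 l0 uX oX; have := crit_min h0 uX oX.
rewrite -/hh; lra.
Qed.

(** Letting the j-tail approach its infimum turns [Tinf_sqr] into T^2 <= K T. The constant uses 1 -
    p_c >= 4/10. *)
Lemma Tinf_upper p : pc < p -> p <= 1 -> Tinf p <= 10 * C * d%:R * (p - pc).
Proof.
move=> pcp p1; have p6 := pc6; have p0 := pc0; have hp : 0 <= p <= 1 by lra.
have q0 : 0 <= (p - pc) / (1 - pc) by rewrite divr_ge0; lra.
set q := _ / (1 - pc) in q0.
have qle : q <= 5 / 2 * (p - pc) by rewrite /q ler_pdivrMr; nra.
have T0 : 0 <= Tinf p by apply: lb_le_inf; [exists (cluster_tail nb o p 0), 0%N|move=> _ [k _ <-]; exact: tail_ge0].
pose K := 4 * (C * (d%:R * q)).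
have cc : 0 <= C by exact: le_trans ler01 C1.
have dq : 0 <= d%:R * q by exact: mulr_ge0.
have K0 : 0 <= K by apply: mulr_ge0 => //; exact: mulr_ge0.
have h : Tinf p ^+ 2 <= K * Tinf p.
  apply/ler_addgt0Pr => e e0; have e1 : 0 < e / (K + 1) by rewrite divr_gt0 //; lra.
  have [j hj] := Tinf_adherent hp e1; apply: le_trans (Tinf_sqr j pcp p1) _; rewrite -/q.
  have -> : 4 * (C * (d%:R * q * cluster_tail nb o p j)) = K * cluster_tail nb o p j by rewrite /K; ring.
  apply: le_trans (ler_wpM2l K0 (ltW hj)) _; rewrite mulrDr lerD2l mulrCA ler_piMr ?(ltW e0) //.
  by rewrite ler_pdivrMr; lra.
have TK : Tinf p <= K.
  have [e|ne] := eqVneq (Tinf p) 0; first by rewrite e.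
  have Tp : 0 < Tinf p by rewrite lt_neqAle eq_sym ne.
  by rewrite expr2 ler_pM2r // in h.
apply: le_trans TK _.
have -> : 10 * C * d%:R * (p - pc) = 4 * (C * (d%:R * (5 / 2 * (p - pc)))) by field.
by rewrite /K; apply: ler_wpM2l => //; apply: ler_wpM2l => //; exact: ler_wpM2l.
Qed.

Lemma beta_mean_field : beta_is nb o (1 : R).
Proof.
have cc := C1; have dR : 0 < d%:R :> R by rewrite ltr0n.
exists (1 / 4), (10 * C * d%:R); split; first by lra.
split; first by rewrite !mulr_gt0 //; lra.
move=> p pcp p1; have p0 := pc0; have hp : 0 <= p <= 1 by rewrite p1 andbT; apply: ltW (lt_trans p0 pcp).
rewrite powRr1; last by rewrite subr_ge0 ltW.
apply/andP; split; first by have := beta_lower pcp p1; rewrite /pc; lra.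
by apply: le_trans (theta_le_Tinf hp) _; exact: Tinf_upper.
Qed.

(** Percolation at p_c + x has probability at least x/4, while the sprinkling bound attributes it,
    up to two errors x/16, to the truncated critical mean. The upper bound [Tinf_upper] makes the
    truncation parameter of order x^2: the constant 50 is 5/2 times 20, with a j-tail of at most
    twice [Tinf]. *)
Lemma crit_lower (x : R) : 0 < x -> x <= 1 - pc -> exists X, [/\ uniq X, o \in X &
  x / 8 <= EX nb pc X (fun w => Num.min 1 (50 * C * d%:R ^+ 2 * x ^+ 2 * (csize nb X w o)%:R))].
Proof.
move=> x0 x1; have p6 := pc6; have p0 := pc0; pose p := pc + x.
have pcp : pc < p by rewrite /p ltrDl.
have p1 : p <= 1 by rewrite /p; lra.
have hp : 0 <= p <= 1 by rewrite p1 andbT /p; lra.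
have xE : p - pc = x by rewrite /p; ring.
have bl := beta_lower pcp p1; rewrite xE in bl.
have tT := theta_le_Tinf hp; have tu := Tinf_upper pcp p1; rewrite xE in tu.
have T0 : 0 < Tinf p by apply: lt_le_trans tT; apply: lt_le_trans bl; rewrite divr_gt0.
have [j hj] := Tinf_adherent hp T0.
have x16 : 0 < x / 16 by rewrite divr_gt0.
have [l [l0 hl]] := sqrt_small x16.
have [X [uX oX hX]] := tail_adherent (l * (1 + d * j)) hp x16.
exists X; split=> //; have := super_tail j pcp p1 l0 uX oX; rewrite xE => st.
have Tl := Tinf_le (l * (1 + d * j)) hp.
have cc : 0 <= C by exact: le_trans ler01 C1.
have mono : EX nb pc X (fun w => Num.min 1 (d%:R * (x / (1 - pc)) * cluster_tail nb o p j * (csize nb X w o)%:R)) <=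
   EX nb pc X (fun w => Num.min 1 (50 * C * d%:R ^+ 2 * x ^+ 2 * (csize nb X w o)%:R)).
  apply: EE_le => // w _; apply: le_min2 => //; apply: ler_wpM2r => //.
  have q1 : x / (1 - pc) <= 5 / 2 * x by rewrite ler_pdivrMr; nra.
  have q0 : 0 <= x / (1 - pc) by rewrite divr_ge0; lra.
  have t2 : cluster_tail nb o p j <= 20 * C * d%:R * x.
    have -> : 20 * C * d%:R * x = 10 * C * d%:R * x + 10 * C * d%:R * x by ring.
    lra.
  have -> : 50 * C * d%:R ^+ 2 * x ^+ 2 = d%:R * (5 / 2 * x) * (20 * C * d%:R * x) by field.
  apply: ler_pM => //; [exact: mulr_ge0|exact: tail_ge0|exact: ler_wpM2l].
lra.
Qed.

Lemma min_split (k N n : nat) : (0 < k)%N -> (0 < N)%N ->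
  Num.min 1 (N%:R^-1 * n%:R) <= k%:R / N%:R * Num.min 1 (k%:R^-1 * n%:R) + (k <= n)%N%:R :> R.
Proof.
move=> k0 N0; have kR : 0 < k%:R :> R by rewrite ltr0n.
have NR : 0 < N%:R :> R by rewrite ltr0n.
case: leqP => h.
  rewrite ge_min; apply/orP; left; rewrite lerDr; apply: mulr_ge0; first exact: divr_ge0.
  by rewrite le_min ler01 mulr_ge0 // invr_ge0.
have kn : k%:R^-1 * n%:R <= 1 :> R by rewrite mulrC ler_pdivrMr // mul1r ler_nat ltnW.
rewrite addr0 (min_r kn) ge_min; apply/orP; right.
rewrite le_eqVlt; apply/orP; left; apply/eqP; field.
by rewrite !gt_eqF.
Qed.

Lemma delta_mean_field : delta_is nb o (2 : R).
Proof.
have p6 := pc6; have p0 := pc0; have cc := C1; have C0 : 0 < C by lra.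
have dR : 1 <= d%:R :> R by rewrite ler1n.
have sk k : powR k%:R (- 2^-1) = (Num.sqrt k%:R)^-1 :> R by rewrite powRN powR12_sqrt.
pose c := 50 * C * d%:R ^+ 2.
have c50 : 50 <= c.
  have : 1 <= d%:R ^+ 2 :> R by apply: exprn_ege1.
  rewrite /c => d1; nra.
pose s := Num.sqrt c.
have s2 : s ^+ 2 = c by rewrite sqr_sqrtr //; lra.
have s7 : 7 <= s by apply: sqrtr_le_of_sqr => //; lra.
                                                                                      
                                                         
(* The scale x below satisfies 50 C d^2 x^2 = 1/(bk). Clusters smaller than k contribute at most 2
   sqrt(C)/(b sqrt(k)) to the truncated mean at that scale, and b >= a^2 makes this at most x/16,
   half of the lower bound x/8. *)
pose a := 32 * Num.sqrt C * s.
have a0 : 0 <= a by rewrite /a !mulr_ge0 // ?sqrtr_ge0 //; lra.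
have [b hb] := natr_archi (a ^+ 2 + 1).
have b1 : 1 <= b%:R :> R by have := sqr_ge0 a; lra.
have b0 : (0 < b)%N by rewrite -(ltr0n R); lra.
pose sb := Num.sqrt (b%:R : R).
have sb2 : sb ^+ 2 = b%:R by rewrite sqr_sqrtr.
have sb1 : 1 <= sb by apply: sqrtr_le_of_sqr => //; rewrite expr1n.
have s0 : 0 < s by exact: lt_le_trans s7.
have sb0 : 0 < sb by exact: lt_le_trans sb1.
have asb : a <= sb by apply: sqrtr_le_of_sqr => //; lra.
exists (16 * s * sb)^-1, (2 * Num.sqrt C).
have ssb : 0 < 16 * s * sb by rewrite !mulr_gt0 //; lra.
split; first by rewrite invr_gt0.
have sC : 0 < Num.sqrt C by rewrite sqrtr_gt0.
split; first by rewrite mulr_gt0.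
move=> k k1; rewrite sk -/pc; have kR : 0 < k%:R :> R by rewrite ltr0n.
have k1R : 1 <= k%:R :> R by rewrite ler1n.
pose t := Num.sqrt (k%:R : R).
have t2 : t ^+ 2 = k%:R by rewrite sqr_sqrtr // ltW.
have t1 : 1 <= t by apply: sqrtr_le_of_sqr => //; rewrite expr1n.
have t0 : 0 < t by exact: lt_le_trans t1.
have sCk : Num.sqrt (C / k%:R) = Num.sqrt C / t by rewrite sqrtrM ?(ltW C0) // sqrtrV.
apply/andP; split; last first.
  apply: ge_sup; first by eexists; exists 0%N.
  move=> _ [n _ <-]; rewrite Pr_size // -mulrA -sCk; apply: crit_tail => //.
    exact: ball_uniq.
  exact: center_in_ball.
pose x := (s * sb * t)^-1.
have sst : 7 <= s * sb * t.
  apply: le_trans s7 _; rewrite -mulrA ler_peMr ?(ltW s0) //.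
  by apply: le_trans sb1 _; rewrite ler_peMr // ltW.
have x0 : 0 < x by rewrite invr_gt0; lra.
have x7 : x <= 7^-1 by rewrite /x lef_pV2 ?posrE //; lra.
have x1 : x <= 1 - pc by lra.
have [X [uX oX hX]] := crit_lower x0 x1.
have N0 : (0 < b * k)%N by rewrite muln_gt0 b0.
have xN : 50 * C * d%:R ^+ 2 * x ^+ 2 = (b * k)%:R^-1.
  rewrite -/c /x exprVn !exprMn s2 sb2 t2 natrM -mulrA invfM mulrA mulfV ?mul1r //.
  by rewrite gt_eqF //; lra.
rewrite xN in hX.
have up : EX nb pc X (fun w => Num.min 1 ((b * k)%:R^-1 * (csize nb X w o)%:R)) <=
   k%:R / (b * k)%:R * (2 * Num.sqrt (C * k%:R^-1)) + cluster_tail nb o pc k.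
  apply: le_trans (_ : EX nb pc X (fun w => k%:R / (b * k)%:R * Num.min 1 (k%:R^-1 * (csize nb X w o)%:R) +
     (k <= csize nb X w o)%N%:R) <= _); first by apply: EE_le => // w _; exact: min_split.
  rewrite /EX EED EEZ; apply: lerD; last exact: tail_le.
  by apply: ler_wpM2l; [rewrite divr_ge0|apply: crit_min => //; rewrite invr_ge0 ltW].
have e1 : k%:R / (b * k)%:R * (2 * Num.sqrt (C * k%:R^-1)) = 2 * Num.sqrt C / (sb ^+ 2 * t).
  by rewrite sCk natrM sb2; field; rewrite !gt_eqF // ltr0n.
rewrite e1 in up.
have e2 : 2 * Num.sqrt C / (sb ^+ 2 * t) <= x / 16.
  have -> : 2 * Num.sqrt C / (sb ^+ 2 * t) = a / sb * (x / 16).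
    by rewrite /x /a; field; rewrite !gt_eqF.
  by rewrite ler_piMl // ?divr_ge0 ?(ltW x0) // ler_pdivrMr ?mul1r.
have -> : (16 * s * sb)^-1 / t = x / 16 by rewrite /x; field; rewrite !gt_eqF.
lra.
Qed.

Hypothesis gamma_bound : forall p, 0 <= p -> p < pc -> chiR nb o p * (pc - p) <= 3.

Lemma gamma_mean_field : gamma_is nb o (1 : R).
Proof.
have p6 := pc6; have dR : 0 < d%:R :> R by rewrite ltr0n.
exists (1 / (28 * d%:R)), 3; split; first by rewrite divr_gt0 // mulr_gt0.
split=> // p p0 ppc; rewrite -/pc in ppc *.
have x0 : 0 < pc - p by rewrite subr_gt0.
have hp : 0 <= p <= 1 by lra.
rewrite powR_inv1 ?(ltW x0) //.
have pcle1 : pc <= 1 by lra.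
have [B hB] := chi_finite_below nbU nbI nbC nbT p0 ppc pcle1.
apply/andP; split; last first.
  apply: ge_ereal_sup => _ [n _ <-]; rewrite Ex_size // lee_fin.
  apply: le_trans (chi_le_chiR nbU nbI nbC nbT o hB (ball_uniq nb o n) (center_in_ball nb o n)) _.
  by rewrite ler_pdivlMr //; exact: gamma_bound.
have hX X : uniq X -> o \in X -> ((EX nb p X (fun w => (csize nb X w o)%:R))%:E <= chi nb o p)%E.
  move=> uX oX; have [n hn] := ball_exhaust o X nbconn.
  apply: le_trans (_ : (EX nb p (ball n) (fun w => (csize nb (ball n) w o)%:R))%:E <= _)%E.
    rewrite lee_fin; apply: (EX_csize_mono nbU nbI nbC (phi := fun n => n%:R)) => //; first exact: ball_uniq.
    by move=> i j ij; rewrite ler_nat.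
  by apply: ereal_sup_ubound; exists n => //; rewrite Ex_size.
case hc : (chi nb o p) hX => [r| |] hX; last 2 first.
- by rewrite leey.
- by have := hX [:: o] isT (mem_head _ _).
have hr' : chi_le nb p r.
  by apply: (chi_le_of_origin nbU nbI nbC nbT) => X uX oX; have := hX X uX oX; rewrite lee_fin.
have r1 : 1 <= r.
  by have := hX [:: o] isT (mem_head _ _); rewrite lee_fin; apply: le_trans; apply: chi_ge1; rewrite ?mem_head.
have p66 : 0 <= p <= 6 / 10 by lra.
have h := gamma_lower_bound nbU nbI nbC nbd d0 hr p66 r1 hr'.
by rewrite lee_fin ler_pdivrMr.
Qed.

End Exponents.

(** * Numerical constants and the assembly of the theorem *)

Section Constants.
Context {R : realType}.
Variables (D p pm eta : R).
Hypothesis D3 : 3 <= D.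
Hypothesis p_low : (22 * D)^-1 <= p.

(** (D-1)(D-2)/D^2 is at least 2/9, its value at D = 3, and 2/(9 times 22^2) = 1/2178. *)
Lemma branching_rate : 1 / 2178 <= p ^+ 2 * ((D - 1) * (D - 2)).
Proof.
have d3 := D3; have pl := p_low.
have D0 : 0 < 22 * D by lra.
have i0 : 0 < (22 * D)^-1 by rewrite invr_gt0.
apply: le_trans (_ : (22 * D)^-1 ^+ 2 * ((D - 1) * (D - 2)) <= _); last first.
  apply: ler_wpM2r; first by apply: mulr_ge0; lra.
  by apply: lerXn2r; rewrite ?nnegrE; lra.
rewrite exprVn [leRHS]mulrC ler_pdivlMr ?exprn_gt0 //.
have := mulr_ge0 (_ : 0 <= 7 * D - 6) (_ : 0 <= D - 3) => h.
have {}h := h (ltac:(lra)) (ltac:(lra)).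
have -> : 1 / 2178 * (22 * D) ^+ 2 = 2 / 9 * D ^+ 2 by field.
have e : (7 * D - 6) * (D - 3) = 9 * ((D - 1) * (D - 2)) - 2 * D ^+ 2 by ring.
lra.
Qed.

(** 1/pm <= D-1 makes the first term a small multiple of the branching rate P, and P >= 1/2178
    absorbs [eta]: together they are at most P/125, and (1-p)^(-2) <= 25/4. *)
Lemma correction_small : p <= 6 / 10 -> 0 < pm -> 1 <= pm * (D - 1) -> 0 <= eta -> eta <= 1 / 1000 / 1000 ->
  (4 * p ^+ 2 * D * (eta / pm) + eta) * (1 - p) ^- 2 <= p ^+ 2 * ((D - 1) * (D - 2)) / 20.
Proof.
move=> p6 pm0 pmd eta0 etas; have d3 := D3; have pr := branching_rate.
set P := p ^+ 2 * _ in pr *.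
have em : eta / pm <= eta * (D - 1).
  rewrite ler_pdivrMr // -mulrA ler_peMr //; lra.
have pl := p_low; have i22 : 0 < (22 * D)^-1 by rewrite invr_gt0; lra.
have pp : 0 <= p by lra.
have p2 : 0 <= p ^+ 2 by exact: sqr_ge0.
have p2D : 0 <= 4 * p ^+ 2 * D by rewrite mulr_ge0 ?mulr_ge0 //; lra.
have t1 : 4 * p ^+ 2 * D * (eta / pm) <= 12 * P * eta.
  apply: le_trans (_ : 4 * p ^+ 2 * D * (eta * (D - 1)) <= _).
    exact: ler_wpM2l.
  have -> : 4 * p ^+ 2 * D * (eta * (D - 1)) = 4 * (p ^+ 2 * (D - 1) * eta) * D by ring.
  have -> : 12 * P * eta = 4 * (p ^+ 2 * (D - 1) * eta) * (3 * (D - 2)) by rewrite /P; ring.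
  apply: ler_wpM2l; last lra.
  have d1 : 0 <= D - 1 by lra.
  by rewrite mulr_ge0 // mulr_ge0 // mulr_ge0.
have i1 : (1 - p) ^- 2 <= 25 / 4.
  have -> : 25 / 4 = ((4 / 10) ^+ 2)^-1 :> R by field.
  rewrite lef_pV2 ?posrE ?exprn_gt0 //; try lra.
  by apply: lerXn2r; rewrite ?nnegrE; lra.
have i0 : 0 <= (1 - p) ^- 2 by rewrite invr_ge0 exprn_ge0 //; lra.
have P0 : 0 <= P by lra.
have t2 : 12 * P * eta <= 12 * P * (1 / 1000 / 1000) by apply: ler_wpM2l => //; lra.
have t0 : 0 <= 4 * p ^+ 2 * D * (eta / pm) + eta.
  by rewrite addr_ge0 // mulr_ge0 // divr_ge0 // ltW.
have t3 : 4 * p ^+ 2 * D * (eta / pm) + eta <= P / 125 by lra.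
apply: le_trans (ler_pM t0 i0 t3 i1) _; lra.
Qed.

End Constants.

Lemma branching_rate_gt0 (R : realType) : exists cc : R, [/\ 0 < cc, cc <= 1 &
  forall D p : R, 3 <= D -> (22 * D)^-1 <= p -> cc <= p ^+ 2 * ((D - 1) * (D - 2))].
Proof. by exists (1 / 2178); split; [lra|lra|exact: branching_rate]. Qed.

Lemma chi_at_zero (R : realType) (V : countType) (nb : V -> seq V) : chi_le nb (0 : R) 1.
Proof.
move=> X v uX vX; have EE0 (T : eqType) (es : seq T) (f : (T -> bool) -> R) : EE 0 es f = f (fun=> false).
  by elim: es f => [//|e es IH] f /=; rewrite mul0r add0r subr0 mul1r IH.
rewrite /EX EE0 lern1 csizeE (eq_bigr (fun y => (v == y : nat))); last first.
  move=> y _; congr nat_of_bool; apply/cnP/eqP => [[[|a s] [ps <-]] //|->]; last by exists [::].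
  by move: ps => /= /andP[/andP[_]].
rewrite -(ler_nat R) natr_sum (eq_bigr (fun y => (v == y)%:R * 1)); last by move=> y _; rewrite mulr1.
by rewrite sum_delta // mulr1 ler_nat leq_b1.
Qed.

Theorem theorem1p3 (R : realType) (rho : R) : rho < 1 ->
  exists L : nat, (0 < L)%N /\
    forall (V : countType) (nb : V -> seq V) (o : V),
      simple_graph nb -> graph_connected nb -> infinite_graph V ->
      regular nb -> spectral_radius (R := R) nb o <= rho -> girth_ge nb L ->
      triangle_condition nb o (p_c (R := R) nb o) /\
      (transitive_graph nb -> unimodular nb ->
        beta_is nb o (1 : R) /\ gamma_is nb o (1 : R) /\ delta_is nb o (2 : R)).
Proof.
move=> rho1; have [e [he hL]] := walk_bounds rho1; have /andP[e0 e1] := he.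
(* [eta <= e] serves the bound on exits, and 10^(-6) the inequalities for susceptibility and
   magnetization. *)
have [eta [eta0 eta_e eta_s]] : exists eta : R, [/\ 0 < eta, eta <= e & eta <= 1 / 1000 / 1000].
  have k0 : (0 : R) < 1 / 1000 / 1000 by lra.
  by exists (Num.min e (1 / 1000 / 1000)); split; rewrite ?lt_min ?e0 ?k0 // ge_min lexx ?orbT.
have [L [L0 hG]] := hL eta eta0; exists L; split=> // V nb o hs hc hi hreg hrho hgirth.
have [d [nbd d3 loops [s [C [s0 hgreen htri]]]]] := hG V nb o hs hc hi hreg hrho.
have [nbU [nbI nbC]] := hs.
split; first exact: (critical_triangle nbU nbI nbC hc nbd d3 hgirth L0 he eta_e loops s0 hgreen htri).
move=> nbT _; set pm := (1 + 2 * e) / (d%:R - 1) in loops.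
have /andP[pm0 pm6] := window_bounds (R := R) d3 he.
have /andP[pc_ge pc_le] := p_c_bounds o nbU nbI nbC nbd d3 hgirth L0 he eta_e loops.
rewrite -/pm in pm0 pm6 pc_le.
have hpm : 0 <= pm <= 1 by lra.
have hr : exists r : R, 0 <= r <= 1 /\ 0 < Pinf nb o r.
  exists pm; split=> //; apply: lt_le_trans (theta_le_Pinf o nbC hpm).
  exact: (theta_pm_gt0 o nbU nbI nbC nbd d3 hgirth L0 he eta_e loops).
have d0 : (0 < d)%N by apply: leq_trans d3.
have D3 : 3 <= d%:R :> R by rewrite ler_nat.
have D1 : 0 < d%:R - 1 :> R by rewrite subr_gt0 ltr1n; apply: ltnW.
have pmd : 1 <= pm * (d%:R - 1).
  by rewrite /pm divfK ?gt_eqF // lerDl mulr_ge0 // ltW.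
(* Sprinkling from parameter 0, where the susceptibility is 1, keeps p_c at least 1/(11d) and thus
   the branching rate bounded away from 0. *)
have pc11 : (11 * d%:R)^-1 <= p_c nb o :> R.
  have h01 : 0 <= (0 : R) <= 1 by rewrite lexx ler01.
  have h := chi_sprinkle nbU nbI nbC nbd d0 h01 (lexx 1) (chi_at_zero R nb).
  have i0 : 0 < (11 * d%:R : R)^-1 by rewrite invr_gt0 mulr_gt0 // ltr0n.
  have i1 : (11 * d%:R : R)^-1 <= 1.
    by rewrite invf_le1 -?natrM ?ltr0n ?ler1n muln_gt0.
  rewrite add0r subr0 mul1r !mulr1 in h.
  by apply: (finite_chi_le_pc nbI nbC hr _ h); rewrite (ltW i0) i1.
have pc0 : 0 < p_c nb o :> R by apply: lt_le_trans pc11; rewrite invr_gt0 mulr_gt0 // ltr0n.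
have pc6 : p_c nb o <= 6 / 10 :> R by exact: le_trans pm6.
have pc1 : p_c nb o <= 1 :> R by apply: le_trans pc6 _; lra.
have [cc [cc0 cc1 hcc]] := branching_rate_gt0 R.
have [C0 C01 C0E] : exists2 C0 : R, 1 <= C0 & C0 = 120 / cc.
  by exists (120 / cc) => //; rewrite ler_pdivlMr // mul1r (le_trans cc1) //; lra.
(* [mag_sqrt] is applied for p in the upper half of the interval below p_c, where the susceptibility
   is finite and p >= 1/(22d); its bound is uniform in p, so it passes to p_c by continuity in the
   fixed volume [X]. *)
have crit h X v : 0 <= h <= 1 -> uniq X -> v \in X ->
    EX nb (p_c nb o) X (fun w => fg h (csize nb X w v)) <= Num.sqrt (C0 * h).
  move=> hh uX vX; have half : p_c nb o / 2 < p_c nb o :> R by rewrite ltr_pdivrMr // ltr_pMr // ltr1n.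
  apply: (EE_le_left half) => p /andP[pl pu].
  have h0 : 0 <= p_c nb o / 2 :> R by rewrite divr_ge0.
  have p0 : 0 <= p := le_trans h0 pl.
  have p6 : p <= 6 / 10 := le_trans (ltW pu) pc6.
  have hp : 0 <= p <= 1 by rewrite p0 (le_trans (ltW pu)).
  have [B hB] := chi_finite_below nbU nbI nbC nbT p0 pu pc1.
  have plow : (22 * d%:R)^-1 <= p.
    apply: le_trans pl; rewrite (_ : (22 * d%:R)^-1 = (11 * d%:R)^-1 / 2 :> R).
      by rewrite ler_pM2r ?invr_gt0.
    by field; rewrite gt_eqF // (lt_le_trans _ D3).
  have ppm : p <= pm := le_trans (ltW pu) pc_le.
  have corr := correction_small D3 plow p6 pm0 pmd (ltW eta0) eta_s.
  have := mag_sqrt nbU nbI nbC nbd hgirth L0 nbT o hp hB pm0 ppm loops d3 p6 cc0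
    (hcc _ _ D3 plow) corr hh.
  rewrite -C0E => hm; apply: le_trans (magX_le nbU nbI nbC nbT o hp hh uX vX) _.
  by apply: sqrtr_le_of_sqr => //; exact: mag_ge0.
have eta20 : eta <= 1 / 20 by apply: le_trans eta_s _; lra.
have gam (p : R) : 0 <= p -> p < p_c nb o -> chiR nb o p * (p_c nb o - p) <= 3.
  exact: (gamma_upper_bound nbU nbI nbC nbd hgirth L0 pm0 loops nbT d0 pm6 eta20 d3 pmd pc_ge pc_le).
split; first exact: (beta_mean_field nbU nbI nbC nbd nbT hc d0 pc0 pc6 hr C01 crit).
split; first exact: (gamma_mean_field nbU nbI nbC nbd nbT hc d0 pc6 hr gam).
exact: (delta_mean_field nbU nbI nbC nbd nbT hc d0 pc0 pc6 hr C01 crit).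
Qed.
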